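(* Let $d\in\{2,3\}$, let $\Omega_b\subset\mathbb{R}^d$ be a bounded Lipschitz domain and let $n\in L^\infty(\Omega_b)$ be real valued with $\mathrm{ess\,inf}_{\Omega_b}n>0$. Consider the eigenvalue problem: find $(w,\lambda)\in (H^2_0(\Omega_b)\setminus\{0\})\times\mathbb{C}$ such that $$\Delta(n^{-1}\Delta w)=-\lambda\,\Delta w\quad\text{in }\Omega_b .$$ Then: (1) The spectrum of this problem consists of real positive isolated eigenvalues of finite multiplicity $0<\lambda_0(n)\le\lambda_1(n)\le\dots\le\lambda_p(n)\le\dots$ (repeated according to multiplicity), with $\lim_{p\to+\infty}\lambda_p(n)=+\infty$, and for all $p\ge0$ $$\lambda_p(n)=\min_{E\in\mathscr{E}_{p}}\ \max_{w\in E\setminus\{0\}}\frac{(n^{-1}\Delta w,\Delta w)_{L^2(\Omega_b)}}{\|\nabla w\|^2_{L^2(\Omega_b)}},$$ where $\mathscr{E}_{p}$ is the set of subspaces of $H^2_0(\Omega_b)$ of dimension $p+1$. (2) If $\hat n\in L^\infty(\Omega_b)$ is real valued with $\mathrm{ess\,inf}_{\Omega_b}\hat n>0$ and $n\ge\hat n$ a.e. in $\Omega_b$, then $\lambda_p(n)\le\lambda_p(\hat n)$ for all $p\ge0$. (3) For all $p\ge0$, $$\mathrm{ess\,inf}_{\Omega_b}n\ \le\ \frac{\lambda_p(1)}{\lambda_p(n)}\ \le\ \mathrm{ess\,sup}_{\Omega_b}n,$$ where $\lambda_p(1)$ denotes the $p$-th eigenvalue for the index identically equal to $1$ in $\Omega_b$.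 (4) If $n$ is constant in $\Omega_b$, then $n=\lambda_p(1)/\lambda_p(n)$ for all $p\ge0$.
   Context: The equation $\Delta(n^{-1}\Delta w)=-\lambda\Delta w$ is understood in the sense of distributions in $\Omega_b$, equivalently $(n^{-1}\Delta w,\Delta w')_{L^2(\Omega_b)}=\lambda(\nabla w,\nabla w')_{L^2(\Omega_b)}$ for all $w'\in H^2_0(\Omega_b)$, where $H^2_0(\Omega_b)$ is the closure of $C_c^\infty(\Omega_b)$ in $H^2(\Omega_b)$. An eigenvalue is a $\lambda$ for which a nonzero solution $w$ exists. *)

(* Defs.v *)
From HB Require Import structures.
From mathcomp Require Import all_boot all_order all_algebra.
From mathcomp Require Import all_classical all_reals all_analysis.
From mathcomp Require Import ess_sup_inf complex.
Set Implicit Arguments.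
Unset Strict Implicit.
Unset Printing Implicit Defensive.
Import Order.TTheory GRing.Theory Num.Theory.
Import numFieldNormedType.Exports.
Local Open Scope classical_set_scope.
Local Open Scope ring_scope.

Section euclidean_measurable.
Context {R : realType} {d : nat}.

Definition coor (i : 'I_d) (x : 'rV[R]_d) : measurableTypeR R := x ord0 i.

Let rV_set0 : g_sigma_preimage coor set0.
Proof. exact: sigma_algebra0. Qed.

Let rV_setC A : g_sigma_preimage coor A -> g_sigma_preimage coor (~` A).
Proof. exact: sigma_algebraC. Qed.

Let rV_bigcup (F : _^nat) : (forall i, g_sigma_preimage coor (F i)) ->
  g_sigma_preimage coor (\bigcup_i (F i)).
Proof. exact: sigma_algebra_bigcup. Qed.

(* The product sigma-algebra, that is, the Borel sigma-algebra of R^d: the     *)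
(* coordinates are continuous, and open sets are measurable by                 *)
(* open_measurable_rV below.                                                   *)
HB.instance Definition _ := @isMeasurable.Build default_measure_display
  'rV[R]_d (g_sigma_preimage coor) rV_set0 rV_setC rV_bigcup.

Lemma measurable_coor (i : 'I_d) : measurable_fun [set: 'rV[R]_d] (coor i).
Proof.
move=> _ Y mY; rewrite setTI; apply: sub_sigma_algebra => /=.
rewrite -bigcup_seq/=; exists i => /=; first by rewrite mem_index_enum.
by exists Y => //; rewrite setTI.
Qed.

Lemma measurable_fun_rV d1 (T : measurableType d1) (f : T -> 'rV[R]_d) :
  (forall i, measurable_fun [set: T] (coor i \o f)) ->
  measurable_fun [set: T] f.
Proof.
move=> mf _ A.
rewrite setTI.
apply: (@smallest_sub _ (@sigma_algebra _ setT) _ [set A | measurable (f @^-1` A)]).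
- split => /=.
  + by rewrite preimage_set0.
  + by move=> B mB; rewrite setTD preimage_setC; exact: measurableC.
  + by move=> F mF; rewrite preimage_bigcup; exact: bigcup_measurable.
- rewrite -bigcup_seq/=; apply: bigcup_sub => i _ _ [B mB <-] /=.
  by rewrite setTI -[X in measurable X]setTI; exact: mf.
Qed.

Lemma open_measurable_rV (A : set 'rV[R]_d) : open A -> measurable A.
Proof.
move=> oA.
pose box (p : 'rV[rat]_d * nat) : set 'rV[R]_d :=
  ball (map_mx ratr p.1 : 'rV[R]_d) (p.2.+1%:R^-1).
have mbox p : measurable (box p).
  have -> : box p = \big[setI/setT]_(i < d)
      (coor i @^-1` ball (ratr (p.1 ord0 i) : R) (p.2.+1%:R^-1)).
    rewrite -bigcap_seq/=; apply/seteqP; split => [x xb i _|x xb].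
      by case: xb => _ /(_ ord0 i); rewrite mxE.
    by split=> [|i j]; rewrite ?invr_gt0// ord1 mxE; apply: xb; rewrite /= mem_index_enum.
  apply: bigsetI_measurable => i _; rewrite -[X in measurable X]setTI.
  apply: measurable_coor => //; rewrite ball_itv; exact: measurable_itv.
have -> : A = \bigcup_(p in [set p | box p `<=` A]) box p.
  apply/seteqP; split => [x Ax|x [p pA /pA //]].
  have /nbhs_ballP[e/= e0 eA] : nbhs x A by exact: open_nbhs_nbhs.
  have [k ke] : exists k : nat, k.+1%:R^-1 < e / 2.
    have e2 : 0 < e / 2 by rewrite divr_gt0.
    exists (Num.truncn (e / 2)^-1).
    by rewrite invf_plt ?posrE// Num.Theory.truncnS_gt.
  have q_ i : {q : rat | ball (ratr q : R) (k.+1%:R^-1) (x ord0 i)}.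
    apply: cid.
    have k0 : 0 < k.+1%:R^-1 :> R by rewrite invr_gt0.
    have [q] := rat_in_itvoo
      (ltr_pwDr k0 (lexx (x ord0 i))).
    rewrite in_itv/= => /andP[q1 q2]; exists q.
    rewrite /ball/= ltr_distlC ltrBlDr q2/=.
    by rewrite (lt_trans q1)// ltrDl.
  pose q : 'rV[rat]_d := \row_i sval (q_ i).
  have xq : box (q, k) x.
    by split=> [|i j]; rewrite ?invr_gt0// ord1 !mxE /=; case: (q_ j).
  exists (q, k) => //= y yq; apply: eA; split=> // i j.
  have := xq.2 i j; have := yq.2 i j; rewrite /ball/= !mxE => h1 h2.
  rewrite (le_lt_trans (ler_distD (ratr (sval (q_ j))) _ _))//.
  rewrite (distrC (x i j)) [ltRHS]splitr ltrD//.
    exact: lt_trans ke.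
  exact: lt_trans ke.
rewrite bigcup_mkcond; apply: countable_bigcupT_measurable => // p.
by case: ifP.
Qed.

End euclidean_measurable.

Section lebesgue_rV.
Context {R : realType}.

Definition rV_cons {d} (p : measurableTypeR R * 'rV[R]_d) : 'rV[R]_d.+1 :=
  \row_i if unlift ord0 i is Some j then p.2 ord0 j else p.1.

Lemma measurable_rV_cons d :
  measurable_fun [set: (measurableTypeR R * 'rV[R]_d)%type] (@rV_cons d).
Proof.
apply: measurable_fun_rV => i; case: (unliftP ord0 i) => [j|] ->.
  apply: (eq_measurable_fun (coor j \o snd)) => [p _|].
    by rewrite /coor/= mxE liftK.
  by apply: measurableT_comp => //; exact: measurable_coor.
by apply: (eq_measurable_fun fst) => // p _; rewrite /coor/= mxE unlift_none.
Qed.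

Section step.
Variables (d : nat) (mu : {sigma_finite_measure set 'rV[R]_d -> \bar R}).

Definition leb_step : set 'rV[R]_d.+1 -> \bar R :=
  pushforward (@lebesgue_measure R \x mu)%E rV_cons.

HB.instance Definition _ := Measure.copy leb_step
  (measure_function_pushforward__canonical__measure_function_Measure
    (@lebesgue_measure R \x mu)%E (@measurable_rV_cons d)).

Let leb_step_sigma_finite : sigma_finite setT leb_step.
Proof.
pose uncons (x : 'rV[R]_d.+1) : measurableTypeR R * 'rV[R]_d :=
  (x ord0 ord0, \row_j x ord0 (lift ord0 j)).
have muncons : measurable_fun [set: 'rV[R]_d.+1] uncons.
  apply/measurable_fun_pairP; split; first exact: (measurable_coor ord0).
  apply: measurable_fun_rV => j.
  apply: (eq_measurable_fun (coor (lift ord0 j))); last exact: measurable_coor.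
  by move=> x _; rewrite /coor/= mxE.
have consK : cancel rV_cons uncons.
  move=> [t y]; rewrite /uncons mxE unlift_none; congr (_, _).
  by apply/rowP => j; rewrite !mxE liftK.
have /sigma_finiteP[F [TF ndF Foo]] := sigma_finiteT (@lebesgue_measure R).
have /sigma_finiteP[G [TG ndG Goo]] := sigma_finiteT mu.
exists (fun k => uncons @^-1` (F k `*` G k)).
  rewrite -preimage_bigcup (_ : \bigcup_k _ = setT) ?preimage_setT//.
  rewrite -setXTT TF TG; apply/seteqP; split=> [[x y] [k _ []/= ? ?]|].
    by split; exists k.
  move=> [x y] [/= [k _ Fkx] [l _ Gly]]; exists (maxn k l) => //; split.
  - by move: x Fkx; exact/subsetPset/ndF/leq_maxl.
  - by move: y Gly; exact/subsetPset/ndG/leq_maxr.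
move=> k; have [mF Fk] := Foo k; have [mG Gk] := Goo k; split.
  by rewrite -[X in measurable X]setTI; apply: muncons => //; exact: measurableX.
rewrite /leb_step /pushforward -comp_preimage.
rewrite (_ : uncons \o rV_cons = id); last exact/funext.
by rewrite preimage_id product_measure1E// lte_mul_pinfty// ge0_fin_numE.
Qed.

HB.instance Definition _ := Measure_isSigmaFinite.Build _ _ _ leb_step
  leb_step_sigma_finite.

End step.

(* Lebesgue measure on R^d, as an iterated product; see lebesgue_rV_box.       *)
Fixpoint lebesgue_rV d : {sigma_finite_measure set 'rV[R]_d -> \bar R} :=
  if d is d'.+1 then leb_step (lebesgue_rV d')
  else [the {sigma_finite_measure set 'rV[R]_0 -> \bar R} of dirac (0 : 'rV[R]_0)].

Lemma lebesgue_rV_box d (A : 'I_d -> set (measurableTypeR R)) :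
  (forall i, measurable (A i)) ->
  lebesgue_rV d [set x | forall i, A i (x ord0 i)] =
  (\prod_(i < d) lebesgue_measure (A i))%E.
Proof.
elim: d A => [|d IH] A mA.
  by rewrite big_ord0 /= diracE mem_set // => -[].
rewrite big_ord_recl -IH//.
pose B : set 'rV[R]_d := [set x | forall i, A (lift ord0 i) (x ord0 i)].
rewrite -[X in _ = (_ * X)%E]/(lebesgue_rV d B).
have mB : measurable B.
  rewrite (_ : B = \big[setI/setT]_(i < d) (coor i @^-1` A (lift ord0 i))).
    apply: bigsetI_measurable => i _; rewrite -[X in measurable X]setTI.
    exact: measurable_coor.
  rewrite -bigcap_seq; apply/seteqP; split=> [x xA i _|x xA i]; first exact: xA.
  by apply: xA; rewrite /= mem_index_enum.
rewrite -product_measure1E//=/leb_step /pushforward.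
congr (_ _); apply/seteqP; split=> [[t y]/= h|[t y]/= [At Ay] i].
  split=> [|i]; first by have := h ord0; rewrite mxE unlift_none.
  by have := h (lift ord0 i); rewrite mxE liftK.
by rewrite mxE; case: unliftP => [j|] ->.
Qed.
End lebesgue_rV.

Local Open Scope complex_scope.

Section domains.
Context {R : realType} {d : nat}.

Record domain := Domain {
  dom_set :> set 'rV[R]_d;
  dom_open : open dom_set;
  dom_nonempty : dom_set !=set0;
  dom_connected : connected dom_set
}.

Definition dotp (x y : 'rV[R]_d) : R := \sum_i x ord0 i * y ord0 i.

(* Near each boundary point and in suitable orthonormal coordinates, O is the  *)
(* strict epigraph of a Lipschitz function of d - 1 variables. Here nu is the  *)
(* unit vector of the vertical axis and x - <x, nu> nu, which ranges over the  *)
(* hyperplane orthogonal to nu, stands for the d - 1 horizontal coordinates.   *)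
Definition lipschitz_boundary (O : set 'rV[R]_d) : Prop :=
  forall x0, (closure O `\` interior O) x0 ->
  exists (nu : 'rV[R]_d) (g : 'rV[R]_d -> R) (r : R),
    [/\ dotp nu nu = 1, lipschitz g, 0 < r &
        forall x, ball x0 r x ->
          (O x <-> g (x - dotp x nu *: nu) < dotp x nu)].

Definition leb_on (O : domain) : {measure set 'rV[R]_d -> \bar R} :=
  mrestr (lebesgue_rV d) (open_measurable_rV (@dom_open O)).

End domains.
Arguments domain : clear implicits.

Section sobolev.
Context {R : realType} {d : nat}.
Local Notation C := R[i].
Local Notation fn := ('rV[R]_d -> C).
Implicit Types (f g w phi psi : fn) (s : seq 'I_d).

Definition pderiv (i : 'I_d) f : fn := fun x =>
  'D_(delta_mx ord0 i) (fun y => complex.Re (f y)) x +i*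
  'D_(delta_mx ord0 i) (fun y => complex.Im (f y)) x.

Definition pderivs s f : fn := foldr pderiv f s.

Definition laplacian f : fn := fun x => \sum_i pderivs [:: i; i] f x.

Definition smooth f : Prop := forall s x,
  differentiable (fun y => complex.Re (pderivs s f y)) x /\
  differentiable (fun y => complex.Im (pderivs s f y)) x.

Variable O : domain R d.
Local Notation mu := (leb_on O).

Definition test_function phi : Prop :=
  [/\ smooth phi, compact (closure [set x | phi x != 0]) &
      closure [set x | phi x != 0] `<=` O].

Definition cintegral f : C :=
  (\int[mu]_x complex.Re (f x)) +i* (\int[mu]_x complex.Im (f x)).

(* L^2(O; C). Elements of L^2(O) are represented by functions on the whole     *)
(* space, and are identified when they agree mu-almost everywhere; their       *)
(* values outside of O are irrelevant.                                         *)
Definition L2 f : Prop :=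
  ((fun x => complex.Re (f x)) \in Lfun mu 2%:E) /\
  ((fun x => complex.Im (f x)) \in Lfun mu 2%:E).

Definition inner f g : C := cintegral (fun x => f x * (g x)^*).

Definition L2norm f : R :=
  Num.sqrt (\int[mu]_x (complex.Re (f x) ^+ 2 + complex.Im (f x) ^+ 2)).

Definition weak_deriv s f g : Prop := forall phi, test_function phi ->
  cintegral (fun x => f x * pderivs s phi x) =
  (-1) ^+ size s * cintegral (fun x => g x * phi x).

(* the weak derivative of f along s, unique up to a mu-negligible set          *)
Definition wD s f : fn := xget (fun=> 0) [set g | L2 g /\ weak_deriv s f g].

Definition wlaplacian f : fn := fun x => \sum_i wD [:: i; i] f x.

Definition H2 f : Prop := L2 f /\
  forall s, (size s <= 2)%N -> exists g, L2 g /\ weak_deriv s f g.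

Definition gradnorm2 f : R := \sum_i L2norm (wD [:: i] f) ^+ 2.

Definition H2norm f : R :=
  Num.sqrt (L2norm f ^+ 2 + gradnorm2 f +
            \sum_i \sum_j L2norm (wD [:: i; j] f) ^+ 2).

Definition H20 f : Prop := H2 f /\
  forall e : R, 0 < e -> exists2 phi, test_function phi & H2norm (f \- phi) < e.

Definition ae_zero f : Prop := f = cst 0 %[ae mu].

Definition lincomb m (c : 'I_m -> C) (b : 'I_m -> fn) : fn :=
  fun x => \sum_i c i * b i x.

(* dimension of a space of functions modulo mu-a.e. equality                   *)
Definition has_dim (E : set fn) (m : nat) : Prop :=
  exists b : 'I_m -> fn,
    [/\ forall i, E (b i),
        forall c, ae_zero (lincomb c b) -> forall i, c i = 0 &
        forall w, E w -> exists c, w = lincomb c b %[ae mu]].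

Definition H20_subspace (E : set fn) : Prop :=
  [/\ E `<=` H20, E (cst 0),
      forall (a : C) u v, E u -> E v -> E (fun x => a * u x + v x) &
      forall u v, E u -> H20 v -> v = u %[ae mu] -> E v].

(* A distribution on O is given by its values on test functions.               *)
Definition dist_of f : fn -> C := fun phi => cintegral (fun x => f x * phi x).

Definition dist_laplacian (T : fn -> C) : fn -> C := fun phi => T (laplacian phi).

(* H^{-2}(O), the dual space of H^2_0(O), as a space of distributions          *)
Definition Hm2 (F : fn -> C) : Prop :=
  (forall (a : C) phi psi, test_function phi -> test_function psi ->
     F (fun x => a * phi x + psi x) = a * F phi + F psi) /\
  exists M : R, forall phi, test_function phi -> `|F phi| <= (M * H2norm phi)%:C.

End sobolev.

Section eigenvalue_problem.
Context {R : realType} {d : nat}.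
Local Notation C := R[i].
Local Notation fn := ('rV[R]_d -> C).
Variables (O : domain R d) (n : 'rV[R]_d -> R).
Implicit Types (w : fn) (l : C).
Local Notation mu := (leb_on O).

Definition admissible_index : Prop :=
  n \in Lfun mu +oo%E /\ (0 < ess_inf mu (EFin \o n))%E.

Definition nlaplacian w : fn := fun x => ((n x)^-1)%:C * wlaplacian O w x.

Definition eigen_eq l w : Prop := forall phi, test_function O phi ->
  dist_laplacian (dist_of O (nlaplacian w)) phi =
  - l * dist_of O (wlaplacian O w) phi.

Definition eigen_space l : set fn := [set w | H20 O w /\ eigen_eq l w].

Definition eigenvalues : set C :=
  [set l | exists2 w, eigen_space l w & ~ ae_zero O w].

(* l is in the resolvent set when w |-> Lap (n^-1 Lap w) + l Lap w is a        *)
(* bijection from H^2_0(O) to H^{-2}(O); its inverse is then automatically     *)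
(* bounded.                                                                    *)
Definition resolves l (F : fn -> C) w : Prop := H20 O w /\
  forall phi, test_function O phi ->
    dist_laplacian (dist_of O (nlaplacian w)) phi +
    l * dist_of O (wlaplacian O w) phi = F phi.

Definition resolvent_set : set C := [set l | forall F, Hm2 O F ->
  exists2 w, resolves l F w & forall v, resolves l F v -> v = w %[ae mu]].

Definition spectrum : set C := ~` resolvent_set.

(* lam lists the eigenvalues in nondecreasing order, each as many times as the *)
(* dimension of its eigenspace, which is finite.                               *)
Definition eigen_enum (lam : R^nat) : Prop :=
  nondecreasing_seq lam /\
  forall l, exists2 m : nat, has_dim O (eigen_space l) m &
    ([set p | (lam p)%:C = l] #= `I_m)%card.

Definition eigval : R^nat := xget (fun=> 0) eigen_enum.

Definition rayleigh w : C :=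
  inner O (nlaplacian w) (wlaplacian O w) / (gradnorm2 O w)%:C.

End eigenvalue_problem.

Section extrema.
Context {disp : Order.disp_t} {T : porderType disp}.
Definition is_max (A : set T) (m : T) : Prop := A m /\ ubound A m.
Definition is_min (A : set T) (m : T) : Prop := A m /\ lbound A m.
End extrema.

Definition subspaces {R : realType} {d : nat} (O : domain R d) (m : nat) :
    set (set ('rV[R]_d -> R[i])) :=
  [set E | H20_subspace O E /\ has_dim O E m].

Definition isolated_point {R : realType} (A : set R[i]) (l : R[i]) : Prop :=
  A l /\ exists2 e : R, 0 < e & forall l', A l' -> l' != l -> e%:C <= `|l' - l|.

(* Main.v *)
Require Import Defs.
From HB Require Import structures.
From mathcomp Require Import all_boot all_order all_algebra.
From mathcomp Require Import all_classical all_reals all_analysis.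
From mathcomp Require Import ess_sup_inf complex.
From mathcomp Require Import measurable_realfun ring lra.
Set Implicit Arguments.
Unset Strict Implicit.
Unset Printing Implicit Defensive.
Import Order.TTheory GRing.Theory Num.Theory.
Import numFieldNormedType.Exports.
Local Open Scope classical_set_scope.
Local Open Scope ring_scope.
Local Open Scope complex_scope.

(** On H^2_0(O) let a(u, v) = (n^-1 Lap u, Lap v) and b(u, v) = (grad u, grad v).
Integrating by parts on test functions, the H^2 norm is equivalent to the norm
of a (Poincare's inequality, and |D^2 u| = |Lap u| in L^2); hence a is complete,
and b is compact relative to a by Rellich's theorem, which for functions
supported in a cube follows from the mean value inequality on small cells. A
maximizer of b / a is an eigenvector for the largest 1 / lambda; restricting to
the a-orthogonal complement and iterating produces an eigensystem (e_p, lam_p)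
with lam_p tending to infinity and a >= lam_p b on the complement of e_0, ...,
e_{p-1}. This gives at once the min-max formula, the list of the eigenspaces, and
the solvability of a(w, .) - l b(w, .) = F for all other l by expansion along the
e_p. The distributional problems are the weak ones tested on the conjugates of
test functions, which are dense. Parts (2) to (4) compare the forms
a for two indices through the min-max formula. Functions are only identified
almost everywhere, so all forms are degenerate and positivity is replaced by
the fact that b(u, u) = 0 forces a(u, u) = 0. *)

(** Weak compactness is avoided in the search for a maximizer of b / a. With mu = sup b / a, the
    form mu a - b is nonnegative and small along a maximizing sequence, so Cauchy for b implies
    Cauchy for a, and strong completeness suffices; Cauchy-Schwarz for the same form gives the
    eigenvector equation. Compactness is stated as b(u, u) <= e a(u, u) + sum |l_j(u)|^2 with
    finitely many bounded functionals: this passes to subspaces, and it forces the eigenvalues to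
    infinity because m functionals have a common nontrivial zero in any span of m + 1 independent
    vectors. For the gradient, Rellich's inequality bounds |u|^2 by e |grad u|^2 and finitely many
    integrals over cells, and |grad u|^2 <= |u| |Lap u| closes the estimate. Inequalities are proved
    on test functions, where derivatives are classical and commute, and pass to H^2_0 because both
    sides are controlled by the H^2 norm. The right-hand side F of the resolvent problem is known on
    test functions only, so it is first extended by density. *)

Local Notation cj := (@conjc _).

(** * Hermitian forms *)

Section complex_square.
Context {R : realType}.
Local Notation C := R[i].
Implicit Types z : C.

(** The squared modulus with values in R rather than in the partially ordered R[i], so that
    estimates and limits are real ones. *)
Definition nsq z : R := complex.Re z ^+ 2 + complex.Im z ^+ 2.

Lemma nsqE z : (nsq z)%:C = z * cj z.
Proof. by case: z => a b; rewrite /nsq /=; simpc; congr (_ +i* _); ring. Qed.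

Lemma conjcM z1 z2 : cj (z1 * z2) = cj z1 * cj z2.
Proof. exact: rmorphM. Qed.

Lemma conjcD z1 z2 : cj (z1 + z2) = cj z1 + cj z2.
Proof. exact: rmorphD. Qed.

Lemma conjcB z1 z2 : cj (z1 - z2) = cj z1 - cj z2.
Proof. exact: rmorphB. Qed.

Lemma nsq_ge0 z : 0 <= nsq z.
Proof. by rewrite addr_ge0 ?sqr_ge0. Qed.

Lemma nsq0 : nsq 0 = 0.
Proof. by rewrite /nsq /= expr0n addr0. Qed.

Lemma nsq_eq0 z : nsq z = 0 -> z = 0.
Proof.
case: z => a b /eqP; rewrite /nsq /= paddr_eq0 ?sqr_ge0// !sqrf_eq0.
by move=> /andP[/eqP -> /eqP ->].
Qed.

Lemma nsqM z1 z2 : nsq (z1 * z2) = nsq z1 * nsq z2.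
Proof. by case: z1 z2 => a b [c e]; rewrite /nsq; simpc => /=; ring. Qed.

Lemma nsq_conj z : nsq (cj z) = nsq z.
Proof. by case: z => a b; rewrite /nsq /= sqrrN. Qed.

Lemma nsqN z : nsq (- z) = nsq z.
Proof. by case: z => a b; rewrite /nsq /= !sqrrN. Qed.

Lemma nsqR (r : R) : nsq r%:C = r ^+ 2.
Proof. by rewrite /nsq /= [0 ^+ 2]expr0n addr0. Qed.

Lemma nsqV z : nsq z^-1 = (nsq z)^-1.
Proof.
have [->|z0] := eqVneq z 0; first by rewrite invr0 nsq0 invr0.
have nz : nsq z != 0 by apply: contra_neq z0 => /nsq_eq0.
apply: (mulfI nz); rewrite mulfV// -nsqM mulfV//.
by rewrite (_ : 1 = 1%:C)// nsqR expr1n.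
Qed.

Lemma nsqD_le z1 z2 : nsq (z1 + z2) <= 2 * nsq z1 + 2 * nsq z2.
Proof.
case: z1 z2 => a b [c e]; rewrite /nsq /= -subr_ge0.
have -> : 2 * (a ^+ 2 + b ^+ 2) + 2 * (c ^+ 2 + e ^+ 2) -
  ((a + c) ^+ 2 + (b + e) ^+ 2) = (a - c) ^+ 2 + (b - e) ^+ 2 by ring.
by rewrite addr_ge0 ?sqr_ge0.
Qed.

Lemma ReM_conj z1 z2 : complex.Re (z1 * cj z2) =
  complex.Re z1 * complex.Re z2 + complex.Im z1 * complex.Im z2.
Proof. by case: z1 z2 => a b [c e]; simpc. Qed.

Lemma ReD z1 z2 : complex.Re (z1 + z2) = complex.Re z1 + complex.Re z2.
Proof. by case: z1 z2 => a b []. Qed.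

Lemma ImD z1 z2 : complex.Im (z1 + z2) = complex.Im z1 + complex.Im z2.
Proof. by case: z1 z2 => a b []. Qed.

Lemma ReN z : complex.Re (- z) = - complex.Re z.
Proof. by case: z. Qed.

Lemma ImN z : complex.Im (- z) = - complex.Im z.
Proof. by case: z. Qed.

Lemma Re_sum (I : Type) (r : seq I) (P : pred I) (F : I -> C) :
  complex.Re (\sum_(i <- r | P i) F i) = \sum_(i <- r | P i) complex.Re (F i).
Proof. by elim/big_rec2: _ => // i x y _ <-; rewrite ReD. Qed.

Lemma Im_sum (I : Type) (r : seq I) (P : pred I) (F : I -> C) :
  complex.Im (\sum_(i <- r | P i) F i) = \sum_(i <- r | P i) complex.Im (F i).
Proof. by elim/big_rec2: _ => // i x y _ <-; rewrite ImD. Qed.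

Lemma RCsum (I : Type) (r : seq I) (P : pred I) (F : I -> R) :
  (\sum_(i <- r | P i) F i)%:C = \sum_(i <- r | P i) (F i)%:C :> C.
Proof. exact: raddf_sum. Qed.

(** With more rows than columns the left kernel of the matrix is nonzero, and any of its nonzero
    rows gives the coefficients. This is the source of the dimension counts below: m + 1 vectors
    have a nontrivial combination killed by m linear conditions. *)
Lemma underdetermined (m n : nat) (M : 'I_n -> 'I_m -> C) : (m < n)%N ->
  exists c : 'I_n -> C, (exists i, c i != 0) /\ forall j, \sum_i c i * M i j = 0.
Proof.
move=> mn; pose A : 'M[C]_(n, m) := \matrix_(i, j) M i j.
have : kermx A != 0.
  rewrite -mxrank_eq0 mxrank_ker -lt0n subn_gt0.
  by rewrite (leq_ltn_trans (rank_leq_col A)).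
move=> /matrix0Pn[i [j kij]].
exists (fun k => kermx A i k); split; first by exists j.
move=> k; have /matrixP/(_ i k) := mulmx_ker A; rewrite !mxE => {2}<-.
by apply: eq_bigr => l _; rewrite !mxE.
Qed.

End complex_square.

(** * Nonnegative Hermitian forms on a subspace *)

Section forms.
Context {R : realType} {X : lmodType R[i]}.
Local Notation C := R[i].
Implicit Types (u v w : X) (V W : set X) (a b : X -> X -> C).

Definition subsp V := V 0 /\ forall c u v, V u -> V v -> V (c *: u + v).

(** The form is a total function about which nothing is assumed off V, since weak derivatives are
    meaningful on H^2 only. Null vectors are allowed: functions that vanish almost everywhere are
    such. *)
Record hform V a : Prop := HForm {
  hlin : forall c u v w, V u -> V v -> V w -> a (c *: u + v) w = c * a u w + a v w;
  hsym : forall u v, V u -> V v -> a v u = cj (a u v);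
  hpos : forall u, V u -> 0 <= a u u }.

Definition sq a u : R := complex.Re (a u u).

Lemma hform_sub V W a : W `<=` V -> hform V a -> hform W a.
Proof.
move=> WV [l s p]; split=> [c u v w /WV Vu /WV Vv /WV Vw|u v /WV Vu /WV Vv|u /WV].
- exact: l.
- exact: s.
- exact: p.
Qed.

Section subsp.
Variables (V : set X) (sV : subsp V).

Lemma subsp0 : V 0. Proof. by case: sV. Qed.

Lemma subspZ c u : V u -> V (c *: u).
Proof. by case: sV => V0 VP Vu; rewrite -[_ *: _]addr0; exact: VP. Qed.

Lemma subspD u v : V u -> V v -> V (u + v).
Proof. by case: sV => V0 VP Vu Vv; rewrite -[u]scale1r; exact: VP. Qed.

Lemma subspN u : V u -> V (- u).
Proof. by move=> Vu; rewrite -scaleN1r; exact: subspZ. Qed.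

Lemma subspB u v : V u -> V v -> V (u - v).
Proof. by move=> Vu Vv; apply: subspD => //; exact: subspN. Qed.

Lemma subsp_sum (I : Type) (r : seq I) (P : pred I) (F : I -> X) :
  (forall i, P i -> V (F i)) -> V (\sum_(i <- r | P i) F i).
Proof.
move=> VF; elim/big_ind: _ => //; [exact: subsp0|exact: subspD].
Qed.

End subsp.

Section hform_theory.
Variables (V : set X) (sV : subsp V) (a : X -> X -> C) (ha : hform V a).
Let V0 := subsp0 sV.
#[local] Hint Resolve V0 : core.

Lemma hform0l w : V w -> a 0 w = 0.
Proof.
move=> Vw; have := hlin ha (-1) V0 V0 Vw.
by rewrite scaler0 addr0 mulN1r addNr.
Qed.

Lemma hformZl c u w : V u -> V w -> a (c *: u) w = c * a u w.
Proof.
by move=> Vu Vw; rewrite -[c *: u]addr0 (hlin ha)// hform0l// addr0.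
Qed.

Lemma hformDl u v w : V u -> V v -> V w -> a (u + v) w = a u w + a v w.
Proof. by move=> Vu Vv Vw; rewrite -{1}[u]scale1r (hlin ha)// mul1r. Qed.

Lemma hformNl u w : V u -> V w -> a (- u) w = - a u w.
Proof. by move=> Vu Vw; rewrite -scaleN1r hformZl// mulN1r. Qed.

Lemma hformBl u v w : V u -> V v -> V w -> a (u - v) w = a u w - a v w.
Proof. by move=> Vu Vv Vw; rewrite hformDl ?hformNl//; exact: subspN. Qed.

Lemma hform0r w : V w -> a w 0 = 0.
Proof. by move=> Vw; rewrite (hsym ha V0 Vw) hform0l// conjc0. Qed.

Lemma hformZr c u w : V u -> V w -> a w (c *: u) = cj c * a w u.
Proof.
move=> Vu Vw; rewrite (hsym ha _ Vw) ?hformZl//; last exact: subspZ.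
by rewrite rmorphM/= -(hsym ha).
Qed.

Lemma hformDr u v w : V u -> V v -> V w -> a w (u + v) = a w u + a w v.
Proof.
move=> Vu Vv Vw; rewrite (hsym ha _ Vw) ?hformDl//; last exact: subspD.
by rewrite rmorphD/= -!(hsym ha).
Qed.

Lemma hformNr u w : V u -> V w -> a w (- u) = - a w u.
Proof.
move=> Vu Vw; rewrite -scaleN1r hformZr// rmorphN1 mulN1r//.
Qed.

Lemma hformBr u v w : V u -> V v -> V w -> a w (u - v) = a w u - a w v.
Proof. by move=> Vu Vv Vw; rewrite hformDr ?hformNr//; exact: subspN. Qed.

Lemma hform_suml (I : Type) (r : seq I) (P : pred I) (F : I -> X) w :
  (forall i, P i -> V (F i)) -> V w ->
  a (\sum_(i <- r | P i) F i) w = \sum_(i <- r | P i) a (F i) w.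
Proof.
move=> VF Vw; suff : V (\sum_(i <- r | P i) F i) /\
  a (\sum_(i <- r | P i) F i) w = \sum_(i <- r | P i) a (F i) w by case.
elim/big_rec2: _ => [|i x y Pi [Vy yx]]; first by rewrite hform0l.
by split; [apply: subspD => //; exact: VF|rewrite hformDl ?yx//; exact: VF].
Qed.

Lemma hform_sumr (I : Type) (r : seq I) (P : pred I) (F : I -> X) w :
  (forall i, P i -> V (F i)) -> V w ->
  a w (\sum_(i <- r | P i) F i) = \sum_(i <- r | P i) a w (F i).
Proof.
move=> VF Vw; rewrite (hsym ha _ Vw) ?hform_suml//; last exact: subsp_sum.
by rewrite rmorph_sum; apply: eq_bigr => i Pi /=; rewrite -(hsym ha)//; exact: VF.
Qed.

Lemma sqE u : V u -> a u u = (sq a u)%:C.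
Proof.
by move=> Vu; have := hpos ha Vu; rewrite /sq; case: (a u u) => x y /ger0_Im/= ->.
Qed.

Lemma sq_ge0 u : V u -> 0 <= sq a u.
Proof. by move=> Vu; rewrite -ler0c -sqE//; exact: (hpos ha Vu). Qed.

Lemma sq0 : sq a 0 = 0.
Proof. by rewrite /sq hform0l. Qed.

Lemma sqZ c u : V u -> sq a (c *: u) = nsq c * sq a u.
Proof.
move=> Vu; apply: complexI; rewrite rmorphM/= nsqE -!sqE//; last exact: subspZ.
by rewrite hformZl ?hformZr//; [ring|exact: subspZ].
Qed.

Lemma sqN u : V u -> sq a (- u) = sq a u.
Proof.
move=> Vu; rewrite -scaleN1r sqZ// nsqN (_ : 1 = 1%:C)// nsqR expr1n mul1r//.
Qed.

Lemma sqD u v : V u -> V v -> sq a (u + v) = sq a u + sq a v + 2 * complex.Re (a u v).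
Proof.
move=> Vu Vv; rewrite /sq hformDl// ?hformDr//; last exact: subspD.
rewrite (hsym ha Vu Vv); case: (a u u) (a v v) (a u v) => [? ?] [? ?] [? ?] /=.
ring.
Qed.

Lemma sqB u v : V u -> V v -> sq a (u - v) = sq a u + sq a v - 2 * complex.Re (a u v).
Proof.
move=> Vu Vv; rewrite sqD//; last exact: subspN.
by rewrite sqN// hformNr//; case: (a u v) => /= ? ?; rewrite mulrN.
Qed.

Lemma sqBC u v : V u -> V v -> sq a (u - v) = sq a (v - u).
Proof. by move=> Vu Vv; rewrite -sqN ?opprB//; exact: subspB. Qed.

Lemma sqD_le u v : V u -> V v -> sq a (u + v) <= 2 * sq a u + 2 * sq a v.
Proof.
move=> Vu Vv; have := sq_ge0 (subspB sV Vu Vv); rewrite sqB// sqD//; lra.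
Qed.

Lemma sqB_le u v : V u -> V v -> sq a (u - v) <= 2 * sq a u + 2 * sq a v.
Proof.
by move=> Vu Vv; rewrite -(sqN Vv); apply: sqD_le => //; exact: subspN.
Qed.

Lemma sq_sum_le (m : nat) (F : 'I_m -> X) : (forall i, V (F i)) ->
  sq a (\sum_i F i) <= m%:R * \sum_i sq a (F i).
Proof.
move=> VF; have VS : V (\sum_i F i) by apply: subsp_sum.
rewrite -lecR -sqE// hform_suml//.
under eq_bigr do rewrite hform_sumr//.
(* The order of R[i] also compares imaginary parts. Those of the double sum are antisymmetric in (i,
   j), so their sum is its own opposite. *)
rewrite lecE; apply/andP; split.
  rewrite !Im_sum /=; apply/eqP/esym.
  under eq_bigr do rewrite Im_sum.
  pose g i j := complex.Im (a (F i) (F j)).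
  have gN i j : g i j = - g j i by rewrite /g (hsym ha (VF j) (VF i)); case: (a _ _).
  have : \sum_i \sum_j g i j = - \sum_i \sum_j g i j.
    rewrite {1}exchange_big/= -sumrN; apply: eq_bigr => i _.
    by rewrite -sumrN; apply: eq_bigr => j _; rewrite gN.
  by rewrite /g; lra.
rewrite Re_sum/=; under eq_bigr do rewrite Re_sum.
apply: (@le_trans _ _ (\sum_i \sum_j (2^-1 * (sq a (F i) + sq a (F j))))).
  apply: ler_sum => i _; apply: ler_sum => j _.
  have := sq_ge0 (subspB sV (VF i) (VF j)); rewrite sqB//; lra.
have -> : \sum_(i < m) \sum_(j < m) 2^-1 * (sq a (F i) + sq a (F j)) =
    \sum_(i < m) (2^-1 * (m%:R * sq a (F i) + \sum_(j < m) sq a (F j))).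
  apply: eq_bigr => i _; rewrite -mulr_sumr big_split/= sumr_const card_ord.
  by rewrite mulr_natl.
rewrite -mulr_sumr big_split/= -mulr_sumr sumr_const card_ord -mulr_natl.
lra.
Qed.

Lemma hform_CS u v : V u -> V v -> nsq (a u v) <= sq a u * sq a v.
Proof.
move=> Vu Vv; set z := a u v.
(* Positivity of [sq a (u - r z v)], a polynomial of degree at most 2 in the real number r. *)
have E (r : R) : 0 <= sq a u + r ^+ 2 * nsq z * sq a v - 2 * r * nsq z.
  have Vrv : V ((r%:C * z) *: v) by exact: subspZ.
  have := sq_ge0 (subspB sV Vu Vrv); rewrite sqB// sqZ// nsqM nsqR hformZr// -/z.
  rewrite (_ : cj (r%:C * z) * z = (r * nsq z)%:C) /= ?mulrA//.
  have -> : (r * nsq z)%:C = r%:C * (nsq z)%:C by rewrite -rmorphM.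
  by rewrite nsqE conjcM conjc_real; ring.
have [t0|t0] := eqVneq (sq a v) 0.
  rewrite t0 mulr0; case: (leP (nsq z) 0) => // z0.
  (* When v is a null vector the polynomial is affine in r, and this r gives it the value -1. *)
  have := E ((sq a u + 1) / (2 * nsq z)); rewrite t0.
  have -> : 2 * ((sq a u + 1) / (2 * nsq z)) * nsq z = sq a u + 1.
    by field; rewrite lt0r_neq0.
  lra.
have tp : 0 < sq a v by rewrite lt_def t0 sq_ge0.
have := E (sq a v)^-1.
have -> : sq a u + (sq a v)^-1 ^+ 2 * nsq z * sq a v - 2 * (sq a v)^-1 * nsq z =
  (sq a u * sq a v - nsq z) / sq a v by field.
by rewrite pmulr_lge0 ?invr_gt0// subr_ge0.
Qed.

Lemma hform_null u v : V u -> V v -> sq a u = 0 -> a u v = 0.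
Proof.
move=> Vu Vv u0; apply: nsq_eq0; apply/eqP; rewrite eq_le nsq_ge0 andbT.
by have := hform_CS Vu Vv; rewrite u0 mul0r.
Qed.

Lemma sqrt_sqD u v : V u -> V v ->
  Num.sqrt (sq a (u + v)) <= Num.sqrt (sq a u) + Num.sqrt (sq a v).
Proof.
move=> Vu Vv; have su := sq_ge0 Vu; have sv := sq_ge0 Vv.
rewrite -(@ler_pXn2r _ 2) ?nnegrE ?addr_ge0 ?sqrtr_ge0//.
rewrite sqr_sqrtr; last by apply: sq_ge0; exact: subspD.
rewrite sqrrD !sqr_sqrtr// sqD// -sqrtrM//.
suff : complex.Re (a u v) <= Num.sqrt (sq a u * sq a v) by rewrite -mulr_natr; lra.
apply: le_trans (ler_norm _) _; rewrite -sqrtr_sqr ler_wsqrtr//.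
apply: le_trans (hform_CS Vu Vv); rewrite /nsq lerDl sqr_ge0//.
Qed.

Lemma sqrt_sqB u v : V u -> V v ->
  `|Num.sqrt (sq a u) - Num.sqrt (sq a v)| <= Num.sqrt (sq a (u - v)).
Proof.
move=> Vu Vv; have Vuv := subspB sV Vu Vv; have Vvu := subspB sV Vv Vu.
rewrite ler_norml; apply/andP; split.
  by rewrite lerNl opprB lerBlDr sqBC// -{1}[v](subrK u) sqrt_sqD.
by rewrite lerBlDr -{1}[u](subrK v) sqrt_sqD.
Qed.

Lemma cvg_sq (s : nat -> X) u : (forall n, V (s n)) -> V u ->
  sq a (s n - u) @[n --> \oo] --> 0 -> sq a (s n) @[n --> \oo] --> sq a u.
Proof.
move=> Vs Vu su.
have h : Num.sqrt (sq a (s n)) @[n --> \oo] --> Num.sqrt (sq a u).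
  apply/cvgrPdist_le => e e0; move/cvgrPdist_le : su => /(_ (e ^+ 2)).
  rewrite exprn_gt0// => /(_ isT); apply: filterS => n.
  rewrite sub0r normrN ger0_norm; last by apply: sq_ge0; exact: subspB.
  move=> h; apply: le_trans (sqrt_sqB _ _) _ => //.
  rewrite sqBC// -[leRHS]ger0_norm ?(ltW e0)// -sqrtr_sqr; exact: ler_wsqrtr.
rewrite -[X in _ --> X]sqr_sqrtr ?sq_ge0//.
have -> : (fun n => sq a (s n)) = (fun n => Num.sqrt (sq a (s n)) * Num.sqrt (sq a (s n))).
  by apply/funext => n; rewrite -expr2 sqr_sqrtr ?sq_ge0.
by rewrite expr2; exact: cvgM.
Qed.

End hform_theory.

End forms.

(** * Relatively compact forms and maximizers *)

Section ultrafilter_limits.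
Context {R : realType} (U : set_system nat) {UU : UltraFilter U}.

(** Compactness of the segment gives a cluster point of the image filter. An ultrafilter contains
    each set or its complement, so the cluster point is a limit. One ultrafilter on the indices
    serves all bounded sequences at once, which replaces repeated extractions of subsequences. *)
Lemma ultra_bounded_cvg (x : nat -> R) (M : R) : (forall k, `|x k| <= M) ->
  exists l, forall e, 0 < e -> U [set k | `|x k - l| < e].
Proof.
move=> xM; have PF : ProperFilter U by exact: ultra_proper.
have FF : ProperFilter (x @ U) by exact: fmap_proper_filter.
have Fc : (x @ U) `[- M, M]%classic.
  by rewrite /fmap/=; apply: (@filterS _ _ _ setT); [move=> k _ /=; rewrite in_itv/= -ler_norml|exact: filterT].
have [l [_ cl]] := segment_compact FF Fc.
exists l => e e0; have [//|UC] := in_ultra_setVsetC [set k | `|x k - l| < e] UU.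
have B : nbhs l (ball l e) by exact: nbhsx_ballx.
have [y [yA yB]] := cl [set y | ~ `|y - l| < e] (ball l e) UC B.
by case: yA; rewrite distrC; exact: yB.
Qed.

Lemma ultra_bounded_nsq (x : nat -> R[i]) (M : R) : (forall k, nsq (x k) <= M) ->
  forall e, 0 < e -> exists A, U A /\ forall k l, A k -> A l -> nsq (x k - x l) <= e.
Proof.
move=> xM e e0; have PF : ProperFilter U by exact: ultra_proper.
have M0 : 0 <= M by apply: le_trans (xM 0%N); exact: nsq_ge0.
have bnd (g : R) : g ^+ 2 <= M -> `|g| <= M + 1.
  by move=> gM; rewrite ler_norml; apply/andP; split; nra.
have rM k : `|complex.Re (x k)| <= M + 1.
  by apply: bnd; apply: le_trans (xM k); rewrite lerDl sqr_ge0.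
have iM k : `|complex.Im (x k)| <= M + 1.
  by apply: bnd; apply: le_trans (xM k); rewrite lerDr sqr_ge0.
have [r hr] := ultra_bounded_cvg rM; have [s hs] := ultra_bounded_cvg iM.
(* Two points within t of the same limit differ by at most 2 t, and (2 t)^2 = e / 2 is the share of
   the real and of the imaginary part. *)
pose t := Num.sqrt (e / 8).
have t0 : 0 < t by rewrite sqrtr_gt0 divr_gt0.
have tt : t ^+ 2 = e / 8 by rewrite sqr_sqrtr// divr_ge0// ltW.
exists ([set k | `|complex.Re (x k) - r| < t] `&` [set k | `|complex.Im (x k) - s| < t]).
split; first by apply: filterI; [exact: hr|exact: hs].
have sqD2 (p q c : R) : `|p - c| < t -> `|q - c| < t -> (p - q) ^+ 2 <= e / 2.
  move=> /[dup] /ltr_normlW h1; rewrite ltr_norml => /andP[h2 _].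
  move=> /[dup] /ltr_normlW h3; rewrite ltr_norml => /andP[h4 _].
  have -> : e / 2 = 4 * t ^+ 2 by rewrite tt; field.
  nra.
move=> k l [/= rk ik] [/= rl il]; rewrite /nsq ReD ReN ImD ImN.
by have := sqD2 _ _ _ rk rl; have := sqD2 _ _ _ ik il; lra.
Qed.

End ultrafilter_limits.

Section maximizer.
Context {R : realType} {X : lmodType R[i]}.
Local Notation C := R[i].
Implicit Types (u v w : X) (V W : set X) (a b : X -> X -> C).

Definition complete_for W a := forall u : nat -> X, (forall k, W (u k)) ->
  (forall e : R, 0 < e -> exists N, forall i j, (N <= i)%N -> (N <= j)%N ->
     sq a (u i - u j) <= e) ->
  exists w, W w /\ sq a (u n - w) @[n --> \oo] --> 0.

(* For complete [a], this is compactness of the embedding of ([W], [a]) into ([W], [b]). *)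
Definition compact_wrt W a b := forall e : R, 0 < e ->
  exists (m : nat) (l : 'I_m -> X -> C),
  [/\ forall j c u v, W u -> W v -> l j (c *: u + v) = c * l j u + l j v,
      exists M : R, 0 <= M /\ forall j u, W u -> nsq (l j u) <= M * sq a u &
      forall u, W u -> sq b u <= e * sq a u + \sum_j nsq (l j u)].

Lemma sub_compact_wrt V W a b : W `<=` V -> compact_wrt V a b -> compact_wrt W a b.
Proof.
move=> WV cb e e0; have [m [l [l1 [M [M0 l2]] l3]]] := cb e e0.
exists m, l; split=> [j c u v /WV Vu /WV Vv| |u /WV]; [exact: l1| |exact: l3].
by exists M; split => // j u /WV; exact: l2.
Qed.

Variables (W : set X) (sW : subsp W) (a b : X -> X -> C).
Hypotheses (ha : hform W a) (hb : hform W b).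
Hypotheses (comp : complete_for W a) (cpt : compact_wrt W a b).

Lemma compact_wrt_bounded : exists M : R, 0 <= M /\ forall u, W u -> sq b u <= M * sq a u.
Proof.
have [m [l [_ [M [M0 lM]] bl]]] := cpt ltr01; exists (1 + m%:R * M); split.
  by rewrite addr_ge0// mulr_ge0.
move=> u Wu; apply: le_trans (bl u Wu) _; rewrite mulrDl lerD2l -mulrA.
rewrite mulr_natl -[X in _ *+ X](card_ord m) -sumr_const; apply: ler_sum => j _; exact: lM.
Qed.

Lemma compact_ultra_cauchy (U : set_system nat) (UU : UltraFilter U) (u : nat -> X) :
  (forall k, W (u k)) -> (forall k, sq a (u k) <= 1) -> forall e : R, 0 < e ->
  exists A, U A /\ forall k l, A k -> A l -> sq b (u k - u l) <= e.
Proof.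
move=> Wu u1 e e0; have PF : ProperFilter U by exact: ultra_proper.
(* Differences of vectors of the unit ball have [sq a] at most 4, so the first term costs e / 2; the
   m functionals share the other half, the division by m + 1 covering the case m = 0. *)
have e8 : 0 < e / 8 by rewrite divr_gt0.
have [m [l [ll [M [M0 lM]] bl]]] := cpt e8.
have e2 : 0 < e / 2 / m.+1%:R by rewrite !divr_gt0.
have lM1 j k : nsq (l j (u k)) <= M.
  by apply: le_trans (lM j _ (Wu k)) _; rewrite ler_piMr.
have /choice[A hA] : forall j, exists A, U A /\ forall k k', A k -> A k' ->
    nsq (l j (u k) - l j (u k')) <= e / 2 / m.+1%:R.
  by move=> j; exact: (ultra_bounded_nsq (lM1 j)).
exists [set k | forall j, A j k]; split.
  by apply: filter_forall => j; case: (hA j).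
move=> k k' Ak Ak'; have Wd : W (u k - u k') by exact: subspB.
apply: le_trans (bl _ Wd) _.
rewrite [leRHS](_ : e = e / 8 * 4 + e / 2); last by field.
apply: lerD.
  by apply: ler_wpM2l; [exact: ltW|apply: le_trans (sqB_le sW ha (Wu k) (Wu k')) _; have := u1 k; have := u1 k'; lra].
apply: (@le_trans _ _ (\sum_(j < m) (e / 2 / m.+1%:R))).
  apply: ler_sum => j _; have [_ hj] := hA j.
  have -> : u k - u k' = (-1) *: u k' + u k by rewrite scaleN1r addrC.
  by rewrite ll// mulN1r addrC; apply: hj; [exact: Ak|exact: Ak'].
rewrite sumr_const card_ord -[_ *+ m]mulr_natl mulrA ler_pdivrMr// mulrC.
by rewrite ler_pM2l ?divr_gt0// ler_nat.
Qed.

(** Let mu be the supremum of [sq b] on the unit sphere of a. The form q = mu a - b is nonnegative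
    and tends to 0 along a maximizing sequence. Since mu a = q + b, a bound on the b-differences of
    such a sequence bounds its a-differences, so that it converges in a, and the limit attains
    mu. *)
Lemma maximizer : (exists2 w, W w & 0 < sq a w) ->
  exists e, [/\ W e, sq a e = 1 & forall u, W u -> sq b u <= sq b e * sq a u].
Proof.
move=> [w0 Ww0 aw0].
have [M [M0 bM]] := compact_wrt_bounded.
have normalize w : W w -> 0 < sq a w ->
    exists2 v, W v & sq a v = 1 /\ sq b v = sq b w / sq a w.
  move=> Ww aw; exists ((Num.sqrt (sq a w)^-1)%:C *: w); first exact: subspZ.
  rewrite (sqZ sW ha)// (sqZ sW hb)// nsqR sqr_sqrtr ?invr_ge0 ?ltW//.
  by rewrite mulVf ?gt_eqF// mulrC.
pose S : set R := [set t | exists2 v, W v & sq a v = 1 /\ sq b v = t].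
have S0 : S !=set0 by have [v Wv [v1 _]] := normalize _ Ww0 aw0; exists (sq b v), v.
have SM : ubound S M by move=> _ [v Wv [v1 <-]]; rewrite (le_trans (bM v Wv))// v1 mulr1.
have hS : has_sup S by split => //; exists M.
pose mu := sup S.
have muP u : W u -> sq b u <= mu * sq a u.
  move=> Wu; have [au|au] := ltP 0 (sq a u).
    have [v Wv [v1 vb]] := normalize _ Wu au.
    rewrite -ler_pdivrMr// -vb; apply: sup_upper_bound => //; by exists v.
  have a0 : sq a u = 0 by apply/eqP; rewrite eq_le au (sq_ge0 ha).
  by rewrite (le_trans (bM u Wu))// a0 !mulr0.
have mu0 : 0 <= mu.
  have [t St] := S0; apply: le_trans (sup_upper_bound hS St).
  by case: St => v Wv [_ <-]; exact: (sq_ge0 hb Wv).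
(* If mu = 0, then [sq b] vanishes on W and any unit vector is a maximizer; otherwise division by mu
   is possible. *)
have [mu00|mupos] := eqVneq mu 0.
  have [v Wv [v1 _]] := normalize _ Ww0 aw0; exists v; split => // u Wu.
  apply: le_trans (muP u Wu) _; rewrite mu00 mul0r mulr_ge0//.
  exact: (sq_ge0 hb Wv). exact: (sq_ge0 ha Wu).
have {}mupos : 0 < mu by rewrite lt_def mupos.
have /choice[u uP] : forall k : nat, exists v, W v /\ sq a v = 1 /\ mu - k.+1%:R^-1 < sq b v.
  move=> k; have k0 : 0 < k.+1%:R^-1 :> R by rewrite invr_gt0.
  by have [t [v Wv [v1 <-]] tmu] := sup_adherent k0 hS; exists v.
have Wu k : W (u k) by case: (uP k).
have u1 k : sq a (u k) = 1 by case: (uP k) => _ [].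
have ub k : mu - k.+1%:R^-1 < sq b (u k) by case: (uP k) => _ [].
have [U [UU ooU]] := ultraFilterLemma eventually_filter.
have PF : ProperFilter U by exact: ultra_proper.
have u1' k : sq a (u k) <= 1 by rewrite u1.
have /choice[A hA] : forall n : nat, exists A, U A /\ forall k l, A k -> A l ->
    sq b (u k - u l) <= n.+1%:R^-1.
  by move=> n; apply: compact_ultra_cauchy => //; rewrite invr_gt0.
(* The indices k >= n that lie in A 0, ..., A n form a member of U, hence a nonempty set. This
   yields an ordinary sequence: for i, j >= N both [f i] and [f j] belong to A N. *)
have /choice[f hf] : forall n : nat, exists k, (n <= k)%N /\ forall i, (i <= n)%N -> A i k.
  move=> n; have UI : U ([set k | (n <= k)%N] `&`
      [set k | forall i : 'I_n.+1, A (nat_of_ord i) k]).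
    apply: filterI; first by apply: ooU; exists n.
    by apply: filter_forall => i; case: (hA i).
  have [k [nk hk]] := filter_ex UI; exists k; split => // i ni.
  exact: (hk (Ordinal (ni : (i < n.+1)%N))).
pose v n := u (f n).
pose q x y := mu%:C * a x y - b x y.
have qlin c x y z : W x -> W y -> W z -> q (c *: x + y) z = c * q x z + q y z.
  by move=> Wx Wy Wz; rewrite /q (hlin ha)// (hlin hb)//; ring.
have qE x : W x -> q x x = (mu * sq a x - sq b x)%:C.
  by move=> Wx; rewrite /q (sqE ha Wx) (sqE hb Wx) rmorphB rmorphM.
have hq : hform W q.
  split => [|x y Wx Wy|x Wx]; first exact: qlin.
    rewrite /q (hsym ha Wx Wy) (hsym hb Wx Wy).
    by rewrite conjcB conjcM conjc_real.
  by rewrite qE// ler0c subr_ge0 muP.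
have sqq x : W x -> sq q x = mu * sq a x - sq b x by move=> Wx; rewrite /sq qE.
have Wv n : W (v n) by exact: Wu.
have vb n : sq q (v n) <= n.+1%:R^-1.
  have h : (f n).+1%:R^-1 <= n.+1%:R^-1 :> R.
    by rewrite lef_pV2 ?posrE// ler_nat ltnS; case: (hf n).
  rewrite (sqq _ (Wv n)) /v u1; move: h (ub (f n)).
  by move: (n.+1%:R^-1) ((f n).+1%:R^-1) => p r; lra.
have vcauchy : forall e : R, 0 < e -> exists N, forall i j, (N <= i)%N -> (N <= j)%N ->
    sq a (v i - v j) <= e.
  (* In units of 1 / (N + 1), the two values of q contribute 2 + 2 and the b-difference contributes
     1. *)
  move=> e e0; have p : 0 < mu * e / 5 by rewrite divr_gt0// mulr_gt0.
  have [N hN] : exists N : nat, N.+1%:R^-1 < mu * e / 5.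
    exists (Num.truncn (mu * e / 5)^-1).
    by rewrite invf_plt ?posrE// Num.Theory.truncnS_gt.
  exists N => i j Ni Nj; have Wd : W (v i - v j) by exact: subspB.
  have NN k : (N <= k)%N -> k.+1%:R^-1 <= N.+1%:R^-1 :> R.
    by move=> Nk; rewrite lef_pV2 ?posrE// ler_nat ltnS.
  have h1 := sqB_le sW hq (Wu (f i)) (Wu (f j)); rewrite -/(v i) -/(v j) in h1.
  have h2 : sq b (v i - v j) <= N.+1%:R^-1.
    by have [_ hAN] := hA N; apply: hAN; [have [_ H] := hf i|have [_ H] := hf j]; exact: H.
  rewrite -(ler_pM2l mupos); move: h1 h2 hN (vb i) (vb j) (NN i Ni) (NN j Nj).
  rewrite (sqq _ Wd); move: (N.+1%:R^-1) (i.+1%:R^-1) (j.+1%:R^-1) => x y z.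
  by move: (sq q (v i)) (sq q (v j)) => s t; lra.
have [e [We ve]] := comp Wv vcauchy.
have e1 : sq a e = 1.
  have := cvg_sq sW ha Wv We ve; under eq_fun do rewrite /v u1.
  by move=> h; rewrite -(cvg_lim (@Rhausdorff R) h) lim_cst.
have be : sq b (v n - e) @[n --> \oo] --> 0.
  apply: (@squeeze_cvgr _ _ _ _ (fun=> 0) (fun n => M * sq a (v n - e))).
  - by apply: nearW => n; rewrite (sq_ge0 hb) ?bM//; exact: subspB.
  - exact: cvg_cst.
  - by rewrite -[X in _ --> X](mulr0 M); apply: cvgM => //; exact: cvg_cst.
have bmu : sq b e = mu.
  apply/eqP; rewrite eq_le; apply/andP; split.
    by rewrite -[mu]mulr1 -e1; exact: muP.
  have h1 := cvg_sq sW hb Wv We be.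
  have h2 : (mu - n.+1%:R^-1) @[n --> \oo] --> mu.
    rewrite -[X in _ --> X]subr0; apply: cvgB; [exact: cvg_cst|exact: cvg_harmonic].
  apply: (ler_cvg_to h2 h1); apply: nearW => n.
  have := vb n; rewrite (sqq _ (Wv n)) {1}/v u1.
  by move: (n.+1%:R^-1) => p; lra.
by exists e; split => // x Wx; rewrite bmu; exact: muP.
Qed.

(** The nonnegative form mu a - b vanishes at e, so by Cauchy-Schwarz e is orthogonal to all of W
    for it: the Euler-Lagrange equation without differentiation. *)
Lemma maximizer_eigen e : W e -> sq a e = 1 ->
  (forall u, W u -> sq b u <= sq b e * sq a u) ->
  forall v, W v -> b e v = (sq b e)%:C * a e v.
Proof.
move=> We e1 be v Wv; pose mu := sq b e.
pose q x y := mu%:C * a x y - b x y.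
have qE x : W x -> q x x = (mu * sq a x - sq b x)%:C.
  by move=> Wx; rewrite /q (sqE ha Wx) (sqE hb Wx) rmorphB rmorphM.
have hq : hform W q.
  split => [c x y z Wx Wy Wz|x y Wx Wy|x Wx].
  - by rewrite /q (hlin ha)// (hlin hb)//; ring.
  - rewrite /q (hsym ha Wx Wy) (hsym hb Wx Wy).
    by rewrite conjcB conjcM conjc_real.
  - by rewrite qE// ler0c subr_ge0; exact: be.
have : sq q e = 0 by rewrite /sq qE//= e1 mulr1 subrr.
move=> /(hform_null sW hq We Wv) /eqP; rewrite subr_eq0 => /eqP <-.
by [].
Qed.

End maximizer.

(** Dependent choice where each term may depend on all the earlier ones, as in iterated maximization
    on orthogonal complements. *)
Lemma history_choice (T : choiceType) (G : T -> Prop) (P : seq T -> T -> Prop) :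
  (forall s : seq T, (forall x, x \in s -> G x) -> exists e, G e /\ P s e) ->
  exists e : nat -> T, forall n, G (e n) /\ P (mkseq e n) (e n).
Proof.
move=> h.
have /choice[F hF] : forall s : seq T, exists e, (forall x, x \in s -> G x) -> G e /\ P s e.
  move=> s; have [Gs|nGs] := pselect (forall x, x \in s -> G x).
    by have [e] := h s Gs; exists e.
  by have [|e _] := h [::] => //; exists e.
pose l n := iter n (fun s => rcons s (F s)) [::].
exists (F \o l) => n; have -> : mkseq (F \o l) n = l n.
  by elim: n => //= n IH; rewrite mkseqS IH.
apply: (hF); elim: n => //= n IH x; rewrite mem_rcons inE => /orP[/eqP ->|/IH//].
by have [] := hF _ IH.
Qed.

Lemma mem_mkseq (T : eqType) (e : nat -> T) n x :
  x \in mkseq e n -> exists2 i, (i < n)%N & x = e i.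
Proof. by move=> /mapP[j]; rewrite mem_iota add0n => /andP[_ jn] ->; exists j. Qed.

(** * Orthonormal sequences and expansions *)

Section orthonormal_sequences.
Context {R : realType} {X : lmodType R[i]}.
Local Notation C := R[i].
Variables (V : set X) (sV : subsp V) (a : X -> X -> C) (ha : hform V a).
Variables (e : nat -> X) (Ve : forall p, V (e p)).
Hypothesis eo : forall p q, a (e p) (e q) = (p == q)%:R.
Implicit Types (u v w : X) (c : nat -> C).

Definition ocomb c n : X := \sum_(i < n) c i *: e i.
Definition oproj u n : X := ocomb (fun i => a u (e i)) n.

Lemma ocomb_in c n : V (ocomb c n).
Proof. by apply: subsp_sum => // i _; exact: subspZ. Qed.

Lemma ocombS c n : ocomb c n.+1 = ocomb c n + c n *: e n.
Proof. by rewrite /ocomb big_ord_recr. Qed.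

Lemma hform_ocomb c n q : a (ocomb c n) (e q) = if (q < n)%N then c q else 0.
Proof.
rewrite (hform_suml sV ha) => [|i _|]; [|exact: subspZ|exact: Ve].
under eq_bigr => i _ do rewrite (hformZl sV ha)// eo.
case: ifP => [qn|qn].
  rewrite (bigD1 (Ordinal qn))//= eqxx mulr1 big1 ?addr0// => i iq.
  by rewrite (negbTE (_ : nat_of_ord i != q)) ?mulr0//.
rewrite big1// => i _; case: eqP => [iq|]; last by rewrite mulr0.
by rewrite -iq ltn_ord in qn.
Qed.

Lemma sq_ocomb c n : sq a (ocomb c n) = \sum_(i < n) nsq (c i).
Proof.
suff E : a (ocomb c n) (ocomb c n) = (\sum_(i < n) nsq (c i))%:C by rewrite /sq E.
rewrite RCsum {2}/ocomb (hform_sumr sV ha) => [|i _|]; [|exact: subspZ|exact: ocomb_in].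
apply: eq_bigr => i _; rewrite (hformZr sV ha)//; last exact: ocomb_in.
by rewrite hform_ocomb ltn_ord nsqE mulrC.
Qed.

Lemma sq_ocombB c m n : (m <= n)%N ->
  sq a (ocomb c n - ocomb c m) = \sum_(i < n) nsq (c i) - \sum_(i < m) nsq (c i).
Proof.
move=> mn; rewrite (sqB sV ha); [|exact: ocomb_in..].
suff -> : a (ocomb c n) (ocomb c m) = (sq a (ocomb c m))%:C.
  by rewrite /= !sq_ocomb; lra.
rewrite sq_ocomb RCsum {2}/ocomb (hform_sumr sV ha) => [|i _|];
  [|exact: subspZ|exact: ocomb_in].
apply: eq_bigr => i _; rewrite (hformZr sV ha)//; last exact: ocomb_in.
by rewrite hform_ocomb (leq_trans (ltn_ord i) mn) nsqE mulrC.
Qed.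

Lemma oproj_orth u n q : V u -> (q < n)%N -> a (u - oproj u n) (e q) = 0.
Proof.
move=> Vu qn; rewrite (hformBl sV ha)//; last exact: ocomb_in.
by rewrite hform_ocomb qn subrr.
Qed.

Lemma bessel u n : V u -> \sum_(i < n) nsq (a u (e i)) <= sq a u.
Proof.
move=> Vu; rewrite -(sq_ocomb (fun i => a u (e i))) -/(oproj u n).
have Vp : V (oproj u n) by exact: ocomb_in.
have Vd : V (u - oproj u n) by exact: subspB.
have z : a (u - oproj u n) (oproj u n) = 0.
  rewrite {2}/oproj /ocomb (hform_sumr sV ha) => [|i _|//]; last exact: subspZ.
  by rewrite big1// => i _; rewrite (hformZr sV ha)// oproj_orth// mulr0.
rewrite -{2}[u](subrK (oproj u n)) (sqD sV ha)// z mulr0 addr0 lerDr.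
exact: (sq_ge0 ha).
Qed.

(** The squared distance between two partial sums is a difference of partial sums of a bounded
    series with nonnegative terms. Coefficients pass to the limit because [a _ (e q)] is continuous
    by Cauchy-Schwarz. *)
Lemma ocomb_cvg c (B : R) : complete_for V a ->
  (forall n, \sum_(i < n) nsq (c i) <= B) ->
  exists w, [/\ V w, sq a (ocomb c n - w) @[n --> \oo] --> 0 &
                forall q, a w (e q) = c q].
Proof.
move=> comp cB; pose S n := \sum_(i < n) nsq (c i).
have ndS : nondecreasing_seq S.
  by apply/nondecreasing_seqP => n; rewrite /S big_ord_recr lerDl nsq_ge0.
have cS : cvgn S by apply: nondecreasing_is_cvgn => //; exists B => _ [n _ <-]; exact: cB.
have [|w [Vw wcvg]] := comp _ (ocomb_in c).
  move=> eps eps0; have e2 : 0 < eps / 2 by rewrite divr_gt0.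
  move/cvgrPdist_le : cS => /(_ _ e2)[N _ hN]; exists N => i j Ni Nj.
  wlog ji : i j Ni Nj / (j <= i)%N.
    move=> h; case/orP: (leq_total j i) => ij; first exact: h.
    by rewrite (sqBC sV ha); [exact: h|exact: ocomb_in..].
  rewrite sq_ocombB// -/(S i) -/(S j).
  have := hN i Ni; have := hN j Nj => /=.
  rewrite !ler_norml => /andP[? ?] /andP[? ?]; lra.
exists w; split => // q; apply/eqP; rewrite -subr_eq0; apply/eqP/nsq_eq0.
apply/eqP; rewrite eq_le nsq_ge0 andbT.
apply: (ler_cvg_to (cvg_cst _) wcvg); exists q.+1 => // n /= qn.
have -> : a w (e q) - c q = a (w - ocomb c n) (e q).
  by rewrite (hformBl sV ha)//; [rewrite hform_ocomb qn|exact: ocomb_in].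
rewrite (sqBC sV ha); [|exact: ocomb_in|by []].
have Vd : V (w - ocomb c n) by apply: subspB => //; exact: ocomb_in.
apply: le_trans (hform_CS sV ha Vd (Ve q)) _.
by rewrite {2}/sq eo eqxx mulr1.
Qed.

End orthonormal_sequences.

(** * Eigensystems of a pair of forms *)

Section eigensystems.
Context {R : realType} {X : lmodType R[i]}.
Local Notation C := R[i].
Implicit Types (u v w : X) (V W : set X) (a b : X -> X -> C).

Record eigensystem V a b (e : nat -> X) (lam : nat -> R) : Prop := Eigensystem {
  es_in : forall p, V (e p);
  es_orth : forall p q, a (e p) (e q) = (p == q)%:R;
  es_eig : forall p v, V v -> a (e p) v = (lam p)%:C * b (e p) v;
  es_gt0 : forall p, 0 < lam p;
  es_nd : forall p q, (p <= q)%N -> lam p <= lam q;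
  es_unb : forall M : R, exists p, M < lam p;
  (* this replaces completeness of [e] in the min-max arguments *)
  es_tail : forall n u, V u -> (forall i, (i < n)%N -> a u (e i) = 0) ->
    lam n * sq b u <= sq a u }.

Section existence.
Variables (V : set X) (sV : subsp V) (a b : X -> X -> C).
Hypotheses (ha : hform V a) (hb : hform V b).
Hypotheses (comp : complete_for V a) (cpt : compact_wrt V a b).
Hypothesis bnull : forall u, V u -> sq b u = 0 -> sq a u = 0.
Hypothesis infdim : forall m, exists f : 'I_m -> X, (forall i, V (f i)) /\
  forall c, sq a (\sum_i c i *: f i) = 0 -> forall i, c i = 0.

Let orth (s : seq X) : set X := [set u | V u /\ forall f, f \in s -> a u f = 0].

Let orth_subsp s : (forall f, f \in s -> V f) -> subsp (orth s).
Proof.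
move=> Vs; split.
  by split => [|f /Vs Vf]; [exact: subsp0|exact: (hform0l sV ha)].
move=> c u v [Vu us] [Vv vs]; split; first by case: sV => _; exact.
by move=> f fs; rewrite (hlin ha)// ?us ?vs ?mulr0 ?addr0//; exact: Vs.
Qed.

(** Orthogonality to f is a closed condition, because [a _ f] is continuous by Cauchy-Schwarz. *)
Let orth_complete s : (forall f, f \in s -> V f) -> complete_for (orth s) a.
Proof.
move=> Vs u Wu cu; have Vu k : V (u k) by case: (Wu k).
have [w [Vw uw]] := comp Vu cu; exists w; split => //; split => // f fs.
have Vf := Vs f fs.
apply/nsq_eq0/eqP; rewrite eq_le nsq_ge0 andbT.
have h : sq a (u n - w) * sq a f @[n --> \oo] --> 0.
  by rewrite -[X in _ --> X](mul0r (sq a f)); apply: cvgM => //; exact: cvg_cst.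
apply: (ler_cvg_to (cvg_cst _) h); apply: nearW => n.
have -> : a w f = a (w - u n) f.
  by rewrite (hformBl sV ha)//; case: (Wu n) => _ -> //; rewrite subr0.
rewrite (sqBC sV ha)//; apply: (hform_CS sV ha) => //; exact: subspB.
Qed.

(** There are size s + 1 independent vectors against size s orthogonality conditions. *)
Let orth_nonzero s : (forall f, f \in s -> V f) -> exists2 u, orth s u & 0 < sq a u.
Proof.
move=> Vs; have [f [Vf fi]] := infdim (size s).+1.
have [c [[i ci] hc]] := underdetermined
  (fun (i : 'I_(size s).+1) (j : 'I_(size s)) => a (f i) (nth 0 s j)) (ltnSn _).
exists (\sum_i c i *: f i).
  split; first by apply: subsp_sum => // k _; exact: subspZ.
  move=> g gs; have gi : (index g s < size s)%N by rewrite index_mem.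
  have := hc (Ordinal gi); rewrite /= nth_index// => <-.
  rewrite (hform_suml sV ha) => [|k _|]; [|exact: subspZ|exact: Vs].
  by apply: eq_bigr => k _; rewrite (hformZl sV ha)//; exact: Vs.
rewrite lt_def (sq_ge0 ha) ?andbT; last by apply: subsp_sum => // k _; exact: subspZ.
by apply: contra_neq ci => /fi.
Qed.

Lemma eigensystem_exists : exists e lam, eigensystem V a b e lam.
Proof.
pose P s e := [/\ orth s e, sq a e = 1 & forall u, orth s u -> sq b u <= sq b e * sq a u].
have [s Vs|e he] := @history_choice X V P.
  have sub : orth s `<=` V by move=> u [].
  have [e [We e1 eb]] := maximizer (orth_subsp Vs) (hform_sub sub ha)
    (hform_sub sub hb) (orth_complete Vs) (sub_compact_wrt sub cpt) (orth_nonzero Vs).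
  by exists e; split; [exact: sub|].
have Ve p : V (e p) by case: (he p).
have Vm n f : f \in mkseq e n -> V f by move=> /mapP[i _ ->].
have lt_orth p q : (p < q)%N -> a (e q) (e p) = 0.
  move=> pq; have [_ [[_ h] _ _]] := he q; apply: h.
  by apply/mapP; exists p => //; rewrite mem_iota.
have e1 p : sq a (e p) = 1 by have [_ []] := he p.
have eo p q : a (e p) (e q) = (p == q)%:R.
  have [pq|pq|->] := ltngtP p q.
  - by rewrite (hsym ha (Ve q) (Ve p)) lt_orth// conjc0.
  - exact: lt_orth.
  - by rewrite (sqE ha)// e1.
pose mu p := sq b (e p).
have orthP n u : V u -> (forall i, (i < n)%N -> a u (e i) = 0) -> orth (mkseq e n) u.
  move=> Vu h; split=> [//|f fs]; have [i i_n ->] := mem_mkseq fs.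
  exact: h.
have tail n u : V u -> (forall i, (i < n)%N -> a u (e i) = 0) -> sq b u <= mu n * sq a u.
  by move=> Vu h; have [_ [_ _]] := he n; apply; exact: orthP.
(* [maximizer_eigen] gives the equation only for v orthogonal to the earlier eigenvectors. On the
   span of these both sides vanish: a by orthonormality, b by the equations already obtained for i <
   n. *)
have eig n v : V v -> b (e n) v = (mu n)%:C * a (e n) v.
  elim/ltn_ind: n v => n IH v Vv.
  have Vp : V (oproj a e v n) by exact: (ocomb_in sV Ve).
  have Wv : orth (mkseq e n) (v - oproj a e v n).
    by apply: orthP => [|i i_n]; [exact: subspB|exact: (oproj_orth sV ha Ve eo)].
  have [_ [We en1 bn]] := he n.
  have sub : orth (mkseq e n) `<=` V by move=> u [].
  have := maximizer_eigen (orth_subsp (@Vm n)) (hform_sub sub ha)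
    (hform_sub sub hb) We en1 bn Wv.
  have z : b (e n) (oproj a e v n) = 0.
    rewrite /oproj /ocomb (hform_sumr sV hb) => [|i _|//]; last exact: subspZ.
    rewrite big1// => i _; rewrite (hformZr sV hb)// (hsym hb (Ve i) (Ve n)).
    by rewrite IH// eo ltn_eqF// mulr0 conjc0 mulr0.
  have z' : a (e n) (oproj a e v n) = 0.
    rewrite /oproj /ocomb (hform_sumr sV ha) => [|i _|//]; last exact: subspZ.
    by rewrite big1// => i _; rewrite (hformZr sV ha)// eo gtn_eqF// mulr0.
  by rewrite (hformBr sV hb)// (hformBr sV ha)// z z' !subr0.
have mu_gt0 p : 0 < mu p.
  rewrite lt_def (sq_ge0 hb)// andbT; apply/eqP => /(bnull (Ve p)).
  by rewrite e1 => /eqP; rewrite oner_eq0.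
have mu_ni p q : (p <= q)%N -> mu q <= mu p.
  move=> pq; rewrite -[leRHS]mulr1 -(e1 q); apply: tail => // i ip.
  by apply: lt_orth; exact: leq_trans pq.
(* Some nontrivial combination u of e_0, ..., e_m is killed by the m functionals that compactness
   provides for eps, so b(u, u) <= eps a(u, u). On that span b(u, u) >= mu m a(u, u), as [mu] is
   nonincreasing. *)
have mu0 eps : 0 < eps -> exists n, mu n <= eps.
  move=> eps0; have [m [l [ll _ bl]]] := cpt eps0; exists m.
  have [c [[i ci] hc]] := underdetermined
    (fun (i : 'I_m.+1) (j : 'I_m) => l j (e i)) (ltnSn _).
  pose c' k := if insub k is Some i then c i else 0.
  have c'E (k : 'I_m.+1) : c' k = c k by rewrite /c' valK.
  pose u := ocomb e c' m.+1; have Vu : V u by exact: (ocomb_in sV Ve).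
  have l0 j : l j u = 0.
    rewrite -(hc j) /u /ocomb.
    have lz : l j 0 = 0.
      have := ll j (-1) 0 0 (subsp0 sV) (subsp0 sV).
      by rewrite scaler0 addr0 mulN1r addNr.
    suff [_ ->] : V (\sum_(k < m.+1) c' k *: e k) /\
        l j (\sum_(k < m.+1) c' k *: e k) = \sum_(k < m.+1) c' k * l j (e k).
      by apply: eq_bigr => k _; rewrite c'E.
    elim/big_rec2: _ => [|k x y _ [Vy yx]]; first by split => //; exact: subsp0.
    split; first by case: sV => _; exact.
    by rewrite ll// yx.
  have su : sq a u = \sum_(k < m.+1) nsq (c k).
    by rewrite (sq_ocomb sV ha Ve eo); apply: eq_bigr => k _; rewrite c'E.
  have su0 : 0 < sq a u.
    rewrite lt_def (sq_ge0 ha)// andbT su; apply: contra_neq ci => /eqP.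
    rewrite psumr_eq0 => [/allP/(_ i)|k _]; last exact: nsq_ge0.
    by rewrite mem_index_enum => /(_ isT)/eqP/nsq_eq0.
  have bu : sq b u = \sum_(k < m.+1) mu k * nsq (c k).
    suff E : b u u = (\sum_(k < m.+1) mu k * nsq (c k))%:C by rewrite /sq E.
    rewrite RCsum {1}/u /ocomb.
    rewrite (hform_suml sV hb) => [|k _|//]; last exact: subspZ.
    apply: eq_bigr => k _; rewrite (hformZl sV hb)// eig// c'E.
    rewrite (hsym ha Vu (Ve k)) (hform_ocomb sV ha Ve eo) ltn_ord c'E.
    by rewrite rmorphM/= nsqE; ring.
  have := bl _ Vu; rewrite big1 ?addr0; last by move=> j _; rewrite l0 nsq0.
  move=> h; rewrite -(ler_pM2r su0); apply: le_trans h.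
  rewrite bu su mulr_sumr; apply: ler_sum => k _.
  by rewrite ler_wpM2r ?nsq_ge0// mu_ni// -ltnS.
exists e, (fun p => (mu p)^-1); split => //.
- move=> p v Vv; rewrite eig// mulrA -rmorphM/= mulVf ?mul1r//.
  by rewrite gt_eqF.
- by move=> p; rewrite invr_gt0.
- by move=> p q pq; rewrite lef_pV2 ?posrE//; exact: mu_ni.
- move=> M; pose M' := `|M| + 1; have M'0 : 0 < M' by rewrite ltr_wpDl.
  have [|p hp] := mu0 M'^-1; first by rewrite invr_gt0.
  exists p; apply: (@lt_le_trans _ _ M'); first by rewrite (le_lt_trans (ler_norm _))// ltrDl.
  by rewrite -[M']invrK lef_pV2 ?posrE// invr_gt0.
- by move=> n u Vu h; rewrite ler_pdivrMl//; exact: tail.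
Qed.

End existence.

End eigensystems.

(** * Cauchy sequences of real and complex numbers *)

Section cauchy_sequences.
Context {R : realType}.

Lemma cauchy_seq_cvg (x : nat -> R) : (forall e, 0 < e -> exists N, forall i j,
  (N <= i)%N -> (N <= j)%N -> `|x i - x j| <= e) -> cvgn x.
Proof.
move=> h; apply: R_complete; apply: cauchy_exP => e e0.
have e2 : 0 < e / 2 by rewrite divr_gt0.
have [N hN] := h _ e2; exists (x N); exists N => // n /= Nn.
by rewrite /ball/=; apply: le_lt_trans (hN N n _ Nn) _ => //; lra.
Qed.

Lemma cauchy_nsq_cvg (x : nat -> R[i]) : (forall e, 0 < e -> exists N, forall i j,
  (N <= i)%N -> (N <= j)%N -> nsq (x i - x j) <= e) ->
  exists z, nsq (x n - z) @[n --> \oo] --> 0.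
Proof.
move=> h.
have cau (f : R[i] -> R) : (forall z z', f (z - z') = f z - f z') ->
    (forall z, f z ^+ 2 <= nsq z) -> cvgn (fun n => f (x n)).
  move=> fB fn; apply: cauchy_seq_cvg => e e0.
  have [N hN] := h _ (exprn_gt0 2 e0); exists N => i j Ni Nj.
  rewrite -(@ler_pXn2r _ 2) ?nnegrE ?(ltW e0)// real_normK ?num_real// -fB.
  by apply: le_trans (fn _) _; exact: hN.
have /cvg_ex[/= r hr] : cvgn (fun n => complex.Re (x n)).
  by apply: cau => [z z'|z]; [rewrite ReD ReN|rewrite lerDl sqr_ge0].
have /cvg_ex[/= s hs] : cvgn (fun n => complex.Im (x n)).
  by apply: cau => [z z'|z]; [rewrite ImD ImN|rewrite lerDr sqr_ge0].
exists (r +i* s).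
have sqc (y : nat -> R) t : y n @[n --> \oo] --> t -> (y n - t) ^+ 2 @[n --> \oo] --> 0.
  move=> yt; have : y n - t @[n --> \oo] --> 0.
    by rewrite -(subrr t); apply: cvgB => //; exact: cvg_cst.
  by move=> /[dup] /cvgM /[apply]; rewrite mulr0; apply: cvg_trans.
have -> : (fun n => nsq (x n - (r +i* s))) =
    (fun n => (complex.Re (x n) - r) ^+ 2 + (complex.Im (x n) - s) ^+ 2).
  by apply/funext => n; rewrite /nsq ReD ReN ImD ImN.
by rewrite -[X in _ --> X]addr0; apply: cvgD; exact: sqc.
Qed.

End cauchy_sequences.

(** * Eigenspaces, min-max bounds and solvability from an eigensystem *)

Section eigensystem_theory.
Context {R : realType} {X : lmodType R[i]}.
Local Notation C := R[i].
Implicit Types (u v w : X) (V W : set X) (a b : X -> X -> C).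

Definition espace V a b (l : C) : set X :=
  [set w | V w /\ forall v, V v -> a w v = l * b w v].

Section one_system.
Variables (V : set X) (sV : subsp V) (a b : X -> X -> C).
Hypotheses (ha : hform V a) (hb : hform V b).
Hypothesis bnull : forall u, V u -> sq b u = 0 -> sq a u = 0.
Variables (e : nat -> X) (lam : nat -> R).
Hypothesis sys : eigensystem V a b e lam.

Let Ve := es_in sys.
Let eo := es_orth sys.
#[local] Hint Resolve Ve : core.

Let lamC_neq0 p : (lam p)%:C != 0 :> C.
Proof. by rewrite eq_complex/= gt_eqF ?(es_gt0 sys). Qed.

Lemma es_eigl p v : V v -> b v (e p) = (lam p)^-1%:C * a v (e p).
Proof.
move=> Vv; rewrite (hsym hb (Ve p) Vv) (hsym ha (Ve p) Vv) (es_eig sys)//.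
rewrite conjcM conjc_real mulrA -rmorphM/= mulVf ?mul1r//.
by rewrite gt_eqF ?(es_gt0 sys).
Qed.

(** Orthogonality to every e_p makes [es_tail] applicable for all p, and since lam is unbounded this
    forces b(u, u) = 0. *)
Lemma es_total u : V u -> (forall p, a u (e p) = 0) -> sq a u = 0.
Proof.
move=> Vu h; apply: bnull => //; apply/eqP; rewrite eq_le (sq_ge0 hb)// andbT.
rewrite leNgt; apply/negP => bu.
have [p] := es_unb sys (sq a u / sq b u); rewrite ltr_pdivrMr// ltNge.
by rewrite (es_tail sys).
Qed.

(** The partial sums converge to a vector with the same coefficients as u, which by [es_total]
    differs from u by a null vector. *)
Lemma oproj_cvg u : complete_for V a -> V u ->
  sq a (u - oproj a e u n) @[n --> \oo] --> 0.
Proof.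
move=> comp Vu.
have B n : \sum_(i < n) nsq ((fun i => a u (e i)) i) <= sq a u.
  exact: (bessel sV ha Ve eo n Vu).
have [w [Vw wcvg wq]] := @ocomb_cvg R X V sV a ha e Ve eo (fun i => a u (e i)) (sq a u) comp B.
have uw : sq a (u - w) = 0.
  apply: es_total; first exact: subspB.
  by move=> p; rewrite (hformBl sV ha)// wq subrr.
apply: (@squeeze_cvgr _ _ _ _ (fun=> 0) (fun n => 2 * sq a (ocomb e (fun i => a u (e i)) n - w))).
- apply: nearW => n; have Vo := ocomb_in sV Ve (fun i => a u (e i)) n.
  rewrite (sq_ge0 ha)/=; last exact: subspB.
  have -> : u - oproj a e u n = (u - w) - (oproj a e u n - w) by rewrite opprB addrA subrK.
  apply: le_trans (sqB_le sV ha _ _) _; [exact: subspB..|].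
  by rewrite uw mulr0 add0r.
- exact: cvg_cst.
- by rewrite -[X in _ --> X](mulr0 2); apply: cvgM => //; exact: cvg_cst.
Qed.

Definition level (l : C) : set nat := [set p | (lam p)%:C = l].

Lemma level_enum l : exists s : seq nat, uniq s /\ forall p, p \in s <-> level l p.
Proof.
have [N hN] := es_unb sys (complex.Re l).
exists [seq p <- iota 0 N | (lam p)%:C == l]; split; first by rewrite filter_uniq// iota_uniq.
move=> p; rewrite mem_filter mem_iota add0n /=; split=> [/andP[/eqP]//|pl].
rewrite pl eqxx/= ltnNge; apply/negP => Np.
by move: hN; rewrite -pl/= ltNge (es_nd sys).
Qed.

(** Testing the equation of w on e_p gives a(w, e_p) = (l / lam p) a(w, e_p), so the coefficients of
    w vanish off the level of l. Subtracting the remaining ones leaves a null vector by [es_total].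
    The level is finite because lam is nondecreasing and unbounded. *)
Lemma level_basis l : exists m (g : 'I_m -> nat),
  [/\ (level l #= `I_m)%card, injective g, forall i, level l (g i) &
      forall w, espace V a b l w ->
        sq a (w - \sum_i a w (e (g i)) *: e (g i)) = 0].
Proof.
have [s [us sl]] := level_enum l.
exists (size s), (fun i => nth 0%N s i); split.
- rewrite card_eq_sym; apply/card_set_bijP; exists (nth 0%N s); split.
  + by move=> i /= ni; apply/sl; exact: mem_nth.
  + move=> i j; rewrite !inE => ni nj ij; apply/eqP.
    by rewrite -(nth_uniq 0%N ni nj us) ij.
  + move=> p /sl ps; exists (index p s); first by rewrite /= index_mem.
    exact: nth_index.
- move=> i j ij; apply/val_inj/eqP; rewrite /= -(nth_uniq 0%N _ _ us) ?ltn_ord//.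
  exact/eqP.
- by move=> i; apply/sl; exact: mem_nth.
move=> w [Vw wl]; apply: es_total.
  by apply: subspB => //; apply: subsp_sum => // i _; exact: subspZ.
move=> p; rewrite (hformBl sV ha)//; last first.
  by apply: subsp_sum => // i _; exact: subspZ.
rewrite (hform_suml sV ha) => [|i _|//]; last exact: subspZ.
under eq_bigr => i _ do rewrite (hformZl sV ha)// eo.
have [ps|ps] := boolP (p \in s).
  have ip : (index p s < size s)%N by rewrite index_mem.
  rewrite (bigD1 (Ordinal ip))//= nth_index// eqxx mulr1 big1 ?addr0 ?subrr// => i ni.
  case: eqP => [ip'|]; last by rewrite mulr0.
  move: ni; rewrite -val_eqE/= -ip'.
  by rewrite index_uniq ?eqxx.
rewrite big1 ?subr0 => [|i _]; last first.
  case: eqP => [ip|]; last by rewrite mulr0.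
  by move: ps; rewrite -ip mem_nth.
have := wl _ (Ve p); rewrite es_eigl// => h.
have ll : l / (lam p)%:C != 1.
  apply: contra ps => /eqP l1; apply/sl; rewrite /level/=.
  by rewrite -[RHS](divfK (lamC_neq0 p)) l1 mul1r.
apply/eqP; move/eqP : h; rewrite fmorphV mulrA -subr_eq0 -{1}[a w (e p)]mul1r -mulrBl.
by rewrite mulf_eq0 subr_eq0 eq_sym (negbTE ll).
Qed.

Lemma es_espace p l : level l p -> espace V a b l (e p).
Proof. by move=> pl; split => // v Vv; rewrite -pl (es_eig sys). Qed.

Lemma espace_null l w : (forall p, ~ level l p) -> espace V a b l w -> sq a w = 0.
Proof.
move=> nl wl; have [m [g [_ _ gl wg]]] := level_basis l.
have := wg _ wl; rewrite big1 ?subr0// => i _; by have := nl _ (gl i).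
Qed.

(** For a nontrivial combination the quotient a / b is a mean of lam 0, ..., lam p with weights
    [nsq (c i) / lam i]. This is the upper half of min-max. *)
Lemma es_comb_upper c p : sq a (ocomb e c p.+1) <= lam p * sq b (ocomb e c p.+1).
Proof.
have Vu := ocomb_in sV Ve c p.+1.
have -> : sq b (ocomb e c p.+1) = \sum_(i < p.+1) nsq (c i) / lam i.
  suff E : b (ocomb e c p.+1) (ocomb e c p.+1) = (\sum_(i < p.+1) nsq (c i) / lam i)%:C.
    by rewrite /sq E.
  rewrite RCsum {2}/ocomb (hform_sumr sV hb) => [|i _|//]; last exact: subspZ.
  apply: eq_bigr => i _; rewrite (hformZr sV hb)// es_eigl//.
  by rewrite (hform_ocomb sV ha Ve eo) ltn_ord rmorphM/= nsqE; ring.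
rewrite (sq_ocomb sV ha Ve eo) mulr_sumr; apply: ler_sum => i _.
rewrite mulrCA ler_peMr ?nsq_ge0// ler_pdivlMr ?(es_gt0 sys)// mul1r.
by apply: (es_nd sys); rewrite -ltnS.
Qed.

Lemma es_comb_indep c p : sq b (ocomb e c p) = 0 -> forall i, (i < p)%N -> c i = 0.
Proof.
move=> /(bnull (ocomb_in sV Ve c p)); rewrite (sq_ocomb sV ha Ve eo) => /eqP.
rewrite psumr_eq0 => [/allP h i ip|i _]; last exact: nsq_ge0.
by have := h (Ordinal ip); rewrite mem_index_enum => /(_ isT)/eqP/nsq_eq0.
Qed.

(** Among p + 1 independent vectors some nontrivial combination is a-orthogonal to the first p
    eigenvectors, and there [es_tail] applies. This is the lower half of min-max. *)
Lemma es_comb_lower p (f : 'I_p.+1 -> X) : (forall i, V (f i)) ->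
  (forall c, sq b (\sum_i c i *: f i) = 0 -> forall i, c i = 0) ->
  exists c, let u := \sum_i c i *: f i in
    0 < sq b u /\ lam p * sq b u <= sq a u.
Proof.
move=> Vf fi.
have [c [[i ci] hc]] := underdetermined
  (fun (i : 'I_p.+1) (j : 'I_p) => a (f i) (e j)) (ltnSn _).
have Vu : V (\sum_i c i *: f i) by apply: subsp_sum => // k _; exact: subspZ.
exists c; split.
  by rewrite lt_def (sq_ge0 hb)// andbT; apply: contra_neq ci => /fi.
apply: (es_tail sys) => // j jp.
rewrite (hform_suml sV ha) => [|k _|//]; last exact: subspZ.
have := hc (Ordinal jp); rewrite /= => hcj; rewrite -[RHS]hcj.
by apply: eq_bigr => k _; rewrite (hformZl sV ha).
Qed.

(** Testing on e_p forces a(w, e_p) = lam p / (lam p - l) F(e_p). These coefficients are square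
    summable, and the vector they define satisfies the equation at every e_p, hence everywhere by
    continuity and [oproj_cvg]. F is antilinear, as a form is in its second argument. *)
Lemma es_solve (F : X -> C) (M : R) (l : C) :
  complete_for V a -> (exists M', forall u, V u -> sq b u <= M' * sq a u) ->
  (forall c u v, V u -> V v -> F (c *: u + v) = cj c * F u + F v) ->
  (forall v, V v -> nsq (F v) <= M * sq a v) ->
  (forall p, ~ level l p) ->
  exists w, V w /\ forall v, V v -> a w v - l * b w v = F v.
Proof.
move=> comp [Mb bM] Flin FM nl.
pose S n := \sum_(i < n) nsq (F (e i)).
have F0 : F 0 = 0.
  have := Flin (-1) 0 0 (subsp0 sV) (subsp0 sV).
  by rewrite scaler0 addr0 (_ : cj (-1) = -1) ?mulN1r ?addNr//= oppr0.
have Fcomb (G : X -> C) c n : G 0 = 0 ->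
    (forall c u v, V u -> V v -> G (c *: u + v) = cj c * G u + G v) ->
    G (ocomb e c n) = \sum_(i < n) cj (c i) * G (e i).
  move=> G0 Glin; elim: n => [|n IH]; first by rewrite /ocomb !big_ord0.
  rewrite ocombS big_ord_recr/= -IH [ocomb _ _ _ + _]addrC [RHS]addrC Glin//.
  exact: (ocomb_in sV Ve).
(* Bessel's inequality for F: at the sum of the F(e_i) e_i for i < n, both F and [sq a] take the
   value S n, so the bound on F reads S n ^+ 2 <= M * S n. *)
have SM n : S n <= M.
  have [S0|S0] := eqVneq (S n) 0.
    rewrite S0; have := FM _ (Ve 0); rewrite /sq eo eqxx/= mulr1.
    by apply: le_trans; exact: nsq_ge0.
  have Sp : 0 < S n by rewrite lt_def S0 sumr_ge0// => i _; exact: nsq_ge0.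
  have := FM _ (ocomb_in sV Ve (fun i => F (e i)) n).
  rewrite (sq_ocomb sV ha Ve eo) -/(S n) Fcomb//.
  have -> : \sum_(i < n) cj (F (e i)) * F (e i) = (S n)%:C.
    by rewrite RCsum; apply: eq_bigr => i _; rewrite nsqE mulrC.
  by rewrite nsqR expr2 ler_pM2r.
pose r p := (lam p)%:C / ((lam p)%:C - l).
have [K [K0 hK]] : exists K, 0 <= K /\ forall p, nsq (r p) <= K.
  (* Once lam p exceeds 2 |Re l|, the modulus of lam p - l is at least lam p / 2, so [nsq (r p)] is
     at most 4; the finitely many earlier terms are bounded by their sum. *)
  have [N hN] := es_unb sys (2 * `|complex.Re l|).
  have S0 : 0 <= \sum_(i < N) nsq (r i) by rewrite sumr_ge0// => i _; exact: nsq_ge0.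
  exists (4 + \sum_(i < N) nsq (r i)); split; first by rewrite addr_ge0.
  move=> p; have [pN|Np] := ltnP p N.
    apply: (@le_trans _ _ (\sum_(i < N) nsq (r i))); last by rewrite lerDr.
    rewrite (bigD1 (Ordinal pN))//= lerDl sumr_ge0// => i _; exact: nsq_ge0.
  apply: (@le_trans _ _ 4); last by rewrite lerDl.
  have hp : 2 * `|complex.Re l| < lam p by apply: lt_le_trans hN _; exact: (es_nd sys).
  have lp := es_gt0 sys p.
  have h1 : (lam p / 2) ^+ 2 <= nsq ((lam p)%:C - l).
    rewrite /nsq ReD ReN /=; apply: (@le_trans _ _ ((lam p - complex.Re l) ^+ 2)).
      rewrite ler_pXn2r ?nnegrE ?divr_ge0 ?(ltW lp)//; last first.
        by rewrite subr_ge0; have := ler_norm (complex.Re l); have := normr_ge0 (complex.Re l); lra.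
      by have := ler_norm (complex.Re l); lra.
    by rewrite lerDl sqr_ge0.
  have h0 : 0 < nsq ((lam p)%:C - l) by apply: lt_le_trans h1; rewrite exprn_gt0// divr_gt0.
  rewrite /r nsqM nsqV nsqR ler_pdivrMr//.
  have -> : lam p ^+ 2 = 4 * (lam p / 2) ^+ 2 by field.
  by rewrite ler_pM2l.
pose c p := r p * F (e p).
have [|w [Vw wcvg wq]] := ocomb_cvg sV ha Ve eo comp (c := c) (B := K * M).
  move=> n; apply: (@le_trans _ _ (K * S n)); last exact: ler_wpM2l.
  rewrite /S mulr_sumr; apply: ler_sum => i _.
  by rewrite /c nsqM ler_wpM2r ?nsq_ge0.
exists w; split => // v Vv; apply/eqP; rewrite -subr_eq0; apply/eqP.
pose G v := a w v - l * b w v - F v; rewrite -/(G v).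
have Glin k x y : V x -> V y -> G (k *: x + y) = cj k * G x + G y.
  move=> Vx Vy; rewrite /G Flin// (hformDr sV ha)// ?(hformZr sV ha)//; last exact: subspZ.
  by rewrite (hformDr sV hb)// ?(hformZr sV hb)//; [ring|exact: subspZ].
have G0 : G 0 = 0 by rewrite /G (hform0r sV ha)// (hform0r sV hb)// F0 mulr0 !subr0.
have Ge p : G (e p) = 0.
  rewrite /G wq es_eigl// wq /c /r fmorphV.
  have nz : (lam p)%:C - l != 0.
    by rewrite subr_eq0; apply/eqP => h; exact: (nl p).
  by field; rewrite nz lamC_neq0.
have GM : exists M', 0 <= M' /\ forall v, V v -> nsq (G v) <= M' * sq a v.
  have M0 : 0 <= M by apply: le_trans (SM 0%N); rewrite /S big_ord0.
  pose M1 := 4 * sq a w + 4 * (nsq l * (sq b w * `|Mb|)) + 2 * M.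
  have := sq_ge0 ha Vw; have := sq_ge0 hb Vw => bw aw.
  exists M1; split; first by rewrite !addr_ge0// !mulr_ge0// nsq_ge0.
  move=> x Vx; apply: le_trans (nsqD_le _ _) _; rewrite nsqN.
  have h1 := nsqD_le (a w x) (- (l * b w x)); rewrite nsqN nsqM in h1.
  have h2 := hform_CS sV ha Vw Vx; have h3 := FM _ Vx.
  have h4 : nsq l * nsq (b w x) <= nsq l * (sq b w * `|Mb|) * sq a x.
    rewrite -!mulrA ler_wpM2l ?nsq_ge0//; apply: le_trans (hform_CS sV hb Vw Vx) _.
    rewrite ler_wpM2l//; apply: le_trans (bM _ Vx) _.
    by rewrite ler_wpM2r ?ler_norm// (sq_ge0 ha).
  rewrite /M1; lra.
have [M' [M'0 hM']] := GM.
apply/nsq_eq0/eqP; rewrite eq_le nsq_ge0 andbT.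
have h : M' * sq a (v - oproj a e v n) @[n --> \oo] --> 0.
  rewrite -[X in _ --> X](mulr0 M'); apply: cvgM; [exact: cvg_cst|exact: oproj_cvg].
apply: (ler_cvg_to (cvg_cst _) h); apply: nearW => n.
have Vo := ocomb_in sV Ve (fun i => a v (e i)) n.
have -> : G v = G (v - oproj a e v n).
  rewrite -[v - _](addrC) -scaleN1r Glin// Fcomb// big1 ?mulr0 ?add0r// => i _.
  by rewrite Ge mulr0.
by apply: hM'; exact: subspB.
Qed.

End one_system.

(** The span of the first p + 1 eigenvectors of the second system contains u with b(u, u) > 0 and
    lam1 p b(u, u) <= a1(u, u); there a1 <= k a2 <= k lam2 p b. *)
Lemma es_compare V (sV : subsp V) a1 a2 b e1 e2 lam1 lam2 (k : R) :
  hform V a1 -> hform V a2 -> hform V b ->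
  (forall u, V u -> sq b u = 0 -> sq a2 u = 0) ->
  eigensystem V a1 b e1 lam1 -> eigensystem V a2 b e2 lam2 ->
  0 <= k -> (forall u, V u -> sq a1 u <= k * sq a2 u) ->
  forall p, lam1 p <= k * lam2 p.
Proof.
move=> ha1 ha2 hb bn2 s1 s2 k0 h12 p.
pose c' (c : 'I_p.+1 -> C) j := if insub j is Some i then c i else 0.
have c'E c (j : 'I_p.+1) : c' c j = c j by rewrite /c' valK.
have comb c : \sum_(i < p.+1) c i *: e2 i = ocomb e2 (c' c) p.+1.
  by apply: eq_bigr => i _; rewrite c'E.
have [i|c h i|c /= [u0 h1]] :=
  @es_comb_lower V sV a1 b ha1 hb e1 lam1 s1 p (fun i : 'I_p.+1 => e2 i).
- exact: (es_in s2).
- rewrite comb in h.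
  by rewrite -c'E; apply: (es_comb_indep sV ha2 bn2 s2 h).
have := es_comb_upper sV ha2 hb s2 (c' c) p; rewrite -comb => h2.
have Vu : V (\sum_(i < p.+1) c i *: e2 i).
  by apply: subsp_sum => // i _; apply: subspZ => //; exact: (es_in s2).
rewrite -(ler_pM2r u0); apply: le_trans h1 _; apply: le_trans (h12 _ Vu) _.
by rewrite -mulrA ler_wpM2l.
Qed.

(* The maximum is an instance of [maximizer] with the roles of the two forms exchanged. *)
Lemma finite_dim_max V (sV : subsp V) a b E m (f : 'I_m -> X) :
  hform V a -> hform V b -> (forall u, V u -> sq b u = 0 -> sq a u = 0) ->
  subsp E -> E `<=` V -> (forall i, E (f i)) ->
  (forall w, E w -> exists c, sq b (w - \sum_i c i *: f i) = 0) ->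
  (exists2 w, E w & 0 < sq b w) ->
  exists e, [/\ E e, sq b e = 1 & forall u, E u -> sq a u <= sq a e * sq b u].
Proof.
move=> hVa hVb bn sE EV Ef fspan wE.
have ha := hform_sub EV hVa; have hb := hform_sub EV hVb.
(* A b-orthonormal family in E has at most m elements. One of maximal length spans E up to b-null
   vectors: otherwise the normalised residue of a projection would extend it. *)
pose P k := `[< exists g : 'I_k -> X, (forall i, E (g i)) /\
  forall i j, b (g i) (g j) = (i == j)%:R >].
have sqcomb k (g : 'I_k -> X) c : (forall i, E (g i)) ->
    (forall i j, b (g i) (g j) = (i == j)%:R) ->
    (forall j, b (\sum_i c i *: g i) (g j) = c j) /\
    sq b (\sum_i c i *: g i) = \sum_i nsq (c i).
  move=> Eg go; have H j : b (\sum_i c i *: g i) (g j) = c j.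
    rewrite (hform_suml sE hb) => [|i _|//]; last exact: subspZ.
    rewrite (bigD1 j)//= big1 ?addr0 => [|i ij].
      by rewrite (hformZl sE hb)// go eqxx mulr1.
    by rewrite (hformZl sE hb)// go (negbTE ij) mulr0.
  split => //; have Es : E (\sum_i c i *: g i) by apply: subsp_sum => // i _; exact: subspZ.
  suff H' : b (\sum_i c i *: g i) (\sum_i c i *: g i) = (\sum_i nsq (c i))%:C.
    by rewrite /sq H'.
  rewrite RCsum (hform_sumr sE hb) => [|i _|//]; last exact: subspZ.
  by apply: eq_bigr => i _; rewrite (hformZr sE hb)// H nsqE mulrC.
have P0 : exists k, P k.
  by exists 0%N; apply/asboolP; exists (fun=> 0); split; [move=> []|move=> []].
have Pm k : P k -> (k <= m)%N.
  move=> /asboolP[g [Eg go]]; rewrite leqNgt; apply/negP => mk.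
  have /choice[M hM] : forall i, exists c, sq b (g i - \sum_j c j *: f j) = 0.
    by move=> i; exact: fspan.
  have [c [[i ci] hc]] := underdetermined M mk.
  have [_] := sqcomb k g c Eg go.
  have -> : sq b (\sum_i c i *: g i) = 0.
    have -> : \sum_i c i *: g i = \sum_i c i *: (g i - \sum_j M i j *: f j).
      under [RHS]eq_bigr do rewrite scalerBr; rewrite sumrB.
      rewrite [X in _ - X](_ : _ = 0) ?subr0//.
      under eq_bigr do rewrite scaler_sumr; rewrite exchange_big big1// => j _.
      under eq_bigr do rewrite scalerA.
      by rewrite -scaler_suml hc scale0r.
    have Ed i' : E (g i' - \sum_j M i' j *: f j).
      by apply: subspB => //; apply: subsp_sum => // j _; exact: subspZ.
    apply/eqP; rewrite eq_le (sq_ge0 hb) ?andbT; last first.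
      by apply: subsp_sum => // i' _; exact: subspZ.
    apply: le_trans (sq_sum_le sE hb _) _; first by move=> i'; exact: subspZ.
    by rewrite big1 ?mulr0// => i' _; rewrite (sqZ sE hb)// hM mulr0.
  move=> /esym/eqP; rewrite psumr_eq0 => [/allP/(_ i)|j _]; last exact: nsq_ge0.
  by rewrite mem_index_enum => /(_ isT)/eqP/nsq_eq0/eqP; rewrite (negbTE ci).
have [k /asboolP[g [Eg go]] kmax] := ex_maxnP P0 Pm.
pose pr w := \sum_i b w (g i) *: g i.
have Epr w : E (pr w) by apply: subsp_sum => // i _; exact: subspZ.
have prg w i : E w -> b (w - pr w) (g i) = 0.
  move=> Ew; rewrite (hformBl sE hb)//.
  by have [-> _] := sqcomb k g (fun i => b w (g i)) Eg go; rewrite subrr.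
have gspan w : E w -> sq b (w - pr w) = 0.
  move=> Ew; apply/eqP; apply/negPn/negP => d0.
  have Ed : E (w - pr w) by exact: subspB.
  have dp : 0 < sq b (w - pr w) by rewrite lt_def d0 (sq_ge0 hb).
  pose h := (Num.sqrt (sq b (w - pr w))^-1)%:C *: (w - pr w).
  have Eh : E h by exact: subspZ.
  have h1 : b h h = 1.
    by rewrite (sqE hb)// (sqZ sE hb)// nsqR sqr_sqrtr ?invr_ge0 ?ltW// mulVf.
  have hg i : b h (g i) = 0 by rewrite (hformZl sE hb)// prg// mulr0.
  have gh i : b (g i) h = 0 by rewrite (hsym hb Eh (Eg i)) hg conjc0.
  suff /kmax : P k.+1 by rewrite ltnn.
  apply/asboolP; exists (fun i => if unlift ord0 i is Some j then g j else h); split.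
    by move=> i; case: unliftP.
  move=> i j; case: (unliftP ord0 i) => [i'|] ->; case: (unliftP ord0 j) => [j'|] ->.
  - by rewrite go (inj_eq lift_inj).
  - by rewrite gh eq_sym (negbTE (neq_lift _ _)).
  - by rewrite hg (negbTE (neq_lift _ _)).
  - by rewrite h1 eqxx.
have bpr w : E w -> sq b w = \sum_i nsq (b w (g i)).
  move=> Ew; have [_ <-] := sqcomb k g (fun i => b w (g i)) Eg go.
  rewrite -{1}[w](subrK (pr w)) (sqD sE hb)//; last exact: subspB.
  rewrite gspan// add0r (hform_null sE hb) ?gspan//=; first by rewrite mulr0 addr0.
  exact: subspB.
apply: (maximizer sE hb ha _ _ wE).
- move=> u Eu cu.
  have bc j : exists z, nsq (b (u n) (g j) - z) @[n --> \oo] --> 0.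
    have le i i' : nsq (b (u i) (g j) - b (u i') (g j)) <= sq b (u i - u i').
      rewrite -(hformBl sE hb)// bpr; last exact: subspB.
      by rewrite (bigD1 j)//= lerDl sumr_ge0// => ? _; exact: nsq_ge0.
    apply: cauchy_nsq_cvg => eps eps0; have [N hN] := cu _ eps0.
    by exists N => i i' Ni Ni'; apply: le_trans (le i i') _; exact: hN.
  have /choice[z hz] := bc; pose w := \sum_i z i *: g i.
  have Ew : E w by apply: subsp_sum => // i _; exact: subspZ.
  exists w; split => //.
  have -> : (fun n => sq b (u n - w)) = (fun n => \sum_j nsq (b (u n) (g j) - z j)).
    apply/funext => n; rewrite bpr; last exact: subspB.
    apply: eq_bigr => j _; rewrite (hformBl sE hb)//.
    by have [-> _] := sqcomb k g z Eg go.
  rewrite [X in _ --> X](_ : 0 = \sum_(j < k) 0); last by rewrite big1.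
  by apply: cvg_big => [|j _]; [exact: add_continuous|exact: hz].
(* Up to null vectors u is its projection on the g_i, so the functionals b(u, g_i), scaled by the
   square root of K, dominate a(u, u) whatever eps is. *)
- move=> eps eps0; pose K := k%:R * \sum_i sq a (g i).
  have S0 : 0 <= \sum_i sq a (g i) by rewrite sumr_ge0// => i _; exact: (sq_ge0 ha).
  have K0 : 0 <= K by rewrite mulr_ge0.
  have nK z : nsq ((Num.sqrt K)%:C * z) = K * nsq z by rewrite nsqM nsqR sqr_sqrtr.
  exists k, (fun j u => (Num.sqrt K)%:C * b u (g j)); split.
  + by move=> j c u v Eu Ev; rewrite (hlin hb)//; ring.
  + exists K; split=> // j u Eu; rewrite nK ler_wpM2l// bpr//.
    by rewrite (bigD1 j)//= lerDl sumr_ge0// => ? _; exact: nsq_ge0.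
  + move=> u Eu; apply: (@le_trans _ _ (sq a (pr u))).
      have d0 : sq a (u - pr u) = 0 by apply: bn; [by apply: EV; exact: subspB|exact: gspan].
      rewrite -{1}[u](subrK (pr u)) (sqD sE ha)//; last exact: subspB.
      rewrite d0 add0r (hform_null sE ha) ?d0//=; first by rewrite mulr0 addr0.
      exact: subspB.
    apply: le_trans (sq_sum_le sE ha _) _; first by move=> i; exact: subspZ.
    rewrite -[leLHS]add0r lerD//; first by rewrite mulr_ge0 ?(ltW eps0)// (sq_ge0 hb).
    rewrite mulr_sumr; apply: ler_sum => i _; rewrite nK (sqZ sE ha)//.
    rewrite /K mulrCA [leRHS]mulrC ler_wpM2l ?nsq_ge0// ler_wpM2l//.
    by rewrite (bigD1 i)//= lerDl sumr_ge0// => ? _; exact: (sq_ge0 ha).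
Qed.

End eigensystem_theory.

(** * Rellich's inequality on a cube *)

Section bounded_finite_support.
Context {R : realType} d (T : measurableType d) (mu : {measure set T -> \bar R}).
Variable D : set T.
Implicit Types f g : T -> R.

(** A class stable under sums, products and restrictions, whose members are integrable when D has
    finite measure: integrability conditions reduce to membership. *)
Definition bmf f : Prop :=
  [/\ measurable_fun setT f, exists M : R, forall x, `|f x| <= M & forall x, ~ D x -> f x = 0].

Lemma bmf_scale (c : R) f : bmf f -> bmf (fun x => c * f x).
Proof.
move=> [mf [M fM] f0]; split.
- exact: measurable_funM.
- by exists (`|c| * M) => x; rewrite normrM ler_wpM2l.
- by move=> x /f0 ->; rewrite mulr0.
Qed.

Lemma bmf_add f g : bmf f -> bmf g -> bmf (fun x => f x + g x).
Proof.
move=> [mf [M fM] f0] [mg [N gN] g0]; split.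
- exact: measurable_funD.
- exists (M + N) => x; apply: le_trans (ler_normD _ _) _; exact: lerD.
- by move=> x Dx; rewrite f0// g0// addr0.
Qed.

Lemma bmf_sub f g : bmf f -> bmf g -> bmf (fun x => f x - g x).
Proof.
move=> hf hg; have -> : (fun x => f x - g x) = (fun x => f x + (-1) * g x).
  by apply/funext => x; rewrite mulN1r.
by apply: bmf_add => //; exact: bmf_scale.
Qed.

Lemma bmf_mul f g : bmf f -> measurable_fun setT g -> (exists M : R, forall x, `|g x| <= M) ->
  bmf (fun x => f x * g x).
Proof.
move=> [mf [M fM] f0] mg [N gN]; split.
- exact: measurable_funM.
- by exists (M * N) => x; rewrite normrM ler_pM.
- by move=> x /f0 ->; rewrite mul0r.
Qed.

Lemma bmf_mul2 f g : bmf f -> bmf g -> bmf (fun x => f x * g x).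
Proof. by move=> hf [mg Mg _]; exact: bmf_mul. Qed.

Lemma bmf_sqr f : bmf f -> bmf (fun x => f x ^+ 2).
Proof. by move=> hf; under eq_fun do rewrite expr2; exact: bmf_mul2. Qed.

Lemma bmf_patch Q f : measurable Q -> bmf f -> bmf (f \_ Q).
Proof.
move=> mQ [mf [M fM] f0]; split.
- apply/(measurable_restrictT _ mQ); exact: measurable_funTS.
- exists `|M| => x; rewrite patchE; case: ifP => _; last by rewrite normr0.
  by rewrite (le_trans (fM x))// ler_norm.
- by move=> x /f0; rewrite patchE; case: ifP.
Qed.

Lemma bmf_cst_patch (c : R) : measurable D -> bmf (cst c \_ D).
Proof.
move=> mD; split.
- apply/(measurable_restrictT _ mD); exact: measurable_cst.
- by exists `|c| => x; rewrite patchE; case: ifP => _ //=; rewrite normr0.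
- by move=> x xD; rewrite patchE ifN//; apply/negP; rewrite inE.
Qed.

Lemma bmf_sum (I : Type) (r : seq I) (P : pred I) (F : I -> T -> R) :
  (forall i, P i -> bmf (F i)) -> bmf (fun x => \sum_(i <- r | P i) F i x).
Proof.
move=> h; elim: r => [|i r IH].
  under eq_fun do rewrite big_nil.
  split; [exact: measurable_cst|by exists 0 => x; rewrite normr0|by []].
have [Pi|Pi] := boolP (P i).
  by under eq_fun do rewrite big_cons Pi; apply: bmf_add => //; exact: h.
by under eq_fun do rewrite big_cons (negbTE Pi).
Qed.

Hypotheses (mD : measurable D) (fD : (mu D < +oo)%E).

Lemma bmf_integrable f : bmf f -> mu.-integrable setT (EFin \o f).
Proof.
move=> [mf [M fM] f0].
have -> : EFin \o f = (EFin \o f) \_ D.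
  apply/funext => x; rewrite patchE; case: ifPn => // /negP xD /=.
  by rewrite f0// => Dx; apply: xD; rewrite inE.
apply/(integrable_mkcond _ mD)/measurable_bounded_integrable => //.
  exact: measurable_funTS.
by exists M; split; [exact: num_real|move=> N MN x _; apply: le_trans (fM x) (ltW MN)].
Qed.

End bounded_finite_support.

Section Rintegral_facts.
Context {R : realType} d (T : measurableType d) (mu : {measure set T -> \bar R}).
Implicit Types f g : T -> R.

Lemma discriminant_le (A B C : R) : 0 <= C ->
  (forall l : R, 0 <= A - 2 * l * B + l ^+ 2 * C) -> B ^+ 2 <= A * C.
Proof.
move=> Cge0 h; have [C0|C0] := eqVneq C 0.
  have [->|B0] := eqVneq B 0; first by rewrite expr0n/= C0 mulr0.
  have := h ((A + 1) / (2 * B)); rewrite C0 mulr0 addr0.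
  have -> : 2 * ((A + 1) / (2 * B)) * B = A + 1 by field.
  lra.
have Cp : 0 < C by rewrite lt_def C0.
have := h (B / C).
have -> : A - 2 * (B / C) * B + (B / C) ^+ 2 * C = (A * C - B ^+ 2) / C by field.
by rewrite pmulr_lge0 ?invr_gt0// subr_ge0.
Qed.

Lemma Rintegral_sum (I : Type) (r : seq I) (F : I -> T -> R) :
  (forall i, mu.-integrable setT (EFin \o F i)) ->
  \int[mu]_x (\sum_(i <- r) F i x) = \sum_(i <- r) \int[mu]_x F i x.
Proof.
move=> h; elim: r => [|i r IH].
  under eq_Rintegral do rewrite big_nil.
  by rewrite Rintegral_cst// mul0r big_nil.
under eq_Rintegral do rewrite big_cons.
rewrite RintegralD ?IH ?big_cons//.
have -> : EFin \o (fun x => \sum_(j <- r) F j x) = (fun x => \sum_(j <- r) (EFin \o F j) x)%E.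
  by apply/funext => x; rewrite /= sumEFin.
exact: integrable_sum.
Qed.

End Rintegral_facts.

(** * Calculus on a line *)

Section line_calculus.
Context {R : realType}.
Local Notation leb := (@lebesgue_measure R).
Implicit Types F : R -> R.

Lemma FTC_line F (a b : R) : a < b -> (forall t, derivable F t 1) -> continuous (derive1 F) ->
  \int[leb]_(t in `[a, b]) derive1 F t = F b - F a.
Proof.
move=> ab dF cF; rewrite /Rintegral.
suff -> : (\int[leb]_(t in `[a, b]) (derive1 F t)%:E = (F b)%:E - (F a)%:E)%E by [].
apply: continuous_FTC2; [by []| | |by move=> x _].
- exact: continuous_subspaceT.
- have cvF t : F x @[x --> t] --> F t.
    by apply: differentiable_continuous; apply/derivable1_diffP; exact: dF.
  split; first by move=> x _; exact: dF.
  + exact: cvg_at_right_filter.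
  + exact: cvg_at_left_filter.
Qed.

Lemma Rintegral_CS d (T : measurableType d) (mu : {measure set T -> \bar R}) (f g : T -> R) :
  mu.-integrable setT (EFin \o (fun x => f x ^+ 2)) ->
  mu.-integrable setT (EFin \o (fun x => f x * g x)) ->
  mu.-integrable setT (EFin \o (fun x => g x ^+ 2)) ->
  (\int[mu]_x (f x * g x)) ^+ 2 <= \int[mu]_x (f x ^+ 2) * \int[mu]_x (g x ^+ 2).
Proof.
move=> iff ifg igg; apply: discriminant_le => [|l].
  by apply: Rintegral_ge0 => x _; exact: sqr_ge0.
have iZ (c : R) (h : T -> R) : mu.-integrable setT (EFin \o h) ->
    mu.-integrable setT (EFin \o (fun x => c * h x)).
  move=> ih; have -> : EFin \o (fun x => c * h x) = (fun x => c%:E * (EFin \o h) x)%E.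
    by apply/funext => x; rewrite /= EFinM.
  exact: integrableZl.
have iB (h k : T -> R) : mu.-integrable setT (EFin \o h) ->
    mu.-integrable setT (EFin \o k) -> mu.-integrable setT (EFin \o (fun x => h x - k x)).
  move=> ih ik; have -> : EFin \o (fun x => h x - k x) = ((EFin \o h) \- (EFin \o k))%E.
    by apply/funext => x; rewrite /= EFinB.
  exact: integrableB.
have : 0 <= \int[mu]_x ((f x - l * g x) ^+ 2).
  by apply: Rintegral_ge0 => x _; exact: sqr_ge0.
have -> : (fun x => (f x - l * g x) ^+ 2) =
    (fun x => (f x ^+ 2 - (2 * l) * (f x * g x)) + l ^+ 2 * (g x ^+ 2)).
  by apply/funext => x; ring.
rewrite RintegralD//; [|exact: iB (iZ _ _ ifg)|exact: iZ].
rewrite RintegralB//; last exact: iZ.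
by rewrite !RintegralZl.
Qed.

Let segD (a b : R) : measurable (`[a, b]%classic : set (measurableTypeR R)).
Proof. exact: measurable_itv. Qed.

Let segfin (a b : R) : (leb `[a, b]%classic < +oo)%E.
Proof. by rewrite lebesgue_measure_itv/=; case: ifP; rewrite // -EFinB ltry. Qed.

Lemma continuous_patch_bmf (a b : R) F : continuous F -> bmf `[a, b]%classic (F \_ `[a, b] : measurableTypeR R -> R).
Proof.
move=> cF.
have mF : measurable_fun [set: measurableTypeR R] F by exact: continuous_measurable_fun.
split.
- by apply/(measurable_restrictT _ (segD a b)); exact: measurable_funTS.
- have : bounded_set (F @` `[a, b]%classic).
    apply: compact_bounded; apply: continuous_compact; last exact: segment_compact.
    exact: continuous_subspaceT.
  move=> [M [_ hM]]; exists (`|M| + 1) => x; rewrite patchE; case: ifPn => [xab|_].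
    apply: hM; first by rewrite (le_lt_trans (ler_norm M))// ltrDl.
    by exists x => //; move: xab; rewrite inE.
  by rewrite normr0 addr_ge0.
- by move=> x xab; rewrite patchE ifN//; apply/negP; rewrite inE.
Qed.

(** Cauchy-Schwarz for the derivative against 1 on [s, t], an interval of length at most h. *)
Lemma increment_sqr_le F (a h s t : R) : 0 < h ->
  (forall t, derivable F t 1) -> continuous (derive1 F) ->
  s \in `[a, a + h] -> t \in `[a, a + h] ->
  (F t - F s) ^+ 2 <= h * \int[leb]_(r in `[a, a + h]) (derive1 F r ^+ 2).
Proof.
move=> h0 dF cF; wlog st : s t / s < t.
  move=> H sI tI; have [st|ts|->] := ltgtP s t.
  - exact: H.
  - by rewrite -sqrrN opprB; exact: H.
  - by rewrite subrr expr0n/= mulr_ge0 ?(ltW h0)// Rintegral_ge0// => x _; exact: sqr_ge0.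
rewrite !in_itv/= => /andP[as_ sah] /andP[at_ tah].
rewrite -(FTC_line st dF cF) Rintegral_mkcond.
have bF := continuous_patch_bmf s t cF.
have b1 : bmf `[s, t]%classic ((cst 1 : measurableTypeR R -> R) \_ `[s, t]).
  by apply: continuous_patch_bmf => x; exact: cvg_cst.
have int := bmf_integrable (segD s t) (segfin s t).
have -> : (fun x => (derive1 F \_ `[s, t]) x) =
    (fun x => (derive1 F \_ `[s, t]) x * ((cst 1 : measurableTypeR R -> R) \_ `[s, t]) x).
  by apply/funext => x; rewrite !patchE; case: ifP; rewrite ?mulr1 ?mulr0.
apply: le_trans (Rintegral_CS _ _ _) _.
- exact/int/bmf_sqr.
- exact/int/bmf_mul2.
- exact/int/bmf_sqr.
rewrite mulrC ler_pM//.
- by apply: Rintegral_ge0 => x _; exact: sqr_ge0.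
- by apply: Rintegral_ge0 => x _; exact: sqr_ge0.
- have -> : (fun x => ((cst 1 : measurableTypeR R -> R) \_ `[s, t]) x ^+ 2) =
      ((cst 1 : measurableTypeR R -> R) \_ `[s, t]).
    by apply/funext => x; rewrite !patchE; case: ifP; rewrite ?expr1n ?expr0n.
  rewrite -Rintegral_mkcond Rintegral_cst; last exact: segD.
  rewrite mul1r -[X in fine X]/(leb `[s, t]%classic) lebesgue_measure_itv/= lte_fin st -EFinB/=.
  lra.
- rewrite [leRHS]Rintegral_mkcond; apply: le_Rintegral => //.
  + exact/int/bmf_sqr.
  + have c2 : continuous (fun r => derive1 F r ^+ 2) by move=> x; exact: (cvgM (cF x) (cF x)).
    exact: (bmf_integrable (segD a (a + h)) (segfin a (a + h)) (continuous_patch_bmf a (a + h) c2)).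
  + move=> x _; rewrite !patchE; case: ifPn => [|_].
      rewrite inE/= in_itv/= => /andP[sx xt]; rewrite ifT// inE/= in_itv/=.
      by rewrite (le_trans as_ sx) (le_trans xt tah).
    by rewrite expr0n/=; case: ifP => // _; exact: sqr_ge0.
Qed.

End line_calculus.

(** * Cubes and the splitting of the first coordinate *)

Section cubes.
Context {R : realType}.

Definition cube d (L : R) : set 'rV[R]_d := [set x | forall i, x ord0 i \in `[- L, L]].
Arguments cube d L : clear implicits.

Lemma cube_measurable d L : measurable (cube d L).
Proof.
have -> : cube d L = \big[setI/setT]_(i < d) (coor i @^-1` `[- L, L]%classic).
  rewrite -bigcap_seq; apply/seteqP; split=> [x xL i _|x xL i]; first exact: xL.
  by apply: xL; rewrite /= mem_index_enum.
apply: bigsetI_measurable => i _; rewrite -[X in measurable X]setTI.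
exact: measurable_coor.
Qed.

Lemma cube_finite d L : (lebesgue_rV d (cube d L) < +oo)%E.
Proof.
rewrite (_ : cube d L = [set x | forall i, `[- L, L]%classic (x ord0 i)])//.
rewrite (lebesgue_rV_box (A := fun=> `[- L, L]%classic))// lebesgue_measure_itv/=.
case: ifP => _.
  have -> : (\prod_(i < d) (L%:E - (- L)%:E) = (\prod_(i < d) (L - - L))%:E)%E.
    by elim/big_rec2 : _ => // i x y _ ->; rewrite -EFinB EFinM.
  exact: ltry.
case: d => [|d]; first by rewrite big_ord0 ltry.
by rewrite big_ord_recl mul0e.
Qed.

Lemma continuous_measurable_rV d (f : 'rV[R]_d -> R) : continuous f -> measurable_fun setT f.
Proof.
move=> cf; apply: (measurability _ (RGenOInfty.measurableE R)) => //.
move=> _ [_ [a ->] <-]; rewrite setTI; apply: open_measurable_rV.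
by move/continuousP : cf; apply; exact: interval_open.
Qed.

Lemma cube_compact d L : compact (cube d L).
Proof.
by apply: (@rV_compact _ _ (fun=> `[- L, L]%classic)) => i; exact: segment_compact.
Qed.

Lemma continuous_cube_bmf d L (f : 'rV[R]_d -> R) : continuous f ->
  (forall x, ~ cube d L x -> f x = 0) -> bmf (cube d L) f.
Proof.
move=> cf f0; split => //; first exact: continuous_measurable_rV.
have : bounded_set (f @` cube d L).
  apply: compact_bounded; apply: continuous_compact; last exact: cube_compact.
  exact: continuous_subspaceT.
move=> [M [_ hM]]; exists (`|M| + 1) => x.
have [xL|xL] := pselect (cube d L x); last by rewrite f0// normr0 addr_ge0.
by apply: hM; [rewrite (le_lt_trans (ler_norm M))// ltrDl|exists x].
Qed.

Lemma cube_cons d L t y : cube d.+1 L (rV_cons (t, y)) <-> t \in `[- L, L] /\ cube d L y.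
Proof.
split=> [h|[tL yL] i].
  split; first by have := h ord0; rewrite mxE unlift_none.
  by move=> i; have := h (lift ord0 i); rewrite mxE liftK.
by rewrite mxE; case: unliftP => [j|] _; [exact: yL|].
Qed.

Lemma rV_consD d t y u z : rV_cons (t, y) + rV_cons (u, z) = rV_cons (t + u, y + z) :> 'rV[R]_d.+1.
Proof. by apply/rowP => i; rewrite !mxE; case: unliftP => [j|] _; rewrite ?mxE. Qed.

Lemma rV_consZ d c t y : c *: rV_cons (t, y) = rV_cons (c * t, c *: y) :> 'rV[R]_d.+1.
Proof. by apply/rowP => i; rewrite !mxE; case: unliftP => [j|] _; rewrite ?mxE. Qed.

Lemma rV_cons_delta0 d : delta_mx ord0 ord0 = rV_cons (1, 0) :> 'rV[R]_d.+1.
Proof.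
apply/rowP => i; rewrite !mxE; case: unliftP => [j|] ->; rewrite ?mxE ?eqxx//=.
Qed.

Lemma rV_cons_deltaS d (j : 'I_d) : delta_mx ord0 (lift ord0 j) = rV_cons (0, delta_mx ord0 j) :> 'rV[R]_d.+1.
Proof.
apply/rowP => i; rewrite !mxE; case: unliftP => [k|] ->; rewrite ?mxE ?eqxx//=.
Qed.

Lemma rV_cons_continuous_r d t : continuous (fun y : 'rV[R]_d => rV_cons (t, y)).
Proof.
move=> y A /nbhs_ballP[e /= e0 eA]; apply/nbhs_ballP; exists e => //= z [_ yz].
apply: eA; split => // i j; rewrite !mxE; case: unliftP => [k|] _; first exact: yz.
exact: ballxx.
Qed.

Lemma rV_cons_continuous_l d (y : 'rV[R]_d) : continuous (fun t : R => rV_cons (t, y)).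
Proof.
move=> t A /nbhs_ballP[e /= e0 eA]; apply/nbhs_ballP; exists e => //= z yz.
apply: eA; split => // i j; rewrite !mxE; case: unliftP => [k|] _; last exact: yz.
exact: ballxx.
Qed.

End cubes.
Arguments cube {R} d L.

(** * Fubini's theorem on a cube *)

Section Fubini_cons.
Context {R : realType} (d : nat) (L : R).
Local Notation leb := (@lebesgue_measure R).
Variables (f : 'rV[R]_d.+1 -> R) (bf : bmf (cube d.+1 L) f).
Let seg : set (measurableTypeR R) := `[- L, L]%classic.

Lemma bmf_slice_r t : bmf (cube d L) (fun y => f (rV_cons (t, y))).
Proof.
case: bf => mf [M fM] f0; split.
- apply: (measurableT_comp mf); apply: (measurableT_comp (@measurable_rV_cons R d)).
  exact: pair1_measurable.
- by exists M.
- by move=> y yL; apply: f0 => /cube_cons[_].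
Qed.

Lemma bmf_slice_l y : bmf (seg) (fun t => f (rV_cons (t, y))).
Proof.
case: bf => mf [M fM] f0; split.
- apply: (measurableT_comp mf); apply: (measurableT_comp (@measurable_rV_cons R d)).
  exact: pair2_measurable.
- by exists M.
- by move=> t tL; apply: f0 => /cube_cons[].
Qed.

Let segD : measurable seg. Proof. exact: measurable_itv. Qed.

Let segfin : (leb seg < +oo)%E.
Proof. by rewrite lebesgue_measure_itv/=; case: ifP; rewrite // -EFinB ltry. Qed.

Let intF : (leb \x lebesgue_rV d)%E.-integrable setT ((EFin \o f) \o @rV_cons R d).
Proof.
case: bf => mf [M fM] f0.
have mX : measurable (seg `*` cube d L) by apply: measurableX => //; exact: cube_measurable.
have bF : bmf (seg `*` cube d L) (f \o @rV_cons R d).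
  split; first by apply: (measurableT_comp mf); exact: measurable_rV_cons.
    by exists M => x /=.
  by move=> [t y] h; apply: f0 => /cube_cons.
apply: (bmf_integrable mX _ bF).
rewrite -[X in (X < _)%E]/((leb \x lebesgue_rV d)%E (seg `*` cube d L)).
rewrite product_measure1E//; last exact: cube_measurable.
by apply: lte_mul_pinfty; [exact: measure_ge0|rewrite ge0_fin_numE ?measure_ge0|exact: cube_finite].
Qed.

Let fin_int_r t : (\int[lebesgue_rV d]_y (f (rV_cons (t, y)))%:E)%E =
  (\int[lebesgue_rV d]_y f (rV_cons (t, y)))%:E.
Proof.
rewrite /Rintegral fineK//; apply: integrable_fin_num => //.
exact: (bmf_integrable (@cube_measurable R d L) (@cube_finite R d L) (bmf_slice_r t)).
Qed.

Let fin_int_l y : (\int[leb]_t (f (rV_cons (t, y)))%:E)%E = (\int[leb]_t f (rV_cons (t, y)))%:E.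
Proof.
rewrite /Rintegral fineK//; apply: integrable_fin_num => //.
exact: (bmf_integrable segD segfin (bmf_slice_l y)).
Qed.

Let consE : (\int[lebesgue_rV d.+1]_x (f x)%:E =
  \int[leb \x lebesgue_rV d]_p ((EFin \o f) \o @rV_cons R d) p)%E.
Proof.
rewrite /=; rewrite (integral_pushforward (@measurable_rV_cons R d))//.
  by case: bf => mf _ _; exact/measurable_EFinP.
Qed.

Lemma bmf_partial_r : bmf (seg) (fun t => \int[lebesgue_rV d]_y f (rV_cons (t, y))).
Proof.
have h := measurable_fubini_F intF.
have E : (fun t => \int[lebesgue_rV d]_y f (rV_cons (t, y))) = fine \o fubini_F (lebesgue_rV d) ((EFin \o f) \o @rV_cons R d).
  by apply/funext.
split.
- by rewrite E; apply: measurableT_comp h; exact: fine_measurable.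
- case: bf => mf [M fM] f0; exists (M * fine (lebesgue_rV d (cube d L))) => t.
  have [mt _ t0] := bmf_slice_r t.
  have it := bmf_integrable (@cube_measurable R d L) (@cube_finite R d L) (bmf_slice_r t).
  apply: le_trans (le_normr_Rintegral _ it) _ => //.
  rewrite -Rintegral_cst; last exact: cube_measurable.
  rewrite [leRHS]Rintegral_mkcond; apply: le_Rintegral => //.
  + exact: integrable_norm.
  + apply: (bmf_integrable (@cube_measurable R d L) (@cube_finite R d L)).
    by apply: bmf_cst_patch; exact: cube_measurable.
  + move=> y _; rewrite patchE; case: ifPn => // yL.
    by rewrite t0 ?normr0// => h'; move/negP : yL; apply; rewrite inE.
- move=> t tL; have -> : (fun y => f (rV_cons (t, y))) = cst 0.
    by apply/funext => y; case: bf => _ _; apply => /cube_cons[].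
  by rewrite Rintegral_cst// mul0r.
Qed.

Lemma bmf_partial_l : bmf (cube d L) (fun y => \int[leb]_t f (rV_cons (t, y))).
Proof.
have h := measurable_fubini_G intF.
have E : (fun y => \int[leb]_t f (rV_cons (t, y))) = fine \o fubini_G leb ((EFin \o f) \o @rV_cons R d).
  by apply/funext.
split.
- by rewrite E; apply: measurableT_comp h; exact: fine_measurable.
- case: bf => mf [M fM] f0; exists (M * fine (leb seg)) => y.
  have [mt _ t0] := bmf_slice_l y.
  have it := bmf_integrable segD segfin (bmf_slice_l y).
  apply: le_trans (le_normr_Rintegral _ it) _ => //.
  rewrite -Rintegral_cst; last exact: segD.
  rewrite [leRHS]Rintegral_mkcond; apply: le_Rintegral => //.
  + exact: integrable_norm.
  + apply: (bmf_integrable segD segfin).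
    by apply: bmf_cst_patch; exact: segD.
  + move=> t _; rewrite patchE; case: ifPn => // yL.
    by rewrite t0 ?normr0// => h'; move/negP : yL; apply; rewrite inE.
- move=> y yL; have -> : (fun t => f (rV_cons (t, y))) = cst 0.
    by apply/funext => t; case: bf => _ _; apply => /cube_cons[].
  by rewrite Rintegral_cst// mul0r.
Qed.

Lemma Rintegral_cons_r : \int[lebesgue_rV d.+1]_x f x =
  \int[leb]_t \int[lebesgue_rV d]_y f (rV_cons (t, y)).
Proof.
rewrite [LHS]/Rintegral consE -(integral12_prod_meas1 intF) [RHS]/Rintegral; congr fine.
by apply: eq_integral => t _; exact: fin_int_r.
Qed.

Lemma Rintegral_cons_l : \int[lebesgue_rV d.+1]_x f x =
  \int[lebesgue_rV d]_y \int[leb]_t f (rV_cons (t, y)).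
Proof.
rewrite [LHS]/Rintegral consE -(integral21_prod_meas1 intF) [RHS]/Rintegral; congr fine.
by apply: eq_integral => y _; exact: fin_int_l.
Qed.

End Fubini_cons.

(** * Integrals of derivatives of functions supported in a cube *)

Section zero_mean.
Context {R : realType}.

Lemma derive_slice_r d (f : 'rV[R]_d.+1 -> R) t (j : 'I_d) y :
  (derivable f (rV_cons (t, y)) (delta_mx ord0 (lift ord0 j)) ->
   derivable (fun y => f (rV_cons (t, y))) y (delta_mx ord0 j)) /\
  'D_(delta_mx ord0 j) (fun y => f (rV_cons (t, y))) y =
  'D_(delta_mx ord0 (lift ord0 j)) f (rV_cons (t, y)).
Proof.
have E h : f (h *: delta_mx ord0 (lift ord0 j) + rV_cons (t, y)) =
    f (rV_cons (t, h *: delta_mx ord0 j + y)).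
  by rewrite rV_cons_deltaS rV_consZ rV_consD mulr0 add0r.
have F : (fun h : R => h^-1 *: ((f \o shift (rV_cons (t, y)))
      (h *: delta_mx ord0 (lift ord0 j)) - f (rV_cons (t, y)))) =
    (fun h : R => h^-1 *: (((fun y => f (rV_cons (t, y))) \o shift y)
      (h *: delta_mx ord0 j) - f (rV_cons (t, y)))).
  by apply/funext => h /=; rewrite E.
by rewrite /derivable /derive F.
Qed.

Lemma derive_slice_l d (f : 'rV[R]_d.+1 -> R) (t : R) y :
  (derivable f (rV_cons (t, y)) (delta_mx ord0 ord0) ->
   derivable (fun t => f (rV_cons (t, y))) t 1) /\
  derive1 (fun t => f (rV_cons (t, y))) t = 'D_(delta_mx ord0 ord0) f (rV_cons (t, y)).
Proof.
have E (h : R) : f (h *: delta_mx ord0 ord0 + rV_cons (t, y)) = f (rV_cons (h *: (1 : R) + t, y)).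
  by rewrite rV_cons_delta0 rV_consZ rV_consD scaler0 add0r.
have F : (fun h : R => h^-1 *: ((f \o shift (rV_cons (t, y))) (h *: delta_mx ord0 ord0) - f (rV_cons (t, y)))) =
  (fun h : R => h^-1 *: (((fun t => f (rV_cons (t, y))) \o shift t) (h *: (1 : R)) - f (rV_cons (t, y)))).
  by apply/funext => h /=; rewrite E.
by rewrite derive1E /derivable /derive F.
Qed.

Lemma derive_off_cube d L (f : 'rV[R]_d -> R) v x :
  (forall x, ~ cube d L x -> f x = 0) -> ~ cube d L x -> 'D_v f x = 0.
Proof.
move=> f0 xL.
have oC : open (~` cube d L).
  by rewrite openC; apply: compact_closed; [exact: norm_hausdorff|exact: cube_compact].
have -> : 'D_v f x = 'D_v (cst 0 : 'rV[R]_d -> R) x.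
  apply: near_eq_derive; apply: filterS (open_nbhs_nbhs (conj oC xL)) => z /= zL.
  exact: f0.
by rewrite derive_cst.
Qed.

(** By Fubini: along the first coordinate the inner integral is an increment of a function that
    vanishes at both ends; along another one the slices are covered by induction on d. *)
Lemma Rintegral_derive0 d L (f : 'rV[R]_d -> R) (i : 'I_d) :
  continuous f -> (forall x, ~ cube d L x -> f x = 0) ->
  (forall x, derivable f x (delta_mx ord0 i)) ->
  continuous (fun x => 'D_(delta_mx ord0 i) f x) ->
  \int[lebesgue_rV d]_x 'D_(delta_mx ord0 i) f x = 0.
Proof.
elim: d f i => [f []//|d IH] f i cf f0 df cdf.
have bD : bmf (cube d.+1 L) (fun x => 'D_(delta_mx ord0 i) f x).
  by apply: continuous_cube_bmf => // x xL; exact: derive_off_cube xL.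
case: (unliftP ord0 i) => [j|] ij; rewrite ij in df cdf bD *.
  rewrite (Rintegral_cons_r bD).
  rewrite (_ : (fun t => _) = cst 0) ?Rintegral_cst ?mul0r//; apply/funext => t /=.
  have -> : (fun y => 'D_(delta_mx ord0 (lift ord0 j)) f (rV_cons (t, y))) =
      (fun y => 'D_(delta_mx ord0 j) (fun y => f (rV_cons (t, y))) y).
    by apply/funext => y; have [_ ->] := derive_slice_r f t j y.
  apply: IH.
  - by move=> y; apply: continuous_comp; [exact: rV_cons_continuous_r|exact: cf].
  - by move=> y yL; apply: f0 => /cube_cons[].
  - by move=> y; have [h _] := derive_slice_r f t j y; exact: h.
  - have -> : (fun y => 'D_(delta_mx ord0 j) (fun y => f (rV_cons (t, y))) y) =
        (fun x => 'D_(delta_mx ord0 (lift ord0 j)) f x) \o (fun y => rV_cons (t, y)).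
      by apply/funext => y; have [_ ->] := derive_slice_r f t j y.
    by move=> y; apply: continuous_comp; [exact: rV_cons_continuous_r|exact: cdf].
rewrite (Rintegral_cons_l bD).
rewrite (_ : (fun y => _) = cst 0) ?Rintegral_cst ?mul0r//; apply/funext => y /=.
pose F t := f (rV_cons (t, y)).
have E : (fun t => 'D_(delta_mx ord0 ord0) f (rV_cons (t, y))) = derive1 F.
  by apply/funext => t; have [_ ->] := derive_slice_l f t y.
(* The slice is known to vanish only outside [-L, L], so the endpoints are taken at distance M >
   |L|. *)
rewrite E; pose M := `|L| + 1.
have F0 t : ~ t \in `[- L, L] -> F t = 0.
  by move=> tL; apply: f0 => /cube_cons[].
have LM : L < M by rewrite (le_lt_trans (ler_norm L))// ltrDl.
have M0 : 0 < M by rewrite ltr_wpDl.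
have F'0 t : ~ t \in `[- M, M] -> derive1 F t = 0.
  move=> tM; rewrite -E; apply: (derive_off_cube _ f0) => /cube_cons[tL _]; apply: tM.
  by move: tL; rewrite !in_itv/= => /andP[h1 h2]; apply/andP; split; lra.
have -> : derive1 F = derive1 F \_ `[- M, M].
  apply/funext => t; rewrite patchE; case: ifPn => // /negP tM.
  by apply: F'0 => h; apply: tM; rewrite inE.
rewrite -Rintegral_mkcond FTC_line//; last 3 first.
- lra.
- by move=> t; have [h _] := derive_slice_l f t y; exact: h.
- rewrite -E; move=> t.
  apply: (@continuous_comp _ _ _ (fun t : R => rV_cons (t, y)) (fun x => 'D_(delta_mx ord0 ord0) f x)).
    exact: rV_cons_continuous_l.
  exact: cdf.
by rewrite !F0 ?subrr//; rewrite in_itv/= => /andP[]; lra.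
Qed.

End zero_mean.

(** * Decomposition of an interval into cells *)

Section cells.
Context {R : realType}.
Local Notation leb := (@lebesgue_measure R).
Implicit Types g : measurableTypeR R -> R.

(** Half-open, so that consecutive cells are disjoint and tile an interval. *)
Definition cell (a h : R) (k : nat) : set (measurableTypeR R) :=
  `[a + k%:R * h, a + k.+1%:R * h[%classic.

Lemma cell_measurable a h k : measurable (cell a h k).
Proof. exact: measurable_itv. Qed.

Lemma patch_itv g (a b t : R) :
  (g \_ `[a, b[) t = if (a <= t) && (t < b) then g t else 0.
Proof. by rewrite patchE mem_setE in_itv. Qed.

Lemma sum_cells a h n g t : 0 <= h ->
  \sum_(k < n) (g \_ (cell a h k)) t = (g \_ `[a, a + n%:R * h[) t.
Proof.
move=> h0; elim: n => [|n IH].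
  by rewrite big_ord0 patch_itv mul0r addr0; case: leP => //= at_; rewrite ltNge at_.
rewrite big_ord_recr/= IH /cell !patch_itv.
have nh : 0 <= n%:R * h by rewrite mulr_ge0.
have -> : a + n.+1%:R * h = a + n%:R * h + h by rewrite -natr1; ring.
move: nh; move: (n%:R * h) => x x0.
by case: (leP a t) => h1; case: (ltP t (a + x)) => h2 /=; rewrite ?addr0 ?add0r//;
  case: (ltP t (a + x + h)) => h3 //=; lra.
Qed.

(** With A the mean of g on the interval, the integral of g^2 is h^-1 times the squared integral of
    g plus the integral of (g - A)^2. The mean is within the oscillation of each value, so the last
    integrand is at most D. *)
Lemma cell_mean_le a h g (D B : R) : 0 < h ->
  measurable_fun setT g -> (forall t, `|g t| <= B) ->
  (forall s t, `[a, a + h[%classic s -> `[a, a + h[%classic t -> (g t - g s) ^+ 2 <= D) ->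
  \int[leb]_t ((g \_ `[a, a + h[) t ^+ 2) <=
  h^-1 * (\int[leb]_t (g \_ `[a, a + h[) t) ^+ 2 + h * D.
Proof.
move=> h0 mg gB gD; pose I : set (measurableTypeR R) := `[a, a + h[%classic.
have mI : measurable I by exact: measurable_itv.
have lI : leb I = h%:E.
  rewrite /I lebesgue_measure_itv/= lte_fin ltrDl h0 -EFinB; congr EFin; ring.
have fI : (leb I < +oo)%E by rewrite lI ltry.
have bg : bmf I (g \_ I).
  split.
  - by apply/(measurable_restrictT _ mI); exact: measurable_funTS.
  - exists B => t; rewrite patchE; case: ifP => // _.
    by rewrite normr0; apply: le_trans (gB t).
  - by move=> t tI; rewrite patchE ifN//; apply/negP; rewrite inE.
have int := bmf_integrable mI fI.
have D0 : 0 <= D.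
  have aI : I a by rewrite /I/= in_itv/= lexx ltrDl.
  by have := gD _ _ aI aI; rewrite subrr expr0n.
have b1 (c : R) : bmf I (cst c \_ I) by exact: bmf_cst_patch.
have int1 (c : R) : \int[leb]_t ((cst c : measurableTypeR R -> R) \_ I) t = c * h.
  by rewrite -Rintegral_mkcond Rintegral_cst// -[X in fine X]/(leb I) lI.
set G := \int[leb]_t (g \_ I) t.
pose A := G / h; pose r := Num.sqrt D.
have close t : I t -> `|g t - A| <= r.
  move=> tI.
  have gr s : I s -> `|g t - g s| <= r.
    by move=> sI; rewrite -sqrtr_sqr ler_wsqrtr// gD.
  rewrite distrC ler_distl; apply/andP; split.
    rewrite /A ler_pdivlMr// -int1; apply: le_Rintegral => //; [exact/int/b1|exact/int|].
    move=> s _; rewrite !patchE; case: ifPn => // /set_mem sI.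
    by have := gr s sI; rewrite ler_norml => /andP[]; rewrite /=; lra.
  rewrite /A ler_pdivrMr// -int1; apply: le_Rintegral => //; [exact/int|exact/int/b1|].
  move=> s _; rewrite !patchE; case: ifPn => // /set_mem sI.
  by have := gr s sI; rewrite ler_norml => /andP[]; rewrite /=; lra.
have : \int[leb]_t (((g \_ I) t ^+ 2 - (2 * A) * (g \_ I) t) + (cst (A ^+ 2) \_ I) t) <= D * h.
  rewrite -int1; apply: le_Rintegral => //; last first.
  - move=> t _; rewrite !patchE; case: ifPn => [/set_mem tI|_]; last first.
      by rewrite expr0n mulr0 subrr addr0.
    rewrite /= (_ : _ + _ = (g t - A) ^+ 2); last by ring.
    rewrite -(sqr_sqrtr D0) -real_normK ?num_real// ler_pXn2r ?nnegrE ?sqrtr_ge0//.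
    exact: close.
  - exact/int/b1.
  - apply: int; apply: bmf_add => //; apply: bmf_sub; first exact: bmf_sqr.
    exact: bmf_scale.
rewrite RintegralD//; [|by apply: int; apply: bmf_sub; [exact: bmf_sqr|exact: bmf_scale]|exact/int/b1].
rewrite RintegralB//; [|exact/int/bmf_sqr|by apply: int; exact: bmf_scale].
rewrite RintegralZl//; last exact: int.
rewrite int1 -/G => H.
have E : A ^+ 2 * h = h^-1 * G ^+ 2 by rewrite /A; field; rewrite gt_eqF.
have E' : A * G = h^-1 * G ^+ 2 by rewrite /A; field; rewrite gt_eqF.
by move: H; rewrite -[2 * A * G]mulrA E E' [h * D]mulrC; lra.
Qed.

End cells.

(** * Rellich's inequality by induction on the dimension *)

Section rellich.
Context {R : realType}.
Local Notation leb := (@lebesgue_measure R).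

Lemma eq_ler (x y : R) : x = y -> x <= y.
Proof. by move=> ->. Qed.

Definition c1c d L (f : 'rV[R]_d -> R) : Prop :=
  [/\ continuous f, forall x, ~ cube d L x -> f x = 0,
      forall i x, derivable f x (delta_mx ord0 i) &
      forall i, continuous (fun x => 'D_(delta_mx ord0 i) f x)].

Lemma c1c_slice d L (f : 'rV[R]_d.+1 -> R) t : c1c L f ->
  c1c L (fun y => f (rV_cons (t, y))).
Proof.
move=> [cf f0 df cdf]; split.
- by move=> y; apply: continuous_comp; [exact: rV_cons_continuous_r|exact: cf].
- by move=> y yL; apply: f0 => /cube_cons[].
- by move=> j y; have [h _] := derive_slice_r f t j y; exact: h.
- move=> j; have -> : (fun y => 'D_(delta_mx ord0 j) (fun y => f (rV_cons (t, y))) y) =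
        (fun x => 'D_(delta_mx ord0 (lift ord0 j)) f x) \o (fun y => rV_cons (t, y)).
    by apply/funext => y; have [_ ->] := derive_slice_r f t j y.
  by move=> y; apply: continuous_comp; [exact: rV_cons_continuous_r|exact: cdf].
Qed.

Lemma bmf_Rintegral_sqr_le d (T : measurableType d) (mu : {measure set T -> \bar R})
    (D : set T) (g : T -> R) : measurable D -> (mu D < +oo)%E -> bmf D g ->
  (\int[mu]_x g x) ^+ 2 <= fine (mu D) * \int[mu]_x (g x ^+ 2).
Proof.
move=> mD fD bg; have int := bmf_integrable mD fD.
have b1 : bmf D (cst (1 : R) \_ D) by exact: bmf_cst_patch.
have -> : g = (fun x => g x * (cst (1 : R) \_ D) x).
  apply/funext => x; rewrite patchE; case: ifPn => [_|/negP xD]; first by rewrite mulr1.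
  by case: bg => _ _ ->; rewrite ?mul0r// => h; apply: xD; rewrite inE.
apply: le_trans (Rintegral_CS _ _ _) _.
- exact/int/bmf_sqr.
- exact/int/bmf_mul2.
- exact/int/bmf_sqr.
rewrite mulrC; apply: ler_pM.
- by apply: Rintegral_ge0 => x _; exact: sqr_ge0.
- by apply: Rintegral_ge0 => x _; exact: sqr_ge0.
- have -> : (fun x => (cst (1 : R) \_ D) x ^+ 2) = cst (1 : R) \_ D.
    by apply/funext => x; rewrite !patchE; case: ifP; rewrite ?expr1n ?expr0n.
  by rewrite -Rintegral_mkcond Rintegral_cst// mul1r.
- rewrite [X in _ <= \int[mu]_x (X x)](_ : _ = (fun x => g x ^+ 2))//.
  apply/funext => x; rewrite patchE; case: ifPn => [_|/negP xD]; first by rewrite mulr1.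
  by case: bg => _ _ ->; rewrite ?mul0r// => h; apply: xD; rewrite inE.
Qed.

Definition rV_tail d (x : 'rV[R]_d.+1) : 'rV[R]_d := \row_j x ord0 (lift ord0 j).

Lemma rV_tail_cons d t y : rV_tail (rV_cons (t, y)) = y :> 'rV[R]_d.
Proof. by apply/rowP => j; rewrite !mxE liftK. Qed.

Lemma rV_head_cons d t y : (rV_cons (t, y) : 'rV[R]_d.+1) ord0 ord0 = t.
Proof. by rewrite mxE unlift_none. Qed.

Lemma measurable_rV_tail d : measurable_fun setT (@rV_tail d).
Proof.
apply: measurable_fun_rV => j.
by apply: (eq_measurable_fun (coor (lift ord0 j))) => [x _|]; [rewrite /coor/= mxE|exact: measurable_coor].
Qed.

Lemma c1c_bmf d L f : c1c L f -> bmf (cube d L) f.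
Proof. by case=> cf f0 _ _; exact: continuous_cube_bmf. Qed.

Lemma c1c_bmf_derive d L f i : c1c L f -> bmf (cube d L) (fun x => 'D_(delta_mx ord0 i) f x).
Proof. by case=> cf f0 df cdf; apply: continuous_cube_bmf => // x; exact: derive_off_cube. Qed.

Lemma Rintegral_sum_cells (a h L : R) n (g : measurableTypeR R -> R) : 0 <= h ->
  a < - L -> L < a + n%:R * h -> bmf `[- L, L]%classic g ->
  \int[leb]_t g t = \sum_(k < n) \int[leb]_t (g \_ (cell a h k)) t.
Proof.
move=> h0 aL Lb bg.
pose seg : set (measurableTypeR R) := `[- L, L]%classic.
have mS : measurable seg by exact: measurable_itv.
have fS : (leb seg < +oo)%E.
  by rewrite /seg lebesgue_measure_itv/=; case: ifP; rewrite // -EFinB ltry.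
rewrite -Rintegral_sum; last first.
  move=> k; apply: (bmf_integrable mS fS); apply: bmf_patch => //; exact: cell_measurable.
apply: eq_Rintegral => t _.
rewrite sum_cells// patch_itv; case: ifPn => // tab; case: bg => _ _ -> //=.
by rewrite in_itv/= => /andP[h1 h2]; move/negP: tab; apply; apply/andP; split; lra.
Qed.

Lemma lebesgue_rV0_setT : lebesgue_rV 0 [set: 'rV[R]_0] = 1%E.
Proof. by rewrite /= diracT. Qed.

Local Opaque Rintegral derive lebesgue_rV.

(** The inequality for the slice at t involves the integrals [m j t] over cells of dimension d.
    These depend on the single variable t, so cutting the line into cells of length h replaces them
    by integrals of f over product cells, with an error proportional to h^2 times the integral of
    the squared first partial derivative. *)
Lemma rellich_cells d (L eps : R) : 0 < eps ->
  exists (J : finType) (Q : J -> set 'rV[R]_d) (K : R),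
  [/\ 0 <= K, forall j, measurable (Q j) & forall f, c1c L f ->
    \int[lebesgue_rV d]_x (f x ^+ 2) <=
    K * \sum_j (\int[lebesgue_rV d]_x (f \_ (Q j)) x) ^+ 2 +
    eps * \sum_i \int[lebesgue_rV d]_x ('D_(delta_mx ord0 i) f x ^+ 2)].
Proof.
move=> eps0; elim: d => [|d [J [Q [K [K0 mQ IH]]]]].
  (* R^0 is a single point of mass 1, so the integral of f^2 is the square of the integral of f. *)
  exists unit, (fun=> setT), 1; split => // f _.
  rewrite mul1r big_ord0 mulr0 addr0 big_const card_unit/= addr0.
  have f0 x : f x = f 0 by congr f; apply/rowP => -[].
  rewrite (_ : (fun x => f x ^+ 2) = cst (f 0 ^+ 2)); last by apply/funext => x; rewrite f0.
  rewrite (_ : (fun x => (f \_ setT) x) = cst (f 0)); last by apply/funext => x; rewrite patchT ?inE// f0.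
  rewrite !Rintegral_cst// -[X in fine X]/(lebesgue_rV 0 [set: 'rV[R]_0]) lebesgue_rV0_setT.
  by rewrite /= !mulr1.
pose seg : set (measurableTypeR R) := `[- L, L]%classic.
have mS : measurable seg by exact: measurable_itv.
have fS : (leb seg < +oo)%E.
  by rewrite /seg lebesgue_measure_itv/=; case: ifP; rewrite // -EFinB ltry.
have int1 := bmf_integrable mS fS.
have intd := bmf_integrable (@cube_measurable R d L) (@cube_finite R d L).
have intS := bmf_integrable (@cube_measurable R d.+1 L) (@cube_finite R d.+1 L).
pose c := fine (lebesgue_rV d (cube d L)); have c0 : 0 <= c by rewrite fine_ge0.
pose M := `|L| + 1.
have M0 : 0 < M by rewrite ltr_wpDl.
have LM : L < M by rewrite (le_lt_trans (ler_norm L))// ltrDl.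
(* With h = 2 M / (N + 1) the error factor K * #|J| * c * h ^+ 2 equals S / (N + 1)^2, which N + 1 >
   S / eps makes at most eps. *)
pose S := K * #|J|%:R * c * (2 * M) ^+ 2.
pose N := Num.truncn (S / eps); pose h := 2 * M / N.+1%:R.
have h0 : 0 < h by rewrite divr_gt0// mulr_gt0.
have Nh : - M + N.+1%:R * h = M by rewrite /h; field.
have aL : - M < - L by rewrite ltrN2.
have Lb : L < - M + N.+1%:R * h by rewrite Nh.
have small : K * #|J|%:R * c * h ^+ 2 <= eps.
  have -> : K * #|J|%:R * c * h ^+ 2 = S / N.+1%:R / N.+1%:R by rewrite /S /h; field.
  rewrite ler_pdivrMr// ler_pdivrMr//.
  have : S / eps < N.+1%:R by exact: truncnS_gt.
  rewrite ltr_pdivrMr// => /ltW SN; apply: le_trans SN _.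
  rewrite mulrC -[leLHS]mulr1 ler_wpM2l ?mulr_ge0 ?(ltW eps0)//.
  by rewrite ler1n.
pose QQ (kj : 'I_N.+1 * J) : set 'rV[R]_d.+1 :=
  ((@coor R d.+1 ord0) @^-1` (cell (- M) h kj.1)) `&` ((@rV_tail d) @^-1` (Q kj.2)).
exists ('I_N.+1 * J)%type, QQ, (K * h^-1); split.
- by rewrite mulr_ge0// invr_ge0 ltW.
- move=> [k j]; apply: measurableI.
    by rewrite -[X in measurable X]setTI; apply: (@measurable_coor R d.+1 ord0) => //; exact: cell_measurable.
  by rewrite -[X in measurable X]setTI; apply: measurable_rV_tail.
move=> f hf; have bf := c1c_bmf hf; have [cf f0 df cdf] := hf.
pose fj j := f \_ ((@rV_tail d) @^-1` (Q j)).
have mtQ j : measurable ((@rV_tail d) @^-1` (Q j)).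
  by rewrite -[X in measurable X]setTI; apply: measurable_rV_tail.
have bfj j : bmf (cube d.+1 L) (fj j) by exact: bmf_patch.
pose m j t := \int[lebesgue_rV d]_y fj j (rV_cons (t, y)).
have bm j : bmf seg (m j) by exact: bmf_partial_r.
have slice j t y : fj j (rV_cons (t, y)) = ((fun y => f (rV_cons (t, y))) \_ (Q j)) y.
  rewrite /fj !patchE; congr (if _ then _ else _).
  by apply/idP/idP; rewrite !inE /= rV_tail_cons.
have bf2 := bmf_sqr bf.
have bD i := c1c_bmf_derive i hf.
have bD2 i := bmf_sqr (bD i).
pose D0 x := 'D_(delta_mx ord0 ord0) f x.
have step1 : \int[lebesgue_rV d.+1]_x (f x ^+ 2) <=
    K * \sum_j \int[leb]_t (m j t ^+ 2) +
    eps * \sum_(i < d) \int[lebesgue_rV d.+1]_x ('D_(delta_mx ord0 (lift ord0 i)) f x ^+ 2).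
  rewrite (Rintegral_cons_r bf2).
  pose G t := K * \sum_j (m j t ^+ 2) +
    eps * \sum_(i < d) \int[lebesgue_rV d]_y ('D_(delta_mx ord0 (lift ord0 i)) f (rV_cons (t, y)) ^+ 2).
  have bG1 : bmf seg (fun t => \sum_j (m j t ^+ 2)).
    by apply: bmf_sum => j _; exact: bmf_sqr.
  have bG2 : bmf seg (fun t => \sum_(i < d) \int[lebesgue_rV d]_y ('D_(delta_mx ord0 (lift ord0 i)) f (rV_cons (t, y)) ^+ 2)).
    by apply: bmf_sum => i _; exact: (bmf_partial_r (bD2 (lift ord0 i))).
  apply: (@le_trans _ _ (\int[leb]_t G t)).
    apply: le_Rintegral => //.
    - exact/int1/(bmf_partial_r bf2).
    - by apply: int1; apply: bmf_add; exact: bmf_scale.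
    move=> t _; have := IH _ (c1c_slice t hf).
    rewrite /G /m; under eq_bigr do rewrite -(eq_Rintegral _ (fun y _ => slice _ t y)).
    move/le_trans; apply; rewrite lerD2l; apply: ler_wpM2l; first exact: ltW.
    apply: ler_sum => i _; rewrite le_eqVlt; apply/orP; left; apply/eqP.
    by apply: eq_Rintegral => y _; have [_ ->] := derive_slice_r f t i y.
  rewrite RintegralD//; [|exact/int1/bmf_scale|exact/int1/bmf_scale].
  rewrite !RintegralZl//; [|exact: int1|exact: int1].
  rewrite !Rintegral_sum; [|by move=> j; exact/int1/(bmf_partial_r (bD2 _))|by move=> j; exact/int1/bmf_sqr].
  by under [X in _ <= _ + eps * X]eq_bigr do rewrite (Rintegral_cons_r (bD2 _)).
have D0M y : bmf seg (fun t => D0 (rV_cons (t, y)) ^+ 2) := bmf_slice_l (bD2 ord0) y.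
pose Dk k x := ((fun x => D0 x ^+ 2) \_ ((@coor R d.+1 ord0) @^-1` (cell (- M) h k))) x.
have bDk k : bmf (cube d.+1 L) (Dk k).
  apply: bmf_patch; last exact: bD2.
  by rewrite -[X in measurable X]setTI; apply: (@measurable_coor R d.+1 ord0) => //; exact: cell_measurable.
have DkE k t y : Dk k (rV_cons (t, y)) = ((fun t => D0 (rV_cons (t, y)) ^+ 2) \_ (cell (- M) h k)) t.
  rewrite /Dk !patchE; congr (if _ then _ else _).
  by apply/idP/idP; rewrite !inE /= /coor rV_head_cons.
pose I k := \int[lebesgue_rV d.+1]_x Dk k x.
have sumI : \sum_(k < N.+1) I k = \int[lebesgue_rV d.+1]_x (D0 x ^+ 2).
  rewrite (Rintegral_cons_l (bD2 ord0)).
  rewrite /I; under eq_bigr do rewrite (Rintegral_cons_l (bDk _)).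
  rewrite -Rintegral_sum; last by move=> k; exact/intd/(bmf_partial_l (bDk k)).
  apply: eq_Rintegral => y _.
  rewrite -/(D0 _) (@Rintegral_sum_cells (- M) h L N.+1 _ (ltW h0) aL Lb (D0M y)).
  by apply: eq_bigr => k _; apply: eq_Rintegral => t _; rewrite DkE.
(* [m j t - m j s] is an integral over the cube of dimension d, whence the factor c by
   Cauchy-Schwarz, of increments in the first variable, whence the factor h. *)
have osc j k s t : cell (- M) h k s -> cell (- M) h k t ->
    (m j t - m j s) ^+ 2 <= c * (h * I k).
  move=> sk tk; pose u y := fj j (rV_cons (t, y)) - fj j (rV_cons (s, y)).
  have bu : bmf (cube d L) u by apply: bmf_sub; exact: (bmf_slice_r (bfj j)).
  have -> : m j t - m j s = \int[lebesgue_rV d]_y u y.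
    by rewrite /u RintegralB//; exact/intd/(bmf_slice_r (bfj j)).
  apply: le_trans (bmf_Rintegral_sqr_le (@cube_measurable R d L) (@cube_finite R d L) bu) _.
  rewrite ler_wpM2l// /I (Rintegral_cons_l (bDk k)) -RintegralZl//; last first.
    exact/intd/(bmf_partial_l (bDk k)).
  apply: le_Rintegral => //.
  - exact/intd/bmf_sqr.
  - exact/intd/bmf_scale/(bmf_partial_l (bDk k)).
  move=> y _; pose F r := f (rV_cons (r, y)).
  have dFE : derive1 F = fun r => D0 (rV_cons (r, y)).
    by apply/funext => r; have [_ ->] := derive_slice_l f r y.
  have dF r : derivable F r 1 by have [H _] := derive_slice_l f r y; exact: H.
  have cF : continuous (derive1 F).
    rewrite dFE => r; apply: (@continuous_comp _ _ _ (fun t : R => rV_cons (t, y)) D0).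
      exact: rV_cons_continuous_l.
    exact: cdf.
  have uF : u y ^+ 2 <= (F t - F s) ^+ 2.
    rewrite /u !slice !patchE; case: ifP => _ //.
    by rewrite subrr expr0n/=; exact: sqr_ge0.
  apply: le_trans uF _; pose a := - M + k%:R * h.
  have cellE : cell (- M) h k = `[a, a + h[%classic.
    by rewrite /cell /a -natr1 mulrDl mul1r addrA.
  have sub r : cell (- M) h k r -> r \in `[a, a + h].
    by rewrite cellE/= !in_itv/= => /andP[-> /ltW ->].
  apply: le_trans (increment_sqr_le h0 dF cF (sub _ sk) (sub _ tk)) _.
  rewrite ler_wpM2l ?(ltW h0)// -Rintegral_itv_bndo_bndc; last first.
    rewrite dFE; apply: (@integrableS _ _ _ leb setT) => //; exact: int1.
  rewrite Rintegral_mkcond dFE -cellE.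
  by apply: eq_ler; apply: eq_Rintegral => r _; rewrite DkE.
have step2 j : \int[leb]_t (m j t ^+ 2) <=
    h^-1 * \sum_(k < N.+1) (\int[lebesgue_rV d.+1]_x (f \_ (QQ (k, j))) x) ^+ 2 +
    c * h ^+ 2 * \int[lebesgue_rV d.+1]_x (D0 x ^+ 2).
  rewrite (@Rintegral_sum_cells (- M) h L N.+1 _ (ltW h0) aL Lb (bmf_sqr (bm j))).
  rewrite -sumI !mulr_sumr -big_split/=; apply: ler_sum => k _.
  have cellE : cell (- M) h k = `[- M + k%:R * h, - M + k%:R * h + h[%classic.
    by rewrite /cell -natr1 mulrDl mul1r addrA.
  have [mm [B mB] _] := bm j.
  have H := @cell_mean_le R (- M + k%:R * h) h (m j) (c * (h * I k)) B h0 mm mB.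
  rewrite -cellE in H; have {}H := H (osc j k).
  have -> : (fun t => m j t ^+ 2) \_ (cell (- M) h k) = (fun t => (m j \_ (cell (- M) h k)) t ^+ 2).
    by apply/funext => t; rewrite !patchE; case: ifP; rewrite ?expr0n.
  apply: le_trans H _; apply: lerD; last by rewrite expr2; apply: eq_ler; ring.
  rewrite ler_wpM2l ?invr_ge0 ?(ltW h0)//.
  have bq : bmf (cube d.+1 L) (f \_ (QQ (k, j))).
    apply: bmf_patch => //; apply: measurableI => //.
    by rewrite -[X in measurable X]setTI; apply: (@measurable_coor R d.+1 ord0) => //; exact: cell_measurable.
  rewrite (Rintegral_cons_r bq); apply: eq_ler; congr (_ ^+ 2).
  apply: eq_Rintegral => t _; rewrite /m patchE.
  have qE y : (f \_ (QQ (k, j))) (rV_cons (t, y)) =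
     if t \in cell (- M) h k then fj j (rV_cons (t, y)) else 0.
    rewrite /fj !patchE /QQ in_setI.
    have -> : (rV_cons (t, y) \in (@coor R d.+1 ord0) @^-1` cell (- M) h k) = (t \in cell (- M) h k).
      by apply/idP/idP; rewrite !inE /= /coor rV_head_cons.
    by case: (t \in _).
  case: ifP => tk.
    by apply: eq_Rintegral => y _; rewrite qE tk.
  rewrite (_ : (fun y => _) = cst 0) ?Rintegral_cst ?mul0r//.
  by apply/funext => y; rewrite qE tk.
apply: le_trans step1 _.
have DD0 : 0 <= \int[lebesgue_rV d.+1]_x (D0 x ^+ 2) by apply: Rintegral_ge0 => x _; exact: sqr_ge0.
have E1 : K * \sum_j \int[leb]_t (m j t ^+ 2) <=
    K * (h^-1 * \sum_kj (\int[lebesgue_rV d.+1]_x (f \_ (QQ kj)) x) ^+ 2) +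
    eps * \int[lebesgue_rV d.+1]_x (D0 x ^+ 2).
  apply: (@le_trans _ _ (K * \sum_j (h^-1 * \sum_(k < N.+1) (\int[lebesgue_rV d.+1]_x (f \_ (QQ (k, j))) x) ^+ 2 +
    c * h ^+ 2 * \int[lebesgue_rV d.+1]_x (D0 x ^+ 2)))).
    by rewrite ler_wpM2l//; apply: ler_sum => j _; exact: step2.
  rewrite big_split/= sumr_const -[_ *+ #|J|]mulr_natl mulrDr; apply: lerD.
    rewrite -mulr_sumr exchange_big/= pair_bigA/=.
    by apply: eq_ler; congr (_ * (_ * _)); apply: eq_bigr => -[].
  apply: le_trans (_ : K * #|J|%:R * c * h ^+ 2 * \int[lebesgue_rV d.+1]_x (D0 x ^+ 2) <= _).
    by apply: eq_ler; ring.
  exact: ler_wpM2r.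
apply: le_trans (lerD E1 (lexx _)) _.
by rewrite [X in _ <= _ + eps * X]big_ord_recl mulrDr -mulrA -addrA.
Qed.

End rellich.

Local Transparent Rintegral derive lebesgue_rV.
(** * Smooth functions and bumps *)

Section real_smooth.
Context {R : realType} {d : nat}.
Implicit Types (f g h : 'rV[R]_d -> R) (i j : 'I_d) (s : seq 'I_d) (x y : 'rV[R]_d).

Definition dd i h : 'rV[R]_d -> R := fun x => 'D_(delta_mx ord0 i) h x.
Definition dds s h := foldr dd h s.

(** Smoothness is cut into finite orders so that stability under products is an induction on n: the
    derivative of a product still contains the factors, taken one order lower by [rsmnW]. *)
Fixpoint rsmn n h : Prop := (forall x, differentiable h x) /\
  if n is n'.+1 then forall i, rsmn n' (dd i h) else True.

Definition rsm h := forall n, rsmn n h.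

Lemma rsmnS n h : rsmn n.+1 h <->
  (forall x, differentiable h x) /\ forall i, rsmn n (dd i h).
Proof. by []. Qed.

Lemma rsmn_diff n h : rsmn n h -> forall x, differentiable h x.
Proof. by case: n => [|n] []. Qed.

Lemma rsmnW n h : rsmn n.+1 h -> rsmn n h.
Proof.
elim: n h => [|n IH] h [dh ih]; first by split.
by split => // i; exact: IH.
Qed.

Lemma rsm_dd h i : rsm h -> rsm (dd i h).
Proof. by move=> rh n; have [_ H] := rh n.+1; exact: H. Qed.

Lemma rsm_dds h s : rsm h -> rsm (dds s h).
Proof. by move=> rh; elim: s => //= i s IH; exact: rsm_dd. Qed.

Lemma rsmP h : rsm h <-> forall s x, differentiable (dds s h) x.
Proof.
split=> [rh s|dh n]; first exact: (rsmn_diff (rsm_dds s rh 0)).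
elim: n h dh => [|n IH] h dh; first by split => //; exact: (dh [::]).
split; first exact: (dh [::]).
by move=> i; apply: IH => s x; have := dh (rcons s i) x; rewrite /dds foldr_rcons.
Qed.

Lemma rsm_diff h x : rsm h -> differentiable h x.
Proof. by move=> /(_ 0%N)[]. Qed.

Lemma rsm_continuous h : rsm h -> continuous h.
Proof. by move=> rh x; apply: differentiable_continuous; exact: rsm_diff. Qed.

Lemma rsm_derivable h x v : rsm h -> derivable h x v.
Proof. by move=> rh; apply: diff_derivable; exact: rsm_diff. Qed.

Lemma ddD f g i : (forall x, differentiable f x) -> (forall x, differentiable g x) ->
  dd i (fun x => f x + g x) = (fun x => dd i f x + dd i g x).
Proof.
by move=> df dg; apply/funext => x; apply: deriveD; exact: diff_derivable.
Qed.

Lemma ddZ f (c : R) i : (forall x, differentiable f x) ->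
  dd i (fun x => c * f x) = (fun x => c * dd i f x).
Proof.
by move=> df; apply/funext => x; apply: (@deriveZ _ _ _ f); exact: diff_derivable.
Qed.

Lemma ddM f g i : (forall x, differentiable f x) -> (forall x, differentiable g x) ->
  dd i (fun x => f x * g x) = (fun x => f x * dd i g x + g x * dd i f x).
Proof.
by move=> df dg; apply/funext => x; apply: deriveM; exact: diff_derivable.
Qed.

Lemma rsmnD n f g : rsmn n f -> rsmn n g -> rsmn n (fun x => f x + g x).
Proof.
elim: n f g => [|n IH] f g.
  by move=> [df _] [dg _]; split => // x; exact: differentiableD.
move=> /rsmnS[df rf] /rsmnS[dg rg]; apply/rsmnS; split; first by move=> x; exact: differentiableD.
by move=> i; rewrite ddD//; exact: IH.
Qed.

Lemma rsmnZ n f (c : R) : rsmn n f -> rsmn n (fun x => c * f x).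
Proof.
elim: n f => [|n IH] f.
  by move=> [df _]; split => // x; exact: (@differentiableZ _ _ _ f).
move=> /rsmnS[df rf]; apply/rsmnS; split; first by move=> x; exact: (@differentiableZ _ _ _ f).
by move=> i; rewrite ddZ//; exact: IH.
Qed.

Lemma rsmnM n f g : rsmn n f -> rsmn n g -> rsmn n (fun x => f x * g x).
Proof.
elim: n f g => [|n IH] f g rf rg.
  by split => // x; apply: differentiableM; [exact: (rsmn_diff rf)|exact: (rsmn_diff rg)].
have /rsmnS[df rf'] := rf; have /rsmnS[dg rg'] := rg.
apply/rsmnS; split; first by move=> x; exact: differentiableM.
by move=> i; rewrite ddM//; apply: rsmnD; apply: IH => //; exact: rsmnW.
Qed.

Lemma rsmD f g : rsm f -> rsm g -> rsm (fun x => f x + g x).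
Proof. by move=> rf rg n; exact: rsmnD. Qed.

Lemma rsmZ f (c : R) : rsm f -> rsm (fun x => c * f x).
Proof. by move=> rf n; exact: rsmnZ. Qed.

Lemma rsmM f g : rsm f -> rsm g -> rsm (fun x => f x * g x).
Proof. by move=> rf rg n; exact: rsmnM. Qed.

Lemma rsm_cst (c : R) : rsm (cst c).
Proof.
move=> n; elim: n c => [|n IH] c; split => //.
by move=> i; rewrite (_ : dd i (cst c) = cst 0)//; apply/funext => x; exact: derive_cst.
Qed.

Lemma rsm_prod (I : Type) (r : seq I) (F : I -> 'rV[R]_d -> R) :
  (forall k, rsm (F k)) -> rsm (fun x => \prod_(k <- r) F k x).
Proof.
move=> h; elim: r => [|k r IH].
  by under eq_fun do rewrite big_nil; exact: rsm_cst.
by under eq_fun do rewrite big_cons; exact: rsmM.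
Qed.

Lemma derive_shift f v w x : 'D_v (fun y => f (y + w)) x = 'D_v f (x + w).
Proof.
rewrite /derive (_ : (fun h : R => _) = (fun h : R => h^-1 *: ((f \o shift (x + w)) (h *: v) - f (x + w))))//.
by apply/funext => t /=; rewrite addrA.
Qed.

Lemma MVT_line f v x (k : R) : 0 < k -> (forall y, differentiable f y) ->
  exists2 t : R, 0 <= t <= k & f (x + k *: v) - f x = k * 'D_v f (x + t *: v).
Proof.
move=> k0 df; pose F (t : R) := f (x + t *: v).
have dF t : is_derive t (1 : R) F ('D_v f (x + t *: v)).
  have E : (fun h : R => h^-1 *: ((F \o shift t) (h *: (1 : R)) - F t)) =
      (fun h : R => h^-1 *: ((f \o shift (x + t *: v)) (h *: v) - f (x + t *: v))).
    apply/funext => h; rewrite /F /=; congr (_ *: (f _ - _)).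
    by rewrite [h *: _]mulr1 scalerDl addrCA.
  split; last by rewrite /derive E.
  by rewrite /derivable E; exact: diff_derivable.
have cF : {within `[0, k], continuous F}.
  apply: continuous_subspaceT => t; apply: differentiable_continuous.
  by apply/derivable1_diffP; case: (dF t).
have [t /itvP tk] := MVT k0 (fun t _ => dF t) cF.
rewrite /F scale0r addr0 subr0 mulrC => ->.
by exists t; rewrite ?tk.
Qed.

(** The second difference of f along i and j is symmetric in them. Two applications of the mean
    value theorem make it k^2 times either mixed derivative at a point close to x, and the mixed
    derivatives are continuous. *)
Lemma dd_comm f i j x : rsm f -> dd i (dd j f) x = dd j (dd i f) x.
Proof.
move=> rf.
have R1 (a b c e : R) : a - b - (c - e) = a - c - (b - e) by ring.
have key i' j' (k : R) : 0 < k -> exists s t : R, [/\ 0 <= s <= k, 0 <= t <= k &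
    f (x + k *: delta_mx ord0 j' + k *: delta_mx ord0 i') - f (x + k *: delta_mx ord0 i') -
    (f (x + k *: delta_mx ord0 j') - f x) =
    k * (k * dd j' (dd i' f) (x + t *: delta_mx ord0 i' + s *: delta_mx ord0 j'))].
  move=> k0; pose A y := f (y + k *: delta_mx ord0 j') - f y.
  have dsh : forall y, differentiable (fun y => f (y + k *: delta_mx ord0 j')) y.
    move=> y; apply: (@differentiable_comp _ _ _ _ (fun y => y + k *: delta_mx ord0 j') f).
      by apply: differentiableD; [exact: ex_diff|exact: differentiable_cst].
    exact: rsm_diff.
  have dA : forall y, differentiable A y.
    by move=> y; apply: differentiableB => //; exact: rsm_diff.
  have [t t0 tE] := MVT_line (delta_mx ord0 i') x k0 dA.
  have DA y : 'D_(delta_mx ord0 i') A y = dd i' f (y + k *: delta_mx ord0 j') - dd i' f y.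
    rewrite /A deriveB; [|exact: diff_derivable|exact: rsm_derivable].
    by rewrite derive_shift.
  have [s s0 sE] := MVT_line (delta_mx ord0 j') (x + t *: delta_mx ord0 i') k0
    (fun y => rsm_diff y (rsm_dd i' rf)).
  exists s, t; split => //; rewrite -sE -DA -tE /A.
  by rewrite [x + k *: delta_mx ord0 j' + _]addrAC R1.
pose Dij := dd i (dd j f); pose Dji := dd j (dd i f).
have cij : continuous Dij by apply: rsm_continuous; do 2 apply: rsm_dd.
have cji : continuous Dji by apply: rsm_continuous; do 2 apply: rsm_dd.
apply/eqP; rewrite -subr_eq0 -normr_le0; apply/ler_addgt0Pr => e e0; rewrite add0r.
have e2 : 0 < e / 2 by rewrite divr_gt0.
have /cvgrPdist_lt/(_ _ e2)/nbhs_ballP[r1 /= r10 h1] := cij x.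
have /cvgrPdist_lt/(_ _ e2)/nbhs_ballP[r2 /= r20 h2] := cji x.
(* The intermediate points are at distance at most 2 k from x, inside both balls of continuity. *)
pose k := Num.min r1 r2 / 4.
have m0 : 0 < Num.min r1 r2 by rewrite lt_min r10 r20.
have k0 : 0 < k by rewrite divr_gt0.
have close (i' j' : 'I_d) (s t r : R) : 0 <= s <= k -> 0 <= t <= k -> Num.min r1 r2 <= r ->
    ball x r (x + t *: delta_mx ord0 i' + s *: delta_mx ord0 j').
  move=> /andP[s0 sk] /andP[t0 tk] mr.
  rewrite -ball_normE /ball_/= -addrA opprD addrA subrr add0r normrN.
  have nd (l : 'I_d) : `|delta_mx ord0 l : 'rV[R]_d| <= 1.
    rewrite [leLHS]mx_normrE; apply: bigmax_le => // -[a b] _ /=.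
    by rewrite mxE; case: (_ && _); rewrite ?normr1 ?normr0.
  apply: le_lt_trans (ler_normD _ _) _; rewrite !normrZ !ger0_norm//.
  have := ler_wpM2l s0 (nd j'); have := ler_wpM2l t0 (nd i'); rewrite !mulr1.
  have : 4 * k = Num.min r1 r2 by rewrite /k; field.
  lra.
have [s [t [s0 t0 E1]]] := key i j k k0.
have [s' [t' [s0' t0' E2]]] := key j i k k0.
have E : Dji (x + t *: delta_mx ord0 i + s *: delta_mx ord0 j) =
    Dij (x + t' *: delta_mx ord0 j + s' *: delta_mx ord0 i).
  apply: (mulfI (lt0r_neq0 k0)); apply: (mulfI (lt0r_neq0 k0)).
  rewrite -[LHS]E1 -[RHS]E2.
  by rewrite [x + k *: delta_mx ord0 j + _]addrAC R1.
have := h1 _ (close j i s' t' r1 s0' t0' _); rewrite /= ge_min lexx => /(_ isT).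
have := h2 _ (close i j s t r2 s0 t0 _); rewrite /= ge_min lexx orbT => /(_ isT).
rewrite E -/Dij -/Dji => H2 H1.
have -> : Dij x - Dji x = (Dij x - Dij (x + t' *: delta_mx ord0 j + s' *: delta_mx ord0 i)) -
   (Dji x - Dij (x + t' *: delta_mx ord0 j + s' *: delta_mx ord0 i)).
  by rewrite opprB addrA subrK.
apply: le_trans (ler_normB _ _) _; rewrite [leRHS](_ : e = e / 2 + e / 2); last by field.
exact: (lerD (ltW H1) (ltW H2)).
Qed.

End real_smooth.

(** * A function flat at the origin *)

Section flat_exponential.
Context {R : realType} (c : R).
Hypothesis c0 : 0 < c.

(* All derivatives of [flat c 0] are combinations of the functions [flat c k], which vanish to infinite order at 0. *)
Definition flat (k : nat) (t : R) : R := if 0 < t then t^-1 ^+ k * expR (- (c * t^-1)) else 0.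

(** Raising expR y >= y, for y = c s / (n + 1), to the power n + 1 bounds s^(n + 1) exp(- c s),
    hence s^n exp(- c s) for s >= 1; the summand 1 covers s < 1. *)
Lemma exp_decay (n : nat) : exists K : R, 0 <= K /\ forall s : R, 0 < s -> s ^+ n * expR (- (c * s)) <= K.
Proof.
exists ((n.+1%:R / c) ^+ n.+1 + 1); split.
  by rewrite addr_ge0// exprn_ge0// divr_ge0// ltW.
have cn0 : c != 0 by rewrite gt_eqF.
have nn0 : n.+1%:R != 0 :> R by [].
have big (s : R) : 0 < s -> s ^+ n.+1 * expR (- (c * s)) <= (n.+1%:R / c) ^+ n.+1.
  move=> s0; rewrite expRN ler_pdivrMr ?expR_gt0//.
  have -> : expR (c * s) = expR (c * s / n.+1%:R) ^+ n.+1.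
    by rewrite -expRM_natl mulrCA mulfV// mulr1.
  rewrite -exprMn ler_pXn2r ?nnegrE ?mulr_ge0 ?expR_ge0 ?invr_ge0 ?(ltW s0) ?(ltW c0)//.
  have := expR_ge1Dx (c * s / n.+1%:R) => h.
  have h2 : c * s / n.+1%:R <= expR (c * s / n.+1%:R) by apply: le_trans h; rewrite lerDr.
  apply: le_trans (_ : n.+1%:R / c * (c * s / n.+1%:R) <= _).
    rewrite le_eqVlt; apply/orP; left; apply/eqP.
    by move: (n.+1%:R : R) nn0 => m m0; field; apply/andP.
  by rewrite ler_pM2l// divr_gt0.
move=> s s0; have [s1|s1] := leP 1 s.
  apply: le_trans (_ : s ^+ n.+1 * expR (- (c * s)) <= _).
    by rewrite ler_wpM2r ?expR_ge0// exprS ler_peMl// exprn_ge0// ltW.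
  by apply: le_trans (big s s0) _; rewrite lerDl.
apply: (@le_trans _ _ 1); last by rewrite lerDr exprn_ge0// divr_ge0// ltW.
rewrite mulr_ile1 ?exprn_ge0 ?expR_ge0 ?(ltW s0)//.
  by apply: exprn_ile1; rewrite ltW.
by rewrite -expR0 ler_expR oppr_le0 mulr_ge0// ltW.
Qed.

Lemma flat_derive k (t : R) :
  is_derive t (1 : R) (flat k) (- k%:R * flat k.+1 t + c * flat k.+2 t).
Proof.
have [t0|t0|->] := ltgtP t 0.
- have E : \forall z \near t, cst 0 z = flat k z.
    have := @lt_nbhsl R t 0 t0; apply: filterS => z z0.
    by rewrite /flat ltNge (ltW z0).
  rewrite /flat ltNge (ltW t0)/= !mulr0 addr0.
  split; first by apply: near_eq_derivable E _; exact: derivable_cst.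
  by rewrite -(near_eq_derive _ E) derive_cst.
- have E : \forall z \near t, z^-1 ^+ k * expR (- (c * z^-1)) = flat k z.
    by have := @lt_nbhsr R 0 t t0; apply: filterS => z z0; rewrite /flat z0.
  have D : is_derive t (1 : R) (fun z => z^-1 ^+ k * expR (- (c * z^-1)))
     (- k%:R * flat k.+1 t + c * flat k.+2 t).
    have dV : is_derive t (1 : R) (fun z : R => z^-1) (- t ^- 2 *: (1 : R)).
      by apply: (@is_deriveV _ id); rewrite gt_eqF.
    have dX := is_deriveX k dV.
    have dL : is_derive t (1 : R) (fun z : R => - (c * z^-1)) (- (c *: (- t ^- 2 *: (1 : R)))).
      exact: is_deriveN (is_deriveZ c dV).
    have dE := @is_derive1_comp _ expR _ t _ _ (is_derive_expR _) dL.
    have dM := is_deriveM dX dE.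
    have E2 : (fun z : R => z^-1 ^+ k * expR (- (c * z^-1))) =
        (fun z : R => z^-1) ^+ k * (expR \o (fun z : R => - (c * z^-1))).
      by apply/funext => z; rewrite exprfctE.
    rewrite E2; apply: (is_derive_eq dM); rewrite /flat t0 /= /GRing.scale/=.
    rewrite exprfctE; move: (expR _) => ex; have tn0 : t != 0 by rewrite gt_eqF.
    have tu : t * t^-1 = 1 by rewrite mulfV.
    case: k {E E2 dX dM} => [|k]; rewrite /= ?exprVn !exprS ?expr0 -?exprVn.
      by rewrite !mulr1 invfM invr1; ring.
    by rewrite !mulr1 exprVn !invfM; move: (1 *+ k.+1 : R) (t ^+ k)^-1 => K P; ring.
  split; first by apply: near_eq_derivable E _; case: D.
  by rewrite -(near_eq_derive _ E) derive_val.
have z0 n : flat n 0 = 0 by rewrite /flat ltxx.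
rewrite !z0 !mulr0 addr0.
(* For h > 0 the difference quotient at 0 is h times (h^-1)^(k + 2) exp(- c / h): the order k + 2
   leaves a factor h that tends to 0. *)
have [K [K0 hK]] := exp_decay k.+2.
have bd (h : R) : `|h^-1 *: ((flat k \o shift 0) (h *: (1 : R)) - flat k 0)| <= K * `|h|.
  rewrite /= z0 subr0 addr0 /GRing.scale/= mulr1 /flat; case: ifPn => [h0|_]; last first.
    by rewrite mulr0 normr0 mulr_ge0.
  have hi : 0 < h^-1 by rewrite invr_gt0.
  rewrite !ger0_norm ?mulr_ge0 ?exprn_ge0 ?expR_ge0 ?invr_ge0 ?(ltW h0)//.
  rewrite mulrA -exprS -ler_pdivrMr// [X in X <= _]mulrC mulrA -exprS.
  exact: hK.
have cv : (fun h : R => h^-1 *: ((flat k \o shift 0) (h *: (1 : R)) - flat k 0)) @ (0 : R)^' --> (0 : R).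
  apply/cvgrPdist_le => e e0; have K1 : 0 < K + 1 by rewrite ltr_wpDl.
  exists (e / (K + 1)); first by rewrite /= divr_gt0.
  move=> h /=; rewrite sub0r normrN => he _; rewrite sub0r normrN.
  apply: le_trans (bd h) _; apply: le_trans (_ : (K + 1) * `|h| <= _).
    by rewrite ler_wpM2r// lerDl.
  by rewrite mulrC -ler_pdivlMr// ltW.
by split; [apply/cvg_ex; exists 0|exact: cvg_lim].
Qed.

Lemma flat0_ge0 t : 0 <= flat 0 t.
Proof. by rewrite /flat; case: ifP => // _; rewrite mulr_ge0 ?expR_ge0. Qed.

Lemma flat0_le1 t : flat 0 t <= 1.
Proof.
rewrite /flat; case: ifP => // t0; rewrite expr0 mul1r -expR0 ler_expR oppr_le0.
by rewrite mulr_ge0 ?invr_ge0 ?(ltW c0) ?(ltW t0).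
Qed.

Lemma flat0_gt0 t : 0 < t -> 0 < flat 0 t.
Proof. by move=> t0; rewrite /flat t0 mul1r expR_gt0. Qed.

Lemma flat0_eq0 t : t <= 0 -> flat 0 t = 0.
Proof. by rewrite leNgt /flat => /negbTE ->. Qed.

End flat_exponential.

(** * Smooth bumps on boxes *)

Section bumps.
Context {R : realType} {d : nat}.
Implicit Types (x : 'rV[R]_d) (al be : 'I_d -> R).

Lemma derive_affine (s b : R) (i : 'I_d) x v :
  'D_v (fun y : 'rV[R]_d => s * y ord0 i + b) x = s * v ord0 i.
Proof.
apply: cvg_lim => //; apply: cvg_near_cst; exists 1 => //= h _ h0 /=.
rewrite !mxE /GRing.scale/=.
by rewrite (_ : _ - _ = h * (s * v ord0 i)); [rewrite mulKf|ring].
Qed.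

Lemma differentiable_affine (s b : R) (i : 'I_d) x :
  differentiable (fun y : 'rV[R]_d => s * y ord0 i + b) x.
Proof.
apply: differentiableD => //.
apply: (@differentiableZ _ _ _ (fun y : 'rV[R]_d => y ord0 i)); exact: differentiable_coord.
Qed.

Lemma dd_comp_affine (g : R -> R) (s b : R) (i j : 'I_d) :
  (forall t, derivable g t 1) ->
  dd j (fun y => g (s * y ord0 i + b)) =
  (fun x => (s * (delta_mx ord0 j : 'rV[R]_d) ord0 i) * derive1 g (s * x ord0 i + b)).
Proof.
move=> dg; apply/funext => x; rewrite /dd.
have df := differentiable_affine s b i x.
have dgx : differentiable g (s * x ord0 i + b) by apply/derivable1_diffP.
have -> : (fun y : 'rV[R]_d => g (s * y ord0 i + b)) = g \o (fun y => s * y ord0 i + b) by [].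
rewrite deriveE; last exact: differentiable_comp.
rewrite diff_comp//.
pose A := fun y : 'rV[R]_d => s * y ord0 i + b.
have HA : 'd A x (delta_mx ord0 j) = s * (delta_mx ord0 j : 'rV[R]_d) ord0 i.
  by rewrite -deriveE//; exact: derive_affine.
transitivity ('d g (s * x ord0 i + b) ('d A x (delta_mx ord0 j))) => //.
by rewrite HA diff1E.
Qed.

(** The induction on the order runs for all k at once, since the derivative of [flat c k] involves
    [flat c k.+1] and [flat c k.+2]. *)
Lemma rsm_flat (c s b : R) (i : 'I_d) : 0 < c ->
  rsm (fun x => flat c 0 (s * x ord0 i + b)).
Proof.
move=> c0 n; suff H k : rsmn n (fun x => flat c k (s * x ord0 i + b)) by exact: H.
elim: n k => [|n IH] k.
all: have df x : differentiable (fun x : 'rV[R]_d => flat c k (s * x ord0 i + b)) x.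
all: try (apply: (@differentiable_comp _ _ _ _ (fun y : 'rV[R]_d => s * y ord0 i + b) (flat c k));
  [exact: differentiable_affine|by apply/derivable1_diffP; case: (flat_derive c0 k (s * x ord0 i + b))]).
  by split.
apply/rsmnS; split => // j.
rewrite dd_comp_affine; last by move=> t; case: (flat_derive c0 k t).
have -> : derive1 (flat c k) = (fun t => - k%:R * flat c k.+1 t + c * flat c k.+2 t).
  by apply/funext => t; rewrite derive1E; case: (flat_derive c0 k t).
by apply: rsmnZ; apply: rsmnD; apply: rsmnZ.
Qed.

Definition obox al be : set 'rV[R]_d := [set x | forall i, al i < x ord0 i < be i].
Definition cbox al be : set 'rV[R]_d := [set x | forall i, al i <= x ord0 i <= be i].

(* As [c] tends to 0, [bump c al be] tends pointwise to the indicator of the open box. *)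
Definition bump (c : R) al be x : R :=
  \prod_(i < d) (flat c 0 (1 * x ord0 i + - al i) * flat c 0 (-1 * x ord0 i + be i)).

Lemma rsm_bump c al be : 0 < c -> rsm (bump c al be).
Proof. by move=> c0; apply: rsm_prod => i; apply: rsmM; exact: rsm_flat. Qed.

Lemma bump_ge0 c al be x : 0 <= bump c al be x.
Proof. by apply: prodr_ge0 => i _; rewrite mulr_ge0 ?flat0_ge0. Qed.

Lemma bump_le1 c al be x : 0 < c -> bump c al be x <= 1.
Proof.
move=> c0; have -> : (1 : R) = \prod_(i < d) 1 by rewrite big1.
by apply: ler_prod => i _; rewrite mulr_ge0 ?flat0_ge0// mulr_ile1 ?flat0_ge0 ?flat0_le1.
Qed.

Lemma bump_off c al be x : ~ obox al be x -> bump c al be x = 0.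
Proof.
move=> /existsNP[i /negP]; rewrite negb_and -!leNgt => h.
rewrite /bump (bigD1 i)//=; case/orP: h => h.
  by rewrite flat0_eq0 ?mul0r//; lra.
by rewrite [X in _ * X * _]flat0_eq0 ?mulr0 ?mul0r//; lra.
Qed.

Lemma bump_gt0 c al be x : obox al be x -> 0 < bump c al be x.
Proof.
move=> h; apply: prodr_gt0 => i _; have /andP[h1 h2] := h i.
by rewrite mulr_gt0 ?flat0_gt0//; lra.
Qed.

Lemma bump_cvg al be x :
  bump n.+1%:R^-1 al be x @[n --> \oo] --> ((\1_(obox al be) x : R)).
Proof.
rewrite indicE; have [xB|xB] := pselect (obox al be x); last first.
  rewrite memNset//; under eq_fun do rewrite bump_off//; exact: cvg_cst.
rewrite mem_set//.
have cvf (t : R) : 0 < t -> flat n.+1%:R^-1 0 t @[n --> \oo] --> (1 : R).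
  move=> t0; rewrite /flat t0; under eq_fun do rewrite expr0 mul1r -mulNr.
  suff : expR (- n.+1%:R^-1 / t) @[n --> \oo] --> expR (0 : R) by rewrite expR0.
  apply: continuous_cvg; first exact: continuous_expR.
  rewrite -[X in _ --> X](mul0r t^-1); apply: cvgMr_tmp.
  by rewrite -oppr0; apply: cvgN; exact: cvg_harmonic.
rewrite [X in _ --> X](_ : _ = \prod_(i < d) (1 * 1 : R)); last by rewrite big1// => *; rewrite mulr1.
apply: cvg_big => [|i _]; first exact: mul_continuous.
by have /andP[h1 h2] := xB i; apply: cvgM; apply: cvf; lra.
Qed.

Lemma cbox_compact al be : compact (cbox al be).
Proof.
have -> : cbox al be = [set x | forall i, `[al i, be i]%classic (x ord0 i)].
  by apply/seteqP; split=> x h i; have := h i; rewrite /= in_itv.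
by apply: (@rV_compact _ _ (fun i => `[al i, be i]%classic)) => i; exact: segment_compact.
Qed.

Lemma cbox_closed al be : closed (cbox al be).
Proof. by apply: compact_closed; [exact: norm_hausdorff|exact: cbox_compact]. Qed.

Lemma bump_support c al be : closure [set x | bump c al be x != 0] `<=` cbox al be.
Proof.
have E : cbox al be = closure (cbox al be) := (closure_id (cbox al be)).1 (@cbox_closed al be).
rewrite E; apply: closure_subset => x /= /eqP bx i.
have [h|/bump_off//] := pselect (obox al be x).
by have /andP[/ltW -> /ltW ->] := h i.
Qed.

Variable O : domain R d.

(** By [test_functionP], a complex test function is a pair of these. *)
Definition rtest (h : 'rV[R]_d -> R) : Prop :=
  [/\ rsm h, compact (closure [set x | h x != 0]) & closure [set x | h x != 0] `<=` O].

Lemma rtest_bump c al be : 0 < c -> cbox al be `<=` O -> rtest (bump c al be).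
Proof.
move=> c0 BO; split; first exact: rsm_bump.
- have := @subclosed_compact _ _ _ (@closed_closure _ [set x | bump c al be x != 0]) (@cbox_compact al be).
  by apply; exact: bump_support.
- by apply: subset_trans BO; exact: bump_support.
Qed.

End bumps.

(** * The du Bois-Reymond lemma *)

Section boxes.
Context {R : realType} {d : nat}.
Implicit Types (x : 'rV[R]_d) (al be : 'I_d -> R).

Definition oboxes : set (set 'rV[R]_d) := [set A | exists al be, A = obox al be].

Lemma obox_measurable al be : measurable (obox al be).
Proof.
have -> : obox al be = \big[setI/setT]_(i < d) (coor i @^-1` `]al i, be i[%classic).
  rewrite -bigcap_seq; apply/seteqP; split=> [x xA i _|x xA i].
    by rewrite /coor/= in_itv; exact: xA.
  by have := xA i (mem_index_enum _); rewrite /coor/= in_itv.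
apply: bigsetI_measurable => i _; rewrite -[X in measurable X]setTI.
by apply: measurable_coor => //; exact: measurable_itv.
Qed.

Lemma oboxes_setI : setI_closed oboxes.
Proof.
move=> _ _ [a [b ->]] [a' [b' ->]].
exists (fun i => Num.max (a i) (a' i)), (fun i => Num.min (b i) (b' i)).
apply/seteqP; split=> x.
  move=> [h h'] i; have /andP[h1 h2] := h i; have /andP[h3 h4] := h' i.
  by rewrite gt_max lt_min h1 h2 h3 h4.
move=> h; split=> i; have := h i; rewrite gt_max lt_min.
  by case/andP=> /andP[-> _] /andP[-> _].
by case/andP=> /andP[_ ->] /andP[_ ->].
Qed.

Lemma rV_coor_bound x : exists k : nat, forall j, `|x ord0 j| < k%:R.
Proof.
exists (Num.truncn `|x|).+1 => j.
apply: le_lt_trans (Num.Theory.truncnS_gt _).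
by rewrite [leRHS]mx_normrE; apply/bigmax_geP; right; exists (ord0, j).
Qed.

(** A half-space is the union over k of open boxes bounded by k in the other directions, so the
    coordinates are measurable for the sigma-algebra of boxes. Boxes being stable under
    intersection, Dynkin's argument applies to them. *)
Lemma measurable_rV_oboxes : @measurable _ 'rV[R]_d = <<s oboxes >>.
Proof.
apply/seteqP; split => [A mA|]; last first.
  apply: smallest_sub; first exact: sigma_algebra_measurable.
  by move=> _ [a [b ->]]; exact: obox_measurable.
pose T := g_sigma_algebraType oboxes.
suff H : measurable_fun [set: T] (id : T -> 'rV[R]_d).
  by have := H measurableT A mA; rewrite setTI preimage_id.
apply: measurable_fun_rV => i.
apply: (@measurability _ _ _ _ _ _ (@RGenOInfty.G R)).
  exact: RGenOInfty.measurableE.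
move=> _ [_ [a ->] <-]; rewrite setTI.
have -> : (coor i \o id) @^-1` `]a, +oo[%classic = \bigcup_(k in [set: nat])
   obox (fun j => if j == i then a else - k%:R) (fun j => k%:R) :> set T.
  apply/seteqP; split=> x /=.
    rewrite /coor/= in_itv andbT => xa; have [k hk] := rV_coor_bound x.
    exists k => // j; have := hk j; rewrite ltr_norml => /andP[h1 h2].
    by rewrite h2 andbT; case: eqP => // ->.
  by move=> [k _ h]; have := h i; rewrite eqxx /coor/= in_itv andbT => /andP[].
apply: bigcupT_measurable => k; apply: sub_sigma_algebra.
by eexists _, _.
Qed.

End boxes.

Section dubois_reymond.
Context {R : realType} {d : nat} (O : domain R d).
Implicit Types (x : 'rV[R]_d) (al be : 'I_d -> R).
Local Notation mu := (leb_on O).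

(** Boxes with rational centre and radius 1 / (k + 1) are countably many, so that null sets attached
    to them have a null union. *)
Lemma box_in_open x : dom_set O x -> exists p : 'rV[rat]_d * nat,
  obox (fun i => ratr (p.1 ord0 i) - p.2.+1%:R^-1) (fun i => ratr (p.1 ord0 i) + p.2.+1%:R^-1) x /\
  cbox (fun i => ratr (p.1 ord0 i) - p.2.+1%:R^-1) (fun i => ratr (p.1 ord0 i) + p.2.+1%:R^-1) `<=` O.
Proof.
move=> Ox.
have /nbhs_ballP[e/= e0 eA] : nbhs x (dom_set O) by apply: open_nbhs_nbhs; split => //; exact: dom_open.
have [k ke] : exists k : nat, k.+1%:R^-1 < e / 2.
  have e2 : 0 < e / 2 by rewrite divr_gt0.
  exists (Num.truncn (e / 2)^-1).
  by rewrite invf_plt ?posrE// Num.Theory.truncnS_gt.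
have k0 : 0 < k.+1%:R^-1 :> R by rewrite invr_gt0.
move: k0 ke; set r := (k.+1%:R^-1 : R) => k0 ke.
have q_ i : {q : rat | `|x ord0 i - (ratr q : R)| < r}.
  apply: cid.
  have [q] := rat_in_itvoo (ltr_pwDr k0 (lexx (x ord0 i))).
  rewrite in_itv/= => /andP[q1 q2]; exists q.
  by rewrite ltr_norml; apply/andP; split; lra.
exists ((\row_i sval (q_ i)), k); rewrite -/r; split=> [i|y yC].
  rewrite mxE; have := svalP (q_ i); move: (ratr _ : R) => z.
  by rewrite ltr_norml => /andP[? ?]; apply/andP; split; lra.
apply: eA; split => // i j; rewrite ord1; have := yC j; rewrite mxE.
have := svalP (q_ j); move: (ratr _ : R) => z; rewrite /ball/=.
by rewrite !ltr_norml => /andP[? ?] /andP[? ?]; apply/andP; split; lra.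
Qed.

Variable u : 'rV[R]_d -> R.
Hypothesis iu : mu.-integrable setT (EFin \o u).
Hypothesis u0 : forall h, rtest O h -> (\int[mu]_x (u x * h x) = 0)%R.

Let mu_u : measurable_fun [set: 'rV[R]_d] u.
Proof. by have /integrableP[/measurable_EFinP] := iu. Qed.

Lemma rsm_measurable (h : 'rV[R]_d -> R) : rsm h -> measurable_fun setT h.
Proof. by move=> sh; apply: continuous_measurable_rV; exact: rsm_continuous. Qed.

(** The bumps with parameter 1 / (n + 1) are test functions bounded by 1 that converge to the
    indicator of the box; dominated convergence applies with majorant |u|. *)
Lemma integral_obox0 al be : cbox al be `<=` O -> (\int[mu]_(x in obox al be) (u x)%:E = 0)%E.
Proof.
move=> BO; rewrite integral_mkcond.
have mb n : measurable_fun setT (bump n.+1%:R^-1 al be).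
  by apply: rsm_measurable; apply: rsm_bump; rewrite invr_gt0.
have H1 n : measurable_fun setT (fun x => (u x * bump n.+1%:R^-1 al be x)%:E).
  by apply/measurable_EFinP; exact: measurable_funM.
have H2 : measurable_fun setT ((EFin \o u) \_ (obox al be)).
  apply/(measurable_restrictT _ (obox_measurable al be)).
  by apply/measurable_EFinP; exact: measurable_funTS.
have H3 : {ae mu, forall x, setT x ->
    (u x * bump n.+1%:R^-1 al be x)%:E @[n --> \oo] --> ((EFin \o u) \_ (obox al be)) x}.
  apply: aeW => x _.
  have -> : ((EFin \o u) \_ (obox al be)) x = (u x * \1_(obox al be) x)%:E.
    by rewrite patchE indicE; case: ifP => _; rewrite ?mulr1 ?mulr0.
  by apply: cvg_EFin; [exact: nearW|apply: cvgMl_tmp; exact: bump_cvg].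
have H4 : {ae mu, forall x (n : nat), setT x ->
    (`|(u x * bump n.+1%:R^-1 al be x)%:E| <= `|(u x)%:E|)%E}.
  apply: aeW => x n _; rewrite !abse_EFin lee_fin normrM ler_piMr//.
  by rewrite ger0_norm ?bump_ge0// bump_le1// invr_gt0.
have [_ _] := dominated_convergence measurableT H1 H2 H3 (integrable_abse iu) H4.
have -> : (fun n => \int[mu]_x (u x * bump n.+1%:R^-1 al be x)%:E)%E = cst 0%E.
  apply/funext => n.
  have n0 : 0 < n.+1%:R^-1 :> R by rewrite invr_gt0.
  have := u0 (rtest_bump n0 BO).
  have ib : mu.-integrable setT (fun x => (u x * bump n.+1%:R^-1 al be x)%:E).
    apply: le_integrable (integrable_abse iu) => //.
    move=> x _; rewrite /= lee_fin normrM normr_id ler_piMr//.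
    by rewrite ger0_norm ?bump_ge0// bump_le1.
  by rewrite /Rintegral => h; rewrite -[LHS]fineK ?integrable_fin_num// h.
move=> H; apply: (cvg_unique _ H); [exact: ereal_hausdorff|exact: cvg_cst].
Qed.

(** The sets A with this property contain the boxes, whose intersection with the given box is a box
    of the same kind, and they are stable under complements and countable disjoint unions. *)
Lemma integral_sub_obox0 al be A : cbox al be `<=` O -> measurable A ->
  (\int[mu]_(x in A `&` obox al be) (u x)%:E = 0)%E.
Proof.
move=> BO mA; have mB := obox_measurable al be.
have i_ S : measurable S -> mu.-integrable S (EFin \o u).
  by move=> mS; exact: (integrableS measurableT).
move: mA; rewrite measurable_rV_oboxes; apply: (@dynkin_induction _ _ oboxes (fun S => (\int[mu]_(x in S `&` obox al be) (u x)%:E = 0)%E)).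
- exact: measurable_rV_oboxes.
- exact: oboxes_setI.
- by rewrite setTI; exact: integral_obox0.
- move=> _ [a [b ->]].
  have [a' [b' E]] : oboxes (obox a b `&` obox al be).
    by apply: oboxes_setI; eexists _, _.
  rewrite E.
  have E2 : obox a' b' = obox (fun i => Num.max (a' i) (al i)) (fun i => Num.min (b' i) (be i)).
    apply/seteqP; split=> x.
      move=> h i; have /andP[h1 h2] := h i.
      have : obox al be x by have : obox a' b' x by []; rewrite -E => -[].
      move=> /(_ i) /andP[h3 h4].
      by rewrite gt_max lt_min h1 h2 h3 h4.
    by move=> h i; have := h i; rewrite gt_max lt_min => /andP[/andP[-> _] /andP[-> _]].
  rewrite E2; apply: integral_obox0; apply: subset_trans BO => x h i; have := h i.
  by rewrite ge_max le_min => /andP[/andP[_ ->] /andP[_ ->]].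
- move=> S mS S0.
  have := integral_obox0 BO.
  have -> : obox al be = (S `&` obox al be) `|` (~` S `&` obox al be).
    by rewrite -setIUl setUv setTI.
  rewrite integral_setU.
  + by rewrite -setIUl setUv setTI S0 add0e.
  + exact: measurableI.
  + by apply: measurableI => //; exact: measurableC.
  + by apply/measurable_EFinP; exact: measurable_funTS.
  + rewrite disj_set2E; apply/eqP; rewrite setIACA setICr set0I//.
- move=> F mF tF F0; rewrite setI_bigcupl integral_bigcup.
  + by apply: eseries0 => k _ _; exact: F0.
  + exact: trivIset_setIr.
  + by move=> k; exact: measurableI.
  + by apply: i_; apply: bigcupT_measurable => k; exact: measurableI.
Qed.

Lemma leb_on_setC : mu.-negligible (~` O).
Proof.
exists (~` O); split => //; first by apply: measurableC; apply: open_measurable_rV; exact: dom_open.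
by rewrite /leb_on /= /mrestr setICl measure0.
Qed.

Lemma du_bois_reymond : {ae mu, forall x, u x = 0}.
Proof.
pose al (p : 'rV[rat]_d * nat) (i : 'I_d) : R := ratr (p.1 ord0 i) - p.2.+1%:R^-1.
pose be (p : 'rV[rat]_d * nat) (i : 'I_d) : R := ratr (p.1 ord0 i) + p.2.+1%:R^-1.
(* The exceptional sets are indexed by the codes of rational boxes; a code of no box inside O gives
   the empty set. *)
pose F (k : nat) : set 'rV[R]_d := [set x | exists p, [/\ pickle p = k,
   cbox (al p) (be p) `<=` O, obox (al p) (be p) x & u x != 0]].
have nF k : mu.-negligible (F k).
  case: (pselect (exists p, pickle p = k /\ cbox (al p) (be p) `<=` O)); last first.
    move=> H; rewrite (_ : F k = set0); first exact: negligible_set0.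
    by apply/seteqP; split=> x // [p [pk pO _ _]]; apply: H; exists p.
  move=> [p [pk pO]].
  have mB := obox_measurable (al p) (be p).
  have H : ae_eq mu (obox (al p) (be p)) (EFin \o u) (cst 0%E).
    apply: integral_ae_eq => //; first exact: (integrableS measurableT).
    move=> E EB mE; rewrite integral0 -(integral_sub_obox0 pO mE).
    by rewrite setIidl.
  apply: negligibleS H => x [q [qk _ xq ux]] /= H.
  have E : q = p by apply: (pcan_inj pickleK); rewrite qk pk.
  have := H; rewrite -E => /(_ xq) [ux0].
  by rewrite ux0 eqxx in ux.
apply: negligibleS (negligibleU leb_on_setC (negligible_bigcup nF)) => x /= ux.
have [Ox|] := pselect (dom_set O x); last by left.
right; have [p [px pO]] := box_in_open Ox.
by exists (pickle p) => //; exists p; split => //; apply/eqP.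
Qed.

End dubois_reymond.

(** * Completeness of L^2 *)

Section square_integrable.
Context {d : measure_display} {T : measurableType d} {R : realType} (mu : {measure set T -> \bar R}).
Implicit Types (f g u v : T -> R).

Definition r2 f := measurable_fun setT f /\ mu.-integrable setT (EFin \o (fun x => f x ^+ 2)).

Lemma Lfun2P f : (f \in Lfun mu 2%:E) <-> r2 f.
Proof.
split=> [fL|[mf If]].
  by split; [exact: set_mem (sub_Lfun_mfun fL)|exact: Lfun2_integrable_sqr].
rewrite inE; apply/andP; split; first by rewrite inE.
rewrite inE /= /finite_norm unlock /Lnorm.
apply: poweR_lty.
have := (integrableP _ _ _ If).2; apply: le_lt_trans; apply: ge0_le_integral => //.
- by move=> x _; exact: poweR_ge0.
- apply/measurable_EFinP; apply: (@measurableT_comp _ _ _ _ _ _ (fun x : R => x `^ 2)%R) => //.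
  exact/measurableT_comp.
- by apply: measurableT_comp => //; apply/measurable_EFinP; exact: measurable_funX.
- by move=> x _; rewrite /= lee_fin normrX powR_mulrn.
Qed.

Lemma r2_mul f g : r2 f -> r2 g -> mu.-integrable setT (EFin \o (fun x => f x * g x)).
Proof.
move=> [mf If] [mg Ig]; apply: le_integrable (integrableD measurableT If Ig) => //.
  by apply/measurable_EFinP; exact: measurable_funM.
move=> x _ /=; rewrite lee_fin normrM [leRHS]ger0_norm ?addr_ge0 ?sqr_ge0//.
by rewrite -[f x ^+ 2]real_normK ?num_real// -[g x ^+ 2]real_normK ?num_real//; nra.
Qed.

Lemma r2Z c f : r2 f -> r2 (fun x => c * f x).
Proof.
move=> [mf If]; split; first exact: measurable_funM.
rewrite (_ : _ \o _ = (fun x => (c ^+ 2)%:E * (EFin \o (fun x => f x ^+ 2)%R) x)%E).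
  exact: integrableZl.
by apply/funext => x /=; rewrite exprMn EFinM.
Qed.

Lemma r2D f g : r2 f -> r2 g -> r2 (fun x => f x + g x).
Proof.
move=> [mf If] [mg Ig]; split; first exact: measurable_funD.
have := integrableZl measurableT 2 (integrableD measurableT If Ig).
apply: le_integrable => //.
  by apply/measurable_EFinP; apply: measurable_funX; exact: measurable_funD.
move=> x _ /=; rewrite lee_fin [leLHS]ger0_norm ?sqr_ge0// [leRHS]ger0_norm ?mulr_ge0 ?addr_ge0 ?sqr_ge0//.
by have := sqr_ge0 (f x - g x); nra.
Qed.

Lemma r2N f : r2 f -> r2 (fun x => - f x).
Proof. by move=> /(r2Z (-1)); under eq_fun do rewrite mulN1r. Qed.

Lemma r2B f g : r2 f -> r2 g -> r2 (fun x => f x - g x).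
Proof. by move=> rf /r2N rg; exact: r2D. Qed.

Lemma r2_0 : r2 (cst 0).
Proof. by split => //; rewrite (_ : _ \o _ = cst 0%E); [exact: integrable0|apply/funext => x /=; rewrite expr0n]. Qed.

Lemma r2_sqr f : r2 f -> mu.-integrable setT (EFin \o (fun x => f x ^+ 2)).
Proof. by case. Qed.

Lemma r2_bounded_mul (c f : T -> R) : measurable_fun setT c -> r2 f ->
  (exists M : R, {ae mu, forall x, `|c x| <= M}) -> r2 (fun x => c x * f x).
Proof.
move=> mc [mf If] [M cM]; have mcf := measurable_funM mc mf; split=> //.
apply/integrableP; split; first by apply/measurable_EFinP; exact: measurable_funX.
have := (integrableP _ _ _ (integrableZl measurableT (M ^+ 2) If)).2.
apply: le_lt_trans; apply: ae_ge0_le_integral => //.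
- by apply: measurableT_comp => //; apply/measurable_EFinP; exact: measurable_funX.
- apply: measurableT_comp => //; apply/measurable_EFinP; apply: measurable_funM => //.
  exact: measurable_funX.
- apply: filterS cM => x cx _ /=; rewrite lee_fin [leLHS]ger0_norm ?sqr_ge0// [leRHS]ger0_norm; last by rewrite mulr_ge0 ?sqr_ge0.
  rewrite exprMn ler_wpM2r ?sqr_ge0// -[c x ^+ 2]real_normK ?num_real//.
  by rewrite ler_pXn2r ?nnegrE// (le_trans _ cx).
Qed.

Lemma Rintegral_ae_eq f g : measurable_fun setT f -> measurable_fun setT g ->
  {ae mu, forall x, f x = g x} -> \int[mu]_x f x = \int[mu]_x g x.
Proof.
move=> mf mg fg; congr fine; apply: ae_eq_integral => //; try exact/measurable_EFinP.
by apply: filterS fg => x fx _; congr EFin.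
Qed.

Lemma Rintegral_sqr_eq0 f : r2 f -> \int[mu]_x (f x ^+ 2) = 0 -> {ae mu, forall x, f x = 0}.
Proof.
move=> [mf If] f0.
have E : (\int[mu]_x `|(f x ^+ 2)%:E| = 0)%E.
  rewrite (eq_integral (fun x => (f x ^+ 2)%:E)); last first.
    by move=> x _ /=; rewrite ger0_norm ?sqr_ge0.
  by rewrite -[LHS]fineK ?integrable_fin_num// [fine _]f0.
have mf2 : measurable_fun setT (EFin \o (fun x => f x ^+ 2)).
  by apply/measurable_EFinP; exact: measurable_funX.
have := (ae_eq_integral_abs mu measurableT mf2).1 E.
by apply: filterS => x /(_ I) [] /eqP; rewrite sqrf_eq0 => /eqP.
Qed.

Hypothesis fmu : mu setT \is a fin_num.

Lemma r2_cst c : r2 (cst c).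
Proof.
split => //; apply/integrableP; split; first exact: (@measurable_cst _ _ _ _ _ (c ^+ 2)%:E).
rewrite (eq_integral (cst `|c ^+ 2|%:E)) ?integral_cst//.
by rewrite lte_mul_pinfty// ltey_eq fmu.
Qed.

Lemma r2_integrable f : r2 f -> mu.-integrable setT (EFin \o f).
Proof.
by move=> rf; have := r2_mul rf (r2_cst 1); congr integrable; apply/funext => x /=; rewrite mulr1.
Qed.

End square_integrable.

(** * The Riesz-Fischer theorem *)

Section riesz_fischer.
Context {d : measure_display} {T : measurableType d} {R : realType} (mu : {measure set T -> \bar R}).
Hypothesis fmu : mu setT \is a fin_num.
Local Notation r2 := (r2 mu).

(* The differences of a fast subsequence have summable L1 norms, hence sum to a finite function. *)
Lemma fast_cauchy_ae_cvg (v : nat -> T -> R) : (forall n, r2 (v n)) ->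
  (forall k, \int[mu]_x ((v k.+1 x - v k x) ^+ 2) <= (4 ^+ k)^-1) ->
  {ae mu, forall x, cvgn (v^~ x)}.
Proof.
move=> rv hv.
pose g k x := `|v k.+1 x - v k x|.
have rd k : r2 (fun x => v k.+1 x - v k x) by exact: r2B.
have mg k : measurable_fun setT (EFin \o g k).
  by apply/measurable_EFinP; apply: measurableT_comp => //; case: (rd k).
pose M := fine (mu setT).
have M0 : 0 <= M by rewrite fine_ge0.
have gk k : (\int[mu]_x (g k x)%:E <= ((1 + M) * 2^-1 ^+ k)%:E)%E.
  have p2 : 0 < 2 ^+ k :> R by rewrite exprn_gt0.
  have r1 := r2_cst fmu (1 : R).
  have I1 := integrableZl measurableT (2 ^+ k) (r2_sqr (rd k)).
  have I2 : mu.-integrable setT (EFin \o (fun x : T => 2^-1 ^+ k : R)).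
    exact: r2_integrable (r2_cst fmu _).
  (* Pointwise |z| <= 2^k z^2 + 2^-k, and the integral of the right-hand side is at most 2^k 4^-k +
     2^-k M. *)
  apply: le_trans (_ : (\int[mu]_x ((2 ^+ k * (v k.+1 x - v k x) ^+ 2) + 2^-1 ^+ k)%:E)%E <= _)%E.
    apply: ge0_le_integral => //.
    - by move=> x _; rewrite lee_fin normr_ge0.
    - exact: mg.
    - by have [] := (integrableP _ _ _ (integrableD measurableT I1 I2)).
    - move=> x _; rewrite lee_fin /g; set z := v k.+1 x - v k x.
      rewrite -[z ^+ 2]real_normK ?num_real// exprVn.
      move: (2 ^+ k : R) p2 `|z| (normr_ge0 z) => p p0 y y0.
      have : 0 <= (p * y - 2^-1) ^+ 2 by exact: sqr_ge0.
      have E : p * y ^+ 2 + p^-1 = y + p^-1 * ((p * y - 2^-1) ^+ 2 + 3 / 4).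
        by field; rewrite gt_eqF.
      move=> h; rewrite E lerDl mulr_ge0 ?invr_ge0 ?(ltW p0)// addr_ge0//.
  rewrite (_ : (\int[mu]_x _ = (2 ^+ k * \int[mu]_x ((v k.+1 x - v k x) ^+ 2) + 2^-1 ^+ k * M)%:E)%E).
    rewrite lee_fin mulrDl mul1r [M * _]mulrC lerD2r.
    apply: le_trans (_ : 2 ^+ k * (4 ^+ k)^-1 <= _); first by rewrite ler_pM2l.
    rewrite (_ : 4 = 2 * 2 :> R) ?exprMn ?exprVn ?invfM ?mulfVK//; last by rewrite -natrM.
    by rewrite mulrA mulfV ?mul1r ?gt_eqF.
  rewrite -RintegralZl//; last exact: r2_sqr.
  rewrite -(Rintegral_cst mu measurableT) -RintegralD//.
  by rewrite fineK// integrable_fin_num//; exact: (integrableD measurableT I1 I2).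
have gi : mu.-integrable setT (fun x => \sum_(0 <= k <oo) (g k x)%:E)%E.
  apply/integrableP; split.
    have := @ge0_emeasurable_sum _ _ _ setT (fun k x => (g k x)%:E) xpredT; apply => //.
      by move=> k x _ _; rewrite lee_fin normr_ge0.
    by move=> k _; exact: mg.
  rewrite (eq_integral (fun x => \sum_(0 <= k <oo) (g k x)%:E)%E); last first.
    by move=> x _; rewrite gee0_abs// nneseries_ge0// => k _ _; rewrite lee_fin normr_ge0.
  rewrite integral_nneseries//; last by move=> k x _; rewrite lee_fin normr_ge0.
  apply: le_lt_trans (_ : (\sum_(0 <= k <oo) ((1 + M) * 2^-1 ^+ k)%:E < +oo)%E).
    by apply: lee_nneseries => [k _ _|k _]; [apply: integral_ge0 => x _; rewrite lee_fin normr_ge0|exact: gk].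
  have cv := @cvg_geometric_series R (1 + M) 2^-1 _.
  have -> : (\sum_(0 <= k <oo) ((1 + M) * 2^-1 ^+ k)%:E = ((1 + M) * (1 - 2^-1)^-1)%:E)%E.
    apply: cvg_lim => //.
    rewrite (_ : (fun n => _) = EFin \o series (geometric (1 + M) 2^-1)); last first.
      by apply/funext => n; rewrite /series/= sumEFin.
    apply: cvg_EFin; first exact: nearW.
    by apply: cv; rewrite ger0_norm ?invr_ge0// invf_lt1// ltr1n.
  by rewrite ltry.
have := integrable_ae measurableT gi; apply: filterS => x /(_ I) gx.
have cs : cvgn [normed series (telescope (v^~ x))].
  apply: nondecreasing_is_cvgn.
    by apply: nondecreasing_series => k _ _; exact: normr_ge0.
  exists (fine (\sum_(0 <= k <oo) (g k x)%:E)%E) => _ [n _ <-].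
  rewrite -lee_fin fineK// /series /= -sumEFin.
  by apply: nneseries_lim_ge => k _ _; rewrite lee_fin normr_ge0.
have := normed_cvg cs; rewrite telescopeK => c1.
have -> : v^~ x = [sequence v n x - v 0%N x]_n + cst (v 0%N x).
  by apply/funext => n; rewrite addrfctE /= subrK.
by apply: is_cvgD => //; exact: is_cvg_cst.
Qed.

(** A subsequence with squared differences at most 4^-k converges almost everywhere by
    [fast_cauchy_ae_cvg]. Fatou's lemma along it carries the Cauchy bounds over to the limit, which
    gives both the square integrability of f and the convergence of the whole sequence. *)
Lemma riesz_fischer (u : nat -> T -> R) : (forall n, r2 (u n)) ->
  (forall e, 0 < e -> exists N : nat, forall m n, (N <= m)%N -> (N <= n)%N ->
     \int[mu]_x ((u m x - u n x) ^+ 2) <= e) ->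
  exists2 f, r2 f & forall e, 0 < e -> exists N : nat, forall n, (N <= n)%N ->
     \int[mu]_x ((u n x - f x) ^+ 2) <= e.
Proof.
move=> ru cu.
have [N0 hN0] := boolp.choice (fun k : nat => cu (4 ^+ k)^-1 (ltac:(by rewrite invr_gt0 exprn_gt0))).
(* Summing the thresholds makes N nondecreasing, and the shift by k in [v] sends the indices to
   infinity. *)
pose N k := (\sum_(j < k.+1) N0 j)%N.
have NS k : (N k <= N k.+1)%N by rewrite /N [leqRHS]big_ord_recr leq_addr.
have N0N k : (N0 k <= N k)%N by rewrite /N big_ord_recr leq_addl.
have Nk k : (k <= N k + k)%N by rewrite leq_addl.
pose v k := u (N k + k)%N.
have rv k : r2 (v k) by exact: ru.
have cv : {ae mu, forall x, cvgn (v^~ x)}.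
  apply: fast_cauchy_ae_cvg => // k; apply: hN0.
    by apply: leq_trans (N0N k) _; apply: leq_trans (NS k) _; exact: leq_addr.
  by apply: leq_trans (N0N k) _; exact: leq_addr.
(* The upper limit is measurable on the whole space and coincides with the limit where that
   exists. *)
pose f x := fine (limn_esup (fun k => (v k x)%:E)).
have mf : measurable_fun setT f.
  apply: measurableT_comp; first exact: fine_measurable.
  by apply: measurable_fun_limn_esup => k; apply/measurable_EFinP; case: (rv k).
have fl : {ae mu, forall x, v^~ x @ \oo --> f x}.
  apply: filterS cv => x cx.
  have cE : (fun k => (v k x)%:E) @ \oo --> (limn (v^~ x))%:E by apply: cvg_EFin; [exact: nearW|].
  by rewrite /f (cvg_limn_einf_sup cE).2.
have key n e : (exists K, forall k, (K <= k)%N -> \int[mu]_x ((u n x - v k x) ^+ 2) <= e) ->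
    (\int[mu]_x ((u n x - f x) ^+ 2)%:E <= e%:E)%E.
  move=> [K hK].
  pose F k x := ((u n x - v (k + K)%N x) ^+ 2)%:E.
  have rF k : r2 (fun x => u n x - v (k + K)%N x) by exact: r2B.
  have mF k : measurable_fun setT (F k).
    by apply/measurable_EFinP; apply: measurable_funX; case: (rF k).
  have F0 k x : setT x -> (0 <= F k x)%E by move=> _; rewrite lee_fin sqr_ge0.
  have muf : measurable_fun setT (fun x => ((u n x - f x) ^+ 2)%:E).
    by apply/measurable_EFinP; apply: measurable_funX; apply: measurable_funB => //; case: (ru n).
  have E : (\int[mu]_x ((u n x - f x) ^+ 2)%:E = \int[mu]_x limn_einf (F^~ x))%E.
    apply: ae_eq_integral => //.
      rewrite (_ : (fun x => limn_einf (F^~ x)) = (fun x => - limn_esup (fun k => - F k x))%E); last first.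
        by apply/funext => x; rewrite -limn_einfN; congr limn_einf; apply/funext => k /=; rewrite opprK.
      apply: measurableT_comp => //; apply: measurable_fun_limn_esup => k.
      by apply: measurableT_comp => //.
    apply: filterS fl => x fx _.
    have cF : (F^~ x) @ \oo --> ((u n x - f x) ^+ 2)%:E.
      apply: cvg_EFin; first exact: nearW.
      have cs : (fun k => v (k + K)%N x) @ \oo --> f x by rewrite (cvg_shiftn K (fun k => v k x) (nbhs (f x))).
      have cB : (fun k => u n x - v (k + K)%N x) @ \oo --> u n x - f x.
        by apply: (cvgB _ cs); exact: cvg_cst.
      have -> : fine \o F^~ x = (fun k => u n x - v (k + K)%N x) \* (fun k => u n x - v (k + K)%N x).
        by apply/funext => k /=; rewrite expr2.
      by rewrite expr2; exact: cvgM.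
    by rewrite (cvg_limn_einf_sup cF).1.
  rewrite E; apply: le_trans (fatou mu measurableT mF F0) _.
  apply: le_trans (limn_einf_sup _) _.
  rewrite limn_esup_lim; apply: lime_le; first exact: is_cvg_esups.
  apply: nearW => j; apply: ub_ereal_sup => _ [k _ <-].
  rewrite -[X in (X <= _)%E]fineK ?integrable_fin_num//; last by case: (rF k).
  by rewrite lee_fin; apply: hK; rewrite leq_addl.
have K1 n e : 0 < e -> (forall m, (n <= m)%N -> \int[mu]_x ((u n x - u m x) ^+ 2) <= e) ->
    (\int[mu]_x ((u n x - f x) ^+ 2)%:E <= e%:E)%E.
  move=> e0 h; apply: key; exists n => k nk; apply: h.
  by apply: leq_trans nk _; exact: leq_addl.
have rB n e : (\int[mu]_x ((u n x - f x) ^+ 2)%:E <= e%:E)%E -> r2 (fun x => u n x - f x).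
  move=> h; split; first by apply: measurable_funB => //; case: (ru n).
  apply/integrableP; split.
    by apply/measurable_EFinP; apply: measurable_funX; apply: measurable_funB => //; case: (ru n).
  apply: le_lt_trans (_ : (e%:E < +oo)%E); last by rewrite ltry.
  apply: le_trans h; rewrite le_eqVlt; apply/orP; left; apply/eqP; apply: eq_integral => x _ /=.
  by rewrite ger0_norm ?sqr_ge0.
have rf : r2 f.
  have [n hn] := cu 1 ltr01.
  have := r2B (ru n) (rB n 1 (K1 n 1 ltr01 (fun m nm => hn n m (leqnn n) nm))).
  by under eq_fun do rewrite opprB addrC subrK.
exists f => // e e0; have [n hn] := cu e e0; exists n => m nm.
have := key m e; rewrite -lee_fin => /(_ _) H.
rewrite fineK ?integrable_fin_num//; last by apply: r2_sqr; exact: r2B.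
apply: H; exists n => k nk; apply: hn => //.
by apply: leq_trans nk _; exact: leq_addl.
Qed.

End riesz_fischer.

(** * Complex-valued square integrable functions *)

Section complex_L2.
Context {R : realType} {d : nat} (O : domain R d).
Local Notation C := R[i].
Local Notation fn := ('rV[R]_d -> C).
Local Notation X := ('rV[R]_d -> R[i]^o).
Local Notation mu := (leb_on O).
Local Notation Re := complex.Re.
Local Notation Im := complex.Im.
Implicit Types (f g h : fn).

Definition L1 f := mu.-integrable setT (EFin \o (fun x => Re (f x))) /\
  mu.-integrable setT (EFin \o (fun x => Im (f x))).

Lemma cReM (z w : C) : Re (z * w) = Re z * Re w - Im z * Im w.
Proof. by case: z w => a b [c e]; simpc. Qed.

Lemma cImM (z w : C) : Im (z * w) = Re z * Im w + Im z * Re w.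
Proof. by case: z w => a b [c e]; simpc. Qed.

Lemma L2P f : L2 O f <-> r2 mu (fun x => Re (f x)) /\ r2 mu (fun x => Im (f x)).
Proof. by split=> -[/Lfun2P h1 /Lfun2P h2]; split. Qed.

Lemma integrable_lin (a b c : R) (u v w : 'rV[R]_d -> R) :
  mu.-integrable setT (EFin \o u) -> mu.-integrable setT (EFin \o v) ->
  mu.-integrable setT (EFin \o w) ->
  mu.-integrable setT (EFin \o (fun x => a * u x + b * v x + c * w x)) /\
  \int[mu]_x (a * u x + b * v x + c * w x) =
    a * \int[mu]_x u x + b * \int[mu]_x v x + c * \int[mu]_x w x.
Proof.
move=> iu iv iw.
have ia : mu.-integrable setT (EFin \o (fun x => a * u x)) := integrableZl measurableT a iu.
have ib : mu.-integrable setT (EFin \o (fun x => b * v x)) := integrableZl measurableT b iv.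
have ic : mu.-integrable setT (EFin \o (fun x => c * w x)) := integrableZl measurableT c iw.
have iab : mu.-integrable setT (EFin \o (fun x => a * u x + b * v x)) := integrableD measurableT ia ib.
split; first exact: (integrableD measurableT iab ic).
by rewrite (RintegralD measurableT iab ic) (RintegralD measurableT ia ib) !RintegralZl.
Qed.

Lemma cintegral_lin (c : C) f g : L1 f -> L1 g ->
  L1 (fun x => c * f x + g x) /\
  cintegral O (fun x => c * f x + g x) = c * cintegral O f + cintegral O g.
Proof.
move=> [rf jf] [rg jg].
have [h1 e1] := integrable_lin (Re c) (- Im c) 1 rf jf rg.
have [h2 e2] := integrable_lin (Re c) (Im c) 1 jf rf jg.
have E1 : (fun x => Re (c * f x + g x)) = (fun x => Re c * Re (f x) + - Im c * Im (f x) + 1 * Re (g x)).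
  by apply/funext => x; rewrite ReD cReM mul1r mulNr.
have E2 : (fun x => Im (c * f x + g x)) = (fun x => Re c * Im (f x) + Im c * Re (f x) + 1 * Im (g x)).
  by apply/funext => x; rewrite ImD cImM mul1r.
split; first by split; rewrite ?E1 ?E2.
rewrite /cintegral E1 E2 e1 e2.
move: (\int[mu]_x _) (\int[mu]_x _) (\int[mu]_x _) (\int[mu]_x _) => p q r s.
by case: c {h1 e1 h2 e2 E1 E2} => a b; simpc => /=; congr (_ +i* _); ring.
Qed.

Lemma cintegral_conj f : L1 f -> cintegral O (fun x => cj (f x)) = cj (cintegral O f).
Proof.
move=> [rf jf]; rewrite /cintegral /=; congr (_ +i* _).
  by apply: eq_Rintegral => x _; case: (f x).
rewrite -mulN1r -RintegralZl//; apply: eq_Rintegral => x _.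
by case: (f x) => a b /=; rewrite mulN1r.
Qed.

Lemma L2_conj f : L2 O f -> L2 O (fun x => cj (f x)).
Proof.
move=> /L2P[rf jf]; apply/L2P; split.
  by rewrite (_ : (fun x => _) = (fun x => Re (f x)))//; apply/funext => x; case: (f x).
rewrite (_ : (fun x => _) = (fun x => - Im (f x))); first exact: r2N.
by apply/funext => x; case: (f x).
Qed.

Lemma L2_mul f g : L2 O f -> L2 O g -> L1 (fun x => f x * g x).
Proof.
move=> /L2P[rf jf] /L2P[rg jg]; split.
  rewrite (_ : _ \o _ = (fun x => (Re (f x) * Re (g x))%:E - (Im (f x) * Im (g x))%:E)%E).
    by apply: (integrableB measurableT); exact: r2_mul.
  by apply/funext => x /=; rewrite cReM EFinB.
rewrite (_ : _ \o _ = (fun x => (Re (f x) * Im (g x))%:E + (Im (f x) * Re (g x))%:E)%E).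
  by apply: (integrableD measurableT); exact: r2_mul.
by apply/funext => x /=; rewrite cImM EFinD.
Qed.

Lemma L2_lin (c : C) f g : L2 O f -> L2 O g -> L2 O (fun x => c * f x + g x).
Proof.
move=> /L2P[rf jf] /L2P[rg jg]; apply/L2P; split.
  have := r2D (r2D (r2Z (Re c) rf) (r2Z (- Im c) jf)) rg.
  by congr r2; apply/funext => x; rewrite ReD cReM mulNr.
have := r2D (r2D (r2Z (Re c) jf) (r2Z (Im c) rf)) jg.
by congr r2; apply/funext => x; rewrite ImD cImM.
Qed.

Lemma L2_0 : L2 O (fun=> 0).
Proof. by apply/L2P; split; exact: r2_0. Qed.

Lemma L2_subsp : subsp (L2 O : set X).
Proof. by split; [exact: L2_0|move=> c u v; exact: L2_lin]. Qed.

Lemma innerE f g : inner O f g = cintegral O (fun x => f x * cj (g x)).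
Proof. by []. Qed.

Lemma inner_self f : inner O f f = (\int[mu]_x (Re (f x) ^+ 2 + Im (f x) ^+ 2))%:C.
Proof.
rewrite innerE /cintegral; congr (_ +i* _).
  by apply: eq_Rintegral => x _; rewrite ReM_conj !expr2.
rewrite (eq_Rintegral mu (g := fun=> 0)).
  by rewrite Rintegral_cst// mul0r.
by move=> x _; case: (f x) => a b; simpc => /=; rewrite mulrC addrC subrr.
Qed.

Lemma inner_hform : hform (L2 O : set X) (@inner R d O).
Proof.
split=> [c u v w Lu Lv Lw|u v Lu Lv|u Lu].
- have := (cintegral_lin c (L2_mul Lu (L2_conj Lw)) (L2_mul Lv (L2_conj Lw))).2.
  rewrite !innerE => <-; congr cintegral; apply/funext => x.
  by rewrite mulrDl mulrA.
- rewrite !innerE -cintegral_conj; last exact: L2_mul Lu (L2_conj Lv).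
  by congr cintegral; apply/funext => x; rewrite conjcM conjcK mulrC.
- rewrite inner_self lecR; apply: Rintegral_ge0 => x _.
  by rewrite addr_ge0 ?sqr_ge0.
Qed.

Lemma sq_inner f : sq (@inner R d O) f = \int[mu]_x (Re (f x) ^+ 2 + Im (f x) ^+ 2).
Proof. by rewrite /sq inner_self. Qed.

Lemma sq_inner_parts f : L2 O f ->
  sq (@inner R d O) f = \int[mu]_x (Re (f x) ^+ 2) + \int[mu]_x (Im (f x) ^+ 2).
Proof. by move=> /L2P[rf jf]; rewrite sq_inner RintegralD//; exact: r2_sqr. Qed.

Lemma L2norm_sqr f : L2norm O f ^+ 2 = sq (@inner R d O) f.
Proof.
rewrite sqr_sqrtr ?sq_inner//; apply: Rintegral_ge0 => x _.
by rewrite addr_ge0 ?sqr_ge0.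
Qed.

Lemma cintegral_ae_eq f g :
  measurable_fun setT (fun x => Re (f x)) -> measurable_fun setT (fun x => Im (f x)) ->
  measurable_fun setT (fun x => Re (g x)) -> measurable_fun setT (fun x => Im (g x)) ->
  {ae mu, forall x, f x = g x} -> cintegral O f = cintegral O g.
Proof.
move=> mf nf mg ng fg; rewrite /cintegral; congr (_ +i* _).
  by apply: Rintegral_ae_eq => //; apply: filterS fg => x ->.
by apply: Rintegral_ae_eq => //; apply: filterS fg => x ->.
Qed.

Lemma L1_measurable f : L1 f -> measurable_fun setT (fun x => Re (f x)) /\ measurable_fun setT (fun x => Im (f x)).
Proof. by move=> [/integrableP[/measurable_EFinP h _] /integrableP[/measurable_EFinP h' _]]. Qed.

Lemma cintegral_ae_eqL1 f g : L1 f -> L1 g -> {ae mu, forall x, f x = g x} -> cintegral O f = cintegral O g.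
Proof.
by move=> /L1_measurable[? ?] /L1_measurable[? ?]; exact: cintegral_ae_eq.
Qed.

Lemma inner_ae f f' g g' : L2 O f -> L2 O f' -> L2 O g -> L2 O g' ->
  {ae mu, forall x, f x = f' x} -> {ae mu, forall x, g x = g' x} -> inner O f g = inner O f' g'.
Proof.
move=> Lf Lf' Lg Lg' ff' gg'; rewrite !innerE; apply: cintegral_ae_eqL1.
- exact: L2_mul Lf (L2_conj Lg).
- exact: L2_mul Lf' (L2_conj Lg').
- by apply: filterS2 ff' gg' => x -> ->.
Qed.

Lemma sq_inner_eq0 f : L2 O f -> sq (@inner R d O) f = 0 -> {ae mu, forall x, f x = 0}.
Proof.
move=> Lf; have /L2P[rf jf] := Lf; rewrite sq_inner_parts// => /eqP.
rewrite paddr_eq0; try by apply: Rintegral_ge0 => x _; exact: sqr_ge0.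
move=> /andP[/eqP/(Rintegral_sqr_eq0 rf) h1 /eqP/(Rintegral_sqr_eq0 jf) h2].
by apply: filterS2 h1 h2 => x; case: (f x) => a b /= -> ->.
Qed.

Lemma sq_inner_ae0 f : L2 O f -> {ae mu, forall x, f x = 0} -> sq (@inner R d O) f = 0.
Proof.
move=> Lf f0; rewrite /sq (inner_ae Lf L2_0 Lf L2_0 f0 f0).
by rewrite -/(sq _ _) (sq0 L2_subsp inner_hform).
Qed.

Lemma L2_real_mul (c : 'rV[R]_d -> R) f : measurable_fun setT c ->
  (exists M : R, {ae mu, forall x, `|c x| <= M}) -> L2 O f -> L2 O (fun x => (c x)%:C * f x).
Proof.
move=> mc cM /L2P[rf jf]; apply/L2P; split.
  have := r2_bounded_mul mc rf cM; congr r2; apply/funext => x.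
  by rewrite cReM /= mul0r subr0.
have := r2_bounded_mul mc jf cM; congr r2; apply/funext => x.
by rewrite cImM /= mul0r addr0.
Qed.

Hypothesis fmu : mu setT \is a fin_num.

Lemma L2_cst c : L2 O (cst c).
Proof. by apply/L2P; split; exact: r2_cst. Qed.

Lemma L2_complete : complete_for (L2 O : set X) (@inner R d O).
Proof.
move=> u Lu cu.
have ru k : r2 mu (fun x => Re (u k x)) by have /L2P[] := Lu k.
have ju k : r2 mu (fun x => Im (u k x)) by have /L2P[] := Lu k.
have E k (w : X) : L2 O w -> sq (@inner R d O) (u k - w) =
    \int[mu]_x ((Re (u k x) - Re (w x)) ^+ 2) + \int[mu]_x ((Im (u k x) - Im (w x)) ^+ 2).
  move=> Lw; rewrite sq_inner_parts; last exact: (subspB L2_subsp (Lu k) Lw).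
  by congr (_ + _); apply: eq_Rintegral => x _; rewrite !fctE ?ReD ?ImD ?ReN ?ImN.
have P (v : 'rV[R]_d -> R) : 0 <= \int[mu]_x (v x ^+ 2).
  by apply: Rintegral_ge0 => x _; exact: sqr_ge0.
have [f rf hf] : exists2 f, r2 mu f & forall e, 0 < e -> exists N : nat, forall n, (N <= n)%N ->
     \int[mu]_x ((Re (u n x) - f x) ^+ 2) <= e.
  apply: (riesz_fischer fmu ru) => e e0; have [N hN] := cu e e0.
  exists N => m n Nm Nn; apply: le_trans (hN m n Nm Nn).
  by rewrite E// lerDl.
have [g rg hg] : exists2 f, r2 mu f & forall e, 0 < e -> exists N : nat, forall n, (N <= n)%N ->
     \int[mu]_x ((Im (u n x) - f x) ^+ 2) <= e.
  apply: (riesz_fischer fmu ju) => e e0; have [N hN] := cu e e0.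
  exists N => m n Nm Nn; apply: le_trans (hN m n Nm Nn).
  by rewrite E// lerDr.
pose w : X := fun x => f x +i* g x.
have Lw : L2 O w by apply/L2P.
exists w; split => //; apply/cvgrPdist_le => e e0.
have e2 : 0 < e / 2 by rewrite divr_gt0.
have [N hN] := hf _ e2; have [N' hN'] := hg _ e2.
exists (maxn N N') => // n /=; rewrite geq_max => /andP[nN nN'].
rewrite sub0r normrN E// ger0_norm ?addr_ge0// [leRHS]splitr lerD//.
  exact: hN.
exact: hN'.
Qed.

End complex_L2.

Local Opaque Rintegral derive lebesgue_rV.

(** * Test functions *)

Section restricted_measure.
Context {R : realType} {d : nat} (O : domain R d).
Local Notation mu := (leb_on O).
Local Notation leb := (@lebesgue_rV R d).

Lemma domain_measurable : measurable (dom_set O).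
Proof. by apply: open_measurable_rV; exact: dom_open. Qed.

(** Lebesgue measure is the sum of its restrictions to O and to the complement of O, and f vanishes
    almost everywhere for the second. *)
Lemma ge0_integral_leb_on (f : 'rV[R]_d -> \bar R) : measurable_fun setT f ->
  (forall x, (0 <= f x)%E) -> (forall x, ~ dom_set O x -> f x = 0%E) ->
  (\int[mu]_x f x = \int[leb]_x f x)%E.
Proof.
move=> mf f0 fO.
have mC := measurableC domain_measurable.
pose nu : {measure set 'rV[R]_d -> \bar R} := mrestr leb mC.
have E : (\int[leb]_x f x = \int[measure_add mu nu]_x f x)%E.
  apply: eq_measure_integral => A mA _; transitivity (mu A + nu A)%E; last by rewrite -measure_addE.
  rewrite -[in LHS](setIT A) -(setUv (dom_set O)) setIUr measureU//.
  - by apply: measurableI => //; exact: domain_measurable.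
  - exact: measurableI.
  - by rewrite setIACA setICr setI0.
rewrite E ge0_integral_measure_add//.
suff -> : (\int[nu]_x f x = 0)%E by rewrite adde0.
rewrite -(integral0 nu setT); apply: ae_eq_integral => //.
exists (dom_set O); split; first exact: domain_measurable.
  by rewrite /nu /= /mrestr setICr measure0.
by move=> x; apply: contra_notP => /fO fx _; rewrite fx.
Qed.

Lemma Rintegral_leb_on (f : 'rV[R]_d -> R) : measurable_fun setT f ->
  (forall x, ~ dom_set O x -> f x = 0) -> \int[mu]_x f x = \int[leb]_x f x.
Proof.
move=> mf fO.
have mF : measurable_fun setT (EFin \o f) by exact/measurable_EFinP.
have P1 : (\int[mu]_x (EFin \o f)^\+ x = \int[leb]_x (EFin \o f)^\+ x)%E.
  apply: ge0_integral_leb_on => //; first exact: measurable_funepos.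
  by move=> x /fO fx; rewrite funeposE /= fx maxxx.
have P2 : (\int[mu]_x (EFin \o f)^\- x = \int[leb]_x (EFin \o f)^\- x)%E.
  apply: ge0_integral_leb_on => //; first exact: measurable_funeneg.
  by move=> x /fO fx; rewrite funenegE /= fx oppr0 maxxx.
have E : (\int[mu]_x (f x)%:E = \int[leb]_x (f x)%:E)%E.
  by rewrite [LHS]integralE [RHS]integralE; rewrite -/(EFin \o f) P1 P2.
by exact: (congr1 fine E).
Qed.

End restricted_measure.

Section real_test_functions.
Context {R : realType} {d : nat} (O : domain R d) (L : R).
Hypothesis OL : dom_set O `<=` cube d L.
Local Notation mu := (leb_on O).
Implicit Types (g h k : 'rV[R]_d -> R).

Lemma leb_on_finite : mu setT \is a fin_num.
Proof.
rewrite /leb_on /= /mrestr setTI ge0_fin_numE//.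
apply: le_lt_trans (@cube_finite R d L); apply: le_measure => //; rewrite inE.
  exact: domain_measurable.
exact: cube_measurable.
Qed.

Lemma rtest_sub g h : rsm g -> (forall x, ~ closure [set x | h x != 0] x -> g x = 0) ->
  rtest O h -> rtest O g.
Proof.
move=> rg gh [rh ch hO].
have S : closure [set x | g x != 0] `<=` closure [set x | h x != 0].
  have E := (closure_id (closure [set x | h x != 0])).1 (@closed_closure _ _).
  rewrite [X in _ `<=` X]E; apply: closure_subset => x /= gx.
  by apply: contrapT => /gh gx0; rewrite gx0 eqxx in gx.
split => //; last exact: subset_trans hO.
have := @subclosed_compact _ _ _ (@closed_closure _ [set x | g x != 0]) ch.
by apply.
Qed.

Lemma rtest_off h x : rtest O h -> ~ dom_set O x -> h x = 0.
Proof.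
move=> [_ _ hO] Ox; apply: contrapT => /eqP hx; apply: Ox; apply: hO.
exact: subset_closure.
Qed.

Lemma support_off h x : ~ closure [set x | h x != 0] x -> h x = 0.
Proof. by move=> cx; apply: contrapT => /eqP hx; apply: cx; exact: subset_closure. Qed.

Lemma rtestM h g : rtest O h -> rsm g -> rtest O (fun x => h x * g x).
Proof.
move=> rh rg; apply: (rtest_sub (h := h)) => //; first by apply: rsmM => //; case: rh.
by move=> x /support_off ->; rewrite mul0r.
Qed.

Lemma rtestZ (c : R) h : rtest O h -> rtest O (fun x => c * h x).
Proof.
move=> rh; apply: (rtest_sub (h := h)) => //; first by apply: rsmZ; case: rh.
by move=> x /support_off ->; rewrite mulr0.
Qed.

Lemma rtestD g h : rtest O g -> rtest O h -> rtest O (fun x => g x + h x).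
Proof.
move=> [rg cg gO] [rh ch hO].
have S : closure [set x | g x + h x != 0] `<=`
    closure [set x | g x != 0] `|` closure [set x | h x != 0].
  rewrite -closureU; apply: closure_subset => x /= ghx.
  case: (eqVneq (g x) 0) => [gx|]; [right|by left].
  by rewrite gx add0r in ghx.
split; first exact: rsmD.
- have := @subclosed_compact _ _ _ (@closed_closure _ [set x | g x + h x != 0]) (compactU cg ch).
  by apply.
- by apply: subset_trans S _; rewrite subUset.
Qed.

Lemma rtest_dd i h : rtest O h -> rtest O (dd i h).
Proof.
move=> rh; apply: (rtest_sub (h := h)) => //; first by apply: rsm_dd; case: rh.
move=> x cx.
have E : \forall y \near x, h y = cst 0 y.
  have : nbhs x (~` closure [set x | h x != 0]).
    by apply: open_nbhs_nbhs; split => //; apply: closed_openC; exact: closed_closure.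
  by apply: filterS => y /support_off.
by rewrite /dd (near_eq_derive _ E) derive_cst.
Qed.

Lemma rtest_dds s h : rtest O h -> rtest O (dds s h).
Proof. by move=> rh; elim: s => //= i s; exact: rtest_dd. Qed.

Lemma rtest_c1c h : rtest O h -> c1c L h.
Proof.
move=> rh; have [sh _ _] := rh; split.
- exact: rsm_continuous.
- by move=> x xL; apply: (rtest_off rh) => /OL.
- by move=> i x; exact: rsm_derivable.
- by move=> i; apply: (rsm_continuous (h := dd i h)); exact: rsm_dd.
Qed.

Lemma rtest_r2 h : rtest O h -> r2 mu h.
Proof.
move=> rh; have [mh [M hM] _] := c1c_bmf (rtest_c1c rh).
have := r2_bounded_mul mh (r2_cst leb_on_finite (1 : R)).
have aM : exists M : R, {ae mu, forall x, `|h x| <= M} by exists M; exact: aeW.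
by move=> /(_ aM); under eq_fun do rewrite mulr1.
Qed.

(** The product of a test function and a smooth function is a test function, and the integral of its
    derivative is 0 by [Rintegral_derive0]. *)
Lemma rtest_IBP i h k : rtest O h -> rsm k ->
  \int[mu]_x (h x * dd i k x) = - \int[mu]_x (dd i h x * k x).
Proof.
move=> rh rk; have [sh _ _] := rh.
have rhk := rtestM rh rk.
have r1 := rtestM rh (rsm_dd i rk).
have r2 := rtestM (rtest_dd i rh) rk.
have i_ f : rtest O f -> mu.-integrable setT (EFin \o f).
  by move=> /rtest_r2; exact: (r2_integrable leb_on_finite).
apply/eqP; rewrite -subr_eq0 opprK -RintegralD//; [|exact: i_|exact: i_].
have E : (fun x => h x * dd i k x + dd i h x * k x) = dd i (fun x => h x * k x).
  rewrite ddM; [|by move=> x; exact: rsm_diff|by move=> x; exact: rsm_diff].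
  by apply/funext => x; rewrite [dd i h x * _]mulrC.
rewrite E Rintegral_leb_on; last 2 first.
- by have [+ _] := rtest_r2 (rtest_dd i rhk).
- by move=> x; exact: (rtest_off (rtest_dd i rhk)).
by have [h1 h2 h3 h4] := rtest_c1c rhk; rewrite /dd (Rintegral_derive0 (L := L)).
Qed.

End real_test_functions.

Section complex_test_functions.
Context {R : realType} {d : nat} (O : domain R d) (L : R).
Hypothesis OL : dom_set O `<=` cube d L.
Local Notation C := R[i].
Local Notation fn := ('rV[R]_d -> C).
Local Notation mu := (leb_on O).
Local Notation Re := complex.Re.
Local Notation Im := complex.Im.
Implicit Types (f g phi psi : fn) (s : seq 'I_d).

Lemma Re_pderivs s f : (fun x => Re (pderivs s f x)) = dds s (fun x => Re (f x)).
Proof. by elim: s => //= i s <-. Qed.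

Lemma Im_pderivs s f : (fun x => Im (pderivs s f x)) = dds s (fun x => Im (f x)).
Proof. by elim: s => //= i s <-. Qed.

Lemma smoothP f : smooth f <-> rsm (fun x => Re (f x)) /\ rsm (fun x => Im (f x)).
Proof.
split=> [sf|[/rsmP h1 /rsmP h2] s x].
  by split; apply/rsmP => s x; have [h1 h2] := sf s x; rewrite -?Re_pderivs -?Im_pderivs.
by rewrite Re_pderivs Im_pderivs.
Qed.

Lemma test_functionP phi : test_function O phi <->
  rtest O (fun x => Re (phi x)) /\ rtest O (fun x => Im (phi x)).
Proof.
have E : [set x | phi x != 0] = [set x | Re (phi x) != 0] `|` [set x | Im (phi x) != 0].
  apply/seteqP; split=> x /=; case: (phi x) => a b /=; rewrite eq_complex /= negb_and.
    by move/orP.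
  by move=> h; apply/orP.
split=> [[/smoothP[r1 r2] c1 c2]|[[r1 c1 s1] [r2 c2 s2]]]; last first.
  split; first exact/smoothP.
  - by rewrite E closureU; exact: compactU.
  - by rewrite E closureU subUset.
have K (B : set 'rV[R]_d) : B `<=` [set x | phi x != 0] -> compact (closure B) /\ closure B `<=` O.
  move=> BS; have S := closure_subset BS; split; last exact: subset_trans c2.
  by have := @subclosed_compact _ _ _ (@closed_closure _ B) c1; apply.
have [k1 k2] := K [set x | Re (phi x) != 0] (ltac:(by rewrite E => x; left)).
have [k3 k4] := K [set x | Im (phi x) != 0] (ltac:(by rewrite E => x; right)).
by split; split.
Qed.

Lemma test_of_rtest h : rtest O h -> test_function O (fun x => (h x)%:C).
Proof.
move=> rh; apply/test_functionP; split => //=.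
by have := rtestZ 0 rh; congr rtest; apply/funext => x; rewrite mul0r.
Qed.

Lemma test_lin (c : C) phi psi : test_function O phi -> test_function O psi ->
  test_function O (fun x => c * phi x + psi x).
Proof.
move=> /test_functionP[r1 j1] /test_functionP[r2 j2]; apply/test_functionP; split.
  have := rtestD (rtestD (rtestZ (Re c) r1) (rtestZ (- Im c) j1)) r2.
  by congr rtest; apply/funext => x; rewrite ReD cReM mulNr.
have := rtestD (rtestD (rtestZ (Re c) j1) (rtestZ (Im c) r1)) j2.
by congr rtest; apply/funext => x; rewrite ImD cImM.
Qed.

Lemma test_conj phi : test_function O phi -> test_function O (fun x => cj (phi x)).
Proof.
move=> /test_functionP[r1 j1]; apply/test_functionP; split.
  by have := r1; congr rtest; apply/funext => x; case: (phi x).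
by have := rtestZ (-1) j1; congr rtest; apply/funext => x; rewrite mulN1r; case: (phi x).
Qed.

Lemma test_0 (x0 : 'rV[R]_d) : test_function O (fun=> 0).
Proof.
have h : rtest O (fun=> 0).
  split; first exact: (rsm_cst 0).
  - rewrite (_ : [set x | _] = set0) ?closure0; first exact: compact0.
    by apply/seteqP; split=> x //=; rewrite eqxx.
  - rewrite (_ : [set x | _] = set0) ?closure0//.
    by apply/seteqP; split=> x //=; rewrite eqxx.
by apply/test_functionP.
Qed.

Lemma test_pderivs s phi : test_function O phi -> test_function O (pderivs s phi).
Proof.
move=> /test_functionP[r1 j1]; apply/test_functionP; rewrite Re_pderivs Im_pderivs.
by split; exact: rtest_dds.
Qed.

Lemma test_L2 phi : test_function O phi -> L2 O phi.
Proof. by move=> /test_functionP[r1 j1]; apply/L2P; split; exact: (rtest_r2 OL). Qed.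

Lemma test_smooth phi : test_function O phi -> smooth phi.
Proof. by case. Qed.

Lemma eq_parts f g : (fun x => Re (f x)) = (fun x => Re (g x)) ->
  (fun x => Im (f x)) = (fun x => Im (g x)) -> f = g.
Proof.
move=> h1 h2; apply/funext => x.
have := congr1 (fun F => F x) h1; have := congr1 (fun F => F x) h2.
by case: (f x) (g x) => a b [? ?] /= -> ->.
Qed.

Lemma pderivs_conj s phi : smooth phi ->
  pderivs s (fun x => cj (phi x)) = (fun x => cj (pderivs s phi x)).
Proof.
move=> /smoothP[r1 j1]; elim: s => //= i s ->.
have /smoothP[r2 j2] : smooth (pderivs s phi).
  by apply/smoothP; rewrite Re_pderivs Im_pderivs; split; exact: rsm_dds.
apply: eq_parts; apply/funext => x /=.
  by congr ('D__ _ x); apply/funext => y; case: (pderivs s phi y).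
have -> : (fun y => Im (cj (pderivs s phi y))) = (fun y => - 1 * Im (pderivs s phi y)).
  by apply/funext => y; case: (pderivs s phi y) => a b /=; rewrite mulN1r.
have := ddZ (-1) i (fun x => rsm_diff x j2).
by move=> /(congr1 (fun F => F x)); rewrite /dd => ->; rewrite mulN1r.
Qed.

Lemma pderivs_comm i s phi : smooth phi ->
  pderivs s (pderiv i phi) = pderiv i (pderivs s phi).
Proof.
move=> /smoothP[r1 j1].
have K (h : 'rV[R]_d -> R) : rsm h -> dds s (dd i h) = dd i (dds s h).
  move=> rh; elim: s => //= j s ->; apply/funext => x; apply: dd_comm; exact: rsm_dds.
apply: eq_parts.
  rewrite Re_pderivs -[RHS]/(dd i (fun y => Re (pderivs s phi y))) Re_pderivs -K//.
rewrite Im_pderivs -[RHS]/(dd i (fun y => Im (pderivs s phi y))) Im_pderivs -K//.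
Qed.

Lemma test_IBP1 i phi psi : test_function O phi -> smooth psi ->
  cintegral O (fun x => phi x * pderiv i psi x) = - cintegral O (fun x => pderiv i phi x * psi x).
Proof.
move=> /test_functionP[r1 j1] /smoothP[r2 j2].
have ii h : rtest O h -> mu.-integrable setT (EFin \o h).
  by move=> /(rtest_r2 OL); exact: (r2_integrable (leb_on_finite OL)).
have A (a b k l : 'rV[R]_d -> R) : rtest O a -> rtest O b -> rsm k -> rsm l ->
   \int[mu]_x (a x * dd i k x + b x * dd i l x) =
   - \int[mu]_x (dd i a x * k x + dd i b x * l x).
  move=> ra rb rk rl; rewrite !RintegralD//; try by apply: ii; apply: rtestM => //; try exact: rsm_dd; exact: rtest_dd.
  by rewrite !(rtest_IBP OL)// opprD.
rewrite /cintegral; simpc; congr (_ +i* _).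
  have rN : rsm (fun x => -1 * Im (psi x)) by exact: rsmZ.
  have dN : dd i (fun x => -1 * Im (psi x)) = (fun x => - dd i (fun y => Im (psi y)) x).
    by rewrite ddZ; [apply/funext => x; rewrite mulN1r|move=> x; exact: rsm_diff].
  have := A _ _ _ _ r1 j1 r2 rN; rewrite dN.
  rewrite (eq_Rintegral mu (g := fun x => Re (phi x * pderiv i psi x))); last first.
    by move=> x _; rewrite cReM mulrN.
  move=> ->; congr (- _); apply: eq_Rintegral => x _.
  by rewrite cReM mulN1r mulrN.
have := A _ _ _ _ r1 j1 j2 r2.
rewrite (eq_Rintegral mu (g := fun x => Im (phi x * pderiv i psi x))); last first.
  by move=> x _; rewrite cImM.
move=> ->; congr (- _); apply: eq_Rintegral => x _.
by rewrite cImM.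
Qed.

Lemma pderivs_smooth s phi : smooth phi -> smooth (pderivs s phi).
Proof.
by move=> /smoothP[? ?]; apply/smoothP; rewrite Re_pderivs Im_pderivs; split; exact: rsm_dds.
Qed.

Lemma test_IBP s phi psi : test_function O phi -> smooth psi ->
  cintegral O (fun x => phi x * pderivs s psi x) =
  (-1) ^+ size s * cintegral O (fun x => pderivs s phi x * psi x).
Proof.
move=> tp sq; elim: s phi tp => [|i s IH] phi tp /=; first by rewrite expr0 mul1r.
rewrite test_IBP1//; last exact: pderivs_smooth.
rewrite IH; last exact: (test_pderivs [:: i]).
(* The induction hypothesis leaves the derivative along i innermost; commutation moves it
   outside. *)
rewrite -(pderivs_comm i s); last by case: tp.
by rewrite exprS mulN1r mulNr.
Qed.

End complex_test_functions.

(** * Sums of forms and passage to the closure *)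

Section hform_constructions.
Context {R : realType} {X : lmodType R[i]}.
Implicit Types (V : set X) (a b : X -> X -> R[i]).

Lemma hform_add V a b : hform V a -> hform V b -> hform V (fun u v => a u v + b u v).
Proof.
move=> [l1 s1 p1] [l2 s2 p2]; split=> [c u v w Vu Vv Vw|u v Vu Vv|u Vu].
- by rewrite l1// l2//; ring.
- by rewrite conjcD -s1// -s2.
- by rewrite addr_ge0 ?p1 ?p2.
Qed.

Lemma hform_bigsum V (I : Type) (r : seq I) (a : I -> X -> X -> R[i]) :
  (forall i, hform V (a i)) -> hform V (fun u v => \sum_(i <- r) a i u v).
Proof.
move=> ha; split=> [c u v w Vu Vv Vw|u v Vu Vv|u Vu].
- by rewrite mulr_sumr -big_split; apply: eq_bigr => i _; exact: (hlin (ha i)).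
- by rewrite raddf_sum; apply: eq_bigr => i _; exact: (hsym (ha i)).
- by apply: sumr_ge0 => i _; exact: (hpos (ha i)).
Qed.

Lemma sq_add a b u : sq (fun u v => a u v + b u v) u = sq a u + sq b u.
Proof. by rewrite /sq ReD. Qed.

Lemma sq_bigsum (I : Type) (r : seq I) (a : I -> X -> X -> R[i]) u :
  sq (fun u v => \sum_(i <- r) a i u v) u = \sum_(i <- r) sq (a i) u.
Proof. by rewrite /sq Re_sum. Qed.

(** Square roots of [sq b1] and [sq b2] are seminorms, Lipschitz for the seminorm of a, so the
    inequality passes from D to its a-closure at a cost of e / 2 on each side. *)
Lemma sq_density V D a b1 b2 (K : R) : subsp V -> hform V a -> hform V b1 -> hform V b2 ->
  D `<=` V -> (forall u, V u -> forall e, 0 < e -> exists2 p, D p & sq a (u - p) < e) ->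
  (forall u, V u -> sq b1 u <= K * sq a u) -> (forall u, V u -> sq b2 u <= K * sq a u) ->
  (forall p, D p -> sq b1 p <= sq b2 p) -> forall u, V u -> sq b1 u <= sq b2 u.
Proof.
move=> sV ha h1 h2 DV dens bK1 bK2 bD u Vu.
have s1 := sq_ge0 h1 Vu; have s2 := sq_ge0 h2 Vu.
rewrite -[sq b1 u]sqr_sqrtr// -[sq b2 u]sqr_sqrtr// ler_pXn2r ?nnegrE ?sqrtr_ge0//.
apply/ler_addgt0Pr => e e0.
have K1 : 0 < `|K| + 1 by rewrite ltr_wpDl.
have d0 : 0 < (e / 2) ^+ 2 / (`|K| + 1) by rewrite divr_gt0 ?exprn_gt0 ?divr_gt0.
have [p Dp up] := dens u Vu _ d0; have Vp := DV _ Dp.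
have Vup := subspB sV Vu Vp.
have small b : (forall u, V u -> sq b u <= K * sq a u) -> Num.sqrt (sq b (u - p)) <= e / 2.
  move=> bK.
  rewrite -[leRHS]ger0_norm ?divr_ge0 ?(ltW e0)// -sqrtr_sqr ler_sqrt ?sqr_ge0//.
  apply: le_trans (bK _ Vup) _.
  apply: le_trans (_ : (`|K| + 1) * sq a (u - p) <= _).
    by apply: ler_wpM2r; [exact: (sq_ge0 ha Vup)|rewrite (le_trans (ler_norm K))// lerDl].
  by move: up; rewrite ltr_pdivlMr// mulrC => /ltW.
have e1 := small _ bK1; have e2 := small _ bK2.
have t1 := sqrt_sqD sV h1 Vup Vp; rewrite subrK in t1.
have Vpu := subspB sV Vp Vu.
have t2 := sqrt_sqD sV h2 Vpu Vu; rewrite subrK in t2.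
have E : sq b2 (p - u) = sq b2 (u - p) by rewrite -opprB (sqN sV h2).
rewrite E in t2.
have t3 : Num.sqrt (sq b1 p) <= Num.sqrt (sq b2 p) by rewrite ler_sqrt ?bD// (sq_ge0 h2 Vp).
lra.
Qed.

Lemma ler_term_sum (I : finType) (F : I -> R) i : (forall k, 0 <= F k) -> F i <= \sum_k F k.
Proof. by move=> F0; rewrite (bigD1 i)//= lerDl; exact: sumr_ge0. Qed.

Lemma cvg_sum0 (I : finType) (F : nat -> I -> R) :
  (forall i, F n i @[n --> \oo] --> (0 : R)) -> \sum_i F n i @[n --> \oo] --> (0 : R).
Proof.
move=> F0; suff : \sum_i F n i @[n --> \oo] --> \sum_(i : I) (0 : R) by rewrite big1_eq.
by apply: cvg_big => [|i _]; [exact: add_continuous|exact: F0].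
Qed.

Lemma lt_quarters (x y e : R) : x < e / 4 -> y < e / 4 -> 2 * x + 2 * y < e.
Proof. by lra. Qed.

End hform_constructions.

(** * Weak derivatives and H^2_0 *)

Section weak_derivatives.
Context {R : realType} {d : nat} (O : domain R d) (L : R).
Hypothesis OL : dom_set O `<=` cube d L.
Local Notation C := R[i].
Local Notation fn := ('rV[R]_d -> C).
Local Notation X := ('rV[R]_d -> R[i]^o).
Local Notation mu := (leb_on O).
Local Notation Re := complex.Re.
Local Notation Im := complex.Im.
Local Notation ip := (@inner R d O).
Local Notation L2 := (L2 O).
Local Notation wD := (wD O).
Implicit Types (f g u v w : fn) (phi psi : fn) (s : seq 'I_d).

Let fmu : mu setT \is a fin_num := leb_on_finite OL.
Let sL2 := @L2_subsp R d O.
Let hip := @inner_hform R d O.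

Lemma cintegral_inner f phi : cintegral O (fun x => f x * phi x) = ip f (fun x => cj (phi x)).
Proof. by rewrite innerE; congr cintegral; apply/funext => x; rewrite conjcK. Qed.

Lemma weak_unique g : L2 g ->
  (forall phi, test_function O phi -> cintegral O (fun x => g x * phi x) = 0) ->
  {ae mu, forall x, g x = 0}.
Proof.
move=> Lg g0; have /L2P[rg jg] := Lg.
have H h : rtest O h -> \int[mu]_x (Re (g x) * h x) = 0 /\ \int[mu]_x (Im (g x) * h x) = 0.
  move=> rh; have := g0 _ (test_of_rtest rh); rewrite /cintegral => -[h1 h2]; split.
    by rewrite -[RHS]h1; apply: eq_Rintegral => x _; rewrite cReM /= mulr0 subr0.
  by rewrite -[RHS]h2; apply: eq_Rintegral => x _; rewrite cImM /= mulr0 add0r.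
have h1 := du_bois_reymond (r2_integrable fmu rg) (fun h rh => (H h rh).1).
have h2 := du_bois_reymond (r2_integrable fmu jg) (fun h rh => (H h rh).2).
by apply: filterS2 h1 h2 => x; case: (g x) => a b /= -> ->.
Qed.

Lemma L2_test f phi : L2 f -> test_function O phi -> L1 O (fun x => f x * phi x).
Proof. by move=> Lf /(test_L2 OL); exact: L2_mul. Qed.

Lemma weak_deriv_lin s (c : C) f f' g g' : L2 f -> L2 f' -> L2 g -> L2 g' ->
  weak_deriv O s f g -> weak_deriv O s f' g' ->
  weak_deriv O s (fun x => c * f x + f' x) (fun x => c * g x + g' x).
Proof.
move=> Lf Lf' Lg Lg' h h' phi tp.
have tp' := test_pderivs s tp.
have [_ E1] := cintegral_lin c (L2_test Lf tp') (L2_test Lf' tp').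
have [_ E2] := cintegral_lin c (L2_test Lg tp) (L2_test Lg' tp).
have M (u v q : fn) : (fun x => (c * u x + v x) * q x) = (fun x => c * (u x * q x) + v x * q x).
  by apply/funext => x; rewrite mulrDl mulrA.
by rewrite !M E1 E2 h// h'// mulrDr mulrCA.
Qed.

Lemma weak_deriv_ae s f f' g : L2 f -> L2 f' -> {ae mu, forall x, f x = f' x} ->
  weak_deriv O s f g -> weak_deriv O s f' g.
Proof.
move=> Lf Lf' ff' h phi tp; rewrite -h//; apply: cintegral_ae_eqL1.
- exact: L2_test Lf' (test_pderivs s tp).
- exact: L2_test Lf (test_pderivs s tp).
- by apply: filterS ff' => x ->.
Qed.

Lemma weak_deriv_unique s f g g' : L2 g -> L2 g' ->
  weak_deriv O s f g -> weak_deriv O s f g' -> {ae mu, forall x, g x = g' x}.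
Proof.
move=> Lg Lg' h h'.
have Lgg' : L2 (fun x => -1 * g' x + g x) by exact: L2_lin.
suff : {ae mu, forall x, -1 * g' x + g x = 0}.
  by apply: filterS => x; rewrite mulN1r addrC => /eqP; rewrite subr_eq0 => /eqP.
apply: weak_unique Lgg' _ => phi tp.
have [_ E] := cintegral_lin (-1) (L2_test Lg' tp) (L2_test Lg tp).
rewrite (_ : (fun x => _) = (fun x => -1 * (g' x * phi x) + g x * phi x)); last first.
  by apply/funext => x; rewrite mulrDl mulrA.
rewrite E; have s0 : (-1) ^+ size s != 0 :> C by rewrite signr_eq0.
apply/eqP; rewrite mulN1r addrC subr_eq0; apply/eqP; apply: (mulfI s0).
by rewrite -h// -h'.
Qed.

Lemma weak_deriv_test s phi : test_function O phi -> weak_deriv O s phi (pderivs s phi).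
Proof. by move=> tp psi tq; rewrite (test_IBP OL) ?mulrA//; case: tq. Qed.

Lemma cvg_inner (u : nat -> fn) w g : (forall k, L2 (u k)) -> L2 w -> L2 g ->
  sq ip ((u n : X) - w) @[n --> \oo] --> 0 ->
  forall e, 0 < e -> exists N : nat, forall k, (N <= k)%N -> nsq (ip (u k) g - ip w g) <= e.
Proof.
move=> Lu Lw Lg cu e e0.
have G0 := sq_ge0 hip Lg.
have d0 : 0 < e / (sq ip g + 1) by rewrite divr_gt0// ltr_wpDl.
have /cvgrPdist_le/(_ _ d0)[N _ hN] := cu.
exists N => k Nk; have := hN k Nk; rewrite sub0r normrN.
have Lk := subspB sL2 (Lu k : (L2 : set X) _) Lw.
rewrite ger0_norm ?(sq_ge0 hip Lk)// => h.
rewrite -(hformBl sL2 hip (Lu k) Lw Lg).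
apply: le_trans (hform_CS sL2 hip Lk Lg) _.
rewrite ler_pdivlMr in h; last by rewrite ltr_wpDl.
apply: le_trans h; rewrite ler_wpM2l ?(sq_ge0 hip Lk)// lerDl//.
Qed.

(** Both sides of the defining identity are inner products with fixed square integrable functions,
    hence continuous. *)
Lemma weak_deriv_closed s (f g : nat -> fn) f0 g0 :
  (forall k, L2 (f k)) -> (forall k, L2 (g k)) -> L2 f0 -> L2 g0 ->
  (forall k, weak_deriv O s (f k) (g k)) ->
  sq ip ((f n : X) - f0) @[n --> \oo] --> 0 -> sq ip ((g n : X) - g0) @[n --> \oo] --> 0 ->
  weak_deriv O s f0 g0.
Proof.
move=> Lf Lg Lf0 Lg0 fg cf cg phi tp.
have tp' := test_pderivs s tp.
rewrite !cintegral_inner; apply/eqP; rewrite -subr_eq0; apply/eqP; apply: nsq_eq0.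
apply/eqP; rewrite eq_le nsq_ge0 andbT; apply/ler_addgt0Pr => e e0; rewrite add0r.
have e4 : 0 < e / 4 by rewrite divr_gt0.
have [N hN] := cvg_inner Lf Lf0 (L2_conj (test_L2 OL tp')) cf e4.
have [M hM] := cvg_inner Lg Lg0 (L2_conj (test_L2 OL tp)) cg e4.
pose k := maxn N M.
have h1 := hN k (leq_maxl _ _); have h2 := hM k (leq_maxr _ _).
have := fg k phi tp; rewrite !cintegral_inner => E.
move: h1 h2 E.
move: (ip (f k) _) (ip (g k) _) (ip f0 _) (ip g0 _) => p q p0 q0 h1 h2 E.
have -> : p0 - (-1) ^+ size s * q0 = - (p - p0) + (-1) ^+ size s * (q - q0).
  by rewrite E; ring.
apply: le_trans (nsqD_le _ _) _; rewrite nsqN nsqM.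
have -> : nsq ((-1) ^+ size s : C) = 1.
  rewrite -signr_odd; case: (odd _); rewrite ?expr1 ?expr0 ?nsqN.
    by rewrite (_ : 1 = 1%:C)// nsqR expr1n.
  by rewrite (_ : 1 = 1%:C)// nsqR expr1n.
lra.
Qed.

Lemma wDP f s : H2 O f -> (size s <= 2)%N -> L2 (wD s f) /\ weak_deriv O s f (wD s f).
Proof.
move=> [_ hf] s2; have [g [Lg hg]] := hf s s2.
by rewrite /Defs.wD; case: xgetP => [_ -> []|/(_ g)]//; case.
Qed.

Lemma wD_L2 f s : H2 O f -> (size s <= 2)%N -> L2 (wD s f).
Proof. by move=> hf hs; case: (wDP hf hs). Qed.

Lemma wD_weak f s : H2 O f -> (size s <= 2)%N -> weak_deriv O s f (wD s f).
Proof. by move=> hf hs; case: (wDP hf hs). Qed.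

Lemma H2_L2 f : H2 O f -> L2 f.
Proof. by case. Qed.

Lemma wD_unique f s g : H2 O f -> (size s <= 2)%N -> L2 g -> weak_deriv O s f g ->
  {ae mu, forall x, wD s f x = g x}.
Proof.
by move=> hf hs Lg hg; have [h1 h2] := wDP hf hs; exact: weak_deriv_unique h1 Lg h2 hg.
Qed.

Lemma H2_lin (c : C) f g : H2 O f -> H2 O g -> H2 O (fun x => c * f x + g x).
Proof.
move=> hf hg; split; first by apply: L2_lin; exact: H2_L2.
move=> s s2; have [h1 h2] := wDP hf s2; have [h3 h4] := wDP hg s2.
exists (fun x => c * wD s f x + wD s g x); split; first exact: L2_lin.
by apply: weak_deriv_lin => //; exact: H2_L2.
Qed.

Lemma wD_lin s (c : C) f g : H2 O f -> H2 O g -> (size s <= 2)%N ->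
  {ae mu, forall x, wD s (fun x => c * f x + g x) x = c * wD s f x + wD s g x}.
Proof.
move=> hf hg s2; have [h1 h2] := wDP hf s2; have [h3 h4] := wDP hg s2.
apply: wD_unique => //; [exact: H2_lin|exact: L2_lin|].
by apply: weak_deriv_lin => //; exact: H2_L2.
Qed.

Lemma H2_test phi : test_function O phi -> H2 O phi.
Proof.
move=> tp; split; first exact: (test_L2 OL).
move=> s _; exists (pderivs s phi); split; last exact: weak_deriv_test.
by apply: (test_L2 OL); exact: test_pderivs.
Qed.

Lemma wD_test s phi : test_function O phi -> (size s <= 2)%N ->
  {ae mu, forall x, wD s phi x = pderivs s phi x}.
Proof.
move=> tp s2; apply: wD_unique => //; first exact: H2_test.
  by apply: (test_L2 OL); exact: test_pderivs.
exact: weak_deriv_test.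
Qed.

Lemma wD_ae s f g : H2 O f -> H2 O g -> (size s <= 2)%N -> {ae mu, forall x, f x = g x} ->
  {ae mu, forall x, wD s f x = wD s g x}.
Proof.
move=> hf hg s2 fg; apply: wD_unique => //; first exact: wD_L2.
apply: (weak_deriv_ae (H2_L2 hg) (H2_L2 hf)); last exact: wD_weak.
by apply: filterS fg => x.
Qed.

(** Weak derivatives are chosen representatives, so u |-> [wD s u] is linear only almost everywhere,
    a defect that the inner product does not see. *)
Lemma pull_hform (V : set X) (T : X -> X) : (forall u, V u -> L2 (T u)) ->
  (forall (c : C) u v, V u -> V v -> V (c *: u + v) /\
     {ae mu, forall x, T (c *: u + v) x = c * T u x + T v x}) ->
  hform V (fun u v => ip (T u) (T v)).
Proof.
move=> VL Tl; split=> [c u v w Vu Vv Vw|u v Vu Vv|u Vu].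
- have [Vuv uv] := Tl c u v Vu Vv.
  have -> : ip (T (c *: u + v)) (T w) = ip (fun x => c * T u x + T v x) (T w).
    apply: inner_ae => //; try exact: VL; first by apply: L2_lin; exact: VL.
    exact: aeW.
  exact: (hlin hip c (VL _ Vu) (VL _ Vv) (VL _ Vw)).
- by apply: (hsym hip); exact: VL.
- by apply: (hpos hip); exact: VL.
Qed.

Lemma H2_subsp : subsp (H2 O : set X).
Proof.
split; last by move=> c u v; exact: H2_lin.
by apply: H2_test; apply: test_0; exact: 0.
Qed.

Lemma wD_hform s : (size s <= 2)%N -> hform (H2 O : set X) (fun u v => ip (wD s u) (wD s v)).
Proof.
move=> s2; apply: (pull_hform (T := fun u => wD s u)) => [u Vu|c u v Vu Vv].
  exact: wD_L2.
by split; [exact: H2_lin|exact: wD_lin].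
Qed.

Definition gradform (u v : X) : C := \sum_i ip (wD [:: i] u) (wD [:: i] v).
Definition hessform (u v : X) : C := \sum_i \sum_j ip (wD [:: i; j] u) (wD [:: i; j] v).
Definition lapform (u v : X) : C := ip (wlaplacian O u) (wlaplacian O v).
Definition H2form (u v : X) : C := ip u v + gradform u v + hessform u v.

Lemma gradform_hform : hform (H2 O : set X) gradform.
Proof. by apply: hform_bigsum => i; exact: wD_hform. Qed.

Lemma hessform_hform : hform (H2 O : set X) hessform.
Proof. by apply: hform_bigsum => i; apply: hform_bigsum => j; exact: wD_hform. Qed.

Lemma ip_hform : hform (H2 O : set X) ip.
Proof. by apply: (hform_sub _ hip) => u; exact: H2_L2. Qed.

Lemma H2form_hform : hform (H2 O : set X) H2form.
Proof.
apply: hform_add; last exact: hessform_hform.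
by apply: hform_add; [exact: ip_hform|exact: gradform_hform].
Qed.

Lemma wlaplacian_L2 f : H2 O f -> L2 (wlaplacian O f).
Proof.
move=> hf; have -> : wlaplacian O f = \sum_i (wD [:: i; i] f : X).
  by apply/funext => x; rewrite /wlaplacian fct_sumE.
by apply: (subsp_sum sL2) => i; exact: (wD_L2 (s := [:: i; i]) hf).
Qed.

Lemma ae_forall_fin (I : finType) (P : I -> 'rV[R]_d -> Prop) :
  (forall i, {ae mu, forall x, P i x}) -> {ae mu, forall x, forall i, P i x}.
Proof.
move=> h.
have : {ae mu, forall x, forall k : nat, forall i, nth i (enum I) k = i -> (k < #|I|)%N -> P i x}.
  apply: ae_foralln => k.
  have [kI|kI] := ltnP k #|I|; last by apply: aeW => x i _ kI'.
  pose i0 : I := enum_val (Ordinal kI).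
  apply: filterS (h i0) => x Px i ik _.
  have -> : i = i0 by rewrite /i0 (enum_val_nth i).
  by [].
apply: filterS => x H i; apply: (H (index i (enum I))).
  by rewrite nth_index// mem_enum.
by rewrite cardE index_mem mem_enum.
Qed.

Lemma wlaplacian_lin (c : C) f g : H2 O f -> H2 O g ->
  {ae mu, forall x, wlaplacian O (fun x => c * f x + g x) x = c * wlaplacian O f x + wlaplacian O g x}.
Proof.
move=> hf hg.
have := ae_forall_fin (fun i : 'I_d => wD_lin c hf hg (leqnn (size [:: i; i]))).
apply: filterS => x H; rewrite /wlaplacian mulr_sumr -big_split.
by apply: eq_bigr => i _; exact: H.
Qed.

Lemma wlaplacian_ae f g : H2 O f -> H2 O g -> {ae mu, forall x, f x = g x} ->
  {ae mu, forall x, wlaplacian O f x = wlaplacian O g x}.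
Proof.
move=> hf hg fg.
have := ae_forall_fin (fun i : 'I_d => wD_ae hf hg (leqnn (size [:: i; i])) fg).
by apply: filterS => x H; rewrite /wlaplacian; apply: eq_bigr => i _; exact: H.
Qed.

Lemma wlaplacian_test phi : test_function O phi ->
  {ae mu, forall x, wlaplacian O phi x = laplacian phi x}.
Proof.
move=> tp.
have := ae_forall_fin (fun i : 'I_d => wD_test tp (leqnn (size [:: i; i]))).
by apply: filterS => x H; rewrite /wlaplacian /laplacian; apply: eq_bigr => i _; exact: H.
Qed.

Lemma lapform_hform : hform (H2 O : set X) lapform.
Proof.
apply: (pull_hform (T := fun u => wlaplacian O u)) => [u Vu|c u v Vu Vv].
  exact: wlaplacian_L2.
by split; [exact: H2_lin|exact: wlaplacian_lin].
Qed.

Lemma gradnorm2E f : gradnorm2 O f = sq gradform f.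
Proof. by rewrite sq_bigsum; apply: eq_bigr => i _; rewrite L2norm_sqr. Qed.

Lemma H2norm_ge0 f : 0 <= H2norm O f.
Proof. exact: sqrtr_ge0. Qed.

Lemma H2norm_sqr f : H2 O f -> H2norm O f ^+ 2 = sq H2form f.
Proof.
move=> hf; rewrite /H2form !sq_add -gradnorm2E sq_bigsum -L2norm_sqr.
have -> : \sum_i sq (fun u v : X => \sum_j ip (wD [:: i; j] u) (wD [:: i; j] v)) f =
    \sum_i \sum_j L2norm O (wD [:: i; j] f) ^+ 2.
  by apply: eq_bigr => i _; rewrite sq_bigsum; apply: eq_bigr => j _; rewrite L2norm_sqr.
rewrite sqr_sqrtr// !addr_ge0 ?sqr_ge0//.
  by apply: sumr_ge0 => i _; exact: sqr_ge0.
by apply: sumr_ge0 => i _; apply: sumr_ge0 => j _; exact: sqr_ge0.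
Qed.

(** The approximation condition is put in terms of [sq] of a form, where the general theory of forms
    applies. *)
Lemma H20P w : H20 O w <-> H2 O w /\
  forall e, 0 < e -> exists2 phi, test_function O phi & sq H2form ((w : X) - phi) < e.
Proof.
have E phi : H2 O w -> test_function O phi -> H2norm O (w \- phi) ^+ 2 = sq H2form ((w : X) - phi).
  by move=> hw tp; rewrite -H2norm_sqr//; exact: (subspB H2_subsp hw (H2_test tp)).
split=> -[hw h]; split=> // e e0.
  have [|phi tp ht] := h (Num.sqrt e); first by rewrite sqrtr_gt0.
  exists phi => //; rewrite -E// -[ltRHS]sqr_sqrtr ?(ltW e0)//.
  by rewrite ltr_pXn2r ?nnegrE ?H2norm_ge0 ?sqrtr_ge0.
have [|phi tp ht] := h (e ^+ 2); first by rewrite exprn_gt0.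
exists phi => //; rewrite -E// in ht.
by move: ht; rewrite ltr_pXn2r ?nnegrE ?H2norm_ge0 ?(ltW e0).
Qed.

Lemma H20_H2 w : H20 O w -> H2 O w.
Proof. by case. Qed.

Lemma H20_test phi : test_function O phi -> H20 O phi.
Proof.
move=> tp; apply/H20P; split; first exact: H2_test.
by move=> e e0; exists phi => //; rewrite subrr (sq0 H2_subsp H2form_hform).
Qed.

Lemma H20_subsp : subsp (H20 O : set X).
Proof.
split; first by apply: H20_test; apply: test_0; exact: 0.
move=> c u v /H20P[hu au] /H20P[hv av]; apply/H20P; split; first exact: H2_lin.
move=> e e0.
have n0 := nsq_ge0 c; have n1 : 0 < 4 * (nsq c + 1) by rewrite mulr_gt0// ltr_wpDl.
have [p tp hp] := au (e / (4 * (nsq c + 1))) (divr_gt0 e0 n1).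
have [q tq hq] := av (e / 4) (divr_gt0 e0 (ltr0n _ 4)).
exists (fun x => c * p x + q x); first exact: test_lin.
have Hp := subspB H2_subsp hu (H2_test tp); have Hq := subspB H2_subsp hv (H2_test tq).
have -> : ((c *: u + v : X) - (fun x => c * p x + q x)) = c *: ((u : X) - p) + ((v : X) - q).
  by rewrite -[X in _ - X]/(c *: (p : X) + q) scalerBr opprD addrACA.
apply: le_lt_trans (sqD_le H2_subsp H2form_hform _ _) _ => //; first exact: subspZ H2_subsp _ _ Hp.
rewrite (sqZ H2_subsp H2form_hform)//.
have : nsq c * sq H2form ((u : X) - p) <= e / 4.
  apply: le_trans (_ : (nsq c + 1) * sq H2form ((u : X) - p) <= _).
    by rewrite ler_wpM2r ?(sq_ge0 H2form_hform)// lerDl.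
  move: hp n1; rewrite ltr_pdivlMr; last by rewrite mulr_gt0// ltr_wpDl.
  by move: (sq _ _) (nsq c) => x y hp _; lra.
move: hq; move: (sq _ _) (nsq c * sq _ _) => x y; lra.
Qed.

Lemma wD_nil_ae f : H2 O f -> {ae mu, forall x, wD [::] f x = f x}.
Proof.
move=> hf; apply: wD_unique => //; first exact: H2_L2.
by move=> phi tp; rewrite expr0 mul1r.
Qed.

Lemma wD_B s f g : H2 O f -> H2 O g -> (size s <= 2)%N ->
  {ae mu, forall x, wD s ((f : X) - g) x = wD s f x - wD s g x}.
Proof.
move=> hf hg s2; have := wD_lin (-1) hg hf s2; apply: filterS => x.
have -> : (fun x => -1 * g x + f x) = ((f : X) - g) by apply/funext => y; rewrite mulN1r addrC.
by move=> ->; rewrite mulN1r addrC.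
Qed.

Lemma sq_wD_le f : H2 O f -> (sq ip f <= sq H2form f) /\
  forall s, (size s <= 2)%N -> sq ip (wD s f) <= sq H2form f.
Proof.
move=> hf; rewrite /H2form !sq_add.
have p1 := sq_ge0 ip_hform hf.
have p2 := sq_ge0 gradform_hform hf.
have p3 := sq_ge0 hessform_hform hf.
split; first lra.
case=> [|i [|j []]]// _.
- have -> : sq ip (wD [::] f) = sq ip f.
    rewrite /sq; congr (Re _); apply: inner_ae; try exact: wD_nil_ae; try exact: H2_L2; exact: wD_L2.
  lra.
- suff : sq ip (wD [:: i] f) <= sq gradform f by lra.
  have -> : sq gradform f = \sum_k sq ip (wD [:: k] f) by rewrite sq_bigsum.
  apply: (ler_term_sum (F := fun k => sq ip (wD [:: k] f))) => k.
  by apply: (sq_ge0 hip); exact: wD_L2.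
- suff : sq ip (wD [:: i; j] f) <= sq hessform f by lra.
  have -> : sq hessform f = \sum_k \sum_l sq ip (wD [:: k; l] f).
    by rewrite sq_bigsum; apply: eq_bigr => k _; rewrite sq_bigsum.
  have P k l : 0 <= sq ip (wD [:: k; l] f) by apply: (sq_ge0 hip); exact: wD_L2.
  apply: le_trans (_ : \sum_l sq ip (wD [:: i; l] f) <= _).
    exact: (ler_term_sum (F := fun l => sq ip (wD [:: i; l] f))).
  by apply: (ler_term_sum (F := fun k => \sum_l sq ip (wD [:: k; l] f))) => k; exact: sumr_ge0.
Qed.

(** Each derivative of order at most 2 has a limit in L2, and closedness of weak differentiation
    identifies it with the derivative of the limit. *)
Lemma H2_complete : complete_for (H2 O : set X) H2form.
Proof.
move=> u hu cu.
have hB k l : H2 O ((u k : X) - u l) by exact: (subspB H2_subsp).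
have wlim s : (size s <= 2)%N -> exists g : X, L2 g /\ sq ip ((wD s (u n) : X) - g) @[n --> \oo] --> 0.
  move=> s2; apply: (L2_complete fmu) => [k|e e0]; first exact: wD_L2.
  have [N hN] := cu e e0; exists N => i j Ni Nj; apply: le_trans (hN i j Ni Nj).
  apply: le_trans ((sq_wD_le (hB i j)).2 s s2).
  rewrite le_eqVlt; apply/orP; left; apply/eqP; rewrite /sq; congr (Re _).
  have h := wD_B (hu i) (hu j) s2.
  have hs : {ae mu, forall x, ((wD s (u i) : X) - wD s (u j)) x = wD s ((u i : X) - u j) x}.
    by apply: filterS h => x ->.
  apply: inner_ae => //; try exact: wD_L2.
    exact: (subspB sL2 (wD_L2 (hu i) s2) (wD_L2 (hu j) s2)).
  exact: (subspB sL2 (wD_L2 (hu i) s2) (wD_L2 (hu j) s2)).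
(* The condition on the length goes inside the existential so that choice produces a total function
   G of s; [G [::]] is the limit of the functions themselves. *)
have H s : exists g : X, (size s <= 2)%N -> L2 g /\ sq ip ((wD s (u n) : X) - g) @[n --> \oo] --> 0.
  by case: (leqP (size s) 2) => [/wlim[g hg]|_]; [exists g|exists 0].
have [G hG] := boolp.choice H.
have E0 k : sq ip ((wD [::] (u k) : X) - G [::]) = sq ip ((u k : X) - G [::]).
  have [LG _] := hG [::] isT.
  have ha : {ae mu, forall x, ((wD [::] (u k) : X) - G [::]) x = ((u k : X) - G [::]) x}.
    by apply: filterS (wD_nil_ae (hu k)) => x; rewrite !fctE => ->.
  rewrite /sq; congr (Re _); apply: inner_ae => //.
  - exact: (subspB sL2 (wD_L2 (hu k) (isT : (size [::] <= 2)%N)) LG).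
  - exact: (subspB sL2 (H2_L2 (hu k)) LG).
  - exact: (subspB sL2 (wD_L2 (hu k) (isT : (size [::] <= 2)%N)) LG).
  - exact: (subspB sL2 (H2_L2 (hu k)) LG).
pose w := G [::].
have [Lw cw] := hG [::] isT.
have cw' : sq ip ((u n : X) - w) @[n --> \oo] --> 0 by under eq_fun do rewrite -E0.
have wd s : (size s <= 2)%N -> weak_deriv O s w (G s).
  move=> s2; have [LG cG] := hG s s2.
  apply: (weak_deriv_closed (f := u) (g := fun k => wD s (u k))) => // k.
  - exact: H2_L2.
  - exact: wD_L2.
  - exact: wD_weak.
have hw : H2 O w by split => // s s2; exists (G s); split; [case: (hG s s2)|exact: wd].
have cD s : (size s <= 2)%N -> sq ip (wD s ((u n : X) - w)) @[n --> \oo] --> 0.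
  move=> s2; have [LG cG] := hG s s2.
  have -> : (fun n => sq ip (wD s ((u n : X) - w))) = (fun n => sq ip ((wD s (u n) : X) - G s)).
    apply/funext => k; rewrite /sq; congr (Re _).
    have h1 := wD_B (hu k) hw s2; have h2 := wD_unique hw s2 LG (wd s s2).
    have h : {ae mu, forall x, wD s ((u k : X) - w) x = ((wD s (u k) : X) - G s) x}.
      by apply: filterS2 h1 h2 => x -> ->.
    have hd : L2 (wD s ((u k : X) - w)) by apply: wD_L2 => //; exact: (subspB H2_subsp).
    have hd2 : L2 ((wD s (u k) : X) - G s) by apply: (subspB sL2) => //; exact: wD_L2.
    exact: inner_ae.
  exact: cG.
exists w; split => //.
have -> : (fun n => sq H2form ((u n : X) - w)) = (fun n => sq ip ((u n : X) - w) +
    \sum_i sq ip (wD [:: i] ((u n : X) - w)) + \sum_i \sum_j sq ip (wD [:: i; j] ((u n : X) - w))).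
  apply/funext => k; rewrite /H2form !sq_add sq_bigsum sq_bigsum; congr (_ + _).
  by apply: eq_bigr => i _; rewrite sq_bigsum.
suff : sq ip ((u n : X) - w) + \sum_i sq ip (wD [:: i] ((u n : X) - w)) +
    \sum_i \sum_j sq ip (wD [:: i; j] ((u n : X) - w)) @[n --> \oo] --> (0 + 0 + 0 : R).
  by rewrite !addr0.
apply: cvgD; first apply: cvgD => //.
- by apply: cvg_sum0 => i; exact: cD.
- by apply: cvg_sum0 => i; apply: cvg_sum0 => j; exact: cD.
Qed.

Lemma H20_complete : complete_for (H20 O : set X) H2form.
Proof.
move=> u hu cu.
have hu2 k : H2 O (u k) by exact: H20_H2.
have [w [hw cw]] := H2_complete hu2 cu.
exists w; split => //; apply/H20P; split => // e e0.
have e4 : 0 < e / 4 by rewrite divr_gt0.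
have /cvgrPdist_lt/(_ _ e4)[N _ hN] := cw.
have /H20P[_ /(_ _ e4)[phi tp hp]] := hu N.
exists phi => //.
have h1 := hN N (leqnn N); rewrite sub0r normrN in h1.
have H1 := subspB H2_subsp (hu2 N) hw; have H2 := subspB H2_subsp (hu2 N) (H2_test tp).
rewrite ger0_norm ?(sq_ge0 H2form_hform)// in h1.
have -> : (w : X) - phi = ((u N : X) - phi) - ((u N : X) - w).
  by rewrite opprB [RHS]addrC subrKA.
exact: le_lt_trans (sqB_le H2_subsp H2form_hform H2 H1) (lt_quarters hp h1).
Qed.

End weak_derivatives.

Section hform_scaling.
Context {R : realType} {X : lmodType R[i]}.
Implicit Types (V : set X) (a b : X -> X -> R[i]).

Lemma hform_scale V a (r : R) : 0 <= r -> hform V a -> hform V (fun u v => r%:C * a u v).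
Proof.
move=> r0 [l1 s1 p1]; split=> [c u v w Vu Vv Vw|u v Vu Vv|u Vu].
- by rewrite l1//; ring.
- by rewrite conjcM -s1//; congr (_ * _); rewrite /= oppr0.
- by rewrite mulr_ge0 ?p1// ler0c.
Qed.

Lemma sq_scale a (r : R) u : sq (fun u v => r%:C * a u v) u = r * sq a u.
Proof. by rewrite /sq; case: (a u u) => x y; simpc. Qed.

Lemma hform_functional V (l : X -> R[i]) :
  (forall c u v, V u -> V v -> l (c *: u + v) = c * l u + l v) ->
  hform V (fun u v => l u * cj (l v)).
Proof.
move=> ll; split=> [c u v w Vu Vv Vw|u v Vu Vv|u Vu].
- by rewrite ll// mulrDl mulrA.
- by rewrite conjcM conjcK mulrC.
- by rewrite -nsqE ler0c nsq_ge0.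
Qed.

Lemma sq_functional (l : X -> R[i]) u : sq (fun u v => l u * cj (l v)) u = nsq (l u).
Proof. by rewrite /sq -nsqE. Qed.

(** The right-hand side squared exceeds y z by a square. This turns a product bound on the gradient
    into a sum whose terms can be absorbed. *)
Lemma sqr_AMGM (x y z e : R) : 0 < e -> 0 <= x -> 0 <= y -> 0 <= z ->
  x ^+ 2 <= y * z -> x <= e * z + y / (4 * e).
Proof.
move=> e0 x0 y0 z0 h; have w0 : 0 <= e * z + y / (4 * e).
  by rewrite addr_ge0// ?divr_ge0 ?mulr_ge0// ltW.
rewrite -(@ler_pXn2r _ 2) ?nnegrE//; apply: le_trans h _; rewrite -subr_ge0.
have -> : (e * z + y / (4 * e)) ^+ 2 - y * z = (e * z - y / (4 * e)) ^+ 2.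
  by field; rewrite gt_eqF.
exact: sqr_ge0.
Qed.

End hform_scaling.

(** * Elliptic estimate and compactness *)

Section norm_equivalence.
Context {R : realType} {d : nat} (O : domain R d) (L : R) (i0 : 'I_d).
Hypothesis OL : dom_set O `<=` cube d L.
Hypothesis L0 : 0 <= L.
Local Notation C := R[i].
Local Notation fn := ('rV[R]_d -> C).
Local Notation X := ('rV[R]_d -> R[i]^o).
Local Notation mu := (leb_on O).
Local Notation leb := (@lebesgue_rV R d).
Local Notation Re := complex.Re.
Local Notation Im := complex.Im.
Local Notation ip := (@inner R d O).
Local Notation L2 := (L2 O).
Local Notation wD := (wD O).
Local Notation gradform := (gradform O).
Local Notation hessform := (hessform O).
Local Notation lapform := (lapform O).
Local Notation H2form := (H2form O).
Implicit Types (f g u v w : fn) (phi psi : fn) (s : seq 'I_d) (h : 'rV[R]_d -> R).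

Let fmu : mu setT \is a fin_num := leb_on_finite OL.
Let sL2 := @L2_subsp R d O.
Let hip := @inner_hform R d O.
Let sH20 := H20_subsp OL.

Lemma rsm_coord (i : 'I_d) : rsm (fun x : 'rV[R]_d => x ord0 i).
Proof.
case=> [|n]; first by split => // x; exact: differentiable_coord.
apply/rsmnS; split; first by move=> x; exact: differentiable_coord.
move=> j; rewrite (_ : dd j _ = cst ((delta_mx ord0 j : 'rV[R]_d) ord0 i)); first exact: rsm_cst.
apply/funext => x; rewrite /dd.
have := derive_affine 1 0 i x (delta_mx ord0 j); rewrite mul1r => <-.
by congr ('D__ _ x); apply/funext => y; rewrite mul1r addr0.
Qed.

Lemma dd_coord (i : 'I_d) : dd i (fun x : 'rV[R]_d => x ord0 i) = cst 1.
Proof.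
apply/funext => x; rewrite /dd.
have := derive_affine 1 0 i x (delta_mx ord0 i); rewrite mul1r mxE !eqxx.
have -> : (fun y : 'rV[R]_d => 1 * y ord0 i + 0) = (fun y => y ord0 i).
  by apply/funext => y; rewrite mul1r addr0.
by [].
Qed.

(** Integration by parts of h^2 against the derivative 1 of the coordinate c = x_i0 gives the
    integral of - 2 h c dh. Since |c| <= L on O, this integrand is at most h^2 / 2 + 2 L^2 (dh)^2,
    and the first term is absorbed. *)
Lemma poincare_real h : rtest O h ->
  \int[mu]_x (h x ^+ 2) <= 4 * L ^+ 2 * \int[mu]_x (dd i0 h x ^+ 2).
Proof.
move=> rh; have [sh _ _] := rh.
pose c (x : 'rV[R]_d) := x ord0 i0.
have rc : rsm c by exact: rsm_coord.
have rhc := rtestM rh rc.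
have rd := rtest_dd i0 rh.
have ii k : rtest O k -> mu.-integrable setT (EFin \o k).
  by move=> /(rtest_r2 OL); exact: (r2_integrable fmu).
have E : \int[mu]_x (h x * c x * dd i0 h x) = (- (\int[mu]_x (h x ^+ 2))) - \int[mu]_x (h x * c x * dd i0 h x).
  rewrite [LHS](rtest_IBP OL i0 rhc sh) ddM; [|by move=> x; exact: rsm_diff|by move=> x; exact: rsm_diff].
  rewrite dd_coord -opprD -RintegralD//; last 2 first.
  - exact: (r2_sqr (rtest_r2 OL rh)).
  - by apply: ii; exact: rtestM rhc (rsm_dd i0 sh).
  by congr (- _); apply: eq_Rintegral => x _; rewrite /cst; ring.
have P1 : \int[mu]_x (h x ^+ 2) = - 2 * \int[mu]_x (h x * c x * dd i0 h x) by lra.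
have r2h := rtest_r2 OL rh; have r2d := rtest_r2 OL rd.
have I1 := integrableZl measurableT 2^-1 (r2_sqr r2h).
have I2 := integrableZl measurableT (2 * L ^+ 2) (r2_sqr r2d).
have I3 := integrableZl measurableT (-2) (ii _ (rtestM rhc (rsm_dd i0 sh))).
have P2 : \int[mu]_x (-2 * (h x * c x * dd i0 h x)) <=
    \int[mu]_x (2^-1 * h x ^+ 2 + 2 * L ^+ 2 * dd i0 h x ^+ 2).
  apply: (le_Rintegral measurableT I3 (integrableD measurableT I1 I2)) => x _.
  have [Ox|Ox] := pselect (dom_set O x); last first.
    by rewrite (rtest_off rh Ox) (rtest_off rd Ox) !mul0r mulr0 expr0n /= !mulr0 addr0.
  have := OL Ox i0; rewrite in_itv /= -/(c x) => /andP[c1 c2].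
  have cL : c x ^+ 2 <= L ^+ 2 by rewrite -[leLHS]real_normK ?num_real// ler_pXn2r ?nnegrE// ler_norml c1 c2.
  move: (h x) (dd i0 h x) (c x) (L ^+ 2) cL => a b k l kl.
  have : 0 <= (l - k ^+ 2) * b ^+ 2 by rewrite mulr_ge0 ?sqr_ge0 ?subr_ge0.
  have : 0 <= (a + 2 * k * b) ^+ 2 by exact: sqr_ge0.
  rewrite -subr_ge0 => h1 h2; rewrite -subr_ge0.
  have -> : 2^-1 * a ^+ 2 + 2 * l * b ^+ 2 - -2 * (a * k * b) =
     2^-1 * ((a + 2 * k * b) ^+ 2 - 0) + 2 * ((l - k ^+ 2) * b ^+ 2) by field.
  by rewrite addr_ge0// mulr_ge0.
move: P2; rewrite RintegralZl//; last by exact: ii (rtestM rhc (rsm_dd i0 sh)).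
rewrite (RintegralD measurableT I1 I2) !RintegralZl//; try by apply: r2_sqr.
rewrite -P1; lra.
Qed.

Lemma sq_ip_test_parts phi : test_function O phi ->
  sq ip phi = \int[mu]_x (Re (phi x) ^+ 2) + \int[mu]_x (Im (phi x) ^+ 2).
Proof. by move=> tp; rewrite sq_inner_parts//; exact: (test_L2 OL). Qed.

Lemma sq_wD_test s phi : test_function O phi -> (size s <= 2)%N ->
  sq ip (wD s phi) = sq ip (pderivs s phi).
Proof.
move=> tp s2; have h := wD_test OL tp s2; rewrite /sq; congr (Re _).
have L1 := wD_L2 (H2_test OL tp) s2.
by apply: inner_ae => //; apply: (test_L2 OL); exact: test_pderivs.
Qed.

Lemma sq_gradform_test phi : test_function O phi ->
  sq gradform phi = \sum_i sq ip (pderiv i phi).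
Proof.
by move=> tp; rewrite /gradform sq_bigsum; apply: eq_bigr => i _; exact: (sq_wD_test (s := [:: i]) tp).
Qed.

Lemma laplacianE phi : laplacian phi = \sum_i (pderivs [:: i; i] phi : X).
Proof. by apply/funext => x; rewrite /laplacian fct_sumE. Qed.

Lemma test_sum (I : Type) (r : seq I) (F : I -> X) : (forall i, test_function O (F i)) ->
  test_function O (\sum_(i <- r) F i).
Proof.
move=> tF; elim: r => [|i r IH]; first by rewrite big_nil; apply: test_0; exact: 0.
rewrite big_cons; have := test_lin 1 (tF i) IH; congr test_function.
by apply/funext => x; rewrite mul1r.
Qed.

Lemma test_laplacian phi : test_function O phi -> test_function O (laplacian phi).
Proof. by move=> tp; rewrite laplacianE; apply: test_sum => i; exact: test_pderivs. Qed.

Lemma sq_lapform_test phi : test_function O phi -> sq lapform phi = sq ip (laplacian phi).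
Proof.
move=> tp; have h := wlaplacian_test OL tp; rewrite /sq; congr (Re _).
have L1 := wlaplacian_L2 (H2_test OL tp).
by apply: inner_ae => //; apply: (test_L2 OL); exact: test_laplacian.
Qed.

Lemma ip_IBP i phi psi : test_function O phi -> test_function O psi ->
  ip (pderiv i phi) psi = - ip phi (pderiv i psi).
Proof.
move=> tp tq; have [sp _ _] := tp; have [sq _ _] := tq.
have := test_IBP1 OL i tp (test_smooth (test_conj tq)).
have := pderivs_conj [:: i] sq => /= ->.
by rewrite !innerE => ->; rewrite opprK.
Qed.

(** Integration by parts turns (phi, Lap phi) into - |grad phi|^2; Cauchy-Schwarz concludes. *)
Lemma gradform_lap phi : test_function O phi ->
  sq gradform phi ^+ 2 <= sq ip phi * sq lapform phi.
Proof.
move=> tp; rewrite sq_lapform_test// sq_gradform_test//.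
have L1 := test_L2 OL tp; have tl := test_laplacian tp.
have E : ip phi (laplacian phi) = - (\sum_i sq ip (pderiv i phi))%:C.
  have Ld i : L2 (pderivs [:: i; i] phi) by apply: (test_L2 OL); exact: test_pderivs.
  rewrite laplacianE (hform_sumr sL2 hip (index_enum 'I_d) (fun i _ => Ld i) L1).
  rewrite RCsum -sumrN; apply: eq_bigr => i _ /=.
  have td := test_pderivs [:: i] tp.
  by rewrite -(sqE hip (test_L2 OL td)) /= (ip_IBP i tp td) opprK.
have := hform_CS sL2 hip L1 (test_L2 OL tl).
by rewrite E nsqN nsqR.
Qed.

(** Moving one derivative, both |d_i d_j phi|^2 and (d_j d_j phi, d_i d_i phi) become - (d_j phi,
    d_i d_i d_j phi), since derivatives commute. Summing over i and j gives the two sides. *)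
Lemma hessform_lap phi : test_function O phi -> sq hessform phi = sq lapform phi.
Proof.
move=> tp; rewrite sq_lapform_test//.
have tdd s := test_pderivs s tp.
have Ldd s := test_L2 OL (tdd s).
have -> : sq hessform phi = \sum_j \sum_i sq ip (pderivs [:: i; j] phi).
  rewrite exchange_big sq_bigsum; apply: eq_bigr => i _; rewrite sq_bigsum.
  by apply: eq_bigr => j _; exact: sq_wD_test.
apply: complexI; rewrite -(sqE hip (test_L2 OL (test_laplacian tp))) laplacianE RCsum.
have LD i : L2 (pderivs [:: i; i] phi) := Ldd [:: i; i].
have LS : L2 (\sum_i (pderivs [:: i; i] phi : X)) by apply: (subsp_sum sL2) => i _; exact: LD.
rewrite (hform_suml sL2 hip (index_enum 'I_d) (fun i _ => LD i) LS).
apply: eq_bigr => j _; rewrite (hform_sumr sL2 hip (index_enum 'I_d) (fun i _ => LD i) (LD j)).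
rewrite RCsum; apply: eq_bigr => i _.
rewrite -(sqE hip (Ldd [:: i; j])).
have E1 : ip (pderiv i (pderiv j phi)) (pderiv i (pderiv j phi)) =
    - ip (pderiv j phi) (pderiv i (pderiv i (pderiv j phi))) := ip_IBP i (tdd [:: j]) (tdd [:: i; j]).
have E2 : pderiv i (pderiv i (pderiv j phi)) = pderiv j (pderiv i (pderiv i phi)) :=
  pderivs_comm j [:: i; i] (test_smooth tp).
have E3 : ip (pderiv j (pderiv j phi)) (pderiv i (pderiv i phi)) =
    - ip (pderiv j phi) (pderiv j (pderiv i (pderiv i phi))) := ip_IBP j (tdd [:: j]) (tdd [:: i; i]).
change (ip (pderiv i (pderiv j phi)) (pderiv i (pderiv j phi)) = ip (pderiv j (pderiv j phi)) (pderiv i (pderiv i phi))).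
exact: (etrans E1 (etrans (congr1 (fun z => - ip (pderiv j phi) z) E2) (esym E3))).
Qed.

Lemma poincare phi : test_function O phi -> sq ip phi <= 4 * L ^+ 2 * sq gradform phi.
Proof.
move=> tp; have [rp jp] := (test_functionP O phi).1 tp.
rewrite sq_gradform_test//; have td := test_pderivs [:: i0] tp.
apply: le_trans (_ : 4 * L ^+ 2 * sq ip (pderiv i0 phi) <= _).
  rewrite sq_ip_test_parts// (sq_ip_test_parts td) mulrDr lerD//.
    exact: poincare_real.
  exact: poincare_real.
rewrite ler_wpM2l ?mulr_ge0 ?sqr_ge0//.
apply: (ler_term_sum (F := fun i => sq ip (pderiv i phi))) => i.
by apply: (sq_ge0 hip); apply: (test_L2 OL); exact: (test_pderivs [:: i]).
Qed.

(** Let P, G and La be the squared norms of u, grad u and Lap u. From G^2 <= P La and P <= 4 L^2 G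
    follow G <= 4 L^2 La and P <= 16 L^4 La; the Hessian contributes exactly La. *)
Definition elliptic_const : R := 16 * L ^+ 4 + 4 * L ^+ 2 + 1.

Lemma elliptic_const_gt0 : 0 < elliptic_const.
Proof. by rewrite ltr_wpDl// addr_ge0// mulr_ge0// exprn_ge0. Qed.

Lemma H2form_le_lap_test phi : test_function O phi ->
  sq H2form phi <= elliptic_const * sq lapform phi.
Proof.
move=> tp; have hp := H2_test OL tp.
have P0 := sq_ge0 (ip_hform O) hp; have G0 := sq_ge0 (gradform_hform OL) hp.
have La0 := sq_ge0 (lapform_hform OL) hp.
have h1 := poincare tp; have h2 := gradform_lap tp; have h3 := hessform_lap tp.
rewrite /H2form !sq_add h3 /elliptic_const.
move: (sq ip phi) (sq gradform phi) (sq lapform phi) P0 G0 La0 h1 h2 => P G La P0 G0 La0 h1 h2.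
have l2 : 0 <= 4 * L ^+ 2 by rewrite mulr_ge0 ?sqr_ge0.
have GL : G <= 4 * L ^+ 2 * La.
  have [G1|G1] := leP G 0; first by apply: le_trans G1 _; rewrite mulr_ge0.
  rewrite -(ler_pM2l G1) -expr2; apply: le_trans h2 _.
  by rewrite mulrCA mulrA; apply: ler_wpM2r.
have PL : P <= 16 * L ^+ 4 * La.
  apply: le_trans h1 _; apply: le_trans (ler_wpM2l l2 GL) _.
  by rewrite le_eqVlt; apply/orP; left; apply/eqP; ring.
lra.
Qed.

Lemma lap_le_H2form u : H2 O u -> sq lapform u <= d%:R * sq H2form u.
Proof.
move=> hu; apply: le_trans (_ : d%:R * sq hessform u <= _); last first.
  rewrite ler_wpM2l// /H2form !sq_add lerDr addr_ge0//.
    exact: (sq_ge0 (ip_hform O) hu).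
  exact: (sq_ge0 (gradform_hform OL) hu).
have -> : sq lapform u = sq ip (\sum_i (wD [:: i; i] u : X)).
  rewrite /sq; congr (Re (ip _ _)); by apply/funext => x; rewrite /wlaplacian fct_sumE.
apply: le_trans (sq_sum_le sL2 hip _) _ => [i|]; first exact: (wD_L2 (s := [:: i; i]) hu).
rewrite ler_wpM2l//.
have -> : sq hessform u = \sum_i \sum_j sq ip (wD [:: i; j] u).
  by rewrite sq_bigsum; apply: eq_bigr => i _; rewrite sq_bigsum.
apply: ler_sum => i _; apply: (ler_term_sum (F := fun j => sq ip (wD [:: i; j] u))) => j.
by apply: (sq_ge0 hip); exact: wD_L2.
Qed.

Let H20sub : (H20 O : set X) `<=` H2 O. Proof. by move=> u; exact: H20_H2. Qed.

Lemma H20_density b1 b2 (K : R) : hform (H20 O : set X) b1 -> hform (H20 O : set X) b2 ->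
  (forall u, H20 O u -> sq b1 u <= K * sq H2form u) ->
  (forall u, H20 O u -> sq b2 u <= K * sq H2form u) ->
  (forall phi, test_function O phi -> sq b1 phi <= sq b2 phi) ->
  forall u, H20 O u -> sq b1 u <= sq b2 u.
Proof.
move=> h1 h2 bK1 bK2 bt u hu.
have hH := hform_sub H20sub (H2form_hform OL).
have DV : (test_function O : set X) `<=` H20 O by move=> p tp; exact: (H20_test OL).
have dens (v : X) : H20 O v -> forall e, 0 < e ->
    exists2 p : X, test_function O p & sq H2form (v - p) < e.
  by move=> /(H20P OL)[_ hv].
exact: (sq_density sH20 hH h1 h2 DV dens bK1 bK2 bt hu).
Qed.

Lemma H2form_le_lap u : H20 O u -> sq H2form u <= elliptic_const * sq lapform u.
Proof.
move=> hu; rewrite -(sq_scale lapform elliptic_const).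
have E0 := ltW elliptic_const_gt0.
have K0 : 0 <= elliptic_const * d%:R by rewrite mulr_ge0.
have h1 := hform_sub H20sub (H2form_hform OL).
have h2 := hform_scale E0 (hform_sub H20sub (lapform_hform OL)).
have b1 v : H20 O v -> sq H2form v <= (1 + elliptic_const * d%:R) * sq H2form v.
  move=> hv; rewrite mulrDl mul1r lerDl; apply: mulr_ge0 => //.
  exact: (sq_ge0 (H2form_hform OL) (H20_H2 hv)).
have b2 v : H20 O v -> sq (fun u v : X => elliptic_const%:C * lapform u v) v <=
    (1 + elliptic_const * d%:R) * sq H2form v.
  move=> hv; have V0 := sq_ge0 (H2form_hform OL) (H20_H2 hv).
  rewrite sq_scale [leRHS]mulrDl mul1r -[X in _ <= _ + X]mulrA; apply: ler_wpDl => //.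
  exact: (ler_wpM2l E0 (lap_le_H2form (H20_H2 hv))).
have bt phi : test_function O phi -> sq H2form phi <= sq (fun u v : X => elliptic_const%:C * lapform u v) phi.
  by move=> tp; rewrite sq_scale; exact: H2form_le_lap_test.
exact: (H20_density h1 h2 b1 b2 bt hu).
Qed.

(** The real inequality is applied to the real and imaginary parts; integrals over O and over R^d
    agree because test functions vanish off O. *)
Lemma rellich_test (e : R) : 0 < e -> exists (m : nat) (Q : 'I_m -> set 'rV[R]_d) (K : R),
  [/\ 0 <= K, forall j, measurable (Q j) &
   forall phi, test_function O phi ->
     sq ip phi <= K * (\sum_j nsq (ip phi (fun x => (\1_(Q j) x)%:C))) + e * sq gradform phi].
Proof.
move=> e0; have [J [Q [K [K0 mQ hQ]]]] := rellich_cells d L e0.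
exists #|J|, (fun k => Q (enum_val k)), K; split => // phi tp.
have [rp jp] := (test_functionP O phi).1 tp.
have key h : rtest O h -> \int[mu]_x (h x ^+ 2) <=
    K * (\sum_j (\int[mu]_x (h x * \1_(Q j) x)) ^+ 2) + e * (\sum_i \int[mu]_x (dd i h x ^+ 2)).
  move=> rh; have mh : measurable_fun setT h by have [] := rtest_r2 OL rh.
  have := hQ h (rtest_c1c OL rh).
  have -> : \int[leb]_x (h x ^+ 2) = \int[mu]_x (h x ^+ 2).
    rewrite Rintegral_leb_on//; first exact: measurable_funX.
    by move=> x /(rtest_off rh) ->; rewrite expr0n.
  have -> : \sum_i \int[leb]_x ('D_(delta_mx ord0 i) h x ^+ 2) = \sum_i \int[mu]_x (dd i h x ^+ 2).
    apply: eq_bigr => i _; have rd := rtest_dd i rh.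
    rewrite Rintegral_leb_on//; first by apply: measurable_funX; have [] := rtest_r2 OL rd.
    by move=> x /(rtest_off rd) ->; rewrite expr0n.
  have -> : \sum_j (\int[leb]_x (h \_ (Q j)) x) ^+ 2 = \sum_j (\int[mu]_x (h x * \1_(Q j) x)) ^+ 2.
    apply: eq_bigr => j _; congr (_ ^+ 2).
    rewrite Rintegral_leb_on; last 2 first.
    - by apply: measurable_funM => //; exact: measurable_indic.
    - by move=> x /(rtest_off rh) ->; rewrite mul0r.
    apply: eq_Rintegral => x _; rewrite patchE indicE.
    by case: ifP => _; rewrite ?mulr1 ?mulr0.
  by [].
have tpd i := test_pderivs [:: i] tp.
rewrite (sq_ip_test_parts tp) sq_gradform_test//.
have -> : \sum_i sq ip (pderiv i phi) = \sum_i \int[mu]_x (dd i (fun x => Re (phi x)) x ^+ 2) +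
   \sum_i \int[mu]_x (dd i (fun x => Im (phi x)) x ^+ 2).
  by rewrite -big_split; apply: eq_bigr => i _ /=; exact: (sq_ip_test_parts (tpd i)).
have -> : \sum_(j < #|J|) nsq (ip phi (fun x => (\1_(Q (enum_val j)) x)%:C)) =
   \sum_j (\int[mu]_x (Re (phi x) * \1_(Q j) x)) ^+ 2 + \sum_j (\int[mu]_x (Im (phi x) * \1_(Q j) x)) ^+ 2.
  rewrite -big_split /=.
  transitivity (\sum_(j in J) ((\int[mu]_x (Re (phi x) * \1_(Q j) x)) ^+ 2 +
    (\int[mu]_x (Im (phi x) * \1_(Q j) x)) ^+ 2)); last by apply: eq_bigl => j; rewrite inE.
  rewrite [RHS]big_enum_val.
  apply: eq_bigr => j _; rewrite /nsq innerE /cintegral /=; congr (_ ^+ 2 + _ ^+ 2).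
    by apply: eq_Rintegral => x _; rewrite cReM /= oppr0 mulr0 subr0.
  by apply: eq_Rintegral => x _; rewrite cImM /= oppr0 mulr0 add0r.
rewrite !mulrDr addrACA; apply: lerD; exact: key.
Qed.

Lemma L2_indic (Q : set 'rV[R]_d) : measurable Q -> L2 (fun x => (\1_Q x)%:C).
Proof.
move=> mQ; have -> : (fun x => (\1_Q x)%:C) = (fun x => (\1_Q x)%:C * cst 1 x) :> fn.
  by apply/funext => x; rewrite /cst mulr1.
apply: L2_real_mul; [exact: measurable_indic| |exact: L2_cst].
by exists 1; apply: aeW => x; rewrite indicE; case: (_ \in _); rewrite ?normr1 ?normr0.
Qed.

(** With P = |u|^2, G = |grad u|^2 and T the sum of the squared integrals over cells, Rellich's
    inequality reads P <= K T + r G. Inserted in G <= (r / 2) |Lap u|^2 + P / (2 r), it leaves a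
    term G / 2 that is absorbed: G <= r |Lap u|^2 + (K / r) T. This holds on test functions and
    extends to H^2_0 by density. *)
Lemma grad_compact (a : X -> X -> C) (k : R) : 0 <= k ->
  hform (H20 O : set X) a -> (forall u, H20 O u -> sq lapform u <= k * sq a u) ->
  compact_wrt (H20 O : set X) a gradform.
Proof.
move=> k0 ha la e e0.
have k1 : 0 < k + 1 by rewrite ltr_wpDl.
(* The Laplacian form is at most k a, and r k <= e. The functionals carry the factor c with c^2 = K
   / r, the constant left by the absorption. *)
pose r := e / (k + 1).
have r0 : 0 < r by rewrite divr_gt0.
have [m [Q [K [K0 mQ hQ]]]] := rellich_test r0.
pose c := Num.sqrt (K / r).
have c2 : c ^+ 2 = K / r by rewrite sqr_sqrtr// divr_ge0// ltW.
pose l (j : 'I_m) (u : X) : C := c%:C * ip u (fun x => (\1_(Q j) x)%:C).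
have LQ j : L2 (fun x => (\1_(Q j) x)%:C) by exact: L2_indic.
have Kr0 : 0 <= K / r by rewrite divr_ge0 ?(ltW r0).
have ll j b u v : H20 O u -> H20 O v -> l j (b *: u + v) = b * l j u + l j v.
  move=> hu hv; rewrite /l (hlin hip b (H2_L2 (H20_H2 hu)) (H2_L2 (H20_H2 hv)) (LQ j)).
  by ring.
have lb j u : H20 O u -> nsq (l j u) <= K / r * sq ip (fun x => (\1_(Q j) x)%:C) * sq ip u.
  move=> hu; rewrite /l nsqM nsqR c2 -[leRHS]mulrA; apply: (ler_wpM2l Kr0).
  by rewrite mulrC; exact: (hform_CS sL2 hip (H2_L2 (H20_H2 hu)) (LQ j)).
have ipH u : H20 O u -> sq ip u <= sq H2form u by move=> hu; exact: (sq_wD_le OL (H20_H2 hu)).1.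
pose S := \sum_j sq ip (fun x => (\1_(Q j) x)%:C).
have S0 j : 0 <= sq ip (fun x => (\1_(Q j) x)%:C) by exact: (sq_ge0 hip (LQ j)).
have lbH j u : H20 O u -> nsq (l j u) <= K / r * S * sq H2form u.
  move=> hu; apply: le_trans (lb j u hu) _.
  have KS : K / r * sq ip (fun x => (\1_(Q j) x)%:C) <= K / r * S.
    by apply: (ler_wpM2l Kr0); exact: (ler_term_sum (F := fun j => sq ip (fun x => (\1_(Q j) x)%:C))).
  apply: ler_pM => //; first exact: mulr_ge0.
    exact: (sq_ge0 hip (H2_L2 (H20_H2 hu))).
  exact: ipH.
have KS0 : 0 <= K / r * S by apply: mulr_ge0 => //; exact: sumr_ge0.
have H0 u : H20 O u -> 0 <= sq H2form u by move=> hu; exact: (sq_ge0 (H2form_hform OL) (H20_H2 hu)).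
have E0 := ltW elliptic_const_gt0.
exists m, l; split => //.
- exists (K / r * S * (elliptic_const * k)); split; first by rewrite mulr_ge0// mulr_ge0.
  move=> j u hu; apply: le_trans (lbH j u hu) _; rewrite -[leRHS]mulrA; apply: (ler_wpM2l KS0).
  apply: le_trans (H2form_le_lap hu) _; rewrite -mulrA; exact: (ler_wpM2l E0 (la u hu)).
move=> u hu.
apply: le_trans (_ : r * sq lapform u + \sum_j nsq (l j u) <= _); last first.
  rewrite lerD2r; apply: le_trans (ler_wpM2l (ltW r0) (la u hu)) _.
  rewrite mulrA ler_wpM2r ?(sq_ge0 ha hu)// /r mulrAC ler_pdivrMr// ler_wpM2l ?(ltW e0)//.
  by rewrite lerDl.
pose b2 (u v : X) : C := r%:C * lapform u v + \sum_(j < m) l j u * cj (l j v).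
have sb2 v : sq b2 v = r * sq lapform v + \sum_j nsq (l j v).
  rewrite /b2 sq_add sq_scale sq_bigsum; congr (_ + _); apply: eq_bigr => j _.
  exact: sq_functional.
rewrite -sb2.
have rd0 : 0 <= r * d%:R by rewrite mulr_ge0 ?(ltW r0).
have mS0 : 0 <= m%:R * (K / r * S) by rewrite mulr_ge0.
have h1 := hform_sub H20sub (gradform_hform OL).
have h2 : hform (H20 O : set X) b2.
  apply: hform_add; first exact: (hform_scale (ltW r0) (hform_sub H20sub (lapform_hform OL))).
  by apply: hform_bigsum => j; apply: hform_functional; exact: ll.
have bK1 v : H20 O v -> sq gradform v <= (1 + r * d%:R + m%:R * (K / r * S)) * sq H2form v.
  move=> hv; have h0 := H0 v hv.
  have c1 := sq_ge0 hip (H2_L2 (H20_H2 hv)).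
  have c3 := sq_ge0 (hessform_hform OL) (H20_H2 hv).
  have GH : sq gradform v <= sq H2form v.
    by rewrite /H2form !sq_add -addrA addrCA lerDl addr_ge0.
  apply: le_trans GH _; rewrite -addrA mulrDl mul1r lerDl; apply: mulr_ge0 => //.
  exact: addr_ge0.
have bK2 v : H20 O v -> sq b2 v <= (1 + r * d%:R + m%:R * (K / r * S)) * sq H2form v.
  move=> hv; have h0 := H0 v hv; rewrite sb2 [leRHS]mulrDl; apply: lerD.
    apply: le_trans (ler_wpM2l (ltW r0) (lap_le_H2form (H20_H2 hv))) _.
    by rewrite mulrA; apply: (ler_wpM2r h0); rewrite lerDr.
  apply: le_trans (_ : \sum_(j < m) (K / r * S * sq H2form v) <= _).
    by apply: ler_sum => j _; exact: lbH.
  by rewrite sumr_const card_ord -[_ *+ m]mulr_natl mulrA.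
apply: (H20_density h1 h2 bK1 bK2 _ hu).
move=> phi tp; rewrite sb2.
  have hp := H2_test OL tp.
  have P0 := sq_ge0 (ip_hform O) hp; have G0 := sq_ge0 (gradform_hform OL) hp.
  have La0 := sq_ge0 (lapform_hform OL) hp.
  have := sqr_AMGM (divr_gt0 r0 (ltr0n R 2)) G0 P0 La0 (gradform_lap tp).
  have := hQ phi tp.
  have -> : \sum_j nsq (l j phi) = K / r * \sum_j nsq (ip phi (fun x => (\1_(Q j) x)%:C)).
    by rewrite mulr_sumr; apply: eq_bigr => j _; rewrite /l nsqM nsqR c2.
  move: (sq ip phi) (sq gradform phi) (sq lapform phi) P0 G0 La0.
  move: (\sum_j _) => T P G La P0 G0 La0 h1' h2'.
  have E : P / (4 * (r / 2)) <= K / r * T / 2 + G / 2.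
    have r20 : 0 < 4 * (r / 2) by move: (r) r0 => z z0; lra.
    rewrite ler_pdivrMr//.
    have -> : (K / r * T / 2 + G / 2) * (4 * (r / 2)) = K * T + r * G by field; rewrite gt_eqF.
    exact: h1'.
  move: E h2'; move: (P / _) (K / r * T) => Y Z; move: (r) => z; lra.
Qed.

End norm_equivalence.

(** * The weighted form *)

Section admissible_indices.
Context {R : realType} {d : nat} (O : domain R d).
Local Notation C := R[i].
Local Notation mu := (leb_on O).
Implicit Types (al be : 'I_d -> R) (n : 'rV[R]_d -> R).

Lemma obox_gt0 al be : (forall i, al i < be i) -> obox al be `<=` O -> (0 < mu (obox al be))%E.
Proof.
move=> ab BO; rewrite /leb_on /= /mrestr setIidl//.
have -> : obox al be = [set x | forall i, (`]al i, be i[%classic : set (measurableTypeR R)) (x ord0 i)].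
  by apply/seteqP; split=> x h i; have := h i; rewrite /= in_itv.
rewrite (lebesgue_rV_box (A := fun i => `]al i, be i[%classic)); last by move=> i; exact: measurable_itv.
rewrite (eq_bigr (fun i => (be i - al i)%:E)); last first.
  by move=> i _; rewrite lebesgue_measure_itv /= lte_fin ab -EFinB.
rewrite prodEFin lte_fin; apply: prodr_gt0 => i _; rewrite subr_gt0; exact: ab.
Qed.

Lemma box_in_domain : exists al be, (forall i, al i < be i) /\ cbox al be `<=` O.
Proof.
have [x Ox] := dom_nonempty O; have [p [_ pO]] := box_in_open Ox.
eexists _, _; split; last exact: pO.
move=> i; have : 0 < p.2.+1%:R^-1 :> R by rewrite invr_gt0.
by move: (p.2.+1%:R^-1 : R) (ratr _ : R) => r q r0; lra.
Qed.

Lemma obox_cbox al be : obox al be `<=` cbox al be.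
Proof. by move=> x h i; have /andP[/ltW -> /ltW ->] := h i. Qed.

Lemma leb_on_gt0 : (0 < mu setT)%E.
Proof.
have [al [be [ab BO]]] := box_in_domain.
apply: lt_le_trans (obox_gt0 ab (subset_trans (@obox_cbox al be) BO)) _.
by apply: le_measure => //; rewrite inE//; exact: obox_measurable.
Qed.

Lemma ae_ex (P : 'rV[R]_d -> Prop) : {ae mu, forall x, P x} -> exists x, P x.
Proof.
have F := ae_properfilter_algebraOfSetsType leb_on_gt0.
by move=> h; exact: (filter_ex h).
Qed.

(** The inverse is continuous off 0, and the point 0 is split off. *)
Lemma measurable_inv : measurable_fun setT (GRing.inv : R -> R).
Proof.
rewrite -(setUv [set (0 : R)]); apply/measurable_funU.
- exact: measurable_set1.
- by apply: measurableC; exact: measurable_set1.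
split; first exact: measurable_fun_set1.
apply: open_continuous_measurable_fun.
  by apply: closed_openC; exact: closed_eq.
by move=> x; rewrite inE /= => /eqP x0; exact: inv_continuous.
Qed.

Lemma admissibleP n : admissible_index O n -> measurable_fun setT n /\
  exists c1 c2 : R, [/\ 0 < c1, ess_inf mu (EFin \o n) = c1%:E, ess_sup mu (EFin \o n) = c2%:E,
    {ae mu, forall x, c1 <= n x} & {ae mu, forall x, n x <= c2}].
Proof.
move=> [nL n0]; have mn : measurable_fun setT n by have := sub_Lfun_mfun nL; rewrite inE.
split => //.
have nf : (ess_sup mu (abse \o (EFin \o n)) < +oo)%E.
  have := sub_Lfun_finLfun nL; rewrite inE /= /finite_norm unlock /Lnorm.
  by rewrite leb_on_gt0.
have sf : (ess_sup mu (EFin \o n) < +oo)%E.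
  apply: le_lt_trans nf; apply: le_ess_sup; apply: aeW => x /=.
  by rewrite lee_fin ler_norm.
have h1 := ess_inf_le mu (EFin \o n); have h2 := ess_sup_ge mu (EFin \o n).
(* A point where both essential bounds hold exists because O has positive measure. The real value n
   x then shows that the lower bound is finite and the upper one nonnegative. *)
have [x [x1 x2]] : exists x, (ess_inf mu (EFin \o n) <= (EFin \o n) x)%E /\ ((EFin \o n) x <= ess_sup mu (EFin \o n))%E.
  by apply: ae_ex; apply: filterS2 h1 h2 => x; split.
have fi : ess_inf mu (EFin \o n) \is a fin_num.
  by rewrite ge0_fin_numE ?(ltW n0)//; apply: le_lt_trans x1 _; rewrite /= ltry.
have fs : ess_sup mu (EFin \o n) \is a fin_num.
  rewrite ge0_fin_numE//; apply: le_trans x2; apply: le_trans x1; exact: ltW.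
exists (fine (ess_inf mu (EFin \o n))), (fine (ess_sup mu (EFin \o n))).
rewrite !fineK//; split=> //.
- by rewrite -lte_fin fineK.
- by apply: filterS h1 => y; rewrite -lee_fin fineK.
- by apply: filterS h2 => y; rewrite -lee_fin fineK.
Qed.

Lemma admissible_cst1 : admissible_index O (cst 1).
Proof.
split; last by rewrite (_ : EFin \o cst 1 = cst 1%E)// ess_inf_cst ?leb_on_gt0// lte01.
rewrite inE; apply/andP; split; first by rewrite inE /=; exact: measurable_cst.
rewrite inE /= /finite_norm unlock /Lnorm leb_on_gt0.
rewrite (_ : abse \o _ = cst 1%E); last by apply/funext => x /=; rewrite normr1.
by rewrite ess_sup_cst ?leb_on_gt0// ltry.
Qed.

End admissible_indices.

Section weighted_form.
Context {R : realType} {d : nat} (O : domain R d) (L : R) (i0 : 'I_d).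
Hypothesis OL : dom_set O `<=` cube d L.
Hypothesis L0 : 0 <= L.
Local Notation C := R[i].
Local Notation fn := ('rV[R]_d -> C).
Local Notation X := ('rV[R]_d -> R[i]^o).
Local Notation mu := (leb_on O).
Local Notation Re := complex.Re.
Local Notation ip := (@inner R d O).
Local Notation L2 := (L2 O).
Implicit Types (u v w : fn) (n : 'rV[R]_d -> R).

Let sL2 := @L2_subsp R d O.
Let hip := @inner_hform R d O.
Let sH20 := H20_subsp OL.
Let H20sub : (H20 O : set X) `<=` H2 O. Proof. by move=> u; exact: H20_H2. Qed.

Definition nform n (u v : X) : C := ip (nlaplacian O n u) (wlaplacian O v).

(** Splitting the weight evenly between the two arguments exhibits the weighted form as a pullback
    of the inner product, hence as Hermitian and nonnegative. *)
Let sqrt_weight n (u : X) : X := fun x => (Num.sqrt (n x)^-1)%:C * wlaplacian O u x.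

Lemma sq_ip_le f g (k : R) : 0 <= k -> L2 f -> L2 g -> {ae mu, forall x, nsq (f x) <= k * nsq (g x)} ->
  sq ip f <= k * sq ip g.
Proof.
move=> k0 Lf Lg fg.
have I f' : L2 f' -> mu.-integrable setT (EFin \o (fun x => nsq (f' x))).
  by move=> /L2P[rf jf]; exact: (integrableD measurableT (r2_sqr rf) (r2_sqr jf)).
have If := I _ Lf; have Ikg := integrableZl measurableT k (I _ Lg).
have E f' : sq ip f' = \int[mu]_x nsq (f' x) by rewrite sq_inner.
rewrite !E -RintegralZl//; last exact: I.
apply: fine_le; [exact: integrable_fin_num|exact: (integrable_fin_num measurableT Ikg)|].
have [m1 _] := integrableP _ _ _ If; have [m2 _] := integrableP _ _ _ Ikg.
apply: ae_ge0_le_integral => //.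
- by move=> x _; rewrite lee_fin nsq_ge0.
- by move=> x _; rewrite lee_fin mulr_ge0 ?nsq_ge0.
- by apply: filterS fg => x h _; rewrite lee_fin.
Qed.

Lemma hform_eq (V : set X) a b : (forall u v, V u -> V v -> a u v = b u v) -> subsp V ->
  hform V a -> hform V b.
Proof.
move=> ab sV [l s p]; split=> [c u v w Vu Vv Vw|u v Vu Vv|u Vu].
- rewrite -!ab//; first exact: l.
  by case: sV => _; apply.
- by rewrite -!ab//; exact: s.
- by rewrite -ab//; exact: p.
Qed.

Lemma complete_equiv (V : set X) a b (k k' : R) : subsp V -> hform V a -> hform V b -> 0 < k -> 0 < k' ->
  (forall u, V u -> sq a u <= k * sq b u) -> (forall u, V u -> sq b u <= k' * sq a u) ->
  complete_for V a -> complete_for V b.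
Proof.
move=> sV ha hb k0 k0' ab ba ca u Vu cu.
have [|w [Vw cw]] := ca u Vu.
  move=> e e0; have [N hN] := cu (e / k) (divr_gt0 e0 k0).
  exists N => i j Ni Nj; apply: le_trans (ab _ (subspB sV (Vu i) (Vu j))) _.
  by rewrite mulrC -ler_pdivlMr//; exact: hN.
exists w; split => //; apply/cvgrPdist_le => e e0.
have /cvgrPdist_le/(_ _ (divr_gt0 e0 k0'))[N _ hN] := cw.
exists N => // n Nn; have Vn := subspB sV (Vu n) Vw.
have := hN n Nn; rewrite !sub0r !normrN !ger0_norm ?(sq_ge0 ha Vn) ?(sq_ge0 hb Vn)//.
by move=> h; apply: le_trans (ba _ Vn) _; rewrite mulrC -ler_pdivlMr.
Qed.

Lemma poincare_H20 u : H20 O u -> sq ip u <= 4 * L ^+ 2 * sq (gradform O) u.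
Proof.
move=> hu; rewrite -(sq_scale (gradform O)).
have l2 : 0 <= 4 * L ^+ 2 by rewrite mulr_ge0 ?sqr_ge0.
have h1 := hform_sub H20sub (ip_hform O).
have h2 := hform_scale l2 (hform_sub H20sub (gradform_hform OL)).
have GH v : H20 O v -> sq (gradform O) v <= sq (H2form O) v.
  move=> hv; have c1 := sq_ge0 hip (H2_L2 (H20_H2 hv)).
  have c3 := sq_ge0 (hessform_hform OL) (H20_H2 hv).
  by rewrite /H2form !sq_add -addrA addrCA lerDl addr_ge0.
have H0 v : H20 O v -> 0 <= sq (H2form O) v.
  by move=> hv; exact: (sq_ge0 (H2form_hform OL) (H20_H2 hv)).
have b1 v : H20 O v -> sq ip v <= (1 + 4 * L ^+ 2) * sq (H2form O) v.
  move=> hv; apply: le_trans (sq_wD_le OL (H20_H2 hv)).1 _.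
  by rewrite mulrDl mul1r lerDl; apply: mulr_ge0 => //; exact: H0.
have b2 v : H20 O v -> sq (fun u v : X => (4 * L ^+ 2)%:C * gradform O u v) v <=
    (1 + 4 * L ^+ 2) * sq (H2form O) v.
  move=> hv; rewrite sq_scale [leRHS]mulrDl mul1r; apply: ler_wpDl; first exact: H0.
  by apply: (ler_wpM2l l2); exact: GH.
have bt phi : test_function O phi -> sq ip phi <= sq (fun u v : X => (4 * L ^+ 2)%:C * gradform O u v) phi.
  by move=> tp; rewrite sq_scale; exact: (poincare i0 OL L0 tp).
exact: (H20_density OL h1 h2 b1 b2 bt hu).
Qed.

Lemma gradform_null_ae u : H20 O u -> sq (gradform O) u = 0 -> {ae mu, forall x, u x = 0}.
Proof.
move=> hu g0; have Lu := H2_L2 (H20_H2 hu); apply: sq_inner_eq0 => //.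
by apply/eqP; rewrite eq_le (sq_ge0 hip Lu) andbT; have := poincare_H20 hu; rewrite g0 mulr0.
Qed.

Lemma H2_zero : H2 O (fun=> 0).
Proof. by case: (H2_subsp OL). Qed.

Lemma ae_gradform_null u : H2 O u -> {ae mu, forall x, u x = 0} -> sq (gradform O) u = 0.
Proof.
move=> hu u0; rewrite /gradform sq_bigsum; apply: big1 => i _.
apply: sq_inner_ae0; first exact: (wD_L2 (s := [:: i]) hu).
have h1 := wD_ae OL (s := [:: i]) hu H2_zero isT u0.
have L00 := @L2_0 R d O.
have h2 : {ae mu, forall x, wD O [:: i] (fun=> 0) x = 0}.
  suff W : weak_deriv O [:: i] (fun=> 0) (fun=> 0) by exact: (wD_unique OL (s := [:: i]) H2_zero isT L00 W).
  move=> phi tp.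
  have Z : cintegral O (fun=> 0) = 0 by rewrite /cintegral /= !Rintegral_cst// !mul0r.
  have -> : (fun x : 'rV[R]_d => (0 : C) * pderivs [:: i] phi x) = (fun=> 0) by apply/funext => x; rewrite mul0r.
  have -> : (fun x : 'rV[R]_d => (0 : C) * phi x) = (fun=> 0) by apply/funext => x; rewrite mul0r.
  by rewrite Z mulr0.
by apply: filterS2 h1 h2 => x -> ->.
Qed.

Section one_index.
Variable n : 'rV[R]_d -> R.
Hypothesis hn : admissible_index O n.

Lemma weight_measurable : measurable_fun setT (fun x => (n x)^-1).
Proof. by have [mn _] := admissibleP hn; exact: (measurableT_comp measurable_inv). Qed.

Lemma weight_bounded : exists M : R, {ae mu, forall x, 0 < (n x)^-1 <= M}.
Proof.
have [_ [c1 [c2 [c10 _ _ h1 _]]]] := admissibleP hn; exists c1^-1.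
apply: filterS h1 => x cx; have nx : 0 < n x by exact: lt_le_trans cx.
by rewrite invr_gt0 nx lef_pV2 ?posrE.
Qed.

Lemma nlaplacian_L2 u : H2 O u -> L2 (nlaplacian O n u).
Proof.
move=> hu; apply: L2_real_mul; [exact: weight_measurable| |exact: wlaplacian_L2].
have [M hM] := weight_bounded; exists M; apply: filterS hM => x /andP[h1 h2].
by rewrite ger0_norm// ltW.
Qed.

Lemma sqrt_weight_L2 u : H2 O u -> L2 (sqrt_weight n u).
Proof.
move=> hu; apply: L2_real_mul; last exact: wlaplacian_L2.
  apply: (measurableT_comp _ weight_measurable).
  by apply: continuous_measurable_fun; exact: sqrt_continuous.
have [M hM] := weight_bounded; exists (Num.sqrt M); apply: filterS hM => x /andP[h1 h2].
by rewrite ger0_norm ?sqrtr_ge0// ler_sqrt// (le_trans (ltW h1)).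
Qed.

Lemma nformE u v : H2 O u -> H2 O v -> nform n u v = ip (sqrt_weight n u) (sqrt_weight n v).
Proof.
move=> hu hv; rewrite /nform !innerE; apply: cintegral_ae_eqL1.
- by apply: L2_mul; [exact: nlaplacian_L2|apply: L2_conj; exact: wlaplacian_L2].
- by apply: L2_mul; [exact: sqrt_weight_L2|apply: L2_conj; exact: sqrt_weight_L2].
have [M hM] := weight_bounded; apply: filterS hM => x /andP[h1 _].
rewrite /sqrt_weight /nlaplacian conjcM.
have -> : cj (Num.sqrt (n x)^-1)%:C = (Num.sqrt (n x)^-1)%:C :> C by rewrite /= oppr0.
rewrite mulrACA -rmorphM /= -expr2 sqr_sqrtr ?(ltW h1)//.
by rewrite mulrA.
Qed.

Lemma nform_hform : hform (H2 O : set X) (nform n).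
Proof.
apply: (hform_eq (a := fun u v => ip (sqrt_weight n u) (sqrt_weight n v))).
- by move=> u v hu hv; rewrite nformE.
- exact: (H2_subsp OL).
apply: (pull_hform (T := sqrt_weight n)) => [u hu|c u v hu hv]; first exact: sqrt_weight_L2.
split; first exact: (H2_lin OL).
have := wlaplacian_lin OL c hu hv; apply: filterS => x E.
by rewrite /sqrt_weight E; ring.
Qed.

Lemma sq_nformE u : H2 O u -> sq (nform n) u = sq ip (sqrt_weight n u).
Proof. by move=> hu; rewrite /sq nformE. Qed.

Lemma nsq_sqrt_weight : {ae mu, forall x, forall u, nsq (sqrt_weight n u x) = (n x)^-1 * nsq (wlaplacian O u x)}.
Proof.
have [M hM] := weight_bounded; apply: filterS hM => x /andP[h1 _] u.
by rewrite /sqrt_weight nsqM nsqR sqr_sqrtr// ltW.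
Qed.

Lemma nform_ae0 u : H2 O u -> {ae mu, forall x, u x = 0} -> sq (nform n) u = 0.
Proof.
move=> hu u0; rewrite sq_nformE//; apply: sq_inner_ae0; first exact: sqrt_weight_L2.
have h1 := wlaplacian_ae OL hu H2_zero u0.
have h2 : {ae mu, forall x, wlaplacian O (fun=> 0) x = 0}.
  have := wlaplacian_lin OL (-1) H2_zero H2_zero; apply: filterS => x.
  have -> : (fun _ : 'rV[R]_d => -1 * (0 : C) + 0) = (fun=> 0) by apply/funext => y; rewrite mulr0 addr0.
  by move=> ->; rewrite mulN1r addNr.
by apply: filterS2 h1 h2 => x; rewrite /sqrt_weight => -> ->; rewrite mulr0.
Qed.

Lemma nform_bnull u : H20 O u -> sq (gradform O) u = 0 -> sq (nform n) u = 0.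
Proof. by move=> hu g0; apply: nform_ae0 (H20_H2 hu) _; exact: gradform_null_ae. Qed.

End one_index.

Lemma nform_le n1 n2 (k : R) u : admissible_index O n1 -> admissible_index O n2 -> 0 <= k ->
  {ae mu, forall x, (n1 x)^-1 <= k * (n2 x)^-1} -> H2 O u ->
  sq (nform n1) u <= k * sq (nform n2) u.
Proof.
move=> h1 h2 k0 n12 hu; rewrite !sq_nformE//; apply: sq_ip_le => //; try exact: sqrt_weight_L2.
apply: filterS3 n12 (nsq_sqrt_weight h1) (nsq_sqrt_weight h2) => x nx E1 E2.
by rewrite E1 E2 mulrA ler_wpM2r ?nsq_ge0.
Qed.

Lemma nform_cst1 u v : nform (cst 1) u v = lapform O u v.
Proof.
rewrite /nform /lapform; congr (ip _ _); apply/funext => x.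
by rewrite /nlaplacian /= invr1 mul1r.
Qed.

(** Since c1 <= n <= c2 almost everywhere, c2 serves for one inequality and 1 / c1 for the other; k
    is their maximum. *)
Lemma nform_equiv_lap n : admissible_index O n -> exists k : R, 0 < k /\
  (forall u, H2 O u -> sq (lapform O) u <= k * sq (nform n) u) /\
  (forall u, H2 O u -> sq (nform n) u <= k * sq (lapform O) u).
Proof.
move=> hn; have [_ [c1 [c2 [c10 _ _ h1 h2]]]] := admissibleP hn.
have adm1 := admissible_cst1 O.
have E u : sq (lapform O) u = sq (nform (cst 1)) u by rewrite /sq nform_cst1.
have m0 : 0 < Num.max c2 c1^-1 by rewrite lt_max invr_gt0 c10 orbT.
exists (Num.max c2 c1^-1); split => //.
split=> u hu; rewrite E; apply: nform_le => //; try exact: ltW.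
  apply: filterS2 h1 h2 => x x1 x2; have nx : 0 < n x by exact: lt_le_trans x1.
  rewrite /= invr1 ler_pdivlMr// mul1r; apply: le_trans x2 _.
  by rewrite le_max lexx.
apply: filterS2 h1 h2 => x x1 x2; have nx : 0 < n x by exact: lt_le_trans x1.
rewrite /= invr1 mulr1; apply: le_trans (_ : c1^-1 <= _); first by rewrite lef_pV2 ?posrE.
by rewrite le_max lexx orbT.
Qed.

Lemma nform_H20 n : admissible_index O n -> hform (H20 O : set X) (nform n).
Proof. by move=> hn; exact: hform_sub H20sub (nform_hform hn). Qed.

Lemma H2form_nform n : admissible_index O n -> exists k : R, 0 < k /\
  (forall u, H20 O u -> sq (H2form O) u <= k * sq (nform n) u) /\
  (forall u, H20 O u -> sq (nform n) u <= k * sq (H2form O) u).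
Proof.
move=> hn; have [k [k0 [k1 k2]]] := nform_equiv_lap hn.
have e0 := elliptic_const_gt0 L0.
have m0 : 0 < Num.max (elliptic_const L * k) (k * d%:R) by rewrite lt_max mulr_gt0.
exists (Num.max (elliptic_const L * k) (k * d%:R)); split => //; split=> u hu.
  apply: le_trans (H2form_le_lap i0 OL L0 hu) _.
  apply: le_trans (ler_wpM2l (ltW e0) (k1 u (H20_H2 hu))) _.
  rewrite mulrA; apply: ler_wpM2r; first exact: (sq_ge0 (nform_hform hn) (H20_H2 hu)).
  by rewrite le_max lexx.
apply: le_trans (k2 u (H20_H2 hu)) _.
apply: le_trans (ler_wpM2l (ltW k0) (lap_le_H2form OL (H20_H2 hu))) _.
rewrite mulrA; apply: ler_wpM2r; first exact: (sq_ge0 (H2form_hform OL) (H20_H2 hu)).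
by rewrite le_max lexx orbT.
Qed.

Lemma nform_complete n : admissible_index O n -> complete_for (H20 O : set X) (nform n).
Proof.
move=> hn; have [k [k0 [k1 k2]]] := H2form_nform hn.
have hH := hform_sub H20sub (H2form_hform OL).
exact: (complete_equiv sH20 hH (nform_H20 hn) k0 k0 k1 k2 (H20_complete OL)).
Qed.

Lemma nform_compact n : admissible_index O n -> compact_wrt (H20 O : set X) (nform n) (gradform O).
Proof.
move=> hn; have [k [k0 [k1 _]]] := nform_equiv_lap hn.
apply: (grad_compact i0 OL L0 (ltW k0) (nform_H20 hn)) => u hu.
exact: (k1 u (H20_H2 hu)).
Qed.

Lemma bump_sq_gt0 al be : (forall i, al i < be i) -> cbox al be `<=` O ->
  sq ip (fun x => (bump 1 al be x)%:C) != 0.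
Proof.
move=> ab BO; apply/negP => /eqP b0.
have tb := test_of_rtest (rtest_bump ltr01 BO).
have := sq_inner_eq0 (test_L2 OL tb) b0; move=> [N [mN N0 hN]].
have : (0 < mu (obox al be))%E by apply: obox_gt0 => //; exact: subset_trans (@obox_cbox _ _ al be) BO.
rewrite lt_neqAle => /andP[/eqP h _]; apply: h; apply/esym.
apply: (subset_measure0 _ _ _ N0) => //; first exact: obox_measurable.
move=> x bx; apply: hN => E; have e0 : bump 1 al be x = 0 := congr1 (fun z : C => Re z) E.
by have := bump_gt0 1 bx; rewrite e0 ltxx.
Qed.

(** Bumps on m disjoint boxes, cut from a box in O along the axis i0, are orthogonal in L2. An
    a-null combination is null in L2, because the H^2 norm is bounded by that of a, so its
    coefficients vanish. *)
Lemma nform_infdim n m : admissible_index O n -> exists f : 'I_m -> X, (forall i, H20 O (f i)) /\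
  forall c, sq (nform n) (\sum_i c i *: f i) = 0 -> forall i, c i = 0.
Proof.
move=> hn; have [al [be [ab BO]]] := box_in_domain O.
(* Division into m + 1 slices keeps w positive for m = 0 as well. *)
pose w := (be i0 - al i0) / m.+1%:R.
have w0 : 0 < w by rewrite divr_gt0// subr_gt0.
have wm : m.+1%:R * w = be i0 - al i0 by rewrite /w mulrC divfK.
pose a (j : 'I_m) (i : 'I_d) := if i == i0 then al i0 + j%:R * w else al i.
pose b (j : 'I_m) (i : 'I_d) := if i == i0 then al i0 + j.+1%:R * w else be i.
have abj j i : a j i < b j i.
  rewrite /a /b; case: eqP => // _; rewrite ltrD2l ltr_pM2r// ltr_nat//.
have cO j : cbox (a j) (b j) `<=` O.
  apply: subset_trans BO => x h i; have := h i; rewrite /a /b; case: eqP => // ->.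
  move=> /andP[h1 h2]; apply/andP; split.
    by apply: le_trans h1; rewrite lerDl mulr_ge0// ltW.
  apply: le_trans h2 _; rewrite -lerBrDl -wm ler_pM2r// ler_nat.
  by apply: leq_trans (ltn_ord j) _.
pose f (j : 'I_m) : X := fun x => (bump 1 (a j) (b j) x)%:C.
have tf j : test_function O (f j) by exact: test_of_rtest (rtest_bump ltr01 (cO j)).
exists f; split=> [j|c c0 j]; first exact: (H20_test OL (tf j)).
have Lf j' := test_L2 OL (tf j').
have hu : H20 O (\sum_i c i *: f i).
  by apply: (subsp_sum sH20) => i _; apply: (subspZ sH20); exact: (H20_test OL (tf i)).
have [k [k0 [k1 _]]] := H2form_nform hn.
have Lu := H2_L2 (H20_H2 hu).
have ip0 : sq ip (\sum_i c i *: f i) = 0.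
  apply/eqP; rewrite eq_le (sq_ge0 hip Lu) andbT.
  apply: le_trans (sq_wD_le OL (H20_H2 hu)).1 _.
  by have := k1 _ hu; rewrite c0 mulr0.
have ort i : i != j -> ip (f i) (f j) = 0.
  move=> ij; rewrite innerE.
  have -> : (fun x => f i x * cj (f j x)) = (fun=> 0).
    apply/funext => x; rewrite /f.
    have [bi|/(bump_off 1) ->] := pselect (obox (a i) (b i) x); last by rewrite mul0r.
    have [bj|/(bump_off 1) ->] := pselect (obox (a j) (b j) x); last by rewrite /= oppr0 mulr0.
    exfalso; have := bi i0; have := bj i0; rewrite /a /b !eqxx => /andP[j1 j2] /andP[i1 i2].
    have H (p q : nat) : al i0 + p%:R * w < x ord0 i0 -> x ord0 i0 < al i0 + q.+1%:R * w -> (p <= q)%N.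
      by move=> h1 h2; have := lt_trans h1 h2; rewrite ltrD2l ltr_pM2r// ltr_nat.
    by move/eqP: ij; apply; apply/val_inj/eqP; rewrite eqn_leq (H _ _ i1 j2) (H _ _ j1 i2).
  by rewrite /cintegral /= !Rintegral_cst// !mul0r.
have := hform_null sL2 hip Lu (Lf j) ip0.
rewrite (hform_suml sL2 hip (index_enum 'I_m) (fun i _ => subspZ sL2 (c i) (Lf i)) (Lf j)).
rewrite (bigD1 j)//= big1 ?addr0; last first.
  by move=> i ij; rewrite (hformZl sL2 hip (c i) (Lf i) (Lf j)) ort// mulr0.
rewrite (hformZl sL2 hip (c j) (Lf j) (Lf j)) (sqE hip (Lf j)) => /eqP.
rewrite mulf_eq0 => /orP[/eqP//|/eqP E].
have h : sq ip (f j) = 0 := congr1 (fun z : C => Re z) E.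
by have := bump_sq_gt0 (abj j) (cO j); rewrite -[X in sq ip X]/(f j) h eqxx.
Qed.

Lemma nform_eigensystem n : admissible_index O n ->
  exists e lam, eigensystem (H20 O : set X) (nform n) (gradform O) e lam.
Proof.
move=> hn; apply: eigensystem_exists.
- exact: sH20.
- exact: nform_H20.
- exact: hform_sub H20sub (gradform_hform OL).
- exact: nform_complete.
- exact: nform_compact.
- by move=> u hu; exact: nform_bnull.
- by move=> m; exact: nform_infdim.
Qed.

End weighted_form.

(** * Spectrum and min-max *)

Section antilinear_extension.
Context {R : realType} {X : lmodType R[i]}.
Local Notation C := R[i].
Variables (V D : set X) (sV : subsp V) (sD : subsp D) (a : X -> X -> C) (ha : hform V a).
Hypothesis DV : D `<=` V.
Hypothesis dens : forall u, V u -> forall e, 0 < e -> exists2 p, D p & sq a (u - p) < e.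

Lemma nsq_small (z : C) : (forall e, 0 < e -> nsq z <= e) -> z = 0.
Proof.
move=> h; apply: nsq_eq0; apply/eqP; rewrite eq_le nsq_ge0 andbT.
by apply/ler_addgt0Pr => e e0; rewrite add0r; exact: h.
Qed.

(** The numerical end of the antilinearity proof in [antilinear_extension]: M bounds F, c is [nsq]
    of the scalar, x and y are the squared distances of u and v to their approximations. *)
Lemma small_arith (M c x y z A1 A2 A3 A4 e : R) : 0 <= M -> 0 <= c ->
  A1 <= 4 * M * z -> 4 * M * z <= 4 * M * (2 * (c * x) + 2 * y) ->
  A4 <= 2 * (c * A3) + 2 * A2 -> A2 <= 4 * M * y -> c * A3 <= c * (4 * M * x) ->
  0 <= x -> 0 <= y ->
  x < e / (16 * M * (4 * c + 4) + 16 * M * c + 16 * M + 1) ->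
  y < e / (16 * M * (4 * c + 4) + 16 * M * c + 16 * M + 1) ->
  2 * A1 + 2 * A4 <= e.
Proof.
move=> M0 c0; set K := (X in e / X); move=> h1 h5 t1 h3 h4 x0 y0 xe ye.
have K0 : 0 < K by rewrite /K ltr_wpDl// !addr_ge0// !mulr_ge0// addr_ge0// mulr_ge0.
have E : e = K * (e / K) by field; rewrite gt_eqF.
rewrite E; move: (e / K) xe ye => r xe ye.
have m1 : M * c * x <= M * c * r by rewrite ler_wpM2l ?mulr_ge0// ltW.
have m2 : M * y <= M * r by rewrite ler_wpM2l// ltW.
have r0 : 0 < r by exact: le_lt_trans xe.
have m3 : 0 <= M * c * r by rewrite !mulr_ge0// ltW.
have m4 : 0 <= M * r by rewrite mulr_ge0// ltW.
have h4' : c * A3 <= 4 * (M * c * x) by apply: le_trans h4 _; rewrite le_eqVlt; apply/orP; left; apply/eqP; ring.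
have h5' : 4 * M * z <= 8 * (M * c * x) + 8 * (M * y).
  by apply: le_trans h5 _; rewrite le_eqVlt; apply/orP; left; apply/eqP; ring.
have -> : K * r = 80 * (M * c * r) + 80 * (M * r) + r by rewrite /K; ring.
lra.
Qed.

Lemma antilinear_dense_eq (G H : X -> C) (M : R) : 0 <= M ->
  (forall c u v, V u -> V v -> G (c *: u + v) = cj c * G u + G v) ->
  (forall c u v, V u -> V v -> H (c *: u + v) = cj c * H u + H v) ->
  (forall v, V v -> nsq (G v) <= M * sq a v) -> (forall v, V v -> nsq (H v) <= M * sq a v) ->
  (forall p, D p -> G p = H p) -> forall v, V v -> G v = H v.
Proof.
move=> M0 lG lH bG bH GH v Vv; apply/eqP; rewrite -subr_eq0; apply/eqP; apply: nsq_small => e e0.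
have M1 : 0 < 4 * (M + 1) by rewrite mulr_gt0// ltr_wpDl.
have [p Dp vp] := dens Vv (divr_gt0 e0 M1).
have Vp := DV Dp; have Vvp := subspB sV Vv Vp.
have E F : (forall c u v, V u -> V v -> F (c *: u + v) = cj c * F u + F v) -> F v = F (v - p) + F p.
  move=> lF; rewrite -{1}[v](subrK p) -[X in F (X + _)]scale1r lF//.
  by rewrite conjc1 mul1r.
have -> : G v - H v = G (v - p) - H (v - p).
  by rewrite (E G lG) (E H lH) (GH p Dp) opprD addrACA subrr addr0.
apply: le_trans (nsqD_le _ _) _; rewrite nsqN.
have h1 := bG _ Vvp; have h2 := bH _ Vvp.
have h3 : (M + 1) * sq a (v - p) <= e / 4.
  by move: vp; rewrite ltr_pdivlMr// => h; lra.
have h4 := sq_ge0 ha Vvp; lra.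
Qed.

(** G u is characterised by an estimate valid at every p of D, so no approximating sequence enters
    its use: antilinearity follows by comparison with F at nearby points of D. The factor 4 comes
    from two uses of |x + y|^2 <= 2 |x|^2 + 2 |y|^2. *)
Lemma antilinear_extension (F : X -> C) (M : R) : 0 <= M ->
  (forall c p q, D p -> D q -> F (c *: p + q) = cj c * F p + F q) ->
  (forall p, D p -> nsq (F p) <= M * sq a p) ->
  exists G : X -> C, [/\ forall p, D p -> G p = F p,
    forall c u v, V u -> V v -> G (c *: u + v) = cj c * G u + G v &
    forall v, V v -> nsq (G v) <= 4 * M * sq a v].
Proof.
move=> M0 lF bF.
have D0 : D 0 by case: sD.
have FB p q : D p -> D q -> F (p - q) = F p - F q.
  move=> Dp Dq; have -> : p - q = -1 *: q + p by rewrite scaleN1r addrC.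
  by rewrite lF// rmorphN1 mulN1r addrC.
have FBn p q : D p -> D q -> nsq (F p - F q) <= M * sq a (p - q).
  by move=> Dp Dq; rewrite -FB//; apply: bF; exact: subspB.
have ex u : exists z, V u -> forall p, D p -> nsq (F p - z) <= 4 * M * sq a (p - u).
  have [Vu|] := pselect (V u); last by exists 0.
  have d0 k : 0 < k.+1%:R^-1 :> R by rewrite invr_gt0.
  have exf (k : nat) : exists p, D p /\ sq a (u - p) < k.+1%:R^-1.
    by have [p Dp up] := dens Vu (d0 k); exists p.
  have [f hf] := boolp.choice exf.
  have Df k : D (f k) by case: (hf k).
  have Vuf k : V (u - f k) by apply: (subspB sV Vu); exact: DV.
  have fu k : sq a (u - f k) <= k.+1%:R^-1 by case: (hf k) => _ /ltW.
  have inv_small (e : R) : 0 < e -> exists N : nat, forall k, (N <= k)%N -> k.+1%:R^-1 <= e.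
    move=> e0; exists (Num.truncn e^-1) => k Nk.
    rewrite -[leRHS]invrK lef_pV2 ?posrE ?invr_gt0//.
    apply/ltW/(lt_le_trans (Num.Theory.truncnS_gt _)).
    by rewrite ler_nat.
  have [|z hz] := @cauchy_nsq_cvg R (fun k => F (f k)).
    move=> e e0; have M1 : 0 < 4 * (M + 1) by rewrite mulr_gt0// ltr_wpDl.
    have [N hN] := inv_small _ (divr_gt0 e0 M1).
    exists N => i j Ni Nj; apply: le_trans (FBn _ _ (Df i) (Df j)) _.
    have -> : f i - f j = (u - f j) - (u - f i) by rewrite opprB [RHS]addrC subrKA.
    apply: le_trans (ler_wpM2l M0 (sqB_le sV ha (Vuf j) (Vuf i))) _.
    have h1 := le_trans (fu i) (hN i Ni); have h2 := le_trans (fu j) (hN j Nj).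
    have : M * (2 * sq a (u - f j) + 2 * sq a (u - f i)) <= M * (4 * (e / (4 * (M + 1)))).
      by apply: (ler_wpM2l M0); lra.
    move/le_trans; apply.
    have -> : M * (4 * (e / (4 * (M + 1)))) = e * (M / (M + 1)) by field; rewrite gt_eqF// ltr_wpDl.
    by rewrite ler_piMr ?(ltW e0)// ler_pdivrMr ?ltr_wpDl// mul1r lerDl.
  exists z => _ p Dp; apply/ler_addgt0Pr => e e0.
  have M1 : 0 < 4 * M + 2 by rewrite ltr_wpDl// mulr_ge0.
  have e1 := divr_gt0 e0 M1.
  have [N hN] := inv_small _ e1.
  have /cvgrPdist_le/(_ _ e1)[N' _ hN'] := hz.
  pose k := maxn N N'.
  have h1 := hN' k (leq_maxr _ _); rewrite sub0r normrN ger0_norm ?nsq_ge0// in h1.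
  have h2 := le_trans (fu k) (hN k (leq_maxl _ _)).
  have -> : F p - z = (F p - F (f k)) + (F (f k) - z) by rewrite subrKA.
  apply: le_trans (nsqD_le _ _) _.
  have h3 := FBn _ _ Dp (Df k).
  have Vpu := subspB sV (DV Dp) Vu.
  have h4 : sq a (p - f k) <= 2 * sq a (p - u) + 2 * sq a (u - f k).
    by rewrite -[p - f k](subrKA u); exact: (sqD_le sV ha Vpu (Vuf k)).
  have h5 := ler_wpM2l M0 h4; have h6 := ler_wpM2l M0 h2.
  have E : e = (4 * M + 2) * (e / (4 * M + 2)) by field; rewrite gt_eqF.
  move: E h1 h5 h6; move: (e / _) => r E h1 h5 h6; rewrite E.
  lra.
have [G hG] := boolp.choice ex.
have GD p : D p -> G p = F p.
  move=> Dp; have := hG p (DV Dp) p Dp; rewrite subrr (sq0 sV ha) mulr0 => h.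
  apply/eqP; rewrite eq_sym -subr_eq0; apply/eqP; apply: nsq_eq0.
  by apply/eqP; rewrite eq_le h nsq_ge0.
exists G; split=> //; last first.
  move=> v Vv; have := hG v Vv 0 D0.
  have -> : F 0 = 0 by have := FB 0 0 D0 D0; rewrite !subrr.
  by rewrite !sub0r nsqN (sqN sV ha).
move=> c u v Vu Vv.
have Vuv : V (c *: u + v) by case: sV => _; apply.
apply/eqP; rewrite -subr_eq0; apply/eqP; apply: nsq_small => e e0.
have n0 := nsq_ge0 c.
pose K := 16 * M * (4 * nsq c + 4) + 16 * M * nsq c + 16 * M + 1.
have K0 : 0 < K by rewrite /K ltr_wpDl// !addr_ge0// !mulr_ge0// addr_ge0// mulr_ge0.
have d0 := divr_gt0 e0 K0.
have [p Dp up] := dens Vu d0; have [q Dq vq] := dens Vv d0.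
have Dpq : D (c *: p + q) by case: sD => _; apply.
have h1 := hG _ Vuv _ Dpq; have h2 := hG _ Vu _ Dp; have h3 := hG _ Vv _ Dq.
have Vup := subspB sV Vu (DV Dp); have Vvq := subspB sV Vv (DV Dq).
have s1 : sq a (c *: p + q - (c *: u + v)) <= 2 * (nsq c * sq a (u - p)) + 2 * sq a (v - q).
  have -> : c *: p + q - (c *: u + v) = - (c *: (u - p) + (v - q)).
    by rewrite scalerBr !opprD !opprK addrACA [c *: p - _]addrC [q - _]addrC.
  have Vc : V (c *: (u - p)) by exact: subspZ.
  rewrite (sqN sV ha); last exact: subspD.
  by apply: le_trans (sqD_le sV ha Vc Vvq) _; rewrite (sqZ sV ha).
have s2 : sq a (p - u) = sq a (u - p) by rewrite -opprB (sqN sV ha).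
have s3 : sq a (q - v) = sq a (v - q) by rewrite -opprB (sqN sV ha).
rewrite s2 in h2; rewrite s3 in h3.
have -> : G (c *: u + v) - (cj c * G u + G v) =
   - (F (c *: p + q) - G (c *: u + v)) + (cj c * (F p - G u) + (F q - G v)).
  by rewrite lF//; ring.
apply: le_trans (nsqD_le _ _) _; rewrite nsqN.
have t1 := nsqD_le (cj c * (F p - G u)) (F q - G v); rewrite nsqM nsq_conj in t1.
have u0 := sq_ge0 ha Vup; have v0 := sq_ge0 ha Vvq.
have h4 := ler_wpM2l n0 h2.
have h5 : 4 * M * sq a (c *: p + q - (c *: u + v)) <= 4 * M * (2 * (nsq c * sq a (u - p)) + 2 * sq a (v - q)).
  by apply: ler_wpM2l => //; rewrite mulr_ge0.
exact: (small_arith M0 n0 h1 h5 t1 h3 h4 u0 v0 up vq).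
Qed.

End antilinear_extension.

(** * Nondecreasing enumerations *)

Section enumerations.
Context {R : realType}.
Implicit Types lam : nat -> R.

(** At the first index k where the sequences differ, say f k < g k, every occurrence of the value f
    k in g lies before k, where f and g agree. Then f takes this value once more, at k, against the
    equality of multiplicities. *)
Lemma nondecreasing_enum_unique lam lam' : (forall p q, (p <= q)%N -> lam p <= lam q) ->
  (forall p q, (p <= q)%N -> lam' p <= lam' q) ->
  (forall l : R, exists m : nat, ([set p | lam p = l] #= `I_m)%card /\ ([set p | lam' p = l] #= `I_m)%card) ->
  forall p, lam p = lam' p.
Proof.
move=> nd nd' fib p.
have key (f g : nat -> R) : (forall p q, (p <= q)%N -> g p <= g q) ->
    (forall l : R, exists m : nat, ([set p | f p = l] #= `I_m)%card /\ ([set p | g p = l] #= `I_m)%card) ->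
    forall k, (forall q, (q < k)%N -> f q = g q) -> f k < g k -> False.
  move=> ndg fb k IH fk; have [m [fm gm]] := fb (f k).
  have [s sE] : exists s : seq nat, uniq s /\ [set q | f q = f k] = [set` s].
    have /finite_seqP[s E] : finite_set [set q | f q = f k] by exists m.
    by exists (undup s); rewrite undup_uniq; split => //; rewrite E; apply/seteqP; split=> x /=; rewrite mem_undup.
  case: sE => us sE.
  pose t := [seq q <- iota 0 k | g q == f k].
  have ut : uniq t by rewrite filter_uniq// iota_uniq.
  have tE : [set q | g q = f k] = [set` t].
    apply/seteqP; split=> q /=; rewrite mem_filter mem_iota add0n /=.
      move=> gq; rewrite gq eqxx /= ltnNge; apply/negP => kq.
      by have := ndg _ _ kq; rewrite gq leNgt fk.
    by case/andP=> /eqP.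
  have szs (r : seq nat) (A : set nat) : uniq r -> A = [set` r] -> (A #= `I_m)%card -> size r = m.
    move=> ur -> rm; apply/card_eq_II; apply: card_eq_trans rm.
    apply/card_set_bijP; exists (nth 0%N r); split.
    + by move=> i /= ni; exact: mem_nth.
    + move=> i j; rewrite !inE => ni nj ij; apply/eqP.
      by rewrite -(nth_uniq 0%N ni nj ur) ij.
    + move=> x /= xr; exists (index x r); first by rewrite /= index_mem.
      exact: nth_index.
  have : (size (k :: t) <= size s)%N.
    apply: uniq_leq_size; first by rewrite /= ut andbT mem_filter mem_iota add0n ltnn !andbF.
    move=> q; rewrite inE => /orP[/eqP ->|].
      by have : [set` s] k by rewrite -sE.
    rewrite mem_filter mem_iota add0n => /andP[/eqP gq qk].
    by have : [set` s] q by rewrite -sE /= IH.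
  by rewrite /= (szs _ _ ut tE gm) (szs _ _ us sE fm) ltnn.
have [n] := ubnP p; elim: n p => // n IHn p pn.
have IH q : (q < p)%N -> lam q = lam' q by move=> qp; apply: IHn; exact: leq_trans qp pn.
apply/eqP; rewrite eq_le !leNgt; apply/andP; split; apply/negP => h.
  apply: (key lam' lam nd _ p _ h) => [l|q qp]; last by rewrite IH.
  by have [m [h1 h2]] := fib l; exists m.
exact: (key lam lam' nd' fib p IH h).
Qed.

(** From some N on all values exceed lam p + 1; the finitely many nonzero gaps before N have a
    positive minimum. *)
Lemma nondecreasing_isolated lam p : (forall p q, (p <= q)%N -> lam p <= lam q) ->
  (forall M, exists q, M < lam q) ->
  exists2 e : R, 0 < e & forall q, lam q != lam p -> e <= `|lam q - lam p|.
Proof.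
move=> nd unb; have [N hN] := unb (lam p + 1).
pose s := [seq `|lam q - lam p| | q <- iota 0 N & lam q != lam p].
exists (\big[Num.min/1]_(x <- s) x).
  rewrite big_seq; elim/big_ind: _ => // [x y|x]; first by rewrite lt_min => -> ->.
  by move=> /mapP[q]; rewrite mem_filter => /andP[qp _] ->; rewrite normr_gt0 subr_eq0.
move=> q qp; have [qN|Nq] := ltnP q N.
  have xs : `|lam q - lam p| \in s by apply: map_f; rewrite mem_filter qp mem_iota add0n.
  elim: (s) xs => // x r IH; rewrite inE big_cons => /orP[/eqP ->|/IH h]; rewrite ge_min ?lexx//.
  by rewrite h orbT.
apply: (@le_trans _ _ 1).
  by elim: (s) => [|x r IH]; rewrite ?big_nil// big_cons ge_min IH orbT.
have := nd _ _ Nq => h; rewrite ler_normr; apply/orP; left; lra.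
Qed.

End enumerations.

(** * Dimension modulo equality almost everywhere *)

Section dimension.
Context {R : realType} {d : nat} (O : domain R d).
Local Notation C := R[i].
Local Notation fn := ('rV[R]_d -> C).
Local Notation X := ('rV[R]_d -> R[i]^o).
Local Notation mu := (leb_on O).
Implicit Types (f g u v w : fn).

Lemma aeE f g : (f = g %[ae mu]) <-> {ae mu, forall x, f x = g x}.
Proof. by split; apply: filterS => x; [apply|move=> h _]. Qed.

Lemma lincombE m (c : 'I_m -> C) (b : 'I_m -> fn) : lincomb c b = \sum_i c i *: (b i : X).
Proof. by apply/funext => x; rewrite /lincomb fct_sumE. Qed.

Lemma lincomb_delta m (f : 'I_m -> fn) i : lincomb (fun j => (j == i)%:R) f = f i.
Proof.
apply/funext => x; rewrite /lincomb (bigD1 i)// big1 => [|j /negbTE ->]; last exact: mul0r.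
by rewrite eqxx; exact: (etrans (addr0 _) (mul1r _)).
Qed.

Lemma has_dim_le (E : set fn) m m' : has_dim O E m -> has_dim O E m' -> (m' <= m)%N.
Proof.
move=> [b [Eb ib sb]] [b' [Eb' ib' sb']]; rewrite leqNgt; apply/negP => mm.
have ex (i : 'I_m') : exists c, b' i = lincomb c b %[ae mu] by exact: sb.
have [M hM] := boolp.choice ex.
have [c [[i ci] hc]] := underdetermined M mm.
move/negP: ci; apply; apply/eqP; apply: ib'; apply/aeE.
have := ae_forall_fin (O := O) (fun i => (aeE _ _).1 (hM i)).
apply: filterS => x H; rewrite /lincomb.
under eq_bigr do rewrite H /lincomb mulr_sumr.
rewrite exchange_big /=; apply: big1 => j _.
under eq_bigr do rewrite mulrA.
by rewrite -mulr_suml hc mul0r.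
Qed.

Lemma has_dim_unique (E : set fn) m m' : has_dim O E m -> has_dim O E m' -> m = m'.
Proof. by move=> h h'; apply/eqP; rewrite eqn_leq (has_dim_le h' h) (has_dim_le h h'). Qed.

End dimension.

(** * Spectrum, resolvent and min-max for one index *)

Section spectral_theory.
Context {R : realType} {d : nat} (O : domain R d) (L : R) (i0 : 'I_d).
Hypothesis OL : dom_set O `<=` cube d L.
Hypothesis L0 : 0 <= L.
Local Notation C := R[i].
Local Notation fn := ('rV[R]_d -> C).
Local Notation X := ('rV[R]_d -> R[i]^o).
Local Notation mu := (leb_on O).
Local Notation ip := (@inner R d O).
Local Notation L2 := (L2 O).
Local Notation wD := (wD O).
Local Notation V := (H20 O : set X).
Local Notation b := (gradform O).
Implicit Types (f g u v w phi psi : fn) (l : C).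

Let sL2 := @L2_subsp R d O.
Let hip := @inner_hform R d O.
Let sV : subsp V := H20_subsp OL.
Let H20sub : V `<=` H2 O. Proof. by move=> u; exact: H20_H2. Qed.
Let hb : hform V b := hform_sub H20sub (gradform_hform OL).
Let hH : hform V (H2form O) := hform_sub H20sub (H2form_hform OL).

Variable n : 'rV[R]_d -> R.
Hypothesis hn : admissible_index O n.
Local Notation a := (nform O n).
Let ha : hform V a := nform_H20 OL hn.

Lemma nform_test w phi : H2 O w -> test_function O phi ->
  cintegral O (fun x => nlaplacian O n w x * laplacian phi x) = a w (fun x => cj (phi x)).
Proof.
move=> hw tp; have tc := test_conj tp.
rewrite cintegral_inner /nform.
have E : (fun x => cj (laplacian phi x)) = laplacian (fun x => cj (phi x)).
  apply/funext => x; rewrite /laplacian raddf_sum; apply: eq_bigr => i _.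
  by rewrite (pderivs_conj [:: i; i] (test_smooth tp)).
rewrite E; apply: inner_ae.
- exact: (nlaplacian_L2 hn hw).
- exact: (nlaplacian_L2 hn hw).
- by apply: (test_L2 OL); exact: test_laplacian.
- by apply: wlaplacian_L2; exact: (H2_test OL).
- exact: aeW.
- by apply: filterS (wlaplacian_test OL tc) => x.
Qed.

(** The second derivative of w tested on phi and its first derivative tested on d_i phi are, up to
    sign, the same integral of w d_i d_i phi. *)
Lemma grad_test w phi : H2 O w -> test_function O phi ->
  cintegral O (fun x => wlaplacian O w x * phi x) = - b w (fun x => cj (phi x)).
Proof.
move=> hw tp; have tc := test_conj tp; have Lc := test_L2 OL tc.
rewrite cintegral_inner.
have -> : wlaplacian O w = \sum_i (wD [:: i; i] w : X).
  by apply/funext => x; rewrite /wlaplacian fct_sumE.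
have LD i : L2 (wD [:: i; i] w) := wD_L2 (s := [:: i; i]) hw isT.
rewrite (hform_suml sL2 hip (index_enum 'I_d) (fun i _ => LD i) Lc).
rewrite /gradform -sumrN; apply: eq_bigr => i _.
have td := test_pderivs [:: i] tp.
have E1 := wD_weak (s := [:: i; i]) hw isT tp.
have E2 := wD_weak (s := [:: i]) hw isT td.
have E3 : cintegral O (fun x => wD [:: i; i] w x * phi x) = - cintegral O (fun x => wD [:: i] w x * pderivs [:: i] phi x).
  move: E1; rewrite sqrrN expr1n mul1r => <-.
  by move: E2; rewrite expr1 mulN1r => <-.
apply: (etrans (esym (cintegral_inner O (wD [:: i; i] w) phi))); rewrite E3 cintegral_inner; congr (- _).
have E4 := pderivs_conj [:: i] (test_smooth tp).
apply: inner_ae.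
- exact: (wD_L2 (s := [:: i]) hw).
- exact: (wD_L2 (s := [:: i]) hw).
- by apply: L2_conj; exact: (test_L2 OL).
- exact: (wD_L2 (s := [:: i]) (H2_test OL tc)).
- exact: aeW.
- have h := wD_test OL (s := [:: i]) tc isT.
  by apply: filterS h => x ->; rewrite E4.
Qed.

Lemma H20_dens u : V u -> forall e, 0 < e -> exists2 p : X, test_function O p & sq (H2form O) ((u : X) - p) < e.
Proof. by move=> /(H20P OL)[]. Qed.

Lemma test_in_V : (test_function O : set X) `<=` V.
Proof. by move=> p; exact: (H20_test OL). Qed.

Lemma test_subsp : subsp (test_function O : set X).
Proof. by split; [apply: test_0; exact: 0|move=> c u v; exact: test_lin]. Qed.

Lemma sq_b_le u : V u -> sq b u <= sq (H2form O) u.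
Proof.
move=> hu; have c1 := sq_ge0 hip (H2_L2 (H20_H2 hu)).
have c3 := sq_ge0 (hessform_hform OL) (H20_H2 hu).
by rewrite /H2form !sq_add -addrA addrCA lerDl addr_ge0.
Qed.

(** Both sides are antilinear in the second argument and bounded by the H^2 norm, so their equality
    extends from test functions by density. *)
Lemma test_espace w l : V w ->
  (forall psi, test_function O psi -> a w psi = l * b w psi) -> espace V a b l w.
Proof.
move=> Vw H; split => // v Vv.
have [k [k0 [_ k2]]] := H2form_nform i0 OL L0 hn.
have aw := sq_ge0 ha Vw; have bw := sq_ge0 hb Vw.
have M0 : 0 <= sq a w * k + nsq l * sq b w.
  by rewrite addr_ge0// mulr_ge0 ?nsq_ge0// ltW.
apply: (antilinear_dense_eq (D := (test_function O : set X)) sV hH test_in_V H20_dens M0 _ _ _ _ H Vv).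
- move=> c p q Vp Vq.
  by rewrite (hformDr sV ha (subspZ sV c Vp) Vq Vw) (hformZr sV ha c Vp Vw).
- move=> c p q Vp Vq.
  by rewrite (hformDr sV hb (subspZ sV c Vp) Vq Vw) (hformZr sV hb c Vp Vw) mulrDr mulrCA.
- move=> p Vp; apply: le_trans (hform_CS sV ha Vw Vp) _.
  apply: le_trans (ler_wpM2l aw (k2 p Vp)) _; rewrite mulrA.
  apply: ler_wpM2r; first exact: (sq_ge0 hH Vp).
  by rewrite lerDl mulr_ge0 ?nsq_ge0.
- move=> p Vp; rewrite nsqM.
  apply: le_trans (ler_wpM2l (nsq_ge0 l) (hform_CS sV hb Vw Vp)) _.
  rewrite mulrA; apply: le_trans (ler_wpM2l _ (sq_b_le Vp)) _; first by rewrite mulr_ge0 ?nsq_ge0.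
  apply: ler_wpM2r; first exact: (sq_ge0 hH Vp).
  by rewrite lerDr mulr_ge0// ltW.
Qed.

Lemma eigen_spaceP l w : eigen_space O n l w <-> espace V a b l w.
Proof.
split=> [[Vw ew]|[Vw ew]].
  apply: test_espace => // psi tq; have tc := test_conj tq.
  have hw := H20_H2 Vw.
  have := ew _ tc; rewrite /dist_laplacian /dist_of (nform_test hw tc) (grad_test hw tc).
  have -> : (fun x => cj (cj (psi x))) = psi by apply/funext => x; rewrite conjcK.
  by rewrite mulrNN.
split => // phi tp; have tc := test_conj tp; have hw := H20_H2 Vw.
rewrite /dist_laplacian /dist_of (nform_test hw tp) (grad_test hw tp) mulrNN.
by apply: ew; exact: test_in_V.
Qed.

Lemma resolvesP l F w : resolves O n l F w <-> V w /\ forall phi, test_function O phi ->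
  a w (fun x => cj (phi x)) - l * b w (fun x => cj (phi x)) = F phi.
Proof.
split=> -[Vw ew]; split => // phi tp; have hw := H20_H2 Vw; rewrite -?ew//.
  by rewrite /dist_laplacian /dist_of (nform_test hw tp) (grad_test hw tp) mulrN.
by rewrite /dist_laplacian /dist_of (nform_test hw tp) (grad_test hw tp) mulrN.
Qed.

Lemma nform_null_ae u : V u -> sq a u = 0 -> {ae mu, forall x, u x = 0}.
Proof.
move=> Vu a0; have Lu := H2_L2 (H20_H2 Vu); apply: sq_inner_eq0 => //.
have [k [k0 [k1 _]]] := H2form_nform i0 OL L0 hn.
apply/eqP; rewrite eq_le (sq_ge0 hip Lu) andbT.
apply: le_trans (sq_wD_le OL (H20_H2 Vu)).1 _.
by have := k1 _ Vu; rewrite a0 mulr0.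
Qed.

Lemma null_diff_sq (c : X -> X -> C) u v : hform V c -> V u -> V v -> sq c ((u : X) - v) = 0 -> sq c u = sq c v.
Proof.
move=> hc Vu Vv h; have Vuv := subspB sV Vu Vv.
rewrite -{1}[u : X](subrK v) (sqD sV hc Vuv Vv) h add0r (hform_null sV hc Vuv Vv h).
by rewrite /= mulr0 addr0.
Qed.

Lemma ae_sub0 u v : {ae mu, forall x, u x = v x} -> {ae mu, forall x, ((u : X) - v) x = 0}.
Proof.
apply: filterS => x ux; have -> : ((u : X) - v) x = u x - v x by [].
by rewrite ux; exact: subrr.
Qed.

Lemma sub0_ae u v : {ae mu, forall x, ((u : X) - v) x = 0} -> {ae mu, forall x, u x = v x}.
Proof. by apply: filterS => x /eqP; rewrite subr_eq0 => /eqP. Qed.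

Lemma ae_sq_b u v : V u -> V v -> {ae mu, forall x, u x = v x} -> sq b u = sq b v.
Proof.
move=> Vu Vv uv; apply: null_diff_sq => //.
by apply: (ae_gradform_null OL); [exact: (subspB (H2_subsp OL) (H20_H2 Vu) (H20_H2 Vv))|exact: ae_sub0].
Qed.

Lemma ae_sq_a u v : V u -> V v -> {ae mu, forall x, u x = v x} -> sq a u = sq a v.
Proof.
move=> Vu Vv uv; apply: null_diff_sq => //.
by apply: (nform_ae0 OL hn); [exact: (subspB (H2_subsp OL) (H20_H2 Vu) (H20_H2 Vv))|exact: ae_sub0].
Qed.

Lemma sq_ip_conj u : sq ip (fun x => cj (u x)) = sq ip u.
Proof.
rewrite !sq_inner; apply: eq_Rintegral => x _.
by case: (u x) => p q /=; rewrite sqrrN.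
Qed.

Lemma sq_H2form_conj phi : test_function O phi ->
  sq (H2form O) (fun x => cj (phi x)) = sq (H2form O) phi.
Proof.
move=> tp; have tc := test_conj tp.
have E s : (size s <= 2)%N -> sq ip (wD s (fun x => cj (phi x))) = sq ip (wD s phi).
  move=> s2; rewrite !(sq_wD_test OL)// (pderivs_conj s (test_smooth tp)).
  exact: sq_ip_conj.
have H u : sq (H2form O) u = sq ip u + \sum_i sq ip (wD [:: i] u) +
    \sum_i \sum_j sq ip (wD [:: i; j] u).
  rewrite /H2form !sq_add /gradform /hessform !sq_bigsum; congr (_ + _).
  by apply: eq_bigr => i _; rewrite sq_bigsum.
refine (etrans (H _) (etrans _ (esym (H _)))).
apply: (congr2 +%R); first apply: (congr2 +%R).
- exact: sq_ip_conj.
- by apply: eq_bigr => i _; exact: (E [:: i] isT).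
- by apply: eq_bigr => i _; apply: eq_bigr => j _; exact: (E [:: i; j] isT).
Qed.

Lemma norm_le_nsq (z : C) (r : R) : `|z| <= r%:C -> nsq z <= r ^+ 2.
Proof.
rewrite normc_def lecR -/(nsq z) => h.
by rewrite -[nsq z]sqr_sqrtr ?nsq_ge0// ler_pXn2r ?nnegrE ?sqrtr_ge0// (le_trans _ h) ?sqrtr_ge0.
Qed.

Section one_eigensystem.
Variables (e : nat -> X) (lam : nat -> R).
Hypothesis sys : eigensystem V a b e lam.

Let bnull u : V u -> sq b u = 0 -> sq a u = 0.
Proof. by move=> Vu; exact: (nform_bnull i0 OL L0 hn Vu). Qed.

Let Ve p : V (e p) := es_in sys p.

Let sq_e p : sq a (e p) = 1.
Proof. by rewrite /sq (es_orth sys) eqxx. Qed.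

Lemma eigenvaluesP l : eigenvalues O n l <-> exists p, (lam p)%:C = l.
Proof.
split=> [[w /eigen_spaceP ew nw]|[p pl]].
  apply: contrapT => h; apply: nw; apply/aeE; apply: nform_null_ae; first by case: ew.
  by apply: (espace_null sV ha hb bnull sys _ ew) => p pl; apply: h; exists p.
exists (e p); first by apply/eigen_spaceP; exact: (es_espace sys).
move=> /aeE h; have := nform_ae0 OL hn (H20_H2 (Ve p)) h.
by rewrite sq_e => /eqP; rewrite oner_eq0.
Qed.

Lemma espace_diff l w w' F : resolves O n l F w -> resolves O n l F w' ->
  espace V a b l ((w : X) - w').
Proof.
move=> /resolvesP[Vw ew] /resolvesP[Vw' ew']; apply: test_espace; first exact: subspB.
move=> psi tq; have tc := test_conj tq; have Vq := test_in_V tq.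
have := ew _ tc; have := ew' _ tc.
have -> : (fun x => cj (cj (psi x))) = psi by apply/funext => x; rewrite conjcK.
rewrite (hformBl sV ha Vw Vw' Vq) (hformBl sV hb Vw Vw' Vq).
move: (a w psi) (a w' psi) (b w psi) (b w' psi) (F _) => p p' q q' f h h'.
by apply/eqP; rewrite -subr_eq0; apply/eqP; rewrite (_ : _ - _ = (p - l * q) - (p' - l * q')); [rewrite h h' subrr|ring].
Qed.

(** F composed with conjugation is antilinear and bounded by the H^2 norm, which conjugation
    preserves. Its extension to H^2_0 is covered by [es_solve]. Two solutions differ by an element
    of an eigenspace that is trivial up to null functions. *)
Lemma resolvent_of_not_eigenvalue l : ~ eigenvalues O n l -> resolvent_set O n l.
Proof.
move=> nl F [lF [M bF]].
have nlev p : ~ level lam l p by move=> h; apply: nl; apply/eigenvaluesP; exists p.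
have [k [k0 [k1 _]]] := H2form_nform i0 OL L0 hn.
pose F' (u : X) := F (fun x => cj (u x)).
have M20 : 0 <= M ^+ 2 by exact: sqr_ge0.
have lF' c p q : test_function O p -> test_function O q -> F' (c *: (p : X) + q) = cj c * F' p + F' q.
  move=> tp tq; rewrite /F' -lF; [|exact: test_conj|exact: test_conj].
  by congr F; apply/funext => x; rewrite conjcD conjcM.
have bF' p : test_function O p -> nsq (F' p) <= M ^+ 2 * sq (H2form O) p.
  move=> tp; have tc := test_conj tp; have := norm_le_nsq (bF _ tc).
  by rewrite exprMn (H2norm_sqr (H2_test OL tc)) sq_H2form_conj.
have [G [GD lG bG]] := antilinear_extension sV test_subsp hH test_in_V H20_dens M20 lF' bF'.
have bG' v : V v -> nsq (G v) <= 4 * M ^+ 2 * k * sq a v.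
  move=> Vv; apply: le_trans (bG v Vv) _; rewrite -[leRHS]mulrA.
  by apply: ler_wpM2l; [rewrite mulr_ge0|exact: k1].
have bdd := compact_wrt_bounded (nform_compact i0 OL L0 hn).
have bdd' : exists M', forall u, V u -> sq b u <= M' * sq a u.
  by have [M' [_ hM']] := bdd; exists M'.
have [w [Vw hw]] := es_solve sV ha hb bnull sys (nform_complete i0 OL L0 hn) bdd' lG bG' nlev.
exists w.
  apply/resolvesP; split => // phi tp; have tc := test_conj tp.
  rewrite hw; last exact: test_in_V.
  rewrite (GD _ tc) /F'; congr F; apply/funext => x; exact: conjcK.
move=> v rv; apply/aeE.
have rw : resolves O n l F w.
  apply/resolvesP; split => // phi tp; have tc := test_conj tp.
  rewrite hw; last exact: test_in_V.
  rewrite (GD _ tc) /F'; congr F; apply/funext => x; exact: conjcK.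
have ed := espace_diff rv rw.
apply: sub0_ae; apply: nform_null_ae; first by case: ed.
exact: (espace_null sV ha hb bnull sys nlev ed).
Qed.

(** For the zero right-hand side both 0 and an eigenvector are solutions, against uniqueness. *)
Lemma not_resolvent_of_eigenvalue l : eigenvalues O n l -> ~ resolvent_set O n l.
Proof.
move=> [w /eigen_spaceP ew nw] rl; have [Vw hw] := ew.
have z0 : Hm2 O (fun _ : fn => 0).
  split=> [c p q _ _|]; first by rewrite mulr0 addr0.
  by exists 0 => phi _; rewrite normr0 mul0r.
have [u _ hu] := rl _ z0.
have r0 : resolves O n l (fun _ => 0) (fun=> 0).
  apply/resolvesP; split; first by case: sV.
  move=> phi tp; have Vc := test_in_V (test_conj tp).
  by rewrite (hform0l sV ha Vc) (hform0l sV hb Vc) mulr0 subrr.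
have rw : resolves O n l (fun _ => 0) w.
  apply/resolvesP; split => // phi tp; have Vc := test_in_V (test_conj tp).
  rewrite (hw _ Vc); exact: subrr.
apply: nw; apply/aeE.
have /aeE h1 := hu _ r0; have /aeE h2 := hu _ rw.
by apply: filterS2 h1 h2 => x <- ->.
Qed.

Lemma spectrum_eigenvalues : spectrum O n = eigenvalues O n.
Proof.
apply/seteqP; split=> l h; last exact: not_resolvent_of_eigenvalue.
by apply: contrapT => /resolvent_of_not_eigenvalue.
Qed.

Lemma spectrum_pos_isolated l : spectrum O n l -> 0 < l /\ isolated_point (spectrum O n) l.
Proof.
rewrite spectrum_eigenvalues => hl; have [p pl] := (eigenvaluesP l).1 hl.
split; first by rewrite -pl ltcR; exact: (es_gt0 sys).
split => //.
have [r r0 hr] := nondecreasing_isolated p (es_nd sys) (es_unb sys).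
exists r => // l' /eigenvaluesP[q ql'] ne.
rewrite -pl -ql' -rmorphB normc_def /= expr0n addr0 sqrtr_sqr lecR; apply: hr.
by apply: contra_neq ne => E; rewrite -ql' -pl E.
Qed.

Lemma eigen_space_dim l : exists2 m : nat, has_dim O (eigen_space O n l) m &
    ([set p | (lam p)%:C = l] #= `I_m)%card.
Proof.
have [m [g [lm ginj gl gs]]] := level_basis sV ha hb bnull sys l.
exists m => //; exists (fun i => e (g i)); split.
- by move=> i; apply/eigen_spaceP; exact: (es_espace sys (gl i)).
- move=> c /aeE; rewrite lincombE => c0 i.
  have Vs : V (\sum_i c i *: e (g i)) by apply: (subsp_sum sV) => j _; exact: subspZ.
  have := hform_null sV ha Vs (Ve (g i)) (nform_ae0 OL hn (H20_H2 Vs) c0).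
  rewrite (hform_suml sV ha (index_enum 'I_m) (fun j _ => subspZ sV (c j) (Ve (g j))) (Ve (g i))).
  rewrite (bigD1 i)//= (hformZl sV ha (c i) (Ve (g i)) (Ve (g i))) (es_orth sys) eqxx mulr1 big1 ?addr0//.
  move=> j ji; rewrite (hformZl sV ha (c j) (Ve (g j)) (Ve (g i))) (es_orth sys).
  by rewrite (inj_eq ginj) (negbTE ji) mulr0.
- move=> w /eigen_spaceP ew; exists (fun i => a w (e (g i))).
  apply/aeE; rewrite lincombE; apply: sub0_ae.
  apply: nform_null_ae; last exact: gs.
  apply: (subspB sV); first by case: ew.
  by apply: (subsp_sum sV) => j _; exact: subspZ.
Qed.

Lemma eigen_enum_lam : eigen_enum O n lam.
Proof. by split; [exact: (es_nd sys)|exact: eigen_space_dim]. Qed.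

(** [eigval] is an enumeration picked by [xget]. It agrees with lam because in both the
    multiplicities are the dimensions of the eigenspaces. *)
Lemma eigvalE p : eigval O n p = lam p.
Proof.
have [nd en] : eigen_enum O n (eigval O n).
  by rewrite /eigval; case: xgetP => [_ -> //|/(_ lam)]; case; exact: eigen_enum_lam.
apply: nondecreasing_enum_unique => //; first exact: (es_nd sys).
move=> l; have [m dm em] := en l%:C; have [m' dm' em'] := eigen_space_dim l%:C.
have E : m = m' := has_dim_unique dm dm'.
have cE (f : nat -> R) : [set p | f p = l] = [set p | (f p)%:C = l%:C].
  by apply/seteqP; split=> q /=; [move=> ->|move/complexI].
by exists m; rewrite !cE; split => //; rewrite E.
Qed.

Lemma rayleighE w : V w -> rayleigh O n w = (sq a w / sq b w)%:C.
Proof.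
move=> Vw; rewrite /rayleigh gradnorm2E -[inner _ _ _]/(a w w) (sqE ha Vw).
by rewrite rmorphM /= fmorphV.
Qed.

Lemma sq_b_gt0 w : V w -> ~ ae_zero O w -> 0 < sq b w.
Proof.
move=> Vw nw; rewrite lt_neqAle (sq_ge0 hb Vw) andbT; apply/eqP => h.
by apply: nw; apply/aeE; exact: (gradform_null_ae i0 OL L0 Vw (esym h)).
Qed.

Lemma not_ae_zero w : V w -> 0 < sq b w -> ~ ae_zero O w.
Proof.
move=> Vw b0 /aeE h; have := ae_gradform_null OL (H20_H2 Vw) h.
by move=> E; rewrite E ltxx in b0.
Qed.

(** A basis of E modulo null sets spans it modulo b-null vectors, so [finite_dim_max] applies. *)
Lemma rayleigh_max_exists p E : subspaces O p.+1 E -> exists M,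
  is_max (rayleigh O n @` (E `\` ae_zero O)) M.
Proof.
move=> [[EV E0 El Eae] [f [Ef fi fs]]].
have sE : subsp (E : set X) by split; [exact: E0|move=> c u v; exact: El].
have Vf i : V (f i) by exact: EV.
have Vsum c : V (\sum_i c i *: (f i : X)) by apply: (subsp_sum sV) => j _; exact: subspZ.
have span w : E w -> exists c, sq b ((w : X) - \sum_i c i *: (f i : X)) = 0.
  move=> Ew; have [c /aeE wc] := fs w Ew; exists c; rewrite lincombE in wc.
  apply: (ae_gradform_null OL); last exact: ae_sub0.
  exact: (subspB (H2_subsp OL) (H20_H2 (EV _ Ew)) (H20_H2 (Vsum c))).
have nz : exists2 w, E w & 0 < sq b w.
  exists (f ord0) => //; apply: sq_b_gt0 => // /aeE h.
  have := fi (fun j => (j == ord0)%:R).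
  rewrite lincomb_delta.
  by move=> /(_ ((aeE _ _ _).2 h) ord0) /eqP; rewrite eqxx oner_eq0.
have [m [Em m1 hm]] := finite_dim_max sV ha hb bnull sE EV Ef span nz.
have Vm := EV _ Em.
exists (rayleigh O n m); split.
  by exists m => //; split => //; apply: not_ae_zero => //; rewrite m1.
move=> _ [u [Eu nu] <-]; have Vu := EV _ Eu; have bu := sq_b_gt0 Vu nu.
have rm : rayleigh O n m = (sq a m)%:C by rewrite (rayleighE Vm) m1 divr1.
rewrite rm (rayleighE Vu) lecR (ler_pdivrMr _ _ bu); exact: (hm u Eu).
Qed.

(** On the span of the first p + 1 eigenvectors the maximum is lam p, attained at e_p, by
    [es_comb_upper]; in any competitor [es_comb_lower] produces a vector with quotient at least lam
    p. *)
Lemma rayleigh_min p : is_min [set M | exists2 E, subspaces O p.+1 E &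
    is_max (rayleigh O n @` (E `\` ae_zero O)) M] (lam p)%:C.
Proof.
split; last first.
  move=> M [E [[EV E0 El Eae] [f [Ef fi fs]]] [_ ub]].
  have Vf i : V (f i) by exact: EV.
  have sE : subsp (E : set X) by split; [exact: E0|move=> c u v; exact: El].
  have indep c : sq b (\sum_i c i *: (f i : X)) = 0 -> forall i, c i = 0.
    move=> h; apply: fi; apply/aeE; rewrite lincombE.
    apply: (gradform_null_ae i0 OL L0) => //.
    by apply: (subsp_sum sV) => j _; exact: subspZ.
  have [c /= [c1 c2]] := es_comb_lower sV ha hb sys Vf indep.
  have Eu : E (\sum_i c i *: (f i : X)).
    by apply: (subsp_sum sE) => j _; exact: (subspZ sE).
  have Vu := EV _ Eu.
  apply: le_trans (ub _ (ex_intro2 _ _ _ (conj Eu (not_ae_zero Vu c1)) erefl)).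
  by rewrite rayleighE// lecR ler_pdivlMr.
pose g (i : 'I_p.+1) : fn := e i.
have Vsum (c : 'I_p.+1 -> C) : V (\sum_i c i *: (g i : X)).
  by apply: (subsp_sum sV) => j _; apply: subspZ => //; exact: Ve.
have toocomb (c : 'I_p.+1 -> C) : \sum_i c i *: (g i : X) = ocomb e (fun i => c (inord i)) p.+1.
  by apply: eq_bigr => i _; rewrite inord_val.
(* The span is enlarged by all elements of H^2_0 that agree almost everywhere with one of its
   members, the saturation that [H20_subspace] asks for. *)
pose E : set fn := [set w | H20 O w /\ exists c, {ae mu, forall x, w x = lincomb c g x}].
exists E.
  split; first split.
  - by move=> w [].
  - split; first by case: sV.
    by exists (fun=> 0); apply: aeW => x; rewrite /lincomb big1// => i _; rewrite mul0r.
  - move=> c u v [Vu [cu hu]] [Vv [cv hv]]; split; first by case: sV => _; apply.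
    exists (fun i => c * cu i + cv i); apply: filterS2 hu hv => x -> ->.
    rewrite /lincomb mulr_sumr -big_split; apply: eq_bigr => i _.
    by rewrite mulrDl mulrA.
  - move=> u v [Vu [cu hu]] Vv /aeE vu; split => //; exists cu.
    by apply: filterS2 vu hu => x ->.
  exists g; split.
  - move=> i; split; first exact: Ve.
    by exists (fun j => (j == i)%:R); apply: aeW => x; rewrite lincomb_delta.
  - move=> c /aeE; rewrite lincombE => h i.
    have h0 := ae_gradform_null OL (H20_H2 (Vsum c)) h.
    rewrite toocomb in h0.
    by have := es_comb_indep sV ha bnull sys h0 (ltn_ord i); rewrite inord_val.
  - by move=> w [Vw [c hc]]; exists c; apply/aeE.
have be q : sq b (e q) = (lam q)^-1.
  rewrite /sq (es_eigl ha hb sys q (Ve q)) (es_orth sys) eqxx mulr1 //=.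
have rq q : rayleigh O n (e q) = (lam q)%:C.
  by rewrite (rayleighE (Ve q)) sq_e be div1r invrK.
split.
  exists (g ord_max); last by rewrite /g rq.
  split; last by apply: not_ae_zero; [exact: Ve|rewrite be invr_gt0; exact: (es_gt0 sys)].
  split; first exact: Ve.
  by exists (fun j => (j == ord_max)%:R); apply: aeW => x; rewrite lincomb_delta.
move=> _ [u [[Vu [c hc]] nu] <-]; rewrite (rayleighE Vu) lecR (ler_pdivrMr _ _ (sq_b_gt0 Vu nu)).
rewrite lincombE in hc.
rewrite (ae_sq_a Vu (Vsum c) hc) (ae_sq_b Vu (Vsum c) hc) toocomb.
exact: (es_comb_upper sV ha hb sys).
Qed.

Lemma lam_cvg : lam p @[p --> \oo] --> +oo.
Proof.
apply/cvgryPge => A; have [N hN] := es_unb sys A.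
by exists N => // k /= Nk; apply: le_trans (ltW hN) _; exact: (es_nd sys).
Qed.

End one_eigensystem.

End spectral_theory.

(** * Comparison of eigenvalues and conclusion *)

Lemma bounded_sub_cube {R : realType} {d : nat} (A : set 'rV[R]_d) :
  bounded_set A -> exists2 L : R, 0 <= L & A `<=` cube d L.
Proof.
move=> [M [_ hM]]; have M1 : M < `|M| + 1 by rewrite ltr_pwDr// ler_norm.
exists (`|M| + 1); first by rewrite addr_ge0.
move=> x Ax i; have h := hM _ M1 x Ax.
rewrite /= in_itv /= -ler_norml; apply: le_trans h.
by rewrite [leRHS]mx_normrE; apply/bigmax_geP; right; exists (ord0, i).
Qed.

Lemma eigval_compare {R : realType} {d : nat} (O : domain R d) (L : R) (i0 : 'I_d)
    (OL : dom_set O `<=` cube d L) (L0 : 0 <= L) (n1 n2 : 'rV[R]_d -> R) (k : R) p :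
  admissible_index O n1 -> admissible_index O n2 -> 0 <= k ->
  (\forall x \ae leb_on O, (n1 x)^-1 <= k / n2 x) ->
  eigval O n1 p <= k * eigval O n2 p.
Proof.
move=> h1 h2 k0 h.
have [e1 [l1 s1]] := nform_eigensystem i0 OL L0 h1.
have [e2 [l2 s2]] := nform_eigensystem i0 OL L0 h2.
rewrite (eigvalE i0 OL L0 h1 s1) (eigvalE i0 OL L0 h2 s2).
apply: (es_compare (H20_subsp OL) (nform_H20 OL h1) (nform_H20 OL h2)
  (hform_sub (@H20_H2 _ _ O) (gradform_hform OL)) _ s1 s2 k0) => u Vu.
  exact: (nform_bnull i0 OL L0 h2 Vu).
exact: (nform_le h1 h2 k0 h (H20_H2 Vu)).
Qed.

Lemma eigval_gt0 {R : realType} {d : nat} (O : domain R d) (L : R) (i0 : 'I_d)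
    (OL : dom_set O `<=` cube d L) (L0 : 0 <= L) (n : 'rV[R]_d -> R) p :
  admissible_index O n -> 0 < eigval O n p.
Proof.
move=> hn; have [e [l s]] := nform_eigensystem i0 OL L0 hn.
by rewrite (eigvalE i0 OL L0 hn s); exact: (es_gt0 s).
Qed.

Theorem mainTheorem3 (R : realType) (d : nat) (hd : d = 2%N \/ d = 3%N)
    (Omega : domain R d) (hbounded : bounded_set Omega)
    (hlipschitz : lipschitz_boundary Omega)
    (n : 'rV[R]_d -> R) (hn : admissible_index Omega n) :
  [/\ spectrum Omega n = eigenvalues Omega n,
      forall l, spectrum Omega n l ->
        0 < l /\ isolated_point (spectrum Omega n) l,
      eigen_enum Omega n (eigval Omega n),
      0 < eigval Omega n 0%N /\ eigval Omega n p @[p --> \oo] --> +oo &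
      forall p : nat,
        (forall E, subspaces Omega p.+1 E -> exists M,
           is_max (rayleigh Omega n @` (E `\` ae_zero Omega)) M) /\
        is_min [set M | exists2 E, subspaces Omega p.+1 E &
                  is_max (rayleigh Omega n @` (E `\` ae_zero Omega)) M]
               (eigval Omega n p)%:C] /\
  (forall nhat : 'rV[R]_d -> R, admissible_index Omega nhat ->
     (\forall x \ae leb_on Omega, nhat x <= n x) ->
     forall p : nat, eigval Omega n p <= eigval Omega nhat p) /\
  (forall p : nat,
     (ess_inf (leb_on Omega) (EFin \o n) <=
        (eigval Omega (cst 1) p / eigval Omega n p)%:E <=
        ess_sup (leb_on Omega) (EFin \o n))%E) /\
  (forall c : R, (\forall x \ae leb_on Omega, n x = c) ->
     forall p : nat, c = eigval Omega (cst 1) p / eigval Omega n p).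
Proof.
(* A coordinate along which Poincare's inequality and the disjoint bumps are set up. *)
have [i0 _] : exists i : 'I_d, True by case: hd => ->; exists ord0.
have [L L0 OL] := bounded_sub_cube hbounded.
have h1 := admissible_cst1 Omega.
have [_ [c1 [c2 [c10 inf_n sup_n nc1 nc2]]]] := admissibleP hn.
have cmp := eigval_compare i0 OL L0; have pos := eigval_gt0 i0 OL L0.
have c20 : 0 <= c2.
  have [x [x1 x2]] : exists x, c1 <= n x /\ n x <= c2.
    by apply: (ae_ex (O := Omega)); apply: filterS2 nc1 nc2.
  exact: le_trans (ltW c10) (le_trans x1 x2).
split; last split; last split.
- have [e [lam s]] := nform_eigensystem i0 OL L0 hn.
  have E : eigval Omega n = lam by apply/funext => p; exact: (eigvalE i0 OL L0 hn s).
  split.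
  + exact: (spectrum_eigenvalues i0 OL L0 hn s).
  + exact: (spectrum_pos_isolated i0 OL L0 hn s).
  + by rewrite E; exact: (eigen_enum_lam i0 OL L0 hn s).
  + by split; [exact: pos|rewrite E; exact: (lam_cvg s)].
  + move=> p; split; first by move=> F; exact: (rayleigh_max_exists i0 OL L0 hn).
    by rewrite E; exact: (rayleigh_min i0 OL L0 hn s).
(* From nhat <= n follows n^-1 <= nhat^-1, so the comparison applies with constant 1. *)
- move=> nhat hhat le_n p; rewrite -[leRHS]mul1r; apply: cmp => //.
  have [_ [c [_ [c0 _ _ hc _]]]] := admissibleP hhat.
  apply: filterS2 hc le_n => x cx nx; have x0 := lt_le_trans c0 cx.
  by rewrite mul1r lef_pV2// posrE// (lt_le_trans x0).
- move=> p; rewrite inf_n sup_n !lee_fin ler_pdivlMr ?pos// ler_pdivrMr ?pos//.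
  apply/andP; split.
    (* The lower bound amounts to lambda_p(n) <= c1^-1 lambda_p(1), and the upper one, next, to
       lambda_p(1) <= c2 lambda_p(n). *)
    rewrite mulrC -ler_pdivlMr// mulrC; apply: cmp => //; first by rewrite invr_ge0 ltW.
    apply: filterS nc1 => x cx; have x0 := lt_le_trans c10 cx.
    by rewrite /= divr1 lef_pV2// posrE.
  apply: cmp => //.
  apply: filterS2 nc1 nc2 => x x1 x2; have x0 := lt_le_trans c10 x1.
  by rewrite /= invr1 ler_pdivlMr// mul1r.
- move=> c nc p.
  have c0 : 0 < c.
    have [x [x1 x2]] : exists x, c1 <= n x /\ n x = c.
      by apply: (ae_ex (O := Omega)); apply: filterS2 nc1 nc.
    by rewrite -x2 (lt_le_trans c10).
  (* The comparison with constants c^-1 and c gives the two inequalities. *)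
  apply/eqP; rewrite eq_le ler_pdivlMr ?pos// ler_pdivrMr ?pos//; apply/andP; split.
    rewrite mulrC -ler_pdivlMr// mulrC; apply: cmp => //; first by rewrite invr_ge0 ltW.
    by apply: filterS nc => x ->; rewrite /= divr1.
  apply: cmp => //; first exact: ltW.
  by apply: filterS nc => x ->; rewrite /= invr1 divff// gt_eqF.
Qed.
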